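(* With notation as in the context, the complex $\Omega^\bullet(\mathcal C_0,\nabla_G)$ is acyclic except in top dimension $n$, $H^n(\Omega^\bullet(\mathcal C_0,\nabla_G))$ is a free $\mathcal O_0$-module of rank $n!\,\mathrm{vol}\,\Delta(\bar f)$, and \[ \mathcal C_0=\sum_{v\in B}\mathcal O_0\,\pi^{w(v)}v\ \oplus\ \sum_{l=1}^nD_{l,t}\,\mathcal C_0 . \]
   Context: Setting: $\bar f\in\mathbb F_q[x_1^{\pm1},\dots,x_n^{\pm1}]$ ($q=p^a$) with $\Delta(\bar f)$ = convex hull of $\mathrm{Supp}(\bar f)\cup\{0\}$ of dimension $n$, $M(\bar f)=\mathbb Z^n\cap\mathrm{Cone}(\Delta(\bar f))$, weight $w(\mu)$ = least $c\ge0$ with $\mu\in c\Delta(\bar f)$; $\bar f$ nondegenerate (for each closed face $\sigma$ not containing $0$, the $x_i\partial\bar f^\sigma/\partial x_i$ have no common zero in $(\overline{\mathbb F}_q^* )^n$, $\bar f^\sigma$ = terms of $\bar f$ with exponents in $\sigma$); all monomials of $\bar f$ have weight $1$. $\bar G=\bar f+\bar P\in\mathbb F_q[x^{\pm},t^{\pm}]$ with every $x$-exponent $\mu$ of $\bar P$ in $\mathrm{Cone}(\Delta(\bar f))$ and $w(\mu)<1$. $\Gamma$ = convex hull in $\mathbb R^s$ of $\{0\}\cup\{\frac{1}{1-w(\mu)}\gamma:(\gamma,\mu)\in\mathrm{Supp}(\bar P)\}$, $M(\Gamma)=\mathbb Z^s\cap\mathrm{Cone}(\Gamma)$, $w_\Gamma$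 its weight function, $W(\gamma,\mu)=w_\Gamma(\gamma)+w(\mu)$. $\bar R$ is the graded ring of $\mathbb F_q[M(\bar f)]$ w.r.t. $w$ (basis $x^\mu$, $x^\mu x^\nu=x^{\mu+\nu}$ if $\mu,\nu$ lie over a common closed face of $\Delta(\bar f)$, else $0$); $\bar B$ is a set of monomials of $\bar R$ whose $\mathbb F_q$-span is a complement of $\sum_i x_i\frac{\partial\bar f}{\partial x_i}\bar R$, and $B$ is the same set of monomials $x^\mu$ viewed in characteristic $0$. $p$-adic data: $\mathbb Q_q$ unramified of degree $a$ over $\mathbb Q_p$, $\mathbb Z_q$ its integers, $\sigma$ Frobenius; $\pi$ a root of $\sum_j t^{p^j}/p^j$ with $\mathrm{ord}_p\pi=1/(p-1)$; $\tilde\pi$ a root of $\pi$ such that all needed fractional powers $\pi^{w}$ are integral powers of $\tilde\pi$; $\sigma(\tilde\pi)=\tilde\pi$. $\mathcal O_0=\{\sum_{\gamma\in M(\Gamma)}C(\gamma)\pi^{w_\Gamma(\gamma)}t^\gamma: C(\gamma)\in\mathbb Z_q[\tilde\pi],\ C(\gamma)\to0\}$, and $\mathcal C_0=\{\sum_{\mu\in M(\bar f)}\xi(\mu)\pi^{w(\mu)}x^\mu:\xi(\mu)\in\mathcal O_0,\ \xi(\mu)\to0\}$ (with sup norm on coefficients). $G(x,t)$ is the lift of $\bar G$ with Teichmüller coefficients, $G^{\sigma^i}$ applies $\sigma^i$ to its coefficients; $\gamma_0=1$, $\gamma_i=\pi^{-1}\sum_{j=0}^i\pi^{p^j}/p^j$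 for $i\ge1$; $H(x,t)=\sum_{i\ge0}\gamma_iG^{\sigma^i}(x^{p^i},t^{p^i})$; $D_{l,t}=x_l\frac{\partial}{\partial x_l}+\pi x_l\frac{\partial H(x,t)}{\partial x_l}$ (an endomorphism of $\mathcal C_0$). $\Omega^i(\mathcal C_0,\nabla_G)=\bigoplus_{k_1<\dots<k_i}\mathcal C_0\frac{dx_{k_1}}{x_{k_1}}\wedge\dots\wedge\frac{dx_{k_i}}{x_{k_i}}$ with $\nabla_G(\eta\,\omega)=\big(\sum_{l}D_{l,t}(\eta)\frac{dx_l}{x_l}\big)\wedge\omega$. *)

(* Defs.v *)
From HB Require Import structures.
From mathcomp Require Import all_boot all_order all_algebra falgebra fieldext.
From mathcomp Require Import finmap.
From mathcomp Require Import all_classical all_reals all_analysis.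

Set Implicit Arguments.
Unset Strict Implicit.
Unset Printing Implicit Defensive.

Import Order.TTheory GRing.Theory Num.Theory.

Local Open Scope classical_set_scope.
Local Open Scope ring_scope.

(* [V] is the internal direct sum of its subgroups [A] and [C]. *)
Definition direct_sum (U : zmodType) (V A C : set U) : Prop :=
  (forall x, V x <-> exists y z, [/\ A y, C z & x = y + z]) /\
  (A `&` C = [set 0]).

Section Polytopes.
Variables (R : realType) (n : nat).
Implicit Types (X D : set 'rV[R]_n) (x y u : 'rV[R]_n) (c : R).

Definition dot u x : R := \sum_(i < n) u ord0 i * x ord0 i.

Definition convex_hull X : set 'rV[R]_n :=
  [set x | exists m (v : 'I_m -> 'rV[R]_n) (lam : 'I_m -> R),
     [/\ forall i, X (v i), forall i, 0 <= lam i, \sum_i lam i = 1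
       & x = \sum_i lam i *: v i]].

(* The affine dimension is n: D contains n + 1 affinely independent points. *)
Definition full_dimensional D : Prop :=
  exists v : 'I_n.+1 -> 'rV[R]_n,
    (forall i, D (v i)) /\
    \rank (\matrix_(i < n) (v (lift ord0 i) - v ord0)) = n.

Definition dilate c D : set 'rV[R]_n := [set c *: x | x in D].

Definition cone D : set 'rV[R]_n :=
  [set y | exists2 c, 0 <= c & dilate c D y].

(* For y in the cone over a polytope D containing 0 the infimum is attained. *)
Definition weight D y : R := inf [set c | 0 <= c /\ dilate c D y].

Definition face D (F : set 'rV[R]_n) : Prop :=
  F !=set0 /\
  exists u c, (forall x, D x -> dot u x <= c) /\
              F = D `&` [set x | dot u x = c].

Definition lat (mu : 'rV[int]_n) : 'rV[R]_n := map_mx intr mu.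

Definition lattice_cone D : set 'rV[int]_n := [set mu | cone D (lat mu)].

Definition lweight D (mu : 'rV[int]_n) : R := weight D (lat mu).

(* Faces through 0, in particular D itself, are excluded: mu and nu lie over F
   when the rays they span meet F. *)
Definition cofacial D (mu nu : 'rV[int]_n) : Prop :=
  exists F, [/\ face D F, ~ F 0, cone F (lat mu) & cone F (lat nu)].

End Polytopes.

(* n-dimensional Lebesgue measure of a Borel set, as the iterated product
   (product_measure1) of the measure of the line; R^0 has measure 1. *)
Fixpoint volume (R : realType) (n : nat) : set 'rV[R]_n -> \bar R :=
  match n with
  | 0 => fun A => (\1_A (0 : 'rV[R]_0))%:E
  | m.+1 => fun A =>
      (\int[@lebesgue_measure R]_x
         volume [set v : 'rV[R]_m |
                  A (row_mx (x%:M : 'rV[R]_1) v : 'rV[R]_(1 + m))])%E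
  end.

(* Laurent polynomials are given by their finitely supported coefficient
   functions on the exponents. *)
Section LaurentPolynomials.
Variables (R : realType) (Fq : finFieldType) (n s : nat).
Implicit Types (f g h : 'rV[int]_n -> Fq) (P : 'rV[int]_s * 'rV[int]_n -> Fq).

Definition newton f : set 'rV[R]_n :=
  convex_hull ([set 0] `|` [set lat R mu | mu in [set mu | f mu != 0]]).

Definition eval_logderiv (Fbar : fieldType) (iota : Fq -> Fbar)
    f (F : set 'rV[R]_n) (i : 'I_n) (x : 'I_n -> Fbar) : Fbar :=
  \sum_(mu \in [set mu | f mu != 0 /\ F (lat R mu)])
    iota (f mu) * (mu ord0 i)%:~R * \prod_(j < n) x j ^ mu ord0 j.

Definition nondegenerate_laurent (Fbar : fieldType) (iota : Fq -> Fbar) f : Prop :=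
  forall F, face (newton f) F -> ~ F 0 ->
    ~ exists x : 'I_n -> Fbar, (forall j, x j != 0) /\
        forall i, eval_logderiv iota f F i x = 0.

Definition logderiv f (i : 'I_n) : 'rV[int]_n -> Fq :=
  fun mu => (mu ord0 i)%:~R * f mu.

Definition finsupported g : Prop := finite_set [set mu | g mu != 0].

(* The underlying space of the graded ring attached to the weight of D. *)
Definition gr_ring (D : set 'rV[R]_n) : set ('rV[int]_n -> Fq) :=
  [set g | finsupported g /\ forall mu, ~ lattice_cone D mu -> g mu = 0].

Definition gr_mul (D : set 'rV[R]_n) g h : 'rV[int]_n -> Fq :=
  fun mu => \sum_(nu \in [set nu | cofacial D nu (mu - nu)])
              g nu * h (mu - nu).

Definition jacobian_ideal f : set ('rV[int]_n -> Fq) :=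
  [set g | exists h : 'I_n -> 'rV[int]_n -> Fq,
     (forall i, gr_ring (newton f) (h i)) /\
     g = \sum_(i < n) gr_mul (newton f) (logderiv f i) (h i)].

Definition monomial_span (B : set 'rV[int]_n) : set ('rV[int]_n -> Fq) :=
  [set g | finsupported g /\ forall mu, ~ B mu -> g mu = 0].

Definition jacobian_basis f (B : set 'rV[int]_n) : Prop :=
  B `<=` lattice_cone (newton f) /\
  direct_sum (gr_ring (newton f)) (monomial_span B) (jacobian_ideal f).

Definition deformation_polytope f P : set 'rV[R]_s :=
  convex_hull ([set 0] `|`
    [set (1 - lweight (newton f) e.2)^-1 *: lat R e.1
       | e in [set e | P e != 0]]).

(* Coefficients of f + P, with exponents written (gamma, mu). *)
Definition deformed f P : 'rV[int]_s * 'rV[int]_n -> Fq :=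
  fun e => (if e.1 == 0 then f e.2 else 0) + P e.

End LaurentPolynomials.

Arguments newton R {Fq n} f.
Arguments deformation_polytope R {Fq n s} f P.

Section Valuations.
Variables (R : realType) (K : fieldType) (ord : K -> \bar R).

Definition valuation : Prop :=
  [/\ forall x, ord x != -oo%E,
      forall x, ord x = +oo%E <-> x = 0,
      forall x y, ord (x * y) = (ord x + ord y)%E
    & forall x y, (Order.min (ord x) (ord y) <= ord (x + y)%R)%E].

Definition val_cvg (u : nat -> K) (l : K) : Prop :=
  forall N : R, exists m0, forall m, (m0 <= m)%N -> (N%:E <= ord (u m - l)%R)%E.

Definition val_cauchy (u : nat -> K) : Prop :=
  forall N : R, exists m0, forall m m', (m0 <= m)%N -> (m0 <= m')%N ->
    (N%:E <= ord (u m - u m')%R)%E.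

(* K is the field of p-adic numbers and ord is ord_p: the completion of the
   rationals for a valuation with ord p = 1 (such a valuation is p-adic). *)
Definition is_Qp (p : nat) : Prop :=
  [/\ valuation, ord p%:R = 1%:E,
      forall (x : K) (N : R), exists r : rat, (N%:E <= ord (x - ratr r)%R)%E
    & forall u, val_cauchy u -> exists l, val_cvg u l].

Definition has_vsum (I : choiceType) (F : I -> K) (S : K) : Prop :=
  forall N : R, exists J0 : {fset I}, forall J : {fset I},
    (J0 `<=` J)%fset -> (N%:E <= ord (S - \sum_(i <- J) F i)%R)%E.

Definition vsum (I : choiceType) (F : I -> K) : K := xget 0 (has_vsum F).

(* F tends to 0 along the complements of finite sets of indices in A. *)
Definition tends0 (I : Type) (A : set I) (F : I -> \bar R) : Prop :=
  forall N : R, finite_set [set i | A i /\ (F i < N%:E)%E].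

End Valuations.

Section PadicData.
Variables (R : realType) (Qp : fieldType) (K : fieldExtType Qp).
Variables (Qq : {subfield K}) (ord : K -> \bar R).

(* Qq is the unramified extension of Qp of degree a. *)
Definition unramified (a : nat) : Prop :=
  \dim Qq = a /\
  forall x, x \in Qq -> x != 0 -> exists m : int, ord x = (m%:~R)%:E.

Definition Zq : set K := [set x | x \in Qq /\ (0 <= ord x)%E].

(* red restricts to a ring morphism from Zq onto its residue field Fq. *)
Definition residue_map (Fq : finFieldType) (red : K -> Fq) : Prop :=
  [/\ red 1 = 1,
      forall x y, Zq x -> Zq y ->
        red (x + y) = red x + red y /\ red (x * y) = red x * red y,
      forall x, Zq x -> (red x = 0 <-> (0 < ord x)%E)
    & forall c, exists2 x, Zq x & red x = c].

Definition teichmuller (Fq : finFieldType) (red : K -> Fq) (tau : Fq -> K) :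
  Prop := forall c, [/\ Zq (tau c), red (tau c) = c & tau c ^+ #|Fq| = tau c].

(* sigma is the Frobenius of Qq over Qp, extended to K with sigma pit = pit. *)
Definition frobenius (p : nat) (Fq : finFieldType) (red : K -> Fq) (pit : K)
    (sigma : {lrmorphism K -> K}) : Prop :=
  [/\ forall x, x \in Qq -> sigma x \in Qq,
      forall x, Zq x -> red (sigma x) = red x ^+ p
    & sigma pit = pit].

(* Partial sums of \sum_j t^{p^j}/p^j at t = ppi. *)
Definition AH_partial (p : nat) (ppi : K) (m : nat) : K :=
  \sum_(j < m) ppi ^+ (p ^ j) / p%:R ^+ j.

Definition AH_root (p : nat) (ppi : K) : Prop :=
  val_cvg ord (AH_partial p ppi) 0 /\ ord ppi = ((p%:R - 1)^-1)%:E.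

Definition Zq_adjoin (pit : K) : set K :=
  [set x | exists P : {poly K}, (forall i, Zq P`_i) /\ x = P.[pit]].

(* gamma_i; the value at 0 is 1. *)
Definition gam (p : nat) (ppi : K) (i : nat) : K :=
  ppi^-1 * AH_partial p ppi i.+1.

(* When pit ^+ d is pi, this is pi^w for every w >= 0 with d w an integer. *)
Definition fracpow (pit : K) (d : nat) (w : R) : K :=
  pit ^+ Num.truncn (d%:R * w).

End PadicData.

(* Series in t (resp. in x and t) are given by their coefficient functions:
   [a gamma] is the coefficient of t^gamma and [eta mu gamma] that of
   t^gamma x^mu. *)
Section Complex.
Variables (R : realType) (K : fieldType) (ord : K -> \bar R).
(* The coefficient ring Z_q[pit], the map w |-> pi^w, the element pi, and the
   coefficients of H. *)
Variables (A : set K) (pipow : R -> K) (ppi : K).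
Variables (n s : nat) (Delta : set 'rV[R]_n) (Gamma : set 'rV[R]_s).
Variable (H : 'rV[int]_s * 'rV[int]_n -> K).

Local Notation tser := ('rV[int]_s -> K).
Local Notation xtser := ('rV[int]_n -> 'rV[int]_s -> K).
Local Notation form := ({set 'I_n} -> xtser).

(* The coefficient C(gamma) in a = \sum C(gamma) pi^{w_Gamma(gamma)} t^gamma. *)
Definition tcoef (a : tser) : tser :=
  fun gamma => a gamma / pipow (lweight Gamma gamma).

Definition O0 : set tser :=
  [set a | [/\ forall gamma, ~ lattice_cone Gamma gamma -> a gamma = 0,
               forall gamma, lattice_cone Gamma gamma -> A (tcoef a gamma)
             & tends0 (lattice_cone Gamma) (fun gamma => ord (tcoef a gamma))]].

(* The valuation of the sup norm on O0. *)
Definition ordO0 (a : tser) : \bar R :=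
  ereal_inf [set ord (tcoef a gamma) | gamma in lattice_cone Gamma].

(* The coefficient xi(mu) in eta = \sum xi(mu) pi^{w(mu)} x^mu. *)
Definition xcoef (eta : xtser) : 'rV[int]_n -> tser :=
  fun mu gamma => eta mu gamma / pipow (lweight Delta mu).

Definition C0 : set xtser :=
  [set eta | [/\ forall mu, ~ lattice_cone Delta mu -> eta mu = 0,
                 forall mu, lattice_cone Delta mu -> O0 (xcoef eta mu)
               & tends0 (lattice_cone Delta) (fun mu => ordO0 (xcoef eta mu))]].

Definition oscale (a : tser) (eta : xtser) : xtser :=
  fun mu gamma => vsum ord (fun g => a g * eta mu (gamma - g)).

(* D_{l,t} = x_l d/dx_l + pi x_l dH/dx_l. *)
Definition Dop (l : 'I_n) (eta : xtser) : xtser :=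
  fun mu gamma =>
    (mu ord0 l)%:~R * eta mu gamma +
    vsum ord (fun e : 'rV[int]_s * 'rV[int]_n =>
      ppi * ((e.2 ord0 l)%:~R * H e) * eta (mu - e.2) (gamma - e.1)).

(* [omega S] is the coefficient of dx_{k_1}/x_{k_1} /\ ... /\ dx_{k_i}/x_{k_i},
   where k_1 < ... < k_i are the elements of S. *)
Definition Omega (i : nat) : set form :=
  [set omega | forall S : {set 'I_n}, if #|S| == i then C0 (omega S) else omega S = 0].

(* The sign moves dx_l/x_l to its place in the ordered product over T. *)
Definition nabla (omega : form) : form :=
  fun T mu gamma =>
    \sum_(l in T) (-1) ^+ #|[pred k in T | (k < l)%N]|
                  * Dop l (omega (T :\ l)%SET) mu gamma.

Definition cocycles (i : nat) : set form :=
  [set omega | Omega i omega /\ nabla omega = 0].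

Definition coboundaries (i : nat) : set form :=
  if i is j.+1 then [set nabla theta | theta in Omega j] else [set 0].

Definition acyclic_at (i : nat) : Prop := cocycles i `<=` coboundaries i.

Definition cohomology_free (i r : nat) : Prop :=
  exists e : 'I_r -> form, (forall j, cocycles i (e j)) /\
    forall omega, cocycles i omega ->
      exists! a : 'I_r -> tser, (forall j, O0 (a j)) /\
        coboundaries i
          (omega - \sum_(j < r) (fun S => oscale (a j) (e j S))).

Definition pimonomial (v : 'rV[int]_n) : xtser :=
  fun mu gamma =>
    if (mu == v) && (gamma == 0) then pipow (lweight Delta v) else 0.

Definition O0_span (B : set 'rV[int]_n) : set xtser :=
  [set eta | exists (J : {fset 'rV[int]_n}) (a : 'rV[int]_n -> tser),
     [/\ forall v, v \in J -> B v, forall v, v \in J -> O0 (a v)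
       & eta = \sum_(v <- J) oscale (a v) (pimonomial v)]].

Definition D_image : set xtser :=
  [set eta | exists theta : 'I_n -> xtser,
     (forall l, C0 (theta l)) /\ eta = \sum_(l < n) Dop l (theta l)].

End Complex.

(* The coefficients of
   H(x,t) = \sum_i gamma_i G^{sigma^i}(x^{p^i}, t^{p^i}),
   where G is the Teichmueller lift of Gbar. *)
Definition Hcoef (R : realType) (Qp : fieldType) (K : fieldExtType Qp)
    (ord : K -> \bar R) (Fq : finFieldType) (tau : Fq -> K) (sigma : K -> K)
    (p : nat) (ppi : K) (n s : nat) (Gbar : 'rV[int]_s * 'rV[int]_n -> Fq) :
    'rV[int]_s * 'rV[int]_n -> K :=
  fun e => vsum ord (fun i : nat => gam p ppi i *
    \sum_(e' \in [set e' : 'rV[int]_s * 'rV[int]_n |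
                   e'.1 *+ p ^ i = e.1 /\ e'.2 *+ p ^ i = e.2])
      iter i sigma (tau (Gbar e'))).

(* Main.v *)
(** Modulo a uniformizer, the top-weight part of [D_{l,t}] is multiplication by
    [F_l = x_l df/dx_l] on the graded ring [Rbar], so everything reduces to showing that
    [Rbar] is free over [k[F_1, ..., F_n]] with basis [B].

    [Rbar] is [A'/tA'], where [A'] is the semigroup ring of the lattice points [(mu, m)] with
    [m >= d w(mu)] and [t = x^(0,1)].  A graded Nullstellensatz and nondegeneracy give that [B]
    is finite.  Freeness is proved in the manner of tight closure: a relation among the
    elements of [B] over [k[t, F_1, ..., F_n]] is raised to the power [q], multiplied by a fixed
    [c != 0] that maps [A'] into a free submodule, and contracted by a Cartier-type operator
    [x^(u + q w) |-> x^w]; since a lattice cone is cut out by integral inequalities this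
    operator preserves [A'], and the outcome contradicts the minimality of [B].  Algebraic
    independence of [t, F_1, ..., F_n] follows by counting lattice points.

    Freeness makes the Koszul complex of [(F_l)] on [Rbar] acyclic except in top degree, and it
    gives [#{mu | w(mu) <= N} = sum_b C(N - w(b) + n, n)] up to bounded shifts of [N]; comparison
    with [N^n vol(Delta)] yields [#|B| = n! vol(Delta)].

    On the [p]-adic side the field is complete and totally ramified over [Qq] with uniformizer
    [pit], its integers are [Zq[pit]] and its residue field is [Fq].  The Artin-Hasse
    estimates show that every term of [pi x_l dH/dx_l] other than those of [f] either is divisible
    by [pit] in the weighted norm or raises the [x]-weight by less than [1].  Exactness, generation
    and independence are therefore lifted by descending induction on the top [x]-weight, then
    [pit]-adically. *)
Require Import Defs.
From HB Require Import structures.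
From mathcomp Require Import all_boot all_order all_algebra.

Set Implicit Arguments.
Unset Strict Implicit.
Unset Printing Implicit Defensive.

(** The usual source of freeness is the Cohen-Macaulay property of normal semigroup rings; the
    Frobenius argument replaces it, over the finite field itself, where raising to the power [q]
    only multiplies exponents. The multiplier [c] is a common denominator for expressing the
    elements of [B] through a maximal subset of [B] that is independent over [k[t, F_1, ..., F_n]];
    contraction along an exponent [u] of [c] turns it into a nonzero constant once [q] exceeds its
    degree.

    Nondegeneracy concerns points over the algebraic closure, so monomials of high weight are first
    shown to lie in the Jacobian ideal there; a linear retraction onto the finite field brings this
    back.

    On the p-adic side the terms of [P] need not be small: they can have total weight [W = 1], like
    those of [f], and then survive modulo [pit]. Only their x-weight is below 1. Hence the induction
    runs on the x-weight alone, the exponent of [t] being a parameter. Weights are scaled by [d] to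
    be natural numbers, and [pit] has valuation [1/(d(p-1))], so that weight [w] has the norm of
    [pit^(d w)]. *)

Module KoszulComplex.
From mathcomp Require Import boolp ring zify.
From mathcomp.multinomials Require Import mpoly.
Import GRing.Theory.
Local Open Scope ring_scope.

(** * Koszul signs and acyclicity of the Koszul complex of the variables *)

Section Signs.
Variable n : nat.
Implicit Types (T : {set 'I_n}) (l k : 'I_n).

Definition cnt l T : nat := #|[pred k in T | (k < l)%N]|.

Lemma cntU l k T : k \notin T -> cnt l (k |: T) = ((k < l) + cnt l T)%N.
Proof.
move=> nk; rewrite /cnt (cardD1 k) !inE eqxx /=; congr (_ + _)%N.
apply: eq_card => i; rewrite !inE; have [->|] := eqVneq i k; last by [].
by rewrite (negPf nk).
Qed.

Lemma cntD l k T : k \in T -> cnt l T = ((k < l) + cnt l (T :\ k))%N.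
Proof. by move=> kT; rewrite -{1}(setD1K kT) cntU // setD11. Qed.

Variable R : pzRingType.
Definition sgn l T : R := (-1) ^+ cnt l T.

Lemma sgn_sq l T : sgn l T * sgn l T = 1.
Proof. by rewrite /sgn -exprD addnn -signr_odd odd_double. Qed.

(** The two orders of removing [l] and inserting [k] differ by exactly one of [l < k] and [k < l];
    this is the anticommutation of an exterior product with a contraction. *)
Lemma sgn_swap l k T : l \in T -> k \notin T ->
  sgn l T * sgn k (k |: (T :\ l)) = - (sgn k (k |: T) * sgn l (k |: T)).
Proof.
move=> lT nk; have nkl : k != l by apply: contraNneq nk => ->.
have nk' : k \notin T :\ l by rewrite !inE (negPf nk) andbF.
rewrite /sgn -!exprD !cntU // ltnn !add0n (cntD k lT).
have : (l < k)%N (+) (k < l)%N by move: nkl; rewrite -val_eqE /=; case: ltngtP.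
rewrite -[RHS]mulN1r -exprS -[LHS]signr_odd -[RHS]signr_odd /=.
by move=> H; congr (_ ^+ _); move: H; rewrite !oddD; case: (l < k)%N; case: (k < l)%N;
   case: (odd (cnt l T)); case: (odd (cnt k (T :\ l))).
Qed.

(** The sign rule behind the vanishing of the square of the differential. *)
Lemma sgn_swap2 l k T : l \in T -> k \in T -> l != k ->
  sgn l T * sgn k (T :\ l) = - (sgn k T * sgn l (T :\ k)).
Proof.
move=> lT kT nlk; rewrite /sgn -!exprD (cntD l kT) (cntD k lT).
have : (l < k)%N (+) (k < l)%N by move: nlk; rewrite -val_eqE /=; case: ltngtP.
rewrite -[RHS]mulN1r -exprS -[LHS]signr_odd -[RHS]signr_odd /=.
by move=> H; congr (_ ^+ _); move: H; rewrite !oddD; case: (l < k)%N; case: (k < l)%N;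
   case: (odd (cnt l _)); case: (odd (cnt k _)).
Qed.

End Signs.

Section KoszulPoly.
Variables (E : fieldType) (n : nat).
Local Notation S := {mpoly E[n]}.
Implicit Types (P : {set 'I_n} -> S) (T : {set 'I_n}) (al : 'X_{1..n}) (l : 'I_n).

(** The Koszul differential of the variables, with the sign convention of [nabla]. *)
Definition dX P T : S := \sum_(l in T) sgn E l T *: ('X_l * P (T :\ l)).

(** [dX] preserves the multidegree [al - 1_T], whose entries are at least -1. The pivot is an index
    where the entry is not -1, so it depends only on the multidegree; it is missing only for [T]
    full and [al = 0], where the cohomology sits. *)
Let pivot T al : option 'I_n := [pick l | (l \notin T) || (al l != 0%N)].

Let pivotU T al l : l \notin T -> pivot (l |: T) (al + U_(l))%MM = pivot T al.
Proof.
move=> nl; apply: eq_pick => k; rewrite !inE mnmDE mnm1E.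
have [E0|nkl] := eqVneq k l; first by rewrite E0 nl addn1 orbT.
by rewrite addn0.
Qed.

Lemma mcoeffXiM l (Q : S) al : ('X_l * Q)@_al = if al l != 0%N then Q@_(al - U_(l))%MM else 0.
Proof.
case: ifP => [le|nle].
  have le' : (U_(l) <= al)%MM by rewrite lep1mP.
  by rewrite -{1}(submK le') addmC mulrC mcoeffMX.
apply/eqP; rewrite mcoeff_eq0; apply/negP; rewrite mulrC (perm_mem (msuppMX _ _)).
by move=> /mapP[x _ Ew]; move: nle; rewrite Ew mnmDE mnm1E eqxx.
Qed.

Lemma koszul_poly P : P [set: 'I_n] = 0 -> (forall T, dX P T = 0) ->
  exists th : {set 'I_n} -> S, (forall T, P T = dX th T) /\
    forall T al, (th T)@_al != 0 ->
      exists l, l \notin T /\ (P (l |: T))@_(al + U_(l))%MM != 0.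
Proof.
move=> PT dP; pose D := (\sum_T msize (P T))%N.
have bigD T al : (D <= mdeg al)%N -> (P T)@_al = 0.
  move=> le; apply: memN_msupp_eq0; apply: msize_mdeg_ge; apply: leq_trans le.
  by rewrite /D (bigD1 T) //= leq_addr.
(* A contracting homotopy in each multidegree: contraction with the pivot index, and zero when the
   pivot already lies in [T]. *)
pose hc T al : E := if pivot T al is Some l then
  (if l \notin T then sgn E l (l |: T) * (P (l |: T))@_(al + U_(l))%MM else 0) else 0.
pose th T : S := \sum_(al : 'X_{1..n < D}) hc T al *: 'X_[al].
have thE T al : (th T)@_al = hc T al.
  have [lt|ge] := ltnP (mdeg al) D; first exact: mcoeff_mpoly.
  have -> : hc T al = 0.
    rewrite /hc; case: (pivot T al) => // l; case: ifP => // _.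
    by rewrite bigD ?mulr0 // mdegD; apply: leq_trans ge (leq_addr _ _).
  rewrite raddf_sum /= big1 // => v _; rewrite mcoeffZ mcoeffX.
  have [Ev|] := eqVneq (val v : 'X_{1..n}) al; last by rewrite mulr0.
  by have := bmdeg v; rewrite Ev ltnNge ge.
exists th; split=> [T|T al]; last first.
  rewrite thE /hc; case: (pivot T al) => [l|]; last by rewrite eqxx.
  case: ifP => [nl nz|]; last by rewrite eqxx.
  by exists l; split=> //; apply: contraNneq nz => ->; rewrite mulr0.
apply/mpolyP => al; rewrite /dX raddf_sum /=.
under eq_bigr do rewrite mcoeffZ mcoeffXiM.
case Ep: (pivot T al) => [k|]; last first.
  have [ET Eal] : T = [set: 'I_n] /\ al = 0%MM.
    move: Ep; rewrite /pivot; case: pickP => // H _; split.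
      by apply/setP => l; rewrite inE; have := H l; case: (l \in T).
    by apply/mnmP => l; rewrite mnm0E; apply/eqP; have := H l; case: (al l == 0%N) => //; rewrite orbT.
  by rewrite ET PT mcoeff0 big1 // => l _; rewrite Eal mnm0E eqxx mulr0.
have pk : (k \notin T) || (al k != 0%N).
  by move: Ep; rewrite /pivot; case: pickP => // l H [<-].
have piv l : l \in T -> al l != 0%N -> pivot (T :\ l) (al - U_(l))%MM = Some k.
  move=> lT al0; rewrite -Ep -[in RHS](setD1K lT).
  have le' : (U_(l) <= al)%MM by rewrite lep1mP.
  by rewrite -{2}(submK le') pivotU // setD11.
(* If the pivot is in [T], only its own term of [dX th T] survives. Otherwise [P T] is rewritten
   through the coefficient at [al + U_(k)] of [dX P (k |: T) = 0]. *)
have [kT|nkT] := boolP (k \in T).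
  rewrite kT /= in pk; rewrite (bigD1 k) //= pk thE /hc piv // setD11 /=.
  have le' : (U_(k) <= al)%MM by rewrite lep1mP.
  rewrite setD1K // submK // mulrA sgn_sq mul1r big1 ?addr0 // => l /andP[lT nlk].
  case: ifP => // al0; rewrite ?mulr0 // thE /hc piv // !inE eq_sym nlk kT /=.
  by rewrite mulr0.
have := congr1 (mcoeff (al + U_(k))%MM) (dP (k |: T)).
rewrite mcoeff0 /dX raddf_sum /= big_setU1 //= mcoeffZ mcoeffXiM mnmDE mnm1E eqxx addn1 /=.
rewrite addmK setU1K // => /eqP; rewrite addr_eq0 => /eqP H.
have -> : (P T)@_al = sgn E k (k |: T) * (sgn E k (k |: T) * (P T)@_al).
  by rewrite mulrA sgn_sq mul1r.
rewrite H mulrN -mulrN -sumrN mulr_sumr; apply: eq_bigr => l lT.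
have nlk : k != l by apply: contraNneq nkT => ->.
rewrite mcoeffZ mcoeffXiM mnmDE mnm1E (negPf nlk) addn0.
case: ifP => al0; last by rewrite !mulr0 oppr0 mulr0.
rewrite thE /hc piv // !inE (negPf nkT) andbF /= mulrA sgn_swap // mulrN mulNr -mulrA.
have le' : (U_(l) <= al)%MM by rewrite lep1mP.
have -> : ((al + U_(k)) - U_(l))%MM = (al - U_(l) + U_(k))%MM.
  by apply/mnmP => x; have := mnm_lepP le' x; rewrite !(mnmDE, mnmBE); lia.
have -> // : (k |: T) :\ l = k |: (T :\ l).
apply/setP => x; rewrite !inE; have [->|//] := eqVneq x k; by rewrite nlk.
Qed.

End KoszulPoly.

End KoszulComplex.

(** * Freeness by Frobenius powers and a Cartier-type contraction *)

Module CartierFreeness.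
From mathcomp Require Import all_field.
From mathcomp Require Import boolp.
From mathcomp Require Import ring.
From mathcomp.multinomials Require Import mpoly.
Import GRing.Theory.
Local Open Scope ring_scope.

Section SemigroupRing.
Variables (k : fieldType) (N : nat) (M : 'X_{1..N} -> Prop).
Hypothesis M0 : M 0%MM.
Hypothesis MD : forall u v, M u -> M v -> M (u + v)%MM.
Implicit Types (a h g : {mpoly k[N]}) (u v w : 'X_{1..N}).

(** The semigroup ring [k[M]], realised inside the polynomial ring. *)
Definition supported a : Prop := forall v, a@_v != 0 -> M v.

Lemma supported0 : supported 0.
Proof. by move=> v; rewrite mcoeff0 eqxx. Qed.

Lemma supportedD a h : supported a -> supported h -> supported (a + h).
Proof.
move=> sa sh v; rewrite mcoeffD => H.
have [a0|/sa//] := eqVneq a@_v 0; apply: sh.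
by move: H; rewrite a0 add0r.
Qed.

Lemma supportedZ c a : supported a -> supported (c *: a).
Proof.
move=> sa v; rewrite mcoeffZ => H; apply: sa.
by apply: contraNneq H => ->; rewrite mulr0.
Qed.

Lemma supported_sum (I : Type) (r : seq I) (P : pred I) (F : I -> {mpoly k[N]}) :
  (forall i, P i -> supported (F i)) -> supported (\sum_(i <- r | P i) F i).
Proof.
move=> H; elim/big_rec: _ => [|i x Pi]; first exact: supported0.
by apply: supportedD; apply: H.
Qed.

Lemma supportedX v : M v -> supported 'X_[v].
Proof.
by move=> Mv w; rewrite mcoeffX; have [<-|_] := eqVneq v w; rewrite ?eqxx.
Qed.

Lemma supportedM a h : supported a -> supported h -> supported (a * h).
Proof.
move=> sa sh; rewrite [a]mpolyE [h]mpolyE mulr_suml big_seq.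
apply: supported_sum => v; rewrite mcoeff_msupp => /sa Mv.
rewrite mulr_sumr big_seq; apply: supported_sum => w.
rewrite mcoeff_msupp => /sh Mw.
rewrite -scalerAl -scalerAr -mpolyXD.
by do 2!apply: supportedZ; apply: supportedX; apply: MD.
Qed.

Lemma supported1 : supported 1.
Proof. by rewrite -mpolyX0; apply: supportedX. Qed.

Lemma supported_exp a j : supported a -> supported (a ^+ j).
Proof.
move=> sa; elim: j => [|j IH]; first by rewrite expr0; apply: supported1.
by rewrite exprS; apply: supportedM.
Qed.

Lemma supported_prod (I : Type) (r : seq I) (P : pred I) (F : I -> {mpoly k[N]}) :
  (forall i, P i -> supported (F i)) -> supported (\prod_(i <- r | P i) F i).
Proof.
move=> H; elim/big_rec: _ => [|i x Pi]; first exact: supported1.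
by apply: supportedM; apply: H.
Qed.

Lemma supported_comp m (y : m.-tuple {mpoly k[N]}) (g : {mpoly k[m]}) :
  (forall i, supported (tnth y i)) -> supported (g \mPo y).
Proof.
move=> sy; rewrite comp_mpolyEX; apply: supported_sum => v _.
apply: supportedZ; rewrite comp_mpolyX; apply: supported_prod => i _.
by apply: supported_exp.
Qed.

End SemigroupRing.

(* A Cartier-type operator: [cartier u q (g ^+ q * h) = g * cartier u q h]. *)
Section Cartier.
Variables (k : fieldType) (N : nat) (u : 'X_{1..N}) (q : nat).
Hypothesis q_gt0 : (0 < q)%N.
Implicit Types (h g : {mpoly k[N]}) (v w : 'X_{1..N}).

Definition cartier h : {mpoly k[N]} :=
  \sum_(w : 'X_{1..N < msize h}) h@_(u + w *+ q)%MM *: 'X_[w].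

Lemma cartierE h w : (cartier h)@_w = h@_(u + w *+ q)%MM.
Proof.
have [ltw|gew] := ltnP (mdeg w) (msize h).
  exact: (mcoeff_mpoly (fun w => h@_(u + w *+ q)%MM)).
have -> : h@_(u + w *+ q)%MM = 0.
  apply: memN_msupp_eq0; apply: msize_mdeg_ge; apply: leq_trans gew _.
  rewrite mdegD mdegMn; apply: leq_trans (leq_addl _ _).
  by rewrite -{1}[mdeg w]muln1 leq_mul2l q_gt0 orbT.
rewrite raddf_sum /= big1 // => v _; rewrite mcoeffZ mcoeffX.
case: eqP => [E|_]; last by rewrite mulr0.
by move: (bmdeg v); rewrite E ltnNge gew.
Qed.

Lemma cartierD g h : cartier (g + h) = cartier g + cartier h.
Proof. by apply/mpolyP => w; rewrite mcoeffD !cartierE mcoeffD. Qed.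

Lemma cartier0 : cartier 0 = 0.
Proof. by apply/mpolyP => w; rewrite cartierE !mcoeff0. Qed.

Lemma cartierZ c h : cartier (c *: h) = c *: cartier h.
Proof. by apply/mpolyP => w; rewrite mcoeffZ !cartierE mcoeffZ. Qed.

Lemma cartier_sum (I : Type) (r : seq I) (P : pred I) (F : I -> {mpoly k[N]}) :
  cartier (\sum_(i <- r | P i) F i) = \sum_(i <- r | P i) cartier (F i).
Proof. exact: (big_morph _ cartierD cartier0). Qed.

Variable M : 'X_{1..N} -> Prop.
(** With [v1 = 0] this gives stability of [k[M]] under the contraction; for general [v1], which may
    lie outside [M], it gives linearity over [q]-th powers of monomials. *)
Hypothesis cancelM : forall v v1 w, M v -> (v + v1 *+ q = u + w *+ q)%MM ->
  exists2 w', M w' & w = (v1 + w')%MM.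

Lemma cartier_supported h : supported M h -> supported M (cartier h).
Proof.
move=> sh w; rewrite cartierE => /sh Mw.
have [|w' Mw' ->] := cancelM (v := (u + w *+ q)%MM) (v1 := 0%MM) (w := w) Mw.
  by apply/mnmP => i; rewrite !mnmDE !mulmnE mnm0E mul0n addn0.
by rewrite add0m.
Qed.

Lemma cartierMX v1 h : supported M h ->
  cartier ('X_[v1 *+ q] * h) = 'X_[v1] * cartier h.
Proof.
move=> sh; rewrite [h]mpolyE mulr_sumr !cartier_sum mulr_sumr.
rewrite !big_seq; apply: eq_bigr => v; rewrite mcoeff_msupp => /sh Mv.
rewrite -scalerAr !cartierZ -scalerAr -mpolyXD; congr (_ *: _).
apply/mpolyP => w; rewrite cartierE mcoeffX.
case: eqP => [E|nE].
  have [|w' Mw' Ew] := cancelM (v := v) (v1 := v1) (w := w) Mv.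
    by rewrite addmC.
  rewrite Ew mulrC mcoeffMX cartierE mcoeffX.
  suff -> : v = (u + w' *+ q)%MM by rewrite eqxx.
  apply: (@addmI _ (v1 *+ q)%MM); rewrite E Ew.
  by apply/mnmP => i; rewrite !(mnmDE, mulmnE) mulnDl addnCA.
symmetry; have [lev|nlev] := boolP (v1 <= w)%MM.
  have [w' Ew] : exists w', w = (v1 + w')%MM.
    by exists (w - v1)%MM; rewrite addmC submK.
  rewrite Ew mulrC mcoeffMX cartierE mcoeffX.
  case: eqP => // Ev; case: nE; rewrite Ev Ew.
  by apply/mnmP => i; rewrite !(mnmDE, mulmnE) mulnDl addnCA.
apply/eqP; rewrite mcoeff_eq0; apply: contra nlev.
rewrite mulrC (perm_mem (msuppMX _ _)) => /mapP[w' _ ->].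
exact: lem_addr.
Qed.

End Cartier.

Section Freeness.
Variables (k : fieldType) (Q N : nat) (M : 'X_{1..N} -> Prop).
Hypothesis Q_gt1 : (1 < Q)%N.
Hypothesis pcharQ : [pchar k].-nat Q.
Hypothesis expQ : forall c : k, c ^+ Q = c.

Lemma pcharQ_mpoly j : [pchar {mpoly k[N]}].-nat (Q ^ j)%N.
Proof.
rewrite pnatX; apply/orP; left; apply: sub_in_pnat pcharQ => p _.
rewrite !inE => /andP[-> /eqP E] /=; apply/eqP.
by rewrite -mpolyC_nat E mpolyC0.
Qed.

Lemma expQX (c : k) j : c ^+ (Q ^ j) = c.
Proof. by elim: j => [|j IH]; rewrite ?expr1 // expnSr exprM IH expQ. Qed.

Lemma frobD (g h : {mpoly k[N]}) j :
  (g + h) ^+ (Q ^ j) = g ^+ (Q ^ j) + h ^+ (Q ^ j).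
Proof. by rewrite exprDn_pchar // pcharQ_mpoly. Qed.

Lemma frob_sum (I : Type) (r : seq I) (P : pred I) (F : I -> {mpoly k[N]}) j :
  (\sum_(i <- r | P i) F i) ^+ (Q ^ j) =
  \sum_(i <- r | P i) F i ^+ (Q ^ j).
Proof.
elim/big_rec2: _ => [|i x y _ <-]; last exact: frobD.
by rewrite expr0n expn_eq0 eqn0Ngt (ltnW Q_gt1).
Qed.

Lemma frobE (g : {mpoly k[N]}) j :
  g ^+ (Q ^ j) = \sum_(v <- msupp g) g@_v *: 'X_[v *+ (Q ^ j)].
Proof.
rewrite {1}[g]mpolyE frob_sum; apply: eq_bigr => v _.
by rewrite exprZn expQX mpolyXn.
Qed.

Hypothesis M0 : M 0%MM.
Hypothesis MD : forall u v, M u -> M v -> M (u + v)%MM.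
Hypothesis starM : forall u, M u -> exists q0, forall q, (q0 <= q)%N ->
  forall v v1 w, M v -> (v + v1 *+ q = u + w *+ q)%MM ->
    exists2 w', M w' & w = (v1 + w')%MM.
Variables (r : nat) (b : 'I_r -> 'X_{1..N}) (y : N.-tuple {mpoly k[N]}).
Hypothesis Mb : forall i, M (b i).
Hypothesis My : forall i, supported M (tnth y i).

Local Notation ev g := (g \mPo y).

Lemma cartier_frobM u j q (g h : {mpoly k[N]}) : q = (Q ^ j)%N ->
  (forall v v1 w, M v -> (v + v1 *+ q = u + w *+ q)%MM ->
     exists2 w', M w' & w = (v1 + w')%MM) ->
  supported M h -> cartier u q (g ^+ q * h) = g * cartier u q h.
Proof.
move=> Eq H sh; have q_gt0 : (0 < q)%N.
  by rewrite Eq expn_gt0 (ltnW Q_gt1).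
have -> : g ^+ q = \sum_(v <- msupp g) g@_v *: 'X_[v *+ q] by rewrite Eq frobE.
rewrite mulr_suml cartier_sum // [in RHS](mpolyE g) mulr_suml.
apply: eq_bigr => v _; rewrite -!scalerAl cartierZ //; congr (_ *: _).
exact: (cartierMX q_gt0 H).
Qed.

(** An exponent [v] of [p] contributes only if [v *+ q <= al *+ q + be], and [be i < q] turns this
    into [v <= al]; as [al] has least degree among the exponents of [p], only [v = al] is left. *)
Lemma mcoeff_frobM (p g : {mpoly k[N]}) (al be : 'X_{1..N}) j q :
  q = (Q ^ j)%N ->
  (forall v, p@_v != 0 -> (mdeg al <= mdeg v)%N) -> (forall i, (be i < q)%N) ->
  (p ^+ q * g)@_(al *+ q + be)%MM = p@_al * g@_be.
Proof.
move=> Eq Hp Hbe.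
have -> : p ^+ q = \sum_(v <- msupp p) p@_v *: 'X_[v *+ q] by rewrite Eq frobE.
rewrite mulr_suml raddf_sum /=.
have Hv v : p@_v != 0 -> v != al ->
    ((p@_v *: 'X_[v *+ q]) * g)@_(al *+ q + be)%MM = 0.
  move=> pv nv; rewrite -scalerAl mcoeffZ.
  suff -> : ('X_[v *+ q] * g)@_(al *+ q + be)%MM = 0 by rewrite mulr0.
  apply/eqP; rewrite mcoeff_eq0; apply: contra nv.
  rewrite mulrC (perm_mem (msuppMX _ _)) => /mapP[w _ Ew].
  have le_v : (v <= al)%MM.
    apply/mnm_lepP => i; move/mnmP/(_ i): Ew.
    rewrite !(mnmDE, mulmnE) => Ei; have Hi := Hbe i.
    have q_gt0 : (0 < q)%N by exact: leq_ltn_trans Hi.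
    rewrite -ltnS -(ltn_pmul2r q_gt0).
    by rewrite (leq_ltn_trans (leq_addr (w i) _)) // -Ei mulSn addnC ltn_add2r.
  have := Hp _ pv; rewrite -{1}(submK le_v) mdegD.
  rewrite -{2}[mdeg v]add0n leq_add2r leqn0 mdeg_eq0 => /eqP E.
  by rewrite -(submK le_v) E add0m.
have Hal : ((p@_al *: 'X_[al *+ q]) * g)@_(al *+ q + be)%MM = p@_al * g@_be.
  by rewrite -scalerAl mcoeffZ mulrC (mulrC 'X_[_]) mcoeffMX mulrC.
have [Zp|nZp] := eqVneq p@_al 0.
  rewrite Zp mul0r big_seq big1 // => v; rewrite mcoeff_msupp => pv.
  by apply: Hv => //; apply: contraNneq pv => ->; rewrite Zp.
rewrite (bigD1_seq al) ?mcoeff_msupp ?msupp_uniq //= Hal.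
rewrite big_seq_cond big1 ?addr0 // => v /andP[]; rewrite mcoeff_msupp.
exact: Hv.
Qed.

(** Membership in the ideal of the ['X_i ^+ q] is read off from the box of exponents below [q];
    [sel] chooses, for each monomial outside the box, one power that divides it. *)
Lemma box_complement (G : {mpoly k[N]}) q :
  (forall be : 'X_{1..N}, (forall i, (be i < q)%N) -> G@_be = 0) ->
  exists s : 'I_N -> {mpoly k[N]}, G = \sum_i 'X_i ^+ q * s i.
Proof.
move=> HG; have Hv v : G@_v != 0 -> exists i, (q <= v i)%N.
  move=> Gv; apply: contrapT => /forallNP H; case/negP: Gv; apply/eqP.
  by apply: HG => i; rewrite ltnNge; apply/negP/H.
pose sel (v : 'X_{1..N}) := [pick i | (q <= v i)%N].
exists (fun i => \sum_(v <- msupp G | sel v == Some i)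
                  G@_v *: 'X_[v - U_(i) *+ q]).
under eq_bigr do rewrite mulr_sumr big_mkcond /=.
rewrite exchange_big /= {1}[G]mpolyE !big_seq; apply: eq_bigr => v.
rewrite mcoeff_msupp => /Hv[i0 Hi0].
have [i Es Ei] : exists2 i, sel v = Some i & (q <= v i)%N.
  by rewrite /sel; case: pickP => [i Hi|/(_ i0)]; [exists i | rewrite Hi0].
rewrite (bigD1 i) //= Es eqxx big1 ?addr0 => [|i' ni']; last first.
  by case: eqP => // -[E]; rewrite E eqxx in ni'.
rewrite -scalerAr mpolyXn -mpolyXD; congr (_ *: 'X_[_]).
rewrite addmC submK //; apply/mnm_lepP => i'; rewrite mulmnE mnm1E.
by case: eqP => [<-|_]; rewrite ?mul1n ?mul0n.
Qed.

Definition poly_indep (J : {set 'I_r}) : Prop :=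
  forall g : 'I_r -> {mpoly k[N]},
    \sum_(j in J) ev (g j) * 'X_[b j] = 0 -> forall j, j \in J -> g j = 0.

Hypothesis spanM : forall a, supported M a ->
  exists g : 'I_r -> {mpoly k[N]}, a = \sum_i ev (g i) * 'X_[b i].
Hypothesis indM : forall (lam : 'I_r -> k) (s : 'I_N -> {mpoly k[N]}),
  (forall i, supported M (s i)) ->
  \sum_i lam i *: 'X_[b i] = \sum_i tnth y i * s i -> forall i, lam i = 0.
Hypothesis algM : forall g, ev g = 0 -> g = 0.

(** By maximality of [J] each other generator becomes a combination of [J] after multiplication by a
    nonzero polynomial; [c] is the product of these polynomials. So [ev c] maps all of [k[M]] into
    the free module on [J]. *)
Lemma max_poly_indep : exists (J : {set 'I_r}) (c : {mpoly k[N]}),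
  [/\ poly_indep J, c != 0 & forall a, supported M a ->
    exists g : 'I_r -> {mpoly k[N]}, ev c * a = \sum_(j in J) ev (g j) * 'X_[b j]].
Proof.
have P0 : [pred J | `[<poly_indep J>]] set0.
  by apply/asboolP => g _ j; rewrite inE.
have [J /maxsetP[/asboolP indJ maxJ] _] := maxset_exists P0.
have Hc i : exists cg : {mpoly k[N]} * ('I_r -> {mpoly k[N]}), cg.1 != 0 /\
    ev cg.1 * 'X_[b i] = \sum_(j in J) ev (cg.2 j) * 'X_[b j].
  have [iJ|niJ] := boolP (i \in J).
    exists (1, fun j => (j == i)%:R); split; first exact: oner_neq0.
    rewrite (bigD1 i) //= eqxx comp_mpoly1 big1 ?addr0 // => j /andP[_ /negPf->].
    by rewrite comp_mpoly0 mul0r.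
  have : ~ poly_indep (i |: J).
    move=> H; have := maxJ (i |: J) (introT (asboolP _) H) (subsetUr _ _).
    by move=> E; rewrite -E setU11 in niJ.
  move=> /existsNP[g /not_implyP[Eg /existsNP[j /not_implyP[jiJ nj]]]].
  have Eg' : ev (g i) * 'X_[b i] = \sum_(j in J) ev (- g j) * 'X_[b j].
    move: Eg; rewrite big_setU1 //= => /eqP; rewrite addr_eq0 => /eqP ->.
    by rewrite -sumrN; apply: eq_bigr => j' _; rewrite comp_mpolyN mulNr.
  exists (g i, fun j => - g j); split=> //; apply/eqP => /= gi0; case: nj.
  move: jiJ; rewrite !inE => /predU1P[->//|jJ].
  apply/eqP; rewrite -oppr_eq0; apply/eqP; apply: (indJ (fun j => - g j)) => //.
  by rewrite -Eg' gi0 comp_mpoly0 mul0r.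
have [cs Hcs] := choice Hc.
exists J, (\prod_i (cs i).1); split=> //.
  by apply/prodf_neq0 => i _; have [] := Hcs i.
move=> a /spanM[h ->].
exists (fun j => \sum_i h i * (\prod_(i' | i' != i) (cs i').1) * (cs i).2 j).
under [RHS]eq_bigr do rewrite rmorph_sum mulr_suml.
rewrite exchange_big mulr_sumr; apply: eq_bigr => i _ /=.
under [RHS]eq_bigr do rewrite rmorphM -mulrA.
rewrite -mulr_sumr -(Hcs i).2 (bigD1 i) //= !rmorphM /=.
by move: (ev (h i)) (ev (cs i).1) (ev _) 'X_[_] => A B C D; ring.
Qed.

(** Tight-closure argument. The coefficients [lam] of a relation at an exponent [al] of least degree
    define [b'] with [b' ^+ q * c] in the ideal of the [y_i ^+ q] for a large [q]; contraction turns
    this into a relation modulo the [y_i], which [indM] excludes. *)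
Lemma comp_basis_free (p : 'I_r -> {mpoly k[N]}) :
  \sum_i ev (p i) * 'X_[b i] = 0 -> forall i, p i = 0.
Proof.
move=> Ep; apply: contrapT => /existsNP[i0 /eqP pi0].
pose P e := `[< exists2 v, mdeg v = e & exists i, (p i)@_v != 0 >].
have exP : exists e, P e.
  exists (mdeg (mlead (p i0))); apply/asboolP; exists (mlead (p i0)) => //.
  by exists i0; rewrite mleadc_eq0.
case: (ex_minnP exP) => e /asboolP[al Eal [i1 pi1]] mine.
have Hmin i v : (p i)@_v != 0 -> (mdeg al <= mdeg v)%N.
  by move=> piv; rewrite Eal; apply: mine; apply/asboolP; exists v => //; exists i.
pose lam i := (p i)@_al.
have [J [c0 [indJ c0n0 spanJ]]] := max_poly_indep.
pose c := ev c0.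
have sc : supported M c by exact: supported_comp.
have cn0 : c != 0 by apply: contraNneq c0n0 => /algM ->.
pose u := mlead c; have cu : c@_u != 0 by rewrite mleadc_eq0.
have [q0 Hq0] := starM (sc _ cu).
(* [q >= q0] makes the contraction along [u] compatible with [M]; [q > msize c] leaves [u] as the
   only exponent of [c] of the form [u + w *+ q]. *)
pose j := (q0 + msize c)%N; pose q := (Q ^ j)%N; have Eq : q = (Q ^ j)%N by [].
have q_gt : (j < q)%N by exact: ltn_expl.
have q_gt0 : (0 < q)%N by exact: leq_ltn_trans q_gt.
have {}Hq0 := Hq0 q (ltnW (leq_ltn_trans (leq_addr _ _) q_gt)).
clearbody q.
have Hg i : exists g : 'I_r -> {mpoly k[N]},
    c * 'X_[b i] ^+ q = \sum_(j in J) ev (g j) * 'X_[b j].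
  by apply: spanJ; apply: supported_exp => //; apply: supportedX.
have {Hg} [g Hg] := choice Hg.
clearbody c.
(* The [q]-th power of the relation, times [c], expands in the free module on [J], so each
   coordinate vanishes. *)
have Hrel jj : jj \in J -> \sum_i (p i) ^+ q * g i jj = 0.
  apply: (indJ (fun jj => \sum_i (p i) ^+ q * g i jj)).
  have : c * (\sum_i ev (p i) * 'X_[b i]) ^+ q = 0.
    by rewrite Ep expr0n eqn0Ngt q_gt0 mulr0.
  rewrite Eq frob_sum -Eq mulr_sumr => E0; rewrite -[RHS]E0.
  under eq_bigr do rewrite rmorph_sum mulr_suml.
  rewrite exchange_big; apply: eq_bigr => i _ /=.
  rewrite exprMn mulrCA Hg mulr_sumr; apply: eq_bigr => j' _.
  by rewrite rmorphM rmorphXn /= mulrA.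
pose G jj := \sum_i lam i *: g i jj.
(* At an exponent [al *+ q + be] with [be] in the box, only [lam i] times the coefficient of
   [g i jj] at [be] survives from each summand of [Hrel]. *)
have HG jj : jj \in J ->
    exists s : 'I_N -> {mpoly k[N]}, G jj = \sum_i 'X_i ^+ q * s i.
  move=> jJ; apply: box_complement => be Hbe.
  have := congr1 (mcoeff (al *+ q + be)%MM) (Hrel _ jJ).
  rewrite mcoeff0 => E0; rewrite -[RHS]E0 /G !raddf_sum /=; apply: eq_bigr => i _.
  by rewrite mcoeffZ (mcoeff_frobM _ Eq) //; apply: Hmin.
have [s Hs] : exists s : 'I_r -> 'I_N -> {mpoly k[N]}, forall jj, jj \in J ->
    G jj = \sum_i 'X_i ^+ q * s jj i.
  have /choice[s Hs] : forall jj, exists s : 'I_N -> {mpoly k[N]}, jj \in J ->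
      G jj = \sum_i 'X_i ^+ q * s i.
    move=> jj; have [/HG[s Es]|_] := boolP (jj \in J); first by exists s.
    by exists (fun _ => 0).
  by exists s.
pose b' := \sum_i lam i *: 'X_[b i] : {mpoly k[N]}.
pose S i := \sum_(jj in J) ev (s jj i) * 'X_[b jj] : {mpoly k[N]}.
have sS i : supported M (S i).
  apply: supported_sum => jj _; apply: supportedM => //.
    exact: supported_comp.
  exact: supportedX.
have Eb' : b' ^+ q * c = \sum_i tnth y i ^+ q * S i.
  have -> : b' ^+ q = \sum_i lam i *: 'X_[b i] ^+ q.
    rewrite Eq frob_sum; apply: eq_bigr => i _.
    by rewrite exprZn expQX.
  rewrite mulr_suml.
  under eq_bigr do rewrite -scalerAl mulrC Hg scaler_sumr.
  rewrite exchange_big /=.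
  under [RHS]eq_bigr do rewrite mulr_sumr.
  rewrite [RHS]exchange_big /=; apply: eq_bigr => jj jJ.
  under [RHS]eq_bigr do rewrite mulrA.
  rewrite -mulr_suml; under eq_bigr do rewrite scalerAl.
  rewrite -mulr_suml; congr (_ * _).
  have := congr1 (comp_mpoly y) (Hs _ jJ); rewrite /G !rmorph_sum /=.
  under eq_bigr do rewrite comp_mpolyZ.
  move=> ->; apply: eq_bigr => i _; rewrite rmorphM rmorphXn /=.
  by rewrite comp_mpolyXU -tnth_nth.
have {}Eb' := congr1 (cartier u q) Eb'; move: Eb'.
rewrite (cartier_frobM _ Eq Hq0 sc) (cartier_sum _ q_gt0).
under [RHS]eq_bigr do rewrite (cartier_frobM _ Eq Hq0 (sS _)).
have -> : cartier u q c = (c@_u)%:MP.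
  apply/mpolyP => w; rewrite cartierE // mcoeffC.
  case: eqP => [->|/eqP nw].
    by rewrite mulr1; congr (c@__); apply/mnmP => i; rewrite mnmDE mulmnE mnm0E addn0.
  rewrite mulr0; apply: memN_msupp_eq0; apply: msize_mdeg_ge.
  rewrite mdegD mdegMn; apply: leq_trans (leq_addl _ _).
  apply: leq_trans (leq_pmull _ _); last by rewrite lt0n mdeg_eq0.
  exact: ltnW (leq_ltn_trans (leq_addl _ _) q_gt).
rewrite mulrC mul_mpolyC scaler_sumr => E.
have H0 := indM (lam := fun i => c@_u * lam i)
  (fun i => cartier_supported q_gt0 Hq0 (sS i)).
have /H0/(_ i1)/eqP : \sum_i (c@_u * lam i) *: 'X_[b i] =
    \sum_i tnth y i * cartier u q (S i).
  by rewrite -E; apply: eq_bigr => i _; rewrite scalerA.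
by rewrite mulf_eq0 (negPf cu) (negPf pi1).
Qed.

End Freeness.

End CartierFreeness.

(** * Algebraic independence by counting lattice points *)

Module AlgebraicIndependence.
From mathcomp Require Import boolp ring zify.
From mathcomp.multinomials Require Import mpoly.
Import CartierFreeness.
Import GRing.Theory.
Local Open Scope ring_scope.

(** The matrix of the coefficients [C] has independent rows, so its rank bounds their number by the
    number of columns; the ambient module may have infinite dimension. *)
Lemma leq_card_span (k : fieldType) (V : lmodType k) (A B : finType)
    (x : A -> V) (z : B -> V) (C : A -> B -> k) :
  (forall a, x a = \sum_b C a b *: z b) ->
  (forall u : A -> k, \sum_a u a *: x a = 0 -> forall a, u a = 0) ->
  (#|A| <= #|B|)%N.
Proof.
move=> Ex indx; pose X := \matrix_(i < #|A|, j < #|B|) C (enum_val i) (enum_val j).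
suff /eqP fX : row_free X by rewrite -{1}fX rank_leq_col.
apply: inj_row_free => v vX; apply/rowP => i; rewrite mxE.
rewrite -[i]enum_valK; apply: (indx (fun a => v 0 (enum_rank a))).
under eq_bigr do rewrite Ex scaler_sumr.
rewrite exchange_big /= big1 // => b _.
under eq_bigr do rewrite scalerA.
rewrite -scaler_suml (_ : \sum_(i0 | _) _ = 0) ?scale0r //.
have := congr1 (fun Y : 'M_(_,_) => Y 0 (enum_rank b)) vX; rewrite !mxE => E0; rewrite -[RHS]E0.
rewrite (reindex_onto (enum_val : 'I_#|A| -> A) enum_rank) /=; last first.
  by move=> a _; rewrite enum_rankK.
apply: eq_big => [j|j _]; first by rewrite enum_valK eqxx.
by rewrite !mxE enum_valK enum_rankK.
Qed.

Lemma leq_card_span_fun (k : fieldType) (X0 : Type) (A B : finType)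
    (x : A -> X0 -> k) (z : B -> X0 -> k) (C : A -> B -> k) :
  (forall a t, x a t = \sum_b C a b * z b t) ->
  (forall u : A -> k, (forall t, \sum_a u a * x a t = 0) -> forall a, u a = 0) ->
  (#|A| <= #|B|)%N.
Proof.
move=> Ex indx; pose X := \matrix_(i < #|A|, j < #|B|) C (enum_val i) (enum_val j).
suff /eqP fX : row_free X by rewrite -{1}fX rank_leq_col.
apply: inj_row_free => v vX; apply/rowP => i; rewrite mxE.
rewrite -[i]enum_valK; apply: (indx (fun a => v 0 (enum_rank a))) => t.
under eq_bigr do rewrite Ex mulr_sumr.
rewrite exchange_big /= big1 // => b _.
under eq_bigr do rewrite mulrA.
rewrite -mulr_suml (_ : \sum_(i0 | _) _ = 0) ?mul0r //.
have := congr1 (fun Y : 'M_(_,_) => Y 0 (enum_rank b)) vX; rewrite !mxE => E0; rewrite -[RHS]E0.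
rewrite (reindex_onto (enum_val : 'I_#|A| -> A) enum_rank) /=; last first.
  by move=> a _; rewrite enum_rankK.
apply: eq_big => [j|j _]; first by rewrite enum_valK eqxx.
by rewrite !mxE enum_valK enum_rankK.
Qed.

Lemma card_ffun_lt (N L c : nat) (j : 'I_N.+1) :
  (#|[set f : {ffun 'I_N.+1 -> 'I_L} | (f j < c)%N]| <= c * L ^ N)%N.
Proof.
pose F x : pred 'I_L := [pred t : 'I_L | (x == j) ==> (t < c)%N].
have /eq_card -> : [set f : {ffun 'I_N.+1 -> 'I_L} | (f j < c)%N] =i family F.
  move=> f; rewrite !inE; apply/idP/forallP => [lt x|/(_ j)].
    by rewrite /F inE /=; apply/implyP => /eqP ->.
  by rewrite /F inE /= eqxx.
rewrite card_family; set s := [seq _ | _ : _].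
have -> : foldr muln 1%N s = (\prod_x #|F x|)%N.
  by rewrite /s foldrE big_map enumT.
rewrite (bigD1 j) //= leq_mul //.
  rewrite -[X in (_ <= X)%N](size_iota 0) cardE -(size_map val).
  apply: uniq_leq_size => [|t /mapP[t']].
    by rewrite map_inj_uniq ?enum_uniq //; apply: val_inj.
  by rewrite mem_enum inE /= eqxx mem_iota => H ->.
rewrite (eq_bigr (fun _ => L)) ?prod_nat_const.
  by rewrite cardC1 card_ord.
move=> x /negPf nx; rewrite -[RHS]card_ord; apply: eq_card => t.
by rewrite !inE /= nx.
Qed.

Section AlgebraicIndependence.
Variables (k : fieldType) (N' : nat).
Let N := N'.+1.
Variables (M : 'X_{1..N} -> Prop) (delta : 'X_{1..N} -> nat).
Variables (r : nat) (b : 'I_r -> 'X_{1..N}) (y : N.-tuple {mpoly k[N]}).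
Local Notation ev g := (g \mPo y).
Hypothesis spanM : forall v, M v -> exists g : 'I_r -> {mpoly k[N]},
  'X_[v] = \sum_i ev (g i) * 'X_[b i] /\
  forall i, (msize (g i) <= (delta v).+1)%N.
Variable C : nat.
Hypothesis growM : forall m, exists E : {ffun 'I_N -> 'I_m.+1} -> 'X_{1..N},
  injective E /\ forall a, M (E a) /\ (delta (E a) <= C * m)%N.

Section Reduction.
Variable g0 : {mpoly k[N]}.
Hypothesis g0n0 : g0 != 0.
Hypothesis ev0 : ev g0 = 0.
Let al0 := mlead g0.

(** Division by the relation [g0]: its leading monomial is rewritten through smaller ones, and the
    degree does not grow because the monomial order refines the degree. *)
Lemma reduce_monomial al : exists g : {mpoly k[N]}, ev g = ev 'X_[al] /\
  forall v, g@_v != 0 -> (mdeg v <= mdeg al)%N /\ ~~ (al0 <= v)%MM.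
Proof.
elim/(@ltmwf N): al => al IH.
have [le_al|nle] := boolP (al0 <= al)%MM; last first.
  exists 'X_[al]; split=> // v; rewrite mcoeffX.
  by have [<-|] := eqVneq al v; rewrite ?eqxx.
have lcn0 : g0@_al0 != 0 by rewrite mleadc_eq0.
have /choice[h Hh] : forall v, exists g : {mpoly k[N]},
    v \in msupp g0 -> v != al0 -> ev g = ev 'X_[al - al0 + v] /\
    forall w, g@_w != 0 -> (mdeg w <= mdeg al)%N /\ ~~ (al0 <= w)%MM.
  move=> v; have [/andP[vs nv]|] := boolP ((v \in msupp g0) && (v != al0)); last first.
    by move=> H; exists 0 => vs nv; rewrite vs nv in H.
  have ltv : ((al - al0 + v)%MM < al)%O.
    rewrite -{2}(submK le_al) ltmc_add2r Order.POrderTheory.lt_neqAle nv.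
    exact: msupp_le_mlead.
  have [g [Eg Hg]] := IH _ ltv; exists g => _ _; split=> // w /Hg[le1 H]; split=> //.
  apply: leq_trans le1 _; apply: lemc_mdeg; exact: Order.POrderTheory.ltW.
exists (- (g0@_al0)^-1 *: \sum_(v <- msupp g0 | v != al0) g0@_v *: h v); split.
  rewrite comp_mpolyZ (raddf_sum (comp_mpoly y)) /=.
  have : ev ('X_[al - al0] * g0) = 0 by rewrite rmorphM /= ev0 mulr0.
  rewrite {1}[g0]mpolyE mulr_sumr (raddf_sum (comp_mpoly y)) /= (bigD1_seq al0) ?msupp_uniq //=; last first.
    by rewrite mcoeff_msupp.
  rewrite -scalerAr -mpolyXD submK // comp_mpolyZ => /eqP.
  rewrite addr_eq0 => /eqP E; apply: (scalerI lcn0).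
  rewrite scalerA mulrN divff // scaleN1r [RHS]E; congr (- _).
  rewrite big_seq_cond [RHS]big_seq_cond; apply: eq_bigr => v /andP[vs nv].
  by rewrite -scalerAr -mpolyXD !comp_mpolyZ (Hh v vs nv).1.
move=> w; rewrite mcoeffZ raddf_sum /= mulf_eq0 negb_or => /andP[_ nz].
have [v [vs /andP[nv hv]]] : exists v, v \in msupp g0 /\ (v != al0) && ((h v)@_w != 0).
  apply: contrapT => H; case/negP: nz; apply/eqP; rewrite big_seq_cond big1 // => v /andP[vs nv].
  rewrite mcoeffZ; have [->|hw] := eqVneq (h v)@_w 0; first by rewrite mulr0.
  by case: H; exists v; rewrite vs nv hw.
by have [_ /(_ w hv)] := Hh v vs nv.
Qed.

Lemma reduce_poly g : exists g' : {mpoly k[N]}, ev g' = ev g /\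
  forall v, g'@_v != 0 -> (mdeg v < msize g)%N /\ ~~ (al0 <= v)%MM.
Proof.
have [h Hh] := choice reduce_monomial.
exists (\sum_(v <- msupp g) g@_v *: h v); split.
  rewrite [in RHS](mpolyE g) !(raddf_sum (comp_mpoly y)) /=; apply: eq_bigr => v _.
  by rewrite !comp_mpolyZ (Hh v).1.
move=> w; rewrite raddf_sum /= => nz.
have [v vs hv] : exists2 v, v \in msupp g & (h v)@_w != 0.
  apply: contrapT => H; case/negP: nz; apply/eqP; rewrite big_seq big1 // => v vs.
  rewrite mcoeffZ; have [->|hw] := eqVneq (h v)@_w 0; first by rewrite mulr0.
  by case: H; exists v.
have [le1 nle] := (Hh v).2 w hv; split=> //.
exact: leq_ltn_trans le1 (msize_mdeg_lt vs).
Qed.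

(** A comparison of growth: [(m+1)^N] independent monomials are spanned by the [b i] times reduced
    monomials of degree at most [C * m]. Not being divisible by [al0] puts some exponent [j] below
    [al0 j], which leaves a number of choices of order [m^(N-1)] only. *)
Lemma count_bound m :
  (m.+1 ^ N <= r * (mdeg al0 * (C * m).+1 ^ N'))%N.
Proof.
have [E [injE HE]] := growM m; pose L := (C * m).+1.
have /choice[g Hg] : forall a, exists g : 'I_r -> {mpoly k[N]},
    'X_[E a] = \sum_i ev (g i) * 'X_[b i] /\
    forall i v, (g i)@_v != 0 -> (mdeg v < L)%N /\ ~~ (al0 <= v)%MM.
  move=> a; have [/spanM[g [Eg sg]] le_d] := HE a.
  have /choice[g' Hg'] := fun i => reduce_poly (g i).
  exists g'; split=> [|i v /((Hg' i).2 v)[le1 nle]].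
    by rewrite Eg; apply: eq_bigr => i _; rewrite (Hg' i).1.
  split=> //; apply: leq_trans le1 _; apply: leq_trans (sg i) _.
  by rewrite ltnS.
pose T := [set f : {ffun 'I_N -> 'I_L} | [exists j, f j < al0 j]%N].
pose mn (f : {ffun 'I_N -> 'I_L}) : 'X_{1..N} := [multinom (f i : nat) | i < N].
have := @leq_card_span k {mpoly k[N]} {ffun 'I_N -> 'I_m.+1}
  ('I_r * 'I_#|T|)%type
  (fun a => 'X_[E a]) (fun z => ev 'X_[mn (enum_val z.2)] * 'X_[b z.1])
  (fun a z => (g a z.1)@_(mn (enum_val z.2))).
rewrite card_ffun card_prod !card_ord => H.
apply: leq_trans (H _ _) _ => {H} [a|u Eu a|].
- rewrite {1}(Hg a).1; under [RHS]eq_bigr do rewrite scalerAl -comp_mpolyZ.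
  rewrite -(pair_big xpredT xpredT (fun i f => ev ((g a i)@_(mn (enum_val f)) *: 'X_[mn (enum_val f)]) * 'X_[b i])) /=.
  apply: eq_bigr => i _; rewrite -mulr_suml -(raddf_sum (comp_mpoly y)); congr (ev _ * _).
  rewrite -(big_enum_val (fun f => (g a i)@_(mn f) *: 'X_[mn f])).
  apply/mpolyP => v; rewrite raddf_sum /=.
  under eq_bigr do rewrite mcoeffZ mcoeffX.
  have [gv0|gvn0] := eqVneq (g a i)@_v 0.
    rewrite big1 // => f _; have [->|_] := eqVneq (mn f) v; last by rewrite mulr0.
    by rewrite gv0 mul0r.
  have [lev nle] := (Hg a).2 i v gvn0.
  have Hv j : (v j < L)%N.
    by apply: leq_ltn_trans lev; rewrite mdegE (bigD1 j) //= leq_addr.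
  pose fv : {ffun 'I_N -> 'I_L} := [ffun j => Ordinal (Hv j)].
  have Efv : mn fv = v by apply/mnmP => j; rewrite mnmE ffunE.
  have Tfv : fv \in T.
    rewrite inE; apply: contraNT nle => /existsPn H; apply/mnm_lepP => j.
    by have := H j; rewrite ffunE /= -leqNgt.
  rewrite (bigD1 fv) //= Efv eqxx mulr1 big1 ?addr0 // => f /andP[_ nf].
  have [Ef|_] := eqVneq (mn f) v; last by rewrite mulr0.
  case/eqP: nf; apply/ffunP => j; apply/val_inj => /=; rewrite ffunE /=.
  by rewrite -Ef mnmE.
- have := congr1 (mcoeff (E a)) Eu; rewrite mcoeff0 raddf_sum /= (bigD1 a) //=.
  rewrite mcoeffZ mcoeffX eqxx mulr1 big1 ?addr0 // => a' na.
  by rewrite mcoeffZ mcoeffX (inj_eq injE) (negPf na) mulr0.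
rewrite leq_mul2l; apply/orP; right.
apply: leq_trans (_ : \sum_j #|[set f : {ffun 'I_N -> 'I_L} | (f j < al0 j)%N]| <= _)%N.
  have -> : #|T| = #|\bigcup_j [set f : {ffun 'I_N -> 'I_L} | (f j < al0 j)%N]|.
    apply: eq_card => f; rewrite !inE; apply/existsP/bigcupP => [[j Hj]|[j _]].
      by exists j => //; rewrite inE.
    by rewrite inE => Hj; exists j.
  elim/big_ind2: _ => [|A x B z HA HB|//]; first by rewrite cards0.
  by apply: leq_trans (leq_add HA HB); rewrite cardsU leq_subr.
rewrite mdegE big_distrl /=; apply: leq_sum => j _; exact: card_ffun_lt.
Qed.

End Reduction.

Lemma comp_alg_indep g : ev g = 0 -> g = 0.
Proof.
move=> ev0; apply: contrapT => /eqP gn0.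
(* For [m = B] the right-hand side of [count_bound] is at most [B * (B+1)^N'], which is below
   [(B+1)^N]. *)
pose B := (r * mdeg (mlead g) * C.+1 ^ N')%N.
have := count_bound gn0 ev0 B; apply/negP; rewrite -ltnNge.
apply: leq_ltn_trans (_ : r * (mdeg (mlead g) * (C.+1 * B.+1) ^ N') < _)%N.
  rewrite !leq_mul2l; apply/orP; right; apply/orP; right.
  have [->|N0] := posnP N'; first by rewrite !expn0.
  by rewrite leq_exp2r //; move: B => B; nia.
rewrite expnMn !mulnA -/B /N expnS ltn_mul2r expn_gt0 /=.
exact: ltnSn.
Qed.

End AlgebraicIndependence.

End AlgebraicIndependence.

(** * A graded Nullstellensatz over an algebraically closed field *)

Module GradedNullstellensatz.
From mathcomp Require Import boolp classical_sets ring zify.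
From mathcomp.multinomials Require Import mpoly.
Import GRing.Theory.
Local Open Scope ring_scope.

Section Ideals.
Variables (F : fieldType) (m : nat).
Local Notation S := {mpoly F[m]}.
Implicit Types (I J : set S) (a b g s : S).

Definition is_ideal I : Prop :=
  [/\ I 0, forall a b, I a -> I b -> I (a + b) & forall a b, I b -> I (a * b)].

Definition adjoin_ideal I g : set S :=
  [set a | exists a' s, I a' /\ a = a' + g * s].

Lemma ideal_opp I a : is_ideal I -> I a -> I (- a).
Proof. by move=> [_ _ IM] Ia; rewrite -mulN1r; apply: (IM _ _). Qed.

Lemma ideal_scale I c a : is_ideal I -> I a -> I (c *: a).
Proof. by move=> [_ _ IM] Ia; rewrite -mul_mpolyC; apply: (IM _ _). Qed.

Lemma ideal_sum I (T : Type) (r : seq T) (P : pred T) (G : T -> S) :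
  is_ideal I -> (forall i, P i -> I (G i)) -> I (\sum_(i <- r | P i) G i).
Proof. by move=> [I0 IA _]; apply: big_ind. Qed.

Lemma adjoin_is_ideal I g : is_ideal I -> is_ideal (adjoin_ideal I g).
Proof.
move=> [I0 IA IM]; split.
- by exists 0, 0; rewrite mulr0 addr0.
- move=> _ _ [a [s [Ia ->]]] [b [t [Ib ->]]]; exists (a + b), (s + t).
  by split; [exact: IA | ring].
- move=> c _ [a [s [Ia ->]]]; exists (c * a), (c * s).
  by split; [exact: IM | ring].
Qed.

Lemma adjoin_sub I g a : I a -> adjoin_ideal I g a.
Proof. by move=> Ia; exists a, 0; rewrite mulr0 addr0. Qed.

Lemma adjoin_mem I g : is_ideal I -> adjoin_ideal I g g.
Proof. by move=> [I0 _ _]; exists 0, 1; rewrite mulr1 add0r. Qed.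

Lemma adjoin1_mul I g1 g2 : is_ideal I ->
  adjoin_ideal I g1 1 -> adjoin_ideal I g2 1 -> adjoin_ideal I (g1 * g2) 1.
Proof.
move=> [I0 IA IM] [a1 [s1 [I1 E1]]] [a2 [s2 [I2 E2]]].
exists (a1 * a2 + a1 * (g2 * s2) + (g1 * s1) * a2), (s1 * s2); split.
  apply: (IA _ _); last exact: IM.
  by apply: (IA (a1 * a2)); [exact: IM | rewrite mulrC; apply: (IM _ _)].
by rewrite -[LHS]mulr1 {1}E1 {1}E2; ring.
Qed.

(** If adjoining each factor gave the unit ideal, so would adjoining the product, which already lies
    in [I]. *)
Lemma split_root I (x : S) (rs : seq F) : is_ideal I -> ~ I 1 ->
  I (\prod_(c <- rs) (x - c%:MP)) ->
  exists c, ~ adjoin_ideal I (x - c%:MP) 1.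
Proof.
move=> hI n1 Iprod; apply: contrapT => /forallNP H; apply: n1.
have : adjoin_ideal I (\prod_(c <- rs) (x - c%:MP)) 1.
  elim: rs {Iprod} => [|c rs IH].
    by exists 0, 1; rewrite big_nil mulr1 add0r; have [] := hI.
  by rewrite big_cons; apply: adjoin1_mul => //; apply: contrapT; apply: H.
case: hI => I0 IA IM [a [s [Ia ->]]]; apply: (IA _ _) => //.
by rewrite mulrC; apply: (IM _ _).
Qed.

(** Roots are adjoined one variable at a time while the ideal stays proper. In the end each ['X_i]
    is congruent to a constant [chi i], hence each [a] to [a.@[chi]], and a proper ideal contains no
    nonzero constant. *)
Lemma ideal_point I : is_ideal I -> ~ I 1 ->
  (forall i, exists rs : seq F, I (\prod_(c <- rs) ('X_i - c%:MP))) ->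
  exists chi : 'I_m -> F, forall a, I a -> a.@[chi] = 0.
Proof.
move=> hI n1 Hrs.
have [I' [chi [hI' n1' sub Hchi]]] : exists I' (chi : 'I_m -> F),
    [/\ is_ideal I', ~ I' 1, (forall a, I a -> I' a)
      & forall i, I' ('X_i - (chi i)%:MP)].
  suff /(_ (enum 'I_m)) [I' [chi [? ? ? H]]] : forall vs : seq 'I_m,
      exists I' (chi : 'I_m -> F),
      [/\ is_ideal I', ~ I' 1, (forall a, I a -> I' a)
        & forall i, i \in vs -> I' ('X_i - (chi i)%:MP)].
    by exists I', chi; split=> // i; apply: H; rewrite mem_enum.
  elim=> [|i vs [I' [chi [hI' n1' sub Hchi]]]]; first by exists I, (fun _ => 0).
  have [ivs|nivs] := boolP (i \in vs).
    by exists I', chi; split=> // j; rewrite inE => /predU1P[->|]; apply: Hchi.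
  have [rs Ers] := Hrs i.
  have [c Hc] := split_root hI' n1' (sub _ Ers).
  exists (adjoin_ideal I' ('X_i - c%:MP)), (fun j => if j == i then c else chi j).
  split=> //.
  - exact: adjoin_is_ideal.
  - by move=> a /sub; apply: adjoin_sub.
  - move=> j; rewrite inE => /predU1P[->|jvs]; first by rewrite eqxx; apply: adjoin_mem.
    case: eqP => [->|_]; first exact: adjoin_mem.
    by apply: adjoin_sub; apply: Hchi.
have [I0 IA IM] := hI'.
have congM a b (a0 b0 : F) : I' (a - a0%:MP) -> I' (b - b0%:MP) ->
    I' (a * b - (a0 * b0)%:MP).
  move=> Ia Ib; rewrite mpolyCM.
  have -> : a * b - a0%:MP * b0%:MP = b * (a - a0%:MP) + a0%:MP * (b - b0%:MP) by ring.
  by apply: (IA _ _); apply: (IM _ _).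
have Hev a : I' (a - (a.@[chi])%:MP).
  elim/mpolyind: a => [|c v p _ _ IH]; first by rewrite meval0 mpolyC0 subrr.
  rewrite mevalD mevalZ mpolyCD opprD addrACA; apply: (IA _ _) => //.
  rewrite mpolyCM mul_mpolyC -scalerBr; apply: ideal_scale hI' _.
  rewrite mevalX mpolyXE_id; elim/big_ind2: _ => [|a a0 b b0|i _].
  - by rewrite mpolyC1 subrr.
  - exact: congM.
  - elim: (v i) => [|e IHe]; first by rewrite !expr0 mpolyC1 subrr.
    by rewrite !exprS; apply: congM.
exists chi => a /sub Ia; apply: contrapT => /eqP nz; apply: n1'.
have : I' ((a.@[chi])%:MP).
  have -> : (a.@[chi])%:MP = a - (a - (a.@[chi])%:MP) by rewrite opprB addrC subrK.
  by apply: (IA _ _) => //; apply: ideal_opp.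
move=> /(ideal_scale (a.@[chi])^-1 hI'); by rewrite -mul_mpolyC -mpolyCM mulVf.
Qed.

End Ideals.

Section GradedNullstellensatz.
Variables (F : closedFieldType) (m : nat).
Local Notation S := {mpoly F[m]}.
Local Notation hc := (pihomog mdeg).
Implicit Types (I J : set S) (a b g s : S).

Lemma mcoeff_hc d a v : (hc d a)@_v = if mdeg v == d then a@_v else 0.
Proof.
rewrite pihomogE raddf_sum /=.
under eq_bigr do rewrite mcoeffZ mcoeffX.
have [vs|nvs] := boolP (v \in msupp a).
  rewrite big_mkcond (bigD1_seq v) ?msupp_uniq //= eqxx mulr1 big1 ?addr0 //.
  by move=> w nw; rewrite (negPf nw) mulr0 if_same.
rewrite (memN_msupp_eq0 nvs) if_same big_seq_cond big1 // => w /andP[ws _].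
have [E|_] := eqVneq w v; last by rewrite mulr0.
by rewrite -E ws in nvs.
Qed.

Lemma hc_X_mul i d a : hc d.+1 ('X_i * a) = 'X_i * hc d a.
Proof.
apply/mpolyP => v; rewrite mcoeff_hc.
have [lev|nlev] := boolP (U_(i) <= v)%MM.
  have [w ->] : exists w, v = (U_(i) + w)%MM by exists (v - U_(i))%MM; rewrite addmC submK.
  by rewrite !(mulrC 'X_i) !mcoeffMX mcoeff_hc mdegD mdeg1 eqSS.
have Z b : ('X_i * b)@_v = 0.
  apply/eqP; rewrite mcoeff_eq0; apply: contra nlev.
  rewrite mulrC (perm_mem (msuppMX _ _)) => /mapP[w _ ->]; exact: lem_addr.
by rewrite !Z if_same.
Qed.

Lemma hc0_X_mul i a : hc 0 ('X_i * a) = 0.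
Proof.
apply/mpolyP => v; rewrite mcoeff_hc mcoeff0; case: eqP => // /eqP.
rewrite mdeg_eq0 => /eqP ->.
apply/eqP; rewrite mcoeff_eq0; apply/negP.
rewrite mulrC (perm_mem (msuppMX _ _)) => /mapP[w _ /eqP].
by rewrite eq_sym mnmD_eq0 mnm1_eq0.
Qed.

Definition graded_ideal I : Prop := is_ideal I /\ forall d a, I a -> I (hc d a).

Lemma adjoin_graded I i : graded_ideal I -> graded_ideal (adjoin_ideal I 'X_i).
Proof.
move=> [hI Ih]; split; first exact: adjoin_is_ideal.
move=> d _ [a [s [Ia ->]]]; rewrite pihomogD; case: d => [|d].
  by rewrite hc0_X_mul addr0; apply: adjoin_sub; apply: Ih.
by rewrite hc_X_mul; exists (hc d.+1 a), (hc d s); split=> //; apply: Ih.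
Qed.

(** Tested on monomials: [I] contains no power of the ideal of the variables. *)
Definition infinite_codim I : Prop :=
  forall N, exists v : 'X_{1..m}, mdeg v = N /\ ~ I 'X_[v].

(** Zorn's lemma applies because there are finitely many monomials in each degree: if the union of a
    chain contained them all, so would one of its members. *)
Lemma maximal_graded J : graded_ideal J -> infinite_codim J ->
  exists I, [/\ graded_ideal I, infinite_codim I, (forall a, J a -> I a)
    & forall i, ~ I 'X_i -> ~ infinite_codim (adjoin_ideal I 'X_i)].
Proof.
move=> hJ infJ.
pose P I := I = set0 \/ [/\ graded_ideal I, infinite_codim I & forall a, J a -> I a].
have [|A [PA maxA]] := @Zorn_bigcup S P.
  move=> C CP totC; set U := (\bigcup_(X in C) X)%classic.
  have [[I0 [CI0 nI0]]|allE] := pselect (exists I, C I /\ I <> set0); last first.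
    left; apply/seteqP; split=> // a [I CI Ia]; case: allE; exists I; split=> // E.
    by rewrite E in Ia.
  have good I : C I -> I <> set0 ->
      [/\ graded_ideal I, infinite_codim I & forall a, J a -> I a].
    by move=> CI nI; have [E|//] := CP _ CI; case: nI.
  have [[[I00 I0A I0M] I0h] _ JI0] := good _ CI0 nI0.
  right; split; last 1 first.
  - by move=> a /JI0 ?; exists I0.
  - have nn I a : I a -> I <> set0 by move=> Ia E; rewrite E in Ia.
    split; last by move=> d a [I CI Ia]; exists I => //; have [[_ H] _ _] := good _ CI (nn _ _ Ia); apply: H.
    split; first by exists I0.
    + move=> a b [I CI Ia] [I' CI' Ib].
      have [[[_ IA _] _] _ _] := good _ CI (nn _ _ Ia).
      have [[[_ IA' _] _] _ _] := good _ CI' (nn _ _ Ib).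
      have [sub|sub] := totC _ _ CI CI'.
        by exists I' => //; apply: IA' => //; apply: sub.
      by exists I => //; apply: IA => //; apply: sub.
    + move=> a b [I CI Ib]; exists I => //.
      by have [[[_ _ IM] _] _ _] := good _ CI (nn _ _ Ib); apply: IM.
  - move=> N; apply: contrapT => /forallNP H.
    have HU v : mdeg v = N -> U 'X_[v].
      by move=> Ev; apply: contrapT => nU; apply: (H v).
    suff /(_ [seq val v | v : 'X_{1..m < N.+1}])[I [CI nI HI]] :
        forall vs : seq 'X_{1..m}, exists I, [/\ C I, I <> set0 &
          forall v, v \in vs -> mdeg v = N -> I 'X_[v]].
      have [_ /(_ N)[v [Ev nIv]] _] := good _ CI nI.
      apply: nIv; apply: HI => //.
      have lt : (mdeg v < N.+1)%N by rewrite Ev.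
      by apply/mapP; exists (BMultinom lt); rewrite ?mem_enum.
    elim=> [|v vs [I [CI nI HI]]]; first by exists I0.
    have [Ev|nEv] := eqVneq (mdeg v) N; last first.
      exists I; split=> // w; rewrite inE => /predU1P[->|]; last exact: HI.
      by move=> E; rewrite E eqxx in nEv.
    have [I' CI' Iv] := HU v Ev; have [sub|sub] := totC _ _ CI CI'.
      exists I'; split=> //; first by move=> E; rewrite E in Iv.
      move=> w; rewrite inE => /predU1P[->//|ws Ew]; apply: sub; exact: HI.
    exists I; split=> // w; rewrite inE => /predU1P[-> _|]; last exact: HI.
    exact: sub.
have {PA} [E|[gA infA JA]] := PA.
  have [J0 _] := hJ; case: (maxA J); last by right.
  by rewrite E; split; [exact: sub0set | move=> /(_ 0); apply; case: J0].
exists A; split=> // i nAi infi; apply: (maxA (adjoin_ideal A 'X_i)); last first.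
  right; split=> //; first exact: adjoin_graded.
  by move=> a /JA; apply: adjoin_sub.
split; first by move=> a; apply: adjoin_sub.
by move=> sub; apply: nAi; apply: sub; apply: adjoin_mem; case: gA.
Qed.

(** The quotient by [I] has finite dimension, so the powers of [x] are dependent in it, and over the
    closed field the relation splits into linear factors. *)
Lemma powers_relation I (x : S) N : is_ideal I ->
  (forall v : 'X_{1..m}, exists g : S, I ('X_[v] - g) /\ (msize g <= N)%N) ->
  exists rs : seq F, I (\prod_(c <- rs) (x - c%:MP)).
Proof.
move=> hI Hred.
have Hred' a : exists g : S, I (a - g) /\ (msize g <= N)%N.
  have [h Hh] := choice Hred; exists (\sum_(v <- msupp a) a@_v *: h v); split.
    rewrite {1}[a]mpolyE -sumrB; apply: (ideal_sum _ hI) => v _.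
    by rewrite -scalerBr; apply: (ideal_scale _ hI); case: (Hh v).
  apply: leq_trans (mmeasure_sum _ _ _ _) _; apply/bigmax_leqP_seq => v _ _.
  by apply: leq_trans (mmeasureZ_le _ _ _) _; case: (Hh v).
have [h Hh] := choice (fun j : nat => Hred' (x ^+ j)).
pose T := 'X_{1..m < N}; pose D := #|{: T}|.
pose C := \matrix_(j < D.+1, t < D) (h j)@_(val (enum_val t : T)).
have /rowV0Pn[u uK un0] : kermx C != 0.
  rewrite kermx_eq0 /row_free; apply/negP => /eqP E.
  by have := rank_leq_col C; rewrite E ltnn.
have uC : u *m C = 0 by apply/sub_kermxP.
pose p := \poly_(j < D.+1) u 0 (inord j).
have pn0 : p != 0.
  apply: contraNneq un0 => p0; apply/eqP/rowP => j; rewrite mxE.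
  have := coef_poly D.+1 (fun j => u 0 (inord j)) j.
  by rewrite -/p p0 coef0 ltn_ord inord_val.
have Ix : I (\sum_(j < D.+1) u 0 j *: x ^+ j).
  have -> : \sum_(j < D.+1) u 0 j *: x ^+ j =
      \sum_(j < D.+1) u 0 j *: (x ^+ j - h j).
    rewrite [RHS](eq_bigr (fun j : 'I__ => u 0 j *: x ^+ j - u 0 j *: h j)) => [|j _]; last exact: scalerBr.
    rewrite sumrB (_ : \sum_(j < D.+1) u 0 j *: h j = 0) ?subr0 //.
    apply/mpolyP => v; rewrite mcoeff0 raddf_sum /=.
    under eq_bigr do rewrite mcoeffZ.
    have [ltv|gev] := ltnP (mdeg v) N; last first.
      apply: big1 => j _; rewrite (memN_msupp_eq0 (p := h j)) ?mulr0 //.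
      apply: msize_mdeg_ge; apply: leq_trans gev; by case: (Hh j).
    have := congr1 (fun Y : 'M_(_,_) => Y 0 (enum_rank (BMultinom ltv : T))) uC.
    rewrite !mxE => E0; rewrite -[RHS]E0; apply: eq_bigr => j _.
    by rewrite !mxE enum_rankK.
  by apply: (ideal_sum _ hI) => j _; apply: (ideal_scale _ hI); case: (Hh j).
have [rs Ers] := closed_field_poly_normal p.
exists rs; have lc0 : lead_coef p != 0 by rewrite lead_coef_eq0.
have -> : \prod_(c <- rs) (x - c%:MP) =
    (lead_coef p)^-1 *: \sum_(j < D.+1) u 0 j *: x ^+ j.
  apply: (scalerI lc0); rewrite scalerA divff // scale1r.
  have -> : \sum_(j < D.+1) u 0 j *: x ^+ j = (map_poly (@mpolyC m F) p).[x].
    rewrite /p poly_def rmorph_sum horner_sum; apply: eq_bigr => j _ /=.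
    rewrite -mul_polyC rmorphM /= map_polyC map_polyXn hornerM hornerC hornerXn inord_val.
    by rewrite mul_mpolyC.
  rewrite [in RHS]Ers -mul_polyC rmorphM /= map_polyC hornerM hornerC mul_mpolyC.
  congr (_ *: _); rewrite rmorph_prod horner_prod; apply: eq_bigr => c _ /=.
  by rewrite rmorphB /= map_polyX map_polyC hornerD hornerX hornerN hornerC.
exact: ideal_scale.
Qed.

(** For a maximal [I] as above some ['X_i] is not nilpotent modulo [I]. Setting ['X_i = 1] gives a
    proper ideal, whose quotient has finite dimension since [I + ('X_i)] contains all monomials of
    some degree [N]; a zero of it has [chi i = 1]. *)
Lemma graded_nullstellensatz J : graded_ideal J -> infinite_codim J ->
  exists chi : 'I_m -> F, (exists i, chi i != 0) /\ forall a, J a -> a.@[chi] = 0.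
Proof.
move=> hJ infJ; have [I [gI infI JI maxI]] := maximal_graded hJ infJ.
have [hI hIh] := gI; have [I0 IA IM] := hI.
have [i Hi] : exists i, forall e, ~ I ('X_i ^+ e).
  apply: contrapT => /forallNP H.
  have /choice[e He] : forall i, exists e, I ('X_i ^+ e).
    by move=> i; have /existsNP[e /contrapT] := H i; exists e.
  have [v [Ev nIv]] := infI (\sum_i e i).+1; apply: nIv.
  have [i Hi] : exists i, (e i <= v i)%N.
    apply: contrapT => /forallNP H'; have : (mdeg v <= \sum_i e i)%N.
      by rewrite mdegE; apply: leq_sum => i _; apply: ltnW; rewrite ltnNge; apply/negP.
    by rewrite Ev ltnn.
  rewrite -(@submK _ (U_(i) *+ e i)%MM v) ?mpolyXD -?mpolyXn.
    exact: IM.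
  apply/mnm_lepP => j; rewrite mulmnE mnm1E.
  by case: eqP => [<-|]; rewrite ?mul1n ?mul0n.
have nIi : ~ I 'X_i by have := Hi 1%N; rewrite expr1.
have /existsNP[N /forallNP HN] := maxI i nIi.
have {}HN (v : 'X_{1..m}) : mdeg v = N -> adjoin_ideal I 'X_i 'X_[v].
  by move=> Ev; apply: contrapT => nv; apply: (HN v).
pose b := adjoin_ideal I ('X_i - 1%:MP).
have hb : is_ideal b by exact: adjoin_is_ideal.
(* The homogeneous components of [1 = a + ('X_i - 1) s] give [hc j s + 'X_i ^+ j] in [I] for all
   [j]; beyond the degree of [s] this puts a power of ['X_i] in [I]. *)
have b1 : ~ b 1.
  move=> [a [s [Ia E]]].
  have Hs j : I (hc j s + 'X_i ^+ j).
    elim: j => [|j IH].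
      have := congr1 (hc 0) E.
      rewrite mulrBl pihomogD pihomogB hc0_X_mul sub0r mpolyC1 mul1r.
      rewrite (pihomog_dE (dhomog1 _ _)) => E0.
      have -> : hc 0 s + 'X_i ^+ 0 = hc 0 a by rewrite expr0 E0; ring.
      exact: hIh.
    have := congr1 (hc j.+1) E.
    rewrite mulrBl pihomogD pihomogB hc_X_mul mpolyC1 mul1r.
    have -> : hc j.+1 1 = 0 :> S.
      by apply/mpolyP => v; rewrite mcoeff_hc mcoeff1 mcoeff0; case: eqP => // Ev;
         case: eqP => // Ev0; rewrite Ev0 mdeg0 in Ev.
    move=> E0; have -> : hc j.+1 s + 'X_i ^+ j.+1 = hc j.+1 a + 'X_i * (hc j s + 'X_i ^+ j).
      rewrite exprS; have -> : hc j.+1 s = hc j.+1 a + 'X_i * hc j s.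
        by apply/eqP; rewrite -subr_eq0 -oppr_eq0; apply/eqP; rewrite [RHS]E0; ring.
      by ring.
    by apply: (IA _ _); [exact: hIh | exact: IM].
  apply: (Hi (msize s)); have := Hs (msize s).
  have -> : hc (msize s) s = 0; last by rewrite add0r.
  apply/mpolyP => v; rewrite mcoeff_hc mcoeff0; case: eqP => // Ev.
  by apply: memN_msupp_eq0; apply: msize_mdeg_ge; rewrite Ev.
have {}HN (v : 'X_{1..m}) : (N <= mdeg v)%N -> adjoin_ideal I 'X_i 'X_[v].
  elim: {v}(mdeg v) {-2}v (erefl (mdeg v)) => [|e IH] v Ev leN.
    by apply: HN; apply/eqP; rewrite eq_sym eqn_leq leN Ev.
  have [/eqP|neN] := eqVneq (mdeg v) N; first by move=> /eqP; apply: HN.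
  have [j Hj] : exists j, v j != 0%N.
    apply: contrapT => /forallNP H; have : mdeg v = 0%N; last by rewrite Ev.
    by rewrite mdegE big1 // => j _; apply/eqP/negPn/negP/H.
  have lev : (U_(j) <= v)%MM by rewrite lep1mP.
  have Ew : mdeg (v - U_(j))%MM = e.
    by apply: succn_inj; rewrite -Ev -{2}(submK lev) mdegD mdeg1 addn1.
  rewrite -(submK lev) mpolyXD mulrC.
  have [_ _ aM] := adjoin_is_ideal 'X_i hI; apply: (aM _ _); apply: IH => //.
  by rewrite Ew -ltnS -Ev ltn_neqAle eq_sym neN leN.
(* In degree at least [N] a monomial is a multiple of ['X_i] modulo [I], and modulo ['X_i - 1] this
   factor disappears, so the degree drops. *)
have red (v : 'X_{1..m}) : exists g : S, b ('X_[v] - g) /\ (msize g <= N)%N.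
  have [n ltn] := ubnP (mdeg v); elim: n v ltn => // n IH v; rewrite ltnS => len.
  have [ltN|leN] := ltnP (mdeg v) N.
    by exists 'X_[v]; rewrite subrr msizeX; split=> //; have [] := hb.
  have [a [s [Ia E]]] := HN v leN.
  have := congr1 (hc (mdeg v)) E; rewrite pihomogX eqxx pihomogD.
  case Ed: (mdeg v) => [|d].
    rewrite hc0_X_mul addr0 => ->; exists 0; rewrite mmeasure0 subr0; split=> //.
    by apply: adjoin_sub; apply: hIh.
  rewrite hc_X_mul; set s' := hc d s => Ev.
  have /choice[h Hh] : forall w, exists g : S, w \in msupp s' ->
      b ('X_[w] - g) /\ (msize g <= N)%N.
    move=> w; have [ws|] := boolP (w \in msupp s'); last by exists 0.
    have Ew : mdeg w = d.
      by apply/eqP; move: ws; rewrite mcoeff_msupp mcoeff_hc; case: ifP; rewrite ?eqxx.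
    have [|g Hg] := IH w; first by rewrite Ew -Ed.
    by exists g.
  exists (\sum_(w <- msupp s') s'@_w *: h w); split.
    have -> : 'X_[v] - \sum_(w <- msupp s') s'@_w *: h w =
        (hc d.+1 a + ('X_i - 1%:MP) * s') + \sum_(w <- msupp s') s'@_w *: ('X_[w] - h w).
      under [X in _ = _ + X]eq_bigr do rewrite scalerBr.
      by rewrite sumrB -mpolyE Ev mpolyC1; ring.
    have [_ bA _] := hb; apply: (bA _ _).
      by exists (hc d.+1 a), s'; split=> //; apply: hIh.
    rewrite big_seq; apply: (ideal_sum _ hb) => w ws.
    by apply: (ideal_scale _ hb); case: (Hh w ws).
  apply: leq_trans (mmeasure_sum _ _ _ _) _; apply/bigmax_leqP_seq => w ws _.
  by apply: leq_trans (mmeasureZ_le _ _ _) _; case: (Hh w ws).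
have [chi Hchi] := ideal_point hb b1 (fun j => powers_relation 'X_j hb red).
exists chi; split; last by move=> a /JI Ia; apply: Hchi; apply: adjoin_sub.
exists i; have := Hchi _ (adjoin_mem _ hI); rewrite mevalB mevalXU mevalC => /eqP.
by rewrite subr_eq0 => /eqP ->; rewrite oner_neq0.
Qed.

End GradedNullstellensatz.

End GradedNullstellensatz.

(** * Extension of characters of lattices, and a linear retraction of a field extension *)

Module ConeCharacters.
From mathcomp Require Import boolp classical_sets ring zify.
Import GRing.Theory.
Local Open Scope ring_scope.

Section CharExtend.
Variable F : closedFieldType.

Definition mact p q (A : 'M[int]_(p, q)) (z : 'I_q -> F) : 'I_p -> F :=
  fun i => \prod_j z j ^ A i j.

Lemma mact_neq0 p q (A : 'M[int]_(p, q)) z : (forall j, z j != 0) ->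
  forall i, mact A z i != 0.
Proof. by move=> nz i; apply/prodf_neq0 => j _; rewrite expfz_neq0. Qed.

Lemma expfz_sum (z : F) (I : Type) (r : seq I) (P : pred I) (e : I -> int) : z != 0 ->
  z ^ (\sum_(i <- r | P i) e i) = \prod_(i <- r | P i) z ^ e i.
Proof.
move=> nz; apply: (big_morph (fun e => z ^ e)) => [a b|]; last exact: expr0z.
exact: expfzDr.
Qed.

Lemma mactM p q s (A : 'M[int]_(p, q)) (B : 'M[int]_(q, s)) z :
  (forall j, z j != 0) -> mact (A *m B) z =1 mact A (mact B z).
Proof.
move=> nz i; rewrite /mact.
under eq_bigr => j _ do rewrite mxE expfz_sum //.
rewrite exchange_big; apply: eq_bigr => k _ /=.
rewrite (big_morph (fun x => x ^ A i k) (op1 := *%R) (op2 := *%R) (id1 := 1) (id2 := 1)).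
- by apply: eq_bigr => j _; rewrite exprz_exp mulrC.
- by move=> a b; rewrite expfzMl.
- by rewrite exp1rz.
Qed.

Lemma mact1 q (z : 'I_q -> F) : mact 1%:M z =1 z.
Proof.
move=> i; rewrite /mact (bigD1 i) //= mxE eqxx expr1z big1 ?mulr1 // => j nj.
by rewrite mxE eq_sym (negPf nj) expr0z.
Qed.

Lemma closed_root (a : F) k : (0 < k)%N -> exists z : F, z ^+ k = a.
Proof.
move=> k0; have [z Ez] := solve_monicpoly (fun i => if i == 0%N then a else 0) k0.
exists z; rewrite Ez; case: k k0 {Ez} => // k _.
by rewrite big_ord_recl /= expr0 mulr1 big1 ?addr0 // => i _; rewrite mul0r.
Qed.

(** The multiplicative group of a closed field is divisible, so a character of the lattice spanned
    by the rows of [V] extends to all of it. The Smith normal form reduces the extension to taking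
    roots coordinate by coordinate. *)
Lemma char_extend m n (V : 'M[int]_(m, n)) (chi : 'I_m -> F) :
  (forall j, chi j != 0) ->
  (forall c : 'rV[int]_m, c *m V = 0 -> \prod_j chi j ^ c ord0 j = 1) ->
  exists x : 'I_n -> F, (forall i, x i != 0) /\ forall j, \prod_i x i ^ V j i = chi j.
Proof.
move=> nz rel; have [L Lu [R Ru [d _ EV]]] := int_Smith_normal_form V.
set Dg := (\matrix_(i, j) _) in EV.
pose chi' := mact (invmx L) chi.
have nz' : forall j, chi' j != 0 by exact: mact_neq0.
have [x' [nx' Ex']] : exists x' : 'I_n -> F,
    (forall i, x' i != 0) /\ forall i, mact Dg x' i = chi' i.
  have /choice[x' Hx'] : forall j : 'I_n, exists z : F, z != 0 /\
      forall i : 'I_m, i = j :> nat -> d`_i != 0 -> z ^ d`_i = chi' i.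
    move=> j; have [ltm|gem] := ltnP j m; last first.
      by exists 1; split=> [|i Ei]; [exact: oner_neq0 | have := ltn_ord i; rewrite Ei ltnNge gem].
    pose i0 := Ordinal ltm.
    have [d0|dn0] := eqVneq d`_i0 0.
      exists 1; split=> [|i Ei]; first exact: oner_neq0.
      by rewrite (_ : i = i0) ?d0 ?eqxx //; apply: val_inj.
    pose e : int := nth 0 d i0.
    have e0 : (0 < `|e|)%N by rewrite absz_gt0.
    have [z Ez] := closed_root (chi' i0) e0.
    have zn0 : z != 0.
      by apply: contraNneq (nz' i0) => z0; rewrite -Ez z0 expr0n eqn0Ngt e0.
    exists (if 0 <= e then z else z^-1); split; first by case: ifP; rewrite ?invr_eq0.
    move=> i Ei _; have -> : i = i0 by apply: val_inj.
    rewrite -/e -Ez; case: ifP => sd.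
      by rewrite -[in LHS](gez0_abs sd).
    have -> : e = - (`|e|%N)%:Z by move: sd; lia.
    by rewrite exprz_inv opprK abszN absz_nat.
  (* A zero row of [Dg] is an integral relation among the rows of [V], to which [rel] applies. *)
  have rowz i : row i Dg = 0 -> chi' i = 1.
    move=> r0; have := rel (row i (invmx L)); rewrite -row_mul EV !mulmxA mulVmx // mul1mx.
    rewrite row_mul r0 mul0mx => /(_ erefl) E1; rewrite -[RHS]E1.
    by apply: eq_bigr => j _; rewrite mxE.
  exists x'; split=> [i|i]; first by have [] := Hx' i.
  have DgE j : Dg i j = nth 0 d i *+ (i == j :> nat) by rewrite mxE.
  have z1 : (forall j, Dg i j = 0) -> mact Dg x' i = chi' i.
    move=> z0; rewrite rowz; last by apply/rowP => j; rewrite [LHS]mxE z0 mxE.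
    by rewrite /mact big1 // => j _; rewrite z0 expr0z.
  have [d0|dn0] := eqVneq (nth 0 d i) 0; first by apply: z1 => j; rewrite DgE d0 mul0rn.
  have [lt|ge] := ltnP i n; last first.
    apply: z1 => j; rewrite DgE; have [Ei|//] := eqVneq (i : nat) j.
    by have := ltn_ord j; rewrite -Ei ltnNge ge.
  pose j0 := Ordinal lt; rewrite /mact (bigD1 j0) //= DgE eqxx mulr1n big1 ?mulr1.
    by have [_] := Hx' j0; apply.
  move=> j nj; rewrite DgE (_ : (_ == _) = false) ?mulr0n ?expr0z //.
  by apply/negbTE; apply: contra nj => /eqP Ei; apply/eqP/val_inj.
pose x := mact (invmx R) x'; have nx : forall i, x i != 0 by exact: mact_neq0.
have ext p q (A : 'M[int]_(p, q)) (z z' : 'I_q -> F) : z =1 z' -> mact A z =1 mact A z'.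
  by move=> E0 i; apply: eq_bigr => j _; rewrite E0.
exists x; split=> // j; rewrite -/(mact V x j) EV mactM // mactM; last exact: mact_neq0.
have E1 : mact R x =1 x'.
  by move=> i; rewrite -(mactM R (invmx R) nx') mulmxV // mact1.
rewrite (ext _ _ _ _ chi') => [|i]; last by rewrite (ext _ _ _ _ x').
by rewrite -(mactM L (invmx L) nz) mulmxV // mact1.
Qed.

End CharExtend.

(** A maximal subspace [W] of [F] not containing 1 is a complement of the line spanned by 1, and
    [rho] is the projection along [W]. *)
Lemma retraction (k F : fieldType) (iota : {rmorphism k -> F}) :
  exists rho : F -> k, [/\ forall x y, rho (x + y) = rho x + rho y,
    forall c x, rho (iota c * x) = c * rho x & rho 1 = 1].
Proof.
pose sub (W : set F) := [/\ W 0, forall x y, W x -> W y -> W (x + y)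
  & forall c x, W x -> W (iota c * x)].
pose P (W : set F) := W = set0 \/ (sub W /\ ~ W 1).
have [C CP totC|W [PW maxW]] := @Zorn_bigcup F P.
  have [[W0 [CW0 nW0]]|allE] := pselect (exists W, C W /\ W <> set0); last first.
    left; apply/seteqP; split=> // a [W CW Wa]; case: allE; exists W; split=> // E0.
    by rewrite E0 in Wa.
  have good W x : C W -> W x -> sub W /\ ~ W 1.
    by move=> CW Wx; have [E0|//] := CP _ CW; rewrite E0 in Wx.
  right; split; last first.
    by move=> [W CW W1]; have [_] := good _ _ CW W1.
  split.
  - have [x W0x] : exists x, W0 x.
      by apply: contrapT => /forallNP H; apply: nW0; apply/seteqP; split=> // x /H.
    by exists W0 => //; have [[]] := good _ _ CW0 W0x.
  - move=> x y [W CW Wx] [W' CW' Wy].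
    have [[_ D _] _] := good _ _ CW Wx; have [[_ D' _] _] := good _ _ CW' Wy.
    have [s|s] := totC _ _ CW CW'; first by exists W' => //; apply: D' => //; apply: s.
    by exists W => //; apply: D => //; apply: s.
  - move=> c x [W CW Wx]; exists W => //.
    by have [[_ _ Z] _] := good _ _ CW Wx; apply: Z.
have [[W0 WD WZ] W1] : sub W /\ ~ W 1.
  case: PW => [EW|//]; case: (maxW [set 0]%classic); last first.
    right; split; last by move=> /eqP; rewrite oner_eq0.
    by split=> [//|x y -> ->|c x ->] /=; rewrite ?addr0 ?mulr0.
  by rewrite EW; split; [exact: sub0set | move=> /(_ 0); apply].
have dec x : exists c : k, W (x - iota c).
  apply: contrapT => /forallNP H.
  pose W' := [set z : F | exists w c, W w /\ z = w + iota c * x]%classic.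
  apply: (maxW W').
    split; first by move=> w Ww; exists w, 0; rewrite rmorph0 mul0r addr0.
    move=> s; apply: (H 0); rewrite rmorph0 subr0; apply: s.
    by exists 0, 1; rewrite rmorph1 mul1r add0r.
  right; split; last first.
    move=> [w [c [Ww E1]]]; have [c0|cn0] := eqVneq c 0.
      by move: E1; rewrite c0 rmorph0 mul0r addr0 => E1; apply: W1; rewrite E1.
    apply: (H c^-1); have := WZ (- c^-1) _ Ww.
    have icn0 : iota c != 0 by rewrite fmorph_eq0.
    have -> : w = 1 - iota c * x by rewrite E1 addrK.
    by rewrite rmorphN fmorphV mulrBr mulr1 !mulNr mulKf // opprK addrC.
  split.
  - by exists 0, 0; rewrite rmorph0 mul0r addr0.
  - move=> _ _ [w [c [Ww ->]]] [w' [c' [Ww' ->]]]; exists (w + w'), (c + c').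
    by split; [exact: WD | rewrite rmorphD; ring].
  - move=> e _ [w [c [Ww ->]]]; exists (iota e * w), (e * c).
    by split; [exact: WZ | rewrite rmorphM; ring].
have [rho Hrho] := choice dec.
have uniq c c' x : W (x - iota c) -> W (x - iota c') -> c = c'.
  move=> Wc Wc'; apply: contrapT => /eqP ncc.
  have ncc0 : iota (c' - c) != 0 by rewrite fmorph_eq0 subr_eq0 eq_sym.
  have Wd : W (iota (c' - c)).
    have := WD _ _ Wc (WZ (-1) _ Wc').
    by rewrite rmorphN rmorph1 mulN1r rmorphB opprB addrC addrA subrK.
  by have := WZ (c' - c)^-1 _ Wd; rewrite fmorphV mulVf.
exists rho; split.
- move=> x y; apply: (uniq _ _ (x + y)) => //; rewrite rmorphD opprD addrACA.
  exact: WD.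
- move=> c x; apply: (uniq _ _ (iota c * x)) => //; rewrite rmorphM -mulrBr.
  exact: WZ.
- by apply: (uniq _ _ 1) => //; rewrite rmorph1 subrr.
Qed.

End ConeCharacters.

(** * The graded ring of the cone as a module over the logarithmic derivatives *)

Module ToricJacobian.
From mathcomp Require Import boolp classical_sets ring zify.
From mathcomp.multinomials Require Import mpoly.
Import CartierFreeness AlgebraicIndependence GradedNullstellensatz ConeCharacters KoszulComplex.
Import GRing.Theory.
Local Open Scope ring_scope.

Lemma comp_mpolyA (E : fieldType) m1 m2 m3 (s : m1.-tuple {mpoly E[m2]})
    (t : m2.-tuple {mpoly E[m3]}) (p : {mpoly E[m1]}) :
  (p \mPo s) \mPo t = p \mPo [tuple (tnth s i) \mPo t | i < m1].
Proof.
rewrite (comp_mpolyEX p s) (raddf_sum (comp_mpoly t)) /= comp_mpolyEX.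
apply: eq_bigr => v _; rewrite comp_mpolyZ !comp_mpolyX rmorph_prod /=.
by congr (_ *: _); apply: eq_bigr => i _; rewrite rmorphXn /= tnth_mktuple.
Qed.

Section GradedOps.
Variables (n : nat) (M : 'rV[int]_n -> Prop) (wd : 'rV[int]_n -> nat) (d : nat).
Variable sup : seq 'rV[int]_n.
Hypothesis M0 : M 0.
Hypothesis MD : forall mu nu, M mu -> M nu -> M (mu + nu).
Hypothesis wd0 : wd 0 = 0%N.
Hypothesis wdD : forall mu nu, M mu -> M nu -> (wd (mu + nu) <= wd mu + wd nu)%N.
Hypothesis supM : forall nu, nu \in sup -> M nu /\ wd nu = d.
Hypothesis d_gt0 : (0 < d)%N.

(** The product of [x^nu] and [x^(mu - nu)] in [Rbar] is nonzero when the weights add;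
    [adm_cofacial] compares this with [cofacial]. *)
Definition adm nu mu : bool := `[< M (mu - nu) /\ wd mu = (wd nu + wd (mu - nu))%N >].

Section Field.
Variables (E : fieldType) (phi : 'rV[int]_n -> E).
Implicit Types (g h : 'rV[int]_n -> E) (mu nu : 'rV[int]_n).

(** [Gx nu] is multiplication by [x^nu] in [Rbar] and [Fo l] multiplication by [F_l], on coefficient
    functions over a field [E] that will be [Fq] as well as its closure. *)
Definition Gx nu g : 'rV[int]_n -> E := fun mu => if adm nu mu then g (mu - nu) else 0.
Definition Fo (l : 'I_n) g : 'rV[int]_n -> E :=
  fun mu => \sum_(nu <- sup) (nu ord0 l)%:~R * phi nu * Gx nu g mu.
Definition Gr g : Prop := exists s : seq 'rV[int]_n, forall mu, g mu != 0 -> mu \in s /\ M mu.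
Definition Jset g : Prop := exists h : 'I_n -> 'rV[int]_n -> E,
  (forall l, Gr (h l)) /\ forall mu, g mu = \sum_l Fo l (h l) mu.
Definition comp (j : nat) g : 'rV[int]_n -> E := fun mu => if wd mu == j then g mu else 0.
Definition dlt nu : 'rV[int]_n -> E := fun mu => (mu == nu)%:R.

Lemma Gr0 : Gr (fun=> 0).
Proof. by exists [::] => mu; rewrite eqxx. Qed.

Lemma GrD g h : Gr g -> Gr h -> Gr (fun mu => g mu + h mu).
Proof.
move=> [s Hs] [t Ht]; exists (s ++ t) => mu nz; rewrite mem_cat.
have [g0|/Hs[-> ?]] := eqVneq (g mu) 0; last by [].
by move: nz; rewrite g0 add0r => /Ht[-> ?]; rewrite orbT.
Qed.

Lemma GrZ c g : Gr g -> Gr (fun mu => c * g mu).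
Proof.
move=> [s Hs]; exists s => mu nz; apply: Hs.
by apply: contraNneq nz => ->; rewrite mulr0.
Qed.

Lemma Gr_comp j g : Gr g -> Gr (comp j g).
Proof.
move=> [s Hs]; exists s => mu; rewrite /comp; case: ifP => _; first exact: Hs.
by rewrite eqxx.
Qed.

Lemma Gr_dlt nu : M nu -> Gr (dlt nu).
Proof.
move=> Mn; exists [:: nu] => mu; rewrite /dlt inE.
by have [->|] := eqVneq mu nu; rewrite ?eqxx.
Qed.

Lemma Gr_Gx nu g : M nu -> Gr g -> Gr (Gx nu g).
Proof.
move=> Mn [s Hs]; exists [seq nu + x | x <- s] => mu; rewrite /Gx.
case: ifP => [_ /Hs[ms Mm]|_]; last by rewrite eqxx.
split; first by apply/mapP; exists (mu - nu) => //; rewrite addrC subrK.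
by rewrite -[mu](subrK nu) addrC; apply: MD.
Qed.

(** Subadditivity makes both partial weights additive as soon as the total one is. The resulting
    condition is symmetric in [nu] and [nu'], whence the multiplications commute. *)
Lemma adm_comm nu nu' mu : M nu -> M nu' ->
  adm nu mu && adm nu' (mu - nu) =
  `[< M (mu - nu - nu') /\ wd mu = (wd nu + wd nu' + wd (mu - nu - nu'))%N >].
Proof.
move=> Mn Mn'; apply/andP/asboolP => [[/asboolP[M1 E1] /asboolP[M2 E2]]|[M2 E2]].
  by split=> //; rewrite E1 E2 addnA.
have M1 : M (mu - nu) by rewrite -[_ - nu](subrK nu') addrC; apply: MD.
have h1 := wdD Mn' M2; have h2 := wdD Mn M1.
rewrite [nu' + _]addrC subrK in h1; rewrite [nu + _]addrC subrK in h2.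
have [Ea Eb] : wd mu = (wd nu + wd (mu - nu))%N /\
    wd (mu - nu) = (wd nu' + wd (mu - nu - nu'))%N.
  move: E2 h1 h2; move: (wd mu) (wd nu) (wd nu') (wd (mu - nu)) (wd _).
  by move=> *; split; lia.
by split; apply/asboolP.
Qed.

Lemma Gx_comm nu nu' g mu : M nu -> M nu' ->
  Gx nu (Gx nu' g) mu = Gx nu' (Gx nu g) mu.
Proof.
move=> Mn Mn'; rewrite /Gx.
have ifand (a b : bool) (x : E) : (if a then (if b then x else 0) else 0) =
    if a && b then x else 0 by case: a.
by rewrite !ifand !adm_comm // addrAC [(wd nu' + wd nu)%N]addnC.
Qed.

Lemma GxD nu g h mu : Gx nu (fun mu => g mu + h mu) mu = Gx nu g mu + Gx nu h mu.
Proof. by rewrite /Gx; case: ifP; rewrite ?addr0. Qed.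

Lemma GxZ nu c g mu : Gx nu (fun mu => c * g mu) mu = c * Gx nu g mu.
Proof. by rewrite /Gx; case: ifP; rewrite ?mulr0. Qed.

Lemma Gx_sum nu (I : Type) (r : seq I) (P : pred I) (F : I -> 'rV[int]_n -> E) mu :
  Gx nu (fun mu => \sum_(i <- r | P i) F i mu) mu = \sum_(i <- r | P i) Gx nu (F i) mu.
Proof. by rewrite /Gx; case: ifP => // _; rewrite big1. Qed.

Lemma FoD l g h mu : Fo l (fun mu => g mu + h mu) mu = Fo l g mu + Fo l h mu.
Proof. by rewrite /Fo -big_split; apply: eq_bigr => nu _; rewrite GxD mulrDr. Qed.

Lemma FoZ l c g mu : Fo l (fun mu => c * g mu) mu = c * Fo l g mu.
Proof. by rewrite /Fo mulr_sumr; apply: eq_bigr => nu _; rewrite GxZ mulrCA. Qed.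

Lemma Fo0 l mu : Fo l (fun=> 0) mu = 0.
Proof. by rewrite /Fo big1 // => nu _; rewrite /Gx if_same mulr0. Qed.

Lemma Fo_Gx l nu g mu : M nu -> Fo l (Gx nu g) mu = Gx nu (Fo l g) mu.
Proof.
move=> Mn; rewrite /Fo Gx_sum big_seq [RHS]big_seq; apply: eq_bigr => nu' ns.
by rewrite Gx_comm ?GxZ //; have [] := supM ns.
Qed.

Lemma Gx_comp nu j g mu : Gx nu (comp j g) mu = comp (wd nu + j) (Gx nu g) mu.
Proof.
rewrite /Gx /comp; case: ifP => [/asboolP[_ ->]|_]; last by rewrite if_same.
by rewrite eqn_add2l.
Qed.

Lemma Fo_comp l j g mu : Fo l (comp j g) mu = comp (d + j) (Fo l g) mu.
Proof.
rewrite /Fo big_seq; under eq_bigr => nu ns do rewrite Gx_comp (supM ns).2.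
rewrite -big_seq /comp; case: ifP => // _; by rewrite big1 // => nu _; rewrite mulr0.
Qed.

Lemma Fo_comp_lt l j g mu : (j < d)%N -> comp j (Fo l g) mu = 0.
Proof.
move=> lt; rewrite /comp /Fo; case: eqP => // Ej.
rewrite big_seq big1 // => nu ns; rewrite /Gx; have [/asboolP[_ E1]|_] := ifP; last by rewrite mulr0.
by have := (supM ns).2; lia.
Qed.

Lemma Jset_ext g h : (forall mu, g mu = h mu) -> Jset g -> Jset h.
Proof. by move=> gh [k [Gk Ek]]; exists k; split=> // mu; rewrite -gh. Qed.

Lemma Jset0 : Jset (fun=> 0).
Proof.
exists (fun _ _ => 0); split=> [l|mu]; first exact: Gr0.
by rewrite big1 // => l _; rewrite Fo0.
Qed.

Lemma JsetD g h : Jset g -> Jset h -> Jset (fun mu => g mu + h mu).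
Proof.
move=> [k [Gk Ek]] [k' [Gk' Ek']]; exists (fun l mu => k l mu + k' l mu); split.
  by move=> l; apply: GrD.
by move=> mu; rewrite Ek Ek' -big_split; apply: eq_bigr => l _; rewrite FoD.
Qed.

Lemma JsetZ c g : Jset g -> Jset (fun mu => c * g mu).
Proof.
move=> [k [Gk Ek]]; exists (fun l mu => c * k l mu); split; first by move=> l; apply: GrZ.
by move=> mu; rewrite Ek mulr_sumr; apply: eq_bigr => l _; rewrite FoZ.
Qed.

Lemma Jset_Gx nu g : M nu -> Jset g -> Jset (Gx nu g).
Proof.
move=> Mn [k [Gk Ek]]; exists (fun l => Gx nu (k l)); split=> [l|mu]; first exact: Gr_Gx.
have -> : Gx nu g mu = Gx nu (fun mu => \sum_l Fo l (k l) mu) mu.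
  by rewrite /Gx; case: ifP => // _; rewrite Ek.
by rewrite Gx_sum; apply: eq_bigr => l _; rewrite Fo_Gx.
Qed.

Lemma Jset_comp j g : Jset g -> exists h : 'I_n -> 'rV[int]_n -> E,
  [/\ forall l, Gr (h l), forall l mu, h l mu != 0 -> (wd mu + d)%N = j
    & forall mu, comp j g mu = \sum_l Fo l (h l) mu].
Proof.
move=> [k [Gk Ek]]; have [le_d|lt_d] := leqP d j; last first.
  exists (fun _ _ => 0); split=> [l|l mu|mu]; [exact: Gr0 | by rewrite eqxx |].
  rewrite /comp; case: eqP => [Ej|_]; last by rewrite big1 // => l _; rewrite Fo0.
  rewrite Ek; apply: eq_bigr => l _; rewrite Fo0.
  by have := Fo_comp_lt l (k l) mu lt_d; rewrite /comp Ej eqxx.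
exists (fun l => comp (j - d) (k l)); split=> [l|l mu|mu]; first exact: Gr_comp.
  by rewrite /comp; have [->|] := eqVneq (wd mu) (j - d)%N; rewrite ?eqxx // subnK.
under [RHS]eq_bigr do rewrite Fo_comp subnKC //.
rewrite /comp; case: eqP => [_|_]; first exact: Ek.
by rewrite big1.
Qed.

Lemma Jset_comp_mem j g : Jset g -> Jset (comp j g).
Proof. by move=> /(Jset_comp j)[h [Gh _ Eh]]; exists h. Qed.

Lemma Gx_dlt nu nu' mu : M nu' ->
  Gx nu (dlt nu') mu = if wd (nu + nu') == (wd nu + wd nu')%N then dlt (nu + nu') mu else 0.
Proof.
move=> Mn'; rewrite /Gx /dlt.
have Eq : (mu - nu == nu') = (mu == nu + nu') by rewrite subr_eq addrC.
rewrite Eq; have [Em|_] := eqVneq mu (nu + nu'); last by rewrite !if_same.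
rewrite /adm Em [nu + nu' - nu]addrC addKr.
by congr (if _ then _ else _); apply/asboolP/eqP => [[]|].
Qed.

End Field.

(** * Nondegeneracy makes the Jacobian ideal of finite codimension *)

Section FiniteCodim.
Variables (F : closedFieldType) (psi : 'rV[int]_n -> F) (m : nat) (v : 'I_m -> 'rV[int]_n).
Hypothesis sup_v : sup = [seq v j | j <- enum 'I_m].
Local Notation S := {mpoly F[m]}.
Implicit Types (a : 'X_{1..m}) (P : S) (t : 'X_{1..m} -> F).

Definition lin t P : F := \sum_(a <- msupp P) P@_a * t a.

Lemma lin_sub t P (s : seq 'X_{1..m}) : uniq s -> {subset msupp P <= s} ->
  lin t P = \sum_(a <- s) P@_a * t a.
Proof.
move=> us sub; rewrite (bigID (mem (msupp P))) /= [X in _ + X]big1 ?addr0 => [|a na].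
  rewrite -big_filter; apply: perm_big; apply: uniq_perm; rewrite ?filter_uniq ?msupp_uniq //.
  by move=> a; rewrite mem_filter; case: (boolP (a \in msupp P)) => //= /sub ->.
by rewrite memN_msupp_eq0 ?mul0r.
Qed.

Lemma linD t P Q : lin t (P + Q) = lin t P + lin t Q.
Proof.
set s := undup (msupp P ++ msupp Q); have us : uniq s by exact: undup_uniq.
rewrite !(@lin_sub t _ s) //.
- by rewrite -big_split; apply: eq_bigr => a _; rewrite mcoeffD mulrDl.
- by move=> a; rewrite mem_undup mem_cat orbC => ->.
- by move=> a; rewrite mem_undup mem_cat => ->.
- by move=> a /msuppD_le; rewrite mem_undup.
Qed.

Lemma linZ t c P : lin t (c *: P) = c * lin t P.
Proof.
rewrite (@lin_sub t _ (msupp P)) ?msupp_uniq //; last exact: msuppZ_le.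
by rewrite mulr_sumr; apply: eq_bigr => a _; rewrite mcoeffZ mulrA.
Qed.

Lemma lin0 t : lin t 0 = 0.
Proof. by rewrite /lin -mpolyC0 msupp0 big_nil. Qed.

Lemma linX t a : lin t 'X_[a] = t a.
Proof. by rewrite /lin msuppX big_seq1 mcoeffX eqxx mul1r. Qed.

Lemma lin_XM t j P : lin t ('X_j * P) = lin (fun a => t (U_(j) + a)%MM) P.
Proof.
rewrite /lin mulrC (perm_big _ (msuppMX _ _)) big_map; apply: eq_bigr => a _.
by rewrite mcoeffMX.
Qed.

Definition tot a : 'rV[int]_n := \sum_j v j *+ a j.
Definition good a : bool := wd (tot a) == (d * mdeg a)%N.

Let v_sup j : v j \in sup.
Proof. by rewrite sup_v; apply/mapP; exists j; rewrite ?mem_enum. Qed.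

Lemma totD a a' : tot (a + a')%MM = tot a + tot a'.
Proof. by rewrite /tot -big_split; apply: eq_bigr => j _; rewrite mnmDE mulrnDr. Qed.

Lemma tot_U j : tot U_(j)%MM = v j.
Proof.
rewrite /tot (bigD1 j) //= mnm1E eqxx mulr1n big1 ?addr0 // => i ni.
by rewrite mnm1E eq_sym (negPf ni) mulr0n.
Qed.

Lemma totP a : M (tot a) /\ (wd (tot a) <= d * mdeg a)%N.
Proof.
rewrite mdegE big_distrr /tot /=; elim/big_ind2: _ => [|x x' y y' [Mx lx] [My ly]|j _].
- by rewrite wd0.
- by split; [exact: MD | exact: leq_trans (wdD Mx My) (leq_add lx ly)].
- have [Mb wb] := supM (v_sup j); elim: (a j) => [|e [Me le]]; first by rewrite mulr0n wd0.
  rewrite mulrS; split; first exact: MD.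
  by apply: leq_trans (wdD Mb Me) _; rewrite wb mulnS leq_add2l.
Qed.

(** The linear map from a polynomial ring with one variable per exponent of [f] to [Rbar], sending
    ['X_j] to [x^(v j)]; a monomial that is not [good] goes to 0, as its product in [Rbar] does. *)
Definition im P : 'rV[int]_n -> F :=
  fun mu => lin (fun a => if good a then dlt F (tot a) mu else 0) P.

Lemma im_XM j P mu : im ('X_j * P) mu = Gx (v j) (im P) mu.
Proof.
rewrite /im lin_XM; have [Mv wv] := supM (v_sup j).
have -> : Gx (v j) (fun mu => lin (fun a => if good a then dlt F (tot a) mu else 0) P) mu =
    lin (fun a => Gx (v j) (fun mu => if good a then dlt F (tot a) mu else 0) mu) P.
  by rewrite /Gx /lin; case: ifP => // _; rewrite big1 // => a _; rewrite mulr0.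
apply: eq_bigr => a _; congr (_ * _); have [Ma la] := totP a.
have -> : Gx (v j) (fun mu => if good a then dlt F (tot a) mu else 0) mu =
    if good a then Gx (v j) (dlt F (tot a)) mu else 0.
  by case: (good a) => //; rewrite /Gx if_same.
rewrite Gx_dlt // totD tot_U wv /good totD tot_U mdegD mdeg1 mulnDr muln1.
have h := wdD Mv Ma; rewrite wv in h.
have [E1|nE1] := eqVneq (wd (tot a)) (d * mdeg a)%N; first by rewrite -E1.
by rewrite ifF //; apply/negbTE; move: h la nE1; move: (wd _) (wd _) (_ * _)%N; lia.
Qed.

Lemma im_hc e P mu : im (pihomog mdeg e P) mu = comp (d * e) (im P) mu.
Proof.
rewrite /im (@lin_sub _ _ (msupp P)) ?msupp_uniq //; last first.
  by move=> a; rewrite !mcoeff_msupp mcoeff_hc; case: ifP; rewrite ?eqxx.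
have -> : comp (d * e) (fun mu => lin (fun a => if good a then dlt F (tot a) mu else 0) P) mu =
    lin (fun a => comp (d * e) (fun mu => if good a then dlt F (tot a) mu else 0) mu) P.
  by rewrite /comp /lin; case: ifP => // _; rewrite big1 // => a _; rewrite mulr0.
apply: eq_bigr => a _; rewrite mcoeff_hc /comp /dlt.
have [ga|] := boolP (good a); last by rewrite if_same !mulr0.
have [Em|] := eqVneq mu (tot a); last by rewrite if_same !mulr0.
rewrite Em (eqP ga) eqn_pmul2l //; by case: ifP; rewrite ?mulr0 ?mul0r.
Qed.

Definition Jim : set S := fun P => Jset psi (im P).

Lemma Jim_graded : graded_ideal Jim.
Proof.
have J0 : Jim 0 by apply: Jset_ext (Jset0 psi) => mu; rewrite /im lin0.
have JD (a b : S) : Jim a -> Jim b -> Jim (a + b).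
  by move=> Ja Jb; apply: Jset_ext (JsetD Ja Jb) => mu; rewrite /im linD.
split; last first.
  by move=> e P Ja; apply: Jset_ext (Jset_comp_mem (d * e) Ja) => mu; rewrite im_hc.
split=> // P b Jb; elim/mpolyind: P => [|c al P _ _ Ja]; first by rewrite mul0r.
rewrite mulrDl; apply: JD => //; rewrite -scalerAl.
suff J1 : Jim ('X_[al] * b).
  by apply: Jset_ext (JsetZ c J1) => mu; rewrite /im linZ.
have JX j (x : S) : Jim x -> Jim ('X_j * x).
  by move=> Jx; apply: Jset_ext (Jset_Gx (supM (v_sup j)).1 Jx) => mu; rewrite im_XM.
rewrite mpolyXE_id; elim/big_rec: _ => [|j x _ Jx]; first by rewrite mul1r.
by elim: (al j) => [|e IHe]; rewrite ?expr0 ?mul1r // exprS -!mulrA; apply: JX; rewrite mulrA.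
Qed.

Definition mono (T : {set 'I_m}) : 'X_{1..m} := [multinom ((j \in T) : nat) | j < m].

(** [Fp] stands for the exponents on the smallest face through those of [T]: products on it never
    vanish, each of its exponents divides a power of the product over [T], and nondegeneracy holds
    on it. *)
Hypothesis hfaceF : forall T : {set 'I_m}, T != finset.set0 ->
  wd (\sum_(j in T) v j) = (d * #|T|)%N ->
  exists Fp : {set 'I_m}, [/\ T \subset Fp,
    forall a : 'I_m -> nat, (forall j, a j != 0%N -> j \in Fp) ->
      wd (\sum_j v j *+ a j) = (d * \sum_j a j)%N,
    forall j, j \in Fp -> exists K (a : 'I_m -> nat), [/\ a j != 0%N,
      \sum_j v j *+ a j = (\sum_(j in T) v j) *+ K & (\sum_j a j = #|T| * K)%N]
    & ~ exists x : 'I_n -> F, (forall i, x i != 0) /\ forall l,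
        \sum_(j in Fp) psi (v j) * (v j ord0 l)%:~R * \prod_i x i ^ v j ord0 i = 0].

Lemma mdeg_mono T : mdeg (mono T) = #|T|.
Proof.
by rewrite mdegE -sum1_card [RHS]big_mkcond; apply: eq_bigr => j _; rewrite mnmE; case: (_ \in _).
Qed.

Lemma tot_mono T : tot (mono T) = \sum_(j in T) v j.
Proof.
rewrite [RHS]big_mkcond /tot; apply: eq_bigr => j _; rewrite mnmE.
by case: (_ \in _).
Qed.

Lemma hface (T : {set 'I_m}) : T != finset.set0 -> good (mono T) ->
  exists Fp : {set 'I_m}, [/\ T \subset Fp,
    forall a, (forall j, a j != 0%N -> j \in Fp) -> good a,
    forall j, j \in Fp -> exists K a, [/\ a j != 0%N, tot a = tot (mono T) *+ K
      & mdeg a = (#|T| * K)%N]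
    & ~ exists x : 'I_n -> F, (forall i, x i != 0) /\ forall l,
        \sum_(j in Fp) psi (v j) * (v j ord0 l)%:~R * \prod_i x i ^ v j ord0 i = 0].
Proof.
move=> Tn; rewrite /good tot_mono mdeg_mono => /eqP gT.
have [Fp [sTF gF sl nd]] := hfaceF Tn gT; exists Fp; split=> //.
  by move=> a Ha; rewrite /good /tot (gF (fun j => a j)) // mdegE.
move=> j jF; have [K [a [aj Ea Ed]]] := sl j jF.
exists K, [multinom a j | j < m]; split; rewrite ?mnmE //.
  by rewrite -Ea; apply: eq_bigr => i _; rewrite mnmE.
by rewrite mdegE -Ed; apply: eq_bigr => i _; rewrite mnmE.
Qed.

Lemma totMn a K : tot (a *+ K)%MM = tot a *+ K.
Proof. by rewrite /tot -sumrMnl; apply: eq_bigr => j _; rewrite mulmnE mulrnA. Qed.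

(** Otherwise the graded Nullstellensatz gives a nonzero common zero [chi] of the preimage of the
    Jacobian ideal. Its support [T] is a whole face, on which [chi] comes from a point of the torus;
    there all logarithmic derivatives would vanish. *)
Lemma finite_codim : exists N, forall a, mdeg a = N -> good a -> Jset psi (dlt F (tot a)).
Proof.
apply: contrapT => /forallNP H.
have inf : infinite_codim Jim.
  move=> N; have /existsNP[a /not_implyP[Ea /not_implyP[ga nJ]]] := H N.
  exists a; split=> // Ja; apply: nJ; apply: Jset_ext Ja => mu.
  by rewrite /im linX ga.
have [chi [[j0 chi0] Hchi]] := graded_nullstellensatz Jim_graded inf.
pose T := [set j | chi j != 0]%SET.
have Tn0 : T != finset.set0 by apply/finset.set0Pn; exists j0; rewrite inE.
have evX a : ('X_[a] : S).@[chi] = \prod_j chi j ^+ a j by exact: mevalX.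
have suppT a : (forall j, a j != 0%N -> j \in T) -> \prod_j chi j ^+ a j != 0.
  move=> Ha; apply/prodf_neq0 => j _; have [->|/Ha] := eqVneq (a j) 0%N; first by rewrite expr0 oner_neq0.
  by rewrite inE => nz; rewrite expf_neq0.
have binom a a' : good a -> good a' -> tot a = tot a' ->
    \prod_j chi j ^+ a j = \prod_j chi j ^+ a' j.
  move=> ga ga' Et; apply/eqP; rewrite -subr_eq0 -!evX -mevalB; apply/eqP; apply: Hchi.
  apply: Jset_ext (Jset0 psi) => mu.
  by rewrite /im -scaleN1r linD linZ !linX ga ga' Et mulN1r subrr.
have gT : good (mono T).
  apply: contrapT => ngT; have : \prod_j chi j ^+ mono T j = 0.
    rewrite -evX; apply: Hchi; apply: Jset_ext (Jset0 psi) => mu.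
    by rewrite /im linX ifN //; apply/negP.
  apply/eqP; apply: suppT => j; rewrite mnmE; by case: (j \in T).
have [Fp [sTF gF slack nond]] := hface Tn0 gT.
(* A power of the product over [T] is nonzero at [chi] and has the same value there as a monomial
   involving ['X_j], so [chi j != 0]. *)
have EFT : Fp = T.
  apply/eqP; rewrite finset.eqEsubset sTF andbT; apply/fintype.subsetP => j jF.
  have [K [a [aj Et Ed]]] := slack j jF.
  have gTK : good (mono T *+ K)%MM.
    apply: gF => i; rewrite mulmnE mnmE; case: (boolP (i \in T)) => // iT _.
    exact: (fintype.subsetP sTF).
  have ga : good a.
    by move: gTK; rewrite /good totMn -Et mdegMn mdeg_mono -Ed.
  have E1 : \prod_j chi j ^+ a j != 0.
    rewrite (binom _ _ ga gTK) ?totMn //; apply: suppT => i; rewrite mulmnE mnmE.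
    by case: (i \in T).
  rewrite inE; apply: contraNneq E1 => cj0; apply/prodf_eq0; exists j => //.
  by rewrite cj0 expr0n (negPf aj).
rewrite {}EFT in nond gF.
pose V : 'M[int]_(m, n) := \matrix_(j, i) (if j \in T then v j ord0 i else 0).
pose chi' j := if j \in T then chi j else 1.
have [|c cV|x [nx Ex]] := @char_extend F m n V chi'.
- by move=> j; rewrite /chi'; case: ifP => [|_]; rewrite ?inE ?oner_neq0.
(* The positive and negative parts of an integral relation are two good monomials with the same
   total exponent, so [chi] takes the same value on them. *)
- pose ap := [multinom (if j \in T then (if (0 <= c ord0 j)%R then `|c ord0 j|%N else 0%N) else 0%N) | j < m].
  pose am := [multinom (if j \in T then (if (0 <= c ord0 j)%R then 0%N else `|c ord0 j|%N) else 0%N) | j < m].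
  have gp : good ap by apply: gF => j; rewrite mnmE; case: ifP.
  have gm : good am by apply: gF => j; rewrite mnmE; case: ifP.
  have Epm : tot ap = tot am.
    apply/eqP; rewrite -subr_eq0 /tot -sumrB; apply/eqP; rewrite -[RHS]cV.
    apply/rowP => i; rewrite summxE mxE; apply: eq_bigr => j _.
    rewrite !mxE !mulmxnE !mnmE; change (c 0 j) with (c ord0 j).
    case: ifP => _; last by rewrite !mulr0n subrr mulr0.
    change (v j 0 i) with (v j ord0 i); move: (v j ord0 i) (c ord0 j) => x e.
    case: ifP => sc; rewrite mulr0n ?subr0 ?sub0r -mulr_natl natz; first by rewrite gez0_abs.
    by have {2}-> : e = - (`|e|%N)%:Z; [move: sc; lia | rewrite mulNr].
  have := binom _ _ gp gm Epm => Eb.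
  have nzm : \prod_j chi j ^+ am j != 0 by apply: suppT => j; rewrite mnmE; case: ifP.
  apply: (mulIf nzm); rewrite mul1r -[in RHS]Eb -big_split /=; apply: eq_bigr => j _.
  rewrite /chi' !mnmE; case: ifP => jT; last by rewrite exp1rz !expr0 mulr1.
  have nzj : chi j != 0 by move: jT; rewrite inE.
  case: ifP => sc; first by rewrite expr0 mulr1 -[in LHS](gez0_abs sc).
  rewrite expr0; have -> : c ord0 j = - (`|c ord0 j|%N)%:Z by move: sc; lia.
  by rewrite abszN absz_nat -invr_expz mulVf // expf_neq0.
apply: nond; exists x; split=> // l.
have : (\sum_j (psi (v j) * (v j ord0 l)%:~R) *: 'X_j : S).@[chi] = 0.
  apply: Hchi; exists (fun l' => if l' == l then dlt F 0 else fun=> 0); split.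
    by move=> l'; case: ifP => _; [exact: Gr_dlt | exact: Gr0].
  move=> mu; rewrite (bigD1 l) //= eqxx [X in _ + X]big1 ?addr0 => [|l' nl]; last first.
    by rewrite (negPf nl) Fo0.
  rewrite /im (big_morph _ (linD _) (lin0 _)) /Fo sup_v big_map big_enum.
  apply: eq_bigr => j _; rewrite linZ linX [(v j ord0 l)%:~R * _]mulrC; congr (_ * _).
  have [Mv wv] := supM (v_sup j).
  by rewrite Gx_dlt // addr0 wd0 addn0 eqxx /good tot_U mdeg1 muln1 wv eqxx.
rewrite (raddf_sum (meval chi)) /= (bigID (mem T)) /= [X in _ + X]big1 ?addr0 => [E0|j nj].
  rewrite -[RHS]E0; apply: eq_bigr => j jT; rewrite mevalZ mevalXU; congr (_ * _).
  have := Ex j; rewrite /chi' jT => <-; apply: eq_bigr => i _.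
  by rewrite mxE jT.
by rewrite mevalZ mevalXU; move: nj; rewrite inE negbK => /eqP ->; rewrite mulr0.
Qed.

Lemma finite_codim_fun : exists N, forall a : 'I_m -> nat, (\sum_j a j)%N = N ->
  wd (\sum_j v j *+ a j) = (d * N)%N -> Jset psi (dlt F (\sum_j v j *+ a j)).
Proof.
have [N HN] := finite_codim; exists N => a Ea Ew.
have Et : tot [multinom a j | j < m] = \sum_j v j *+ a j.
  by apply: eq_bigr => j _; rewrite mnmE.
have Ed : mdeg [multinom a j | j < m] = N.
  by rewrite mdegE -Ea; apply: eq_bigr => j _; rewrite mnmE.
by rewrite -Et; apply: HN => //; rewrite /good Et Ed Ew.
Qed.

End FiniteCodim.

(** * The semigroup of lattice points above the graph of the weight *)

Variable C : nat.
Hypothesis boundM : forall mu, M mu -> forall i, (`|mu ord0 i| <= C * wd mu)%N.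
Variable rows : seq ('rV[int]_n * int).
Hypothesis rowsM : forall mu (m : int), (M mu /\ (wd mu)%:Z <= m) <->
  forall r, r \in rows -> 0 <= \sum_i r.1 ord0 i * mu ord0 i + r.2 * m.
Variable bs : 'I_n -> 'rV[int]_n.
Hypothesis bs_sup : forall i, bs i \in sup.
Hypothesis bs_free : forall c : 'I_n -> int, \sum_i c i *: bs i = 0 -> forall i, c i = 0.

(* The cone over the graph of [wd], placed in the positive orthant by a shear. *)
Definition toX (mu : 'rV[int]_n) (m : nat) : 'X_{1..n.+1} :=
  [multinom (if unlift ord0 i is Some j then `|(mu ord0 j + (C * m)%:Z)%R|%N else m) | i < n.+1].
Definition muX (v : 'X_{1..n.+1}) : 'rV[int]_n :=
  \row_j ((v (lift ord0 j))%:Z - (C * v ord0)%:Z).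
Definition MX v : Prop := M (muX v) /\ (wd (muX v) <= v ord0)%N.

Lemma toX0 mu m : toX mu m ord0 = m.
Proof. by rewrite mnmE unlift_none. Qed.

Lemma toXl mu m j : toX mu m (lift ord0 j) = `|(mu ord0 j + (C * m)%:Z)%R|%N.
Proof. by rewrite mnmE liftK. Qed.

Lemma muXK v : toX (muX v) (v ord0) = v.
Proof.
apply/mnmP => i; rewrite mnmE; case: unliftP => [j ->|-> //].
by rewrite mxE subrK.
Qed.

Lemma toXK mu m : M mu -> (wd mu <= m)%N -> muX (toX mu m) = mu.
Proof.
move=> Mm le; apply/rowP => j; rewrite mxE toX0 toXl.
have h := boundM Mm j; have h2 : (C * wd mu <= C * m)%N by rewrite leq_mul2l le orbT.
change (mu 0 j) with (mu ord0 j); move: (mu ord0 j) h => x h; lia.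
Qed.

Lemma toX_MX mu m : M mu -> (wd mu <= m)%N -> MX (toX mu m).
Proof. by move=> Mm le; rewrite /MX toXK // toX0. Qed.

Lemma muXD v w : muX (v + w)%MM = muX v + muX w.
Proof. by apply/rowP => j; rewrite !mxE !mnmDE; lia. Qed.

Lemma muX0 : muX 0%MM = 0.
Proof. by apply/rowP => j; rewrite !mxE !mnm0E; lia. Qed.

Lemma muX_inj v w : muX v = muX w -> v ord0 = w ord0 -> v = w.
Proof. by move=> E1 E2; rewrite -[v]muXK E1 E2 muXK. Qed.

Lemma MX0 : MX 0%MM.
Proof. by rewrite /MX muX0 mnm0E wd0. Qed.

Lemma MXD v w : MX v -> MX w -> MX (v + w)%MM.
Proof.
move=> [Mv lv] [Mw lw]; rewrite /MX muXD mnmDE; split; first exact: MD.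
exact: leq_trans (wdD Mv Mw) (leq_add lv lw).
Qed.

Lemma toXD mu nu m m' : M mu -> M nu -> (wd mu <= m)%N -> (wd nu <= m')%N ->
  toX (mu + nu) (m + m') = (toX mu m + toX nu m')%MM.
Proof.
move=> Mm Mn le le'; apply: muX_inj; last by rewrite mnmDE !toX0.
rewrite muXD !toXK //; first exact: MD.
exact: leq_trans (wdD Mm Mn) (leq_add le le').
Qed.

(** An integral form that is nonnegative at [u + q (w - v1)] and smaller than [q] in absolute value
    at [u] is greater than -1, hence nonnegative, at [w - v1]. *)
Lemma starMX u : MX u -> exists q0, forall q, (q0 <= q)%N ->
  forall v v1 w, MX v -> (v + v1 *+ q = u + w *+ q)%MM ->
    exists2 w', MX w' & w = (v1 + w')%MM.
Proof.
pose rho (r : 'rV[int]_n * int) (mu : 'rV[int]_n) (m : int) : int :=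
  \sum_i r.1 ord0 i * mu ord0 i + r.2 * m.
move=> _; exists (\sum_(r <- rows) `|rho r (muX u) (u ord0)|%N).+1 => q leq v v1 w [Mv lv] Evw.
pose om := muX w - muX v1; pose m : int := (w ord0)%:Z - (v1 ord0)%:Z.
have Emu : muX v = muX u + om *+ q.
  have := congr1 muX Evw; rewrite !muXD.
  have muXMn x : muX (x *+ q)%MM = muX x *+ q.
    elim: (q) => [|q' IH]; first by rewrite mulm0n muX0.
    by rewrite mulmS muXD IH mulrS.
  rewrite !muXMn /om mulrnBl => Ev; apply: (@addIr _ (muX v1 *+ q)).
  by rewrite Ev -addrA subrK.
have Em : (v ord0)%:Z = (u ord0)%:Z + m * q%:Z.
  by have := congr1 (fun x : 'X_{1..n.+1} => x ord0) Evw; rewrite !mnmDE !mulmnE /m; lia.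
have q_gt0 : (0 < q)%N by exact: leq_trans leq.
have [Mom wom] : M om /\ (wd om)%:Z <= m.
  apply/rowsM => r rs; rewrite -/(rho r om m).
  have : 0 <= rho r (muX v) (v ord0).
    by have := (rowsM (muX v) (v ord0)).1; apply=> //; split.
  have -> : rho r (muX v) (v ord0) = rho r (muX u) (u ord0) + rho r om m * q%:Z.
    rewrite /rho Emu Em.
    have -> : \sum_i r.1 ord0 i * (muX u + om *+ q) ord0 i =
        \sum_i r.1 ord0 i * muX u ord0 i + (\sum_i r.1 ord0 i * om ord0 i) * q%:Z.
      rewrite mulr_suml -big_split; apply: eq_bigr => i _ /=.
      by rewrite mxE mulmxnE -mulr_natr natz; ring.
    by ring.
  have lt : (`|rho r (muX u) (u ord0)| < q)%N.
    apply: leq_trans leq; rewrite ltnS (big_rem r) //=; exact: leq_addr.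
  move: (rho _ _ _) (rho _ _ _) lt => x z lt h.
  by nia.
have m_ge0 : 0 <= m by exact: (Order.POrderTheory.le_trans _ wom).
exists (toX om `|m|%N); first by apply: toX_MX => //; lia.
apply: muX_inj.
  by rewrite muXD toXK //; [rewrite /om addrC subrK | lia].
by rewrite mnmDE toX0; move: m_ge0; rewrite /m; lia.
Qed.

(** The points are combinations, with coefficients at most [m], of [n] independent exponents of [f]
    placed in height [d] and of the vertical direction; independence makes them distinct. *)
Lemma growMX m : exists E : {ffun 'I_n.+1 -> 'I_m.+1} -> 'X_{1..n.+1},
  injective E /\ forall a, MX (E a) /\ (E a ord0 <= (1 + n * d) * m)%N.
Proof.
pose ms (a : {ffun 'I_n.+1 -> 'I_m.+1}) := \sum_(i < n) bs i *+ a (lift ord0 i).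
pose dg (a : {ffun 'I_n.+1 -> 'I_m.+1}) := (a ord0 + \sum_(i < n) d * a (lift ord0 i))%N.
have Hms a : M (ms a) /\ (wd (ms a) <= \sum_(i < n) d * a (lift ord0 i))%N.
  rewrite /ms; elim/big_ind2: _ => [|x x' y y' [Mx lx] [My ly]|i _].
  - by rewrite wd0.
  - by split; [exact: MD | exact: leq_trans (wdD Mx My) (leq_add lx ly)].
  - have [Mb wb] := supM (bs_sup i).
    elim: (nat_of_ord (a _)) => [|e [Me le]]; first by rewrite mulr0n wd0.
    rewrite mulrS; split; first exact: MD.
    by apply: leq_trans (wdD Mb Me) _; rewrite wb mulnS leq_add2l.
have Hdg a : (wd (ms a) <= dg a)%N by apply: leq_trans (Hms a).2 _; rewrite leq_addl.
exists (fun a => toX (ms a) (dg a)); split=> [a a' Eaa|a].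
  have E1 : ms a = ms a'.
    by have := congr1 muX Eaa; rewrite !toXK //; have [] := Hms a; have [] := Hms a'.
  have E2 : dg a = dg a' by have := congr1 (fun x : 'X_{1..n.+1} => x ord0) Eaa; rewrite !toX0.
  have El i : a (lift ord0 i) = a' (lift ord0 i).
    apply: val_inj => /=; apply/eqP; rewrite -eqz_nat -subr_eq0; apply/eqP.
    apply: (bs_free (c := fun i => (a (lift ord0 i))%:Z - (a' (lift ord0 i))%:Z)).
    under eq_bigr do rewrite scalerBl -!natz !scaler_nat.
    by rewrite sumrB -/(ms a) -/(ms a') E1 subrr.
  apply/ffunP => i; case: (unliftP ord0 i) => [j ->|->]; first exact: El.
  apply: val_inj => /=; move: E2; rewrite /dg.
  by rewrite (eq_bigr (fun i => d * a' (lift ord0 i))%N) => [/addIn|j _] //; rewrite El.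
split; first by apply: toX_MX; [have [] := Hms a | exact: Hdg].
rewrite toX0 /dg mulnDl mul1n leq_add ?leq_ord //.
apply: leq_trans (_ : \sum_(i < n) d * m <= _)%N.
  by apply: leq_sum => i _; rewrite leq_mul2l leq_ord orbT.
by rewrite sum_nat_const card_ord mulnA.
Qed.

Section Projection.
Variables (E : fieldType) (phi : 'rV[int]_n -> E).
Local Notation Fo := (Fo phi).
Local Notation S := {mpoly E[n.+1]}.

(** The quotient map from [A'] to [A'/tA' = Rbar]: only exponents on the graph of the weight
    survive. In [yX] the index [ord0] is [t], and [lift ord0 l] is the lift of [F_l] in height
    [d]. *)
Definition prX (a : S) : 'rV[int]_n -> E := fun mu => if `[< M mu >] then a@_(toX mu (wd mu)) else 0.
Definition yX (i : 'I_n.+1) : S :=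
  if unlift ord0 i is Some l then \sum_(nu <- sup) ((nu ord0 l)%:~R * phi nu) *: 'X_[toX nu d]
  else 'X_[toX 0 1].
Definition liftX (s : seq 'rV[int]_n) (g : 'rV[int]_n -> E) : S :=
  \sum_(mu <- undup s) g mu *: 'X_[toX mu (wd mu)].

Lemma prXD a b mu : prX (a + b) mu = prX a mu + prX b mu.
Proof. by rewrite /prX; case: ifP; rewrite ?addr0 // mcoeffD. Qed.

Lemma prXZ c a mu : prX (c *: a) mu = c * prX a mu.
Proof. by rewrite /prX; case: ifP; rewrite ?mulr0 // mcoeffZ. Qed.

Lemma prX_sum (I : Type) (r : seq I) (P : pred I) (F : I -> S) mu :
  prX (\sum_(i <- r | P i) F i) mu = \sum_(i <- r | P i) prX (F i) mu.
Proof. by rewrite /prX; case: ifP => _; rewrite ?raddf_sum // big1. Qed.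

Lemma prX_mono nu mu : M nu -> prX 'X_[toX nu (wd nu)] mu = dlt E nu mu.
Proof.
move=> Mn; rewrite /prX /dlt mcoeffX; case: asboolP => [Mm|nM].
  congr (_%:R); congr nat_of_bool; apply/eqP/eqP => [Et|->//].
  by have := congr1 muX Et; rewrite !toXK.
by have [Em|] := eqVneq mu nu => //; rewrite Em in nM.
Qed.

Lemma supportedX0 i : supported MX (yX i).
Proof.
rewrite /yX; case: unliftP => [l _|_].
  rewrite big_seq; apply: supported_sum => nu ns; apply: supportedZ; apply: supportedX.
  by have [Mn wn] := supM ns; apply: toX_MX; rewrite ?wn.
by apply: supportedX; apply: toX_MX; rewrite ?wd0.
Qed.

Lemma mcoeffXM (v w : 'X_{1..n.+1}) (a : S) : ('X_[v] * a)@_w =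
  if (v <= w)%MM then a@_(w - v)%MM else 0.
Proof.
case: ifP => [le|nle].
  by rewrite -{1}(submK le) addmC mulrC mcoeffMX.
apply/eqP; rewrite mcoeff_eq0; apply/negP; rewrite mulrC (perm_mem (msuppMX _ _)).
by move=> /mapP[x _ Ew]; rewrite Ew lem_addr in nle.
Qed.

(** A sum of two exponents lies on the graph only if both do and their weights add, which is the
    multiplication rule of [Rbar]. *)
Lemma prX_XM nu m a mu : M nu -> (wd nu <= m)%N -> supported MX a ->
  prX ('X_[toX nu m] * a) mu = if m == wd nu then Gx nu (prX a) mu else 0.
Proof.
move=> Mn lem sa; rewrite /prX mcoeffXM; case: asboolP => [Mm|nM]; last first.
  case: eqP => // _; rewrite /Gx; have [/asboolP[Md _]|//] := ifP; case: nM.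
  by rewrite -[mu](subrK nu) addrC; apply: MD.
have [Z|nz] := eqVneq (if (toX nu m <= toX mu (wd mu))%MM then
    a@_(toX mu (wd mu) - toX nu m)%MM else 0) 0.
  rewrite Z; case: eqP => // Em; rewrite /Gx; have [/asboolP[Md Ew]|//] := ifP.
  rewrite asboolT //; have Et : toX mu (wd mu) = (toX nu m + toX (mu - nu) (wd (mu - nu)))%MM.
    by rewrite -toXD ?Em ?leqnn // [nu + _]addrC subrK -Ew.
  by move: Z; rewrite Et lem_addr [X in a@_X](_ : _ = toX (mu - nu) (wd (mu - nu))) // addmC addmK.
move: nz; case: ifP => [le nz|_]; last by rewrite eqxx.
have [Md ld] := sa _ nz.
have Ev : toX mu (wd mu) = (toX nu m + (toX mu (wd mu) - toX nu m))%MM by rewrite addmC submK.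
set v := (toX mu (wd mu) - toX nu m)%MM in nz Md ld Ev *.
have Emu : muX v = mu - nu.
  have := congr1 muX Ev; rewrite muXD !toXK // => ->; by rewrite [nu + _]addrC addrK.
have E0 : wd mu = (m + v ord0)%N.
  by have := congr1 (fun x : 'X_{1..n.+1} => x ord0) Ev; rewrite mnmDE !toX0.
rewrite Emu in Md ld; have h := wdD Mn Md; rewrite [nu + _]addrC subrK in h.
have [Em Ewv] : m = wd nu /\ v ord0 = wd (mu - nu).
  move: E0 h ld lem; move: (wd mu) (wd nu) (wd _) (v ord0); move=> *; split; lia.
have A : adm nu mu by apply/asboolP; split=> //; rewrite -Em -Ewv.
by rewrite Em eqxx /Gx A asboolT // -Ewv -Emu muXK.
Qed.

Lemma prX_yl l a mu : supported MX a -> prX (yX (lift ord0 l) * a) mu = Fo l (prX a) mu.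
Proof.
move=> sa; rewrite /yX liftK mulr_suml prX_sum /Fo big_seq [RHS]big_seq.
apply: eq_bigr => nu ns; have [Mn wn] := supM ns.
by rewrite -scalerAl prXZ prX_XM ?wn // eqxx.
Qed.

Lemma prX_y0 a mu : supported MX a -> prX (yX ord0 * a) mu = 0.
Proof. by move=> sa; rewrite /yX unlift_none prX_XM ?wd0. Qed.

Definition homX m (a : S) : Prop := forall v, a@_v != 0 -> MX v /\ v ord0 = m.

(** An exponent strictly above the graph remains in the semigroup after one step down, that is,
    after division by [t]. The last clause records the loss of one in height for the inductions. *)
Lemma kerX a : supported MX a -> (forall mu, prX a mu = 0) ->
  exists a', [/\ supported MX a', a = yX ord0 * a' &
    forall m, homX m a -> if m is m'.+1 then homX m' a' else a' = 0].
Proof.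
move=> sa pa; have Hv v : a@_v != 0 -> exists2 v', MX v' & v = (toX 0 1 + v')%MM.
  move=> nz; have [Mv lv] := sa _ nz.
  have lt : (wd (muX v) < v ord0)%N.
    rewrite ltn_neqAle lv andbT; apply: contraNneq nz => Ew.
    by have := pa (muX v); rewrite /prX asboolT // Ew muXK => ->.
  exists (toX (muX v) (v ord0).-1); first by apply: toX_MX => //; lia.
  rewrite -toXD ?wd0 // ?add0r; last by lia.
  by rewrite add1n prednK ?muXK //; lia.
have [sg Hsg] : exists sg : 'X_{1..n.+1} -> 'X_{1..n.+1}, forall v, a@_v != 0 ->
    MX (sg v) /\ v = (toX 0 1 + sg v)%MM.
  have /choice[sg Hsg] : forall v, exists v', a@_v != 0 -> MX v' /\ v = (toX 0 1 + v')%MM.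
    by move=> v; have [_|/Hv[v' ? ?]] := eqVneq a@_v 0; [exists v | exists v'].
  by exists sg.
exists (\sum_(v <- msupp a) a@_v *: 'X_[sg v]); split.
- rewrite big_seq; apply: supported_sum => v; rewrite mcoeff_msupp => /Hsg[Mv _].
  by apply: supportedZ; apply: supportedX.
- rewrite {1}[a]mpolyE /yX unlift_none mulr_sumr !big_seq; apply: eq_bigr => v.
  by rewrite mcoeff_msupp => va; rewrite -scalerAr -mpolyXD -(Hsg v va).2.
- move=> m ha; have key v : a@_v != 0 -> m = (sg v ord0).+1.
    by move=> nz; have [_ <-] := ha v nz; rewrite {1}(Hsg v nz).2 mnmDE toX0.
  case: m ha key => [ha key|m' ha key].
    by rewrite big_seq big1 // => v; rewrite mcoeff_msupp => /key.
  move=> w; rewrite raddf_sum /= => nz.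
  have [v [va Ew]] : exists v, a@_v != 0 /\ sg v = w.
    apply: contrapT => H; case/negP: nz; apply/eqP; rewrite big_seq big1 // => v.
    rewrite mcoeff_msupp => va; rewrite mcoeffZ mcoeffX; have [Ew|] := eqVneq (sg v) w.
      by case: H; exists v.
    by rewrite mulr0.
  by rewrite -Ew; split; [have [] := Hsg v va | have [->] := key v va].
Qed.

Lemma liftX_pr s g mu : (forall mu, g mu != 0 -> mu \in s /\ M mu) ->
  prX (liftX s g) mu = g mu.
Proof.
move=> Hs; rewrite /liftX prX_sum.
have term nu : prX (g nu *: 'X_[toX nu (wd nu)]) mu = g nu * dlt E nu mu.
  rewrite prXZ; have [->|/Hs[_ Mn]] := eqVneq (g nu) 0; first by rewrite !mul0r.
  by rewrite prX_mono.
under eq_bigr do rewrite term.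
have [g0|nz] := eqVneq (g mu) 0.
  rewrite g0 big1 // => nu _; rewrite /dlt; have [<-|] := eqVneq mu nu; last by rewrite mulr0.
  by rewrite g0 mul0r.
rewrite (bigD1_seq mu) ?undup_uniq ?mem_undup //=; last by have [] := Hs _ nz.
rewrite /dlt eqxx mulr1 big1 ?addr0 // => nu nm.
by rewrite eq_sym (negPf nm) mulr0.
Qed.

Lemma liftX_hom s g m : (forall mu, g mu != 0 -> mu \in s /\ M mu) ->
  (forall mu, g mu != 0 -> wd mu = m) -> homX m (liftX s g).
Proof.
move=> Hs Hm v; rewrite /liftX raddf_sum /= => nz.
have [mu [gm Ev]] : exists mu, g mu != 0 /\ v = toX mu (wd mu).
  apply: contrapT => H; case/negP: nz; apply/eqP; apply: big1 => mu _.
  rewrite mcoeffZ mcoeffX; have [->|gm] := eqVneq (g mu) 0; first by rewrite mul0r.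
  have [Ev|] := eqVneq (toX mu (wd mu)) v; last by rewrite mulr0.
  by case: H; exists mu.
by rewrite Ev toX0; split; [apply: toX_MX; [have [] := Hs _ gm |] | exact: Hm].
Qed.

Lemma homX_supported m a : homX m a -> supported MX a.
Proof. by move=> h v /h[]. Qed.

End Projection.

(** * Freeness of the graded ring and the resulting counts *)

Section Basis.
Variables (E : fieldType) (phi : 'rV[int]_n -> E) (Q : nat).
Hypothesis Q_gt1 : (1 < Q)%N.
Hypothesis pcharQ : [pchar E].-nat Q.
Hypothesis expQ : forall c : E, c ^+ Q = c.
Variables (r : nat) (b : 'I_r -> 'rV[int]_n).
Hypothesis Mb : forall i, M (b i).
Local Notation Fo := (Fo phi).
Local Notation Jset := (Jset phi).
Local Notation dlt := (@dlt E).
Hypothesis hspan : forall g, Gr g -> exists c : 'I_r -> E,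
  Jset (fun mu => g mu - \sum_i c i * dlt (b i) mu).
Hypothesis hind : forall c : 'I_r -> E,
  Jset (fun mu => \sum_i c i * dlt (b i) mu) -> forall i, c i = 0.

Local Notation yX := (yX phi).
Local Notation S := {mpoly E[n.+1]}.
Let bX i := toX (b i) (wd (b i)).
Let y := [tuple yX i | i < n.+1].
Local Notation ev g := (g \mPo y).

Let MXbX i : MX (bX i).
Proof. by apply: toX_MX. Qed.

Let sy i : supported MX (tnth y i).
Proof. by rewrite tnth_mktuple; apply: supportedX0. Qed.

Let MX0' : MX 0%MM. Proof. exact: MX0. Qed.
Let MXD' u v : MX u -> MX v -> MX (u + v)%MM. Proof. exact: MXD. Qed.

Lemma Gr_prX (a : S) : Gr (prX a).
Proof.
exists [seq muX v | v <- msupp a] => mu; rewrite /prX .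
case: asboolP => [Mm nz|_]; last by rewrite eqxx.
split=> //; apply/mapP; exists (toX mu (wd mu)); first by rewrite mcoeff_msupp.
by rewrite toXK.
Qed.

(** Graded Nakayama, by induction on the height: modulo [t] and the [F_l] the element is a
    combination of [b], and the multipliers of [t] and [F_l] have heights [m - 1] and [m - d]. The
    degree bound is what [comp_alg_indep] requires. *)
Lemma span_hom m (a : S) : homX m a -> exists g : 'I_r -> S,
  a = \sum_i ev (g i) * 'X_[bX i] /\
  forall i al, (g i)@_al != 0 -> (mdeg al <= m)%N.
Proof.
elim/ltn_ind: m a => m IH a ha.
have sa : supported MX a by exact: homX_supported ha.
have [c Hc] := hspan (Gr_prX a).
(* Taking the component of weight [m] keeps only the basis elements of that weight. *)
pose c' i := if wd (b i) == m then c i else 0.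
have [h [Gh wh Eh]] := Jset_comp m Hc.
have wpa mu : prX a mu != 0 -> wd mu = m.
  rewrite /prX; case: asboolP => [Mm /ha[_]|_]; last by rewrite eqxx.
  by rewrite toX0.
have {}Eh mu : prX a mu = \sum_i c' i * dlt (b i) mu + \sum_l Fo l (h l) mu.
  rewrite -Eh /comp; have [Em|nEm] := eqVneq (wd mu) m.
    rewrite addrC -addrA [X in _ + X](_ : _ = 0) ?addr0 //.
    rewrite addrC -sumrB big1 // => i _; rewrite /c' /dlt .
    have [Emb|] := eqVneq mu (b i); last by rewrite !mulr0 subrr.
    by rewrite -Emb Em eqxx subrr.
  rewrite addr0 big1 => [|i _].
    by apply: contraNeq nEm => /wpa ->.
  rewrite /c' /dlt ; have [Emb|] := eqVneq mu (b i); last by rewrite mulr0.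
  by rewrite -Emb (negPf nEm) mul0r.
have /choice[sl Hsl] : forall l, exists s : seq 'rV[int]_n,
    forall mu, h l mu != 0 -> mu \in s /\ M mu by exact: Gh.
pose hl l := liftX (sl l) (h l).
have hhl l : homX (m - d) (hl l).
  by apply: (liftX_hom (Hsl l)) => mu /wh E0; lia.
have shl l : supported MX (hl l) by exact: homX_supported (hhl l).
have prhl l mu : prX (hl l) mu = h l mu by exact: (liftX_pr mu (Hsl l)).
have hl0 l : (m < d)%N -> hl l = 0.
  move=> lt; rewrite /hl /liftX big1 // => mu _.
  have [->|/wh E0] := eqVneq (h l mu) 0; first by rewrite scale0r.
  by move: lt; rewrite -E0 ltnNge leq_addl.
pose a2 := a - \sum_i c' i *: 'X_[bX i] - \sum_l yX (lift ord0 l) * hl l.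
have ha2 : homX m a2.
  have key v : a2@_v != 0 -> [\/ a@_v != 0, exists i, c' i != 0 /\ v = bX i
      | exists l, (yX (lift ord0 l) * hl l)@_v != 0].
    rewrite /a2 !mcoeffB => nz; have [a0|] := eqVneq a@_v 0; last by constructor 1.
    have [s0|s0] := eqVneq ((\sum_i c' i *: 'X_[bX i])@_v) 0.
      constructor 3; move: nz; rewrite a0 s0 subrr sub0r oppr_eq0 => nz.
      apply: contrapT => /forallNP H; case/negP: nz; rewrite raddf_sum /=.
      by apply/eqP; apply: big1 => l _; apply/eqP/negPn/negP/H.
    constructor 2; apply: contrapT => H; case/negP: s0; rewrite raddf_sum /=.
    apply/eqP; apply: big1 => i _; rewrite mcoeffZ mcoeffX.
    have [->|ci] := eqVneq (c' i) 0; first by rewrite mul0r.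
    have [Ev|] := eqVneq (bX i) v; last by rewrite mulr0.
    by case: H; exists i.
  move=> v /key[/ha//|[i [ci ->]]|[l]].
    split; first exact: MXbX.
    by rewrite /bX toX0; move: ci; rewrite /c'; have [//|_] := eqVneq (wd (b i)) m; rewrite eqxx.
  have [lt|le] := ltnP m d; first by rewrite (hl0 l lt) mulr0 mcoeff0 eqxx.
  have sM : supported MX (yX (lift ord0 l) * hl l).
    by apply: (supportedM MXD'); [exact: supportedX0 | exact: shl].
  move=> nz; split; first exact: sM.
  move: nz; rewrite /yX  liftK mulr_suml raddf_sum /= => nz.
  have [nu [ns nz']] : exists nu, nu \in sup /\ ('X_[toX nu d] * hl l)@_v != 0.
    apply: contrapT => /forallNP H; case/negP: nz; apply/eqP; rewrite big_seq.
    apply: big1 => nu ns; rewrite -scalerAl mcoeffZ.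
    have [->|nz'] := eqVneq (('X_[toX nu d] * hl l)@_v) 0; first by rewrite mulr0.
    by case: (H nu).
  move: nz'; rewrite mcoeffXM; case: ifP => [lev /(hhl l)[_ E0]|]; last by rewrite eqxx.
  by rewrite -(submK lev) mnmDE E0 toX0 subnK.
have pa2 mu : prX a2 mu = 0.
  rewrite /a2 -!(scaleN1r (\sum__ _)) !prXD !prXZ !prX_sum Eh.
  have -> : \sum_i prX (c' i *: 'X_[bX i]) mu = \sum_i c' i * dlt (b i) mu.
    by apply: eq_bigr => i _; rewrite prXZ prX_mono.
  have -> : \sum_l prX (yX (lift ord0 l) * hl l) mu = \sum_l Fo l (h l) mu.
    apply: eq_bigr => l _; rewrite prX_yl //.
    by congr (Fo _ _ _); apply: funext => x; apply: prhl.
  by ring.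
have [a' [sa' Ea' ha']] := kerX phi (homX_supported ha2) pa2.
have Ea : a = \sum_i c' i *: 'X_[bX i] + \sum_l yX (lift ord0 l) * hl l + yX ord0 * a'.
  by rewrite -Ea' /a2; ring.
have /choice[gl Hgl] : forall l, exists g : 'I_r -> S,
    hl l = \sum_i ev (g i) * 'X_[bX i] /\ forall i al, (g i)@_al != 0 -> (mdeg al < m)%N.
  move=> l; have [lt|le] := ltnP m d.
    exists (fun _ => 0); split=> [|i al]; last by rewrite mcoeff0 eqxx.
    by rewrite hl0 // big1 // => i _; rewrite comp_mpoly0 mul0r.
  have ltm : (m - d < m)%N by lia.
  have [g [Eg Hg]] := IH _ ltm _ (hhl l); exists g; split=> // i al /Hg le'.
  exact: leq_ltn_trans le' ltm.
have [g' [Eg' Hg']] : exists g : 'I_r -> S,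
    a' = \sum_i ev (g i) * 'X_[bX i] /\ forall i al, (g i)@_al != 0 -> (mdeg al < m)%N.
  have := ha' m ha2; case Em: m => [|m'] H.
    exists (fun _ => 0); split=> [|i al]; last by rewrite mcoeff0 eqxx.
    by rewrite H big1 // => i _; rewrite comp_mpoly0 mul0r.
  have ltm : (m' < m)%N by rewrite Em.
  by have [g [Eg Hg]] := IH _ ltm _ H; exists g; split=> // i al /Hg; rewrite ltnS.
exists (fun i => (c' i)%:MP + \sum_l 'X_(lift ord0 l) * gl l i + 'X_ord0 * g' i); split.
  rewrite Ea.
  have evX j : ev 'X_j = yX j by rewrite comp_mpolyXU -tnth_nth tnth_mktuple.
  under [RHS]eq_bigr do rewrite !comp_mpolyD comp_mpolyC (raddf_sum (comp_mpoly y)) /= rmorphM /= evX !mulrDl mulr_suml.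
  rewrite !big_split /=; congr (_ + _ + _).
  - by apply: eq_bigr => i _; rewrite mul_mpolyC.
  - rewrite exchange_big; apply: eq_bigr => l _ /=; rewrite (Hgl l).1 mulr_sumr.
    by apply: eq_bigr => i _; rewrite rmorphM /= evX mulrA.
  - by rewrite Eg' mulr_sumr; apply: eq_bigr => i _; rewrite mulrA.
move=> i al; rewrite !mcoeffD mcoeffC raddf_sum /= => nz.
have [->|aln0] := eqVneq al 0%MM; first by rewrite mdeg0.
have shiftX (q : S) j : (forall be, q@_be != 0 -> (mdeg be < m)%N) ->
    ('X_j * q)@_al != 0 -> (mdeg al <= m)%N.
  move=> Hq; rewrite mcoeffXM; case: ifP => [le /Hq lt|]; last by rewrite eqxx.
  by rewrite -(submK le) mdegD mdeg1 addn1.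
have [z0|] := eqVneq (('X_ord0 * g' i)@_al) 0; last by apply: shiftX => be; apply: Hg'.
move: nz; rewrite z0 addr0 (negPf aln0) mulr0 add0r => nz.
have [l nzl] : exists l, ('X_(lift ord0 l) * gl l i)@_al != 0.
  apply: contrapT => /forallNP H; case/negP: nz; apply/eqP; apply: big1 => l _.
  by apply/eqP/negPn/negP/H.
by apply: shiftX nzl => be; apply: (Hgl l).2.
Qed.

Lemma span_MX v : MX v -> exists g : 'I_r -> S,
  'X_[v] = \sum_i ev (g i) * 'X_[bX i] /\ forall i, (msize (g i) <= (v ord0).+1)%N.
Proof.
move=> Mv; have hv : homX (v ord0) ('X_[v] : S).
  by move=> w; rewrite mcoeffX; have [<-|] := eqVneq v w; rewrite ?eqxx.
have [g [Eg Hg]] := span_hom hv; exists g; split=> // i.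
rewrite msizeE; apply/bigmax_leqP_seq => al; rewrite mcoeff_msupp => /Hg le _.
by rewrite ltnS.
Qed.

Lemma span_supported a : supported MX a -> exists g : 'I_r -> S,
  a = \sum_i ev (g i) * 'X_[bX i].
Proof.
move=> sa; have /choice[g Hg] : forall v, exists g : 'I_r -> S,
    a@_v != 0 -> 'X_[v] = \sum_i ev (g i) * 'X_[bX i].
  move=> v; have [_|/sa/span_MX[g [Eg _]]] := eqVneq a@_v 0; last by exists g.
  by exists (fun _ => 0).
exists (fun i => \sum_(v <- msupp a) a@_v *: g v i).
under [RHS]eq_bigr do rewrite (raddf_sum (comp_mpoly y)) /= mulr_suml.
rewrite exchange_big {1}[a]mpolyE !big_seq /=; apply: eq_bigr => v.
rewrite mcoeff_msupp => /Hg ->; rewrite scaler_sumr; apply: eq_bigr => i _.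
by rewrite comp_mpolyZ scalerAl.
Qed.

(** Modulo [t] a relation with multipliers in [A'] becomes one in [Rbar], so [hind] supplies the
    independence that the Frobenius argument would contradict. *)
Lemma basis_free (p : 'I_r -> S) : \sum_i ev (p i) * 'X_[bX i] = 0 -> forall i, p i = 0.
Proof.
apply: (comp_basis_free Q_gt1 pcharQ expQ MX0' MXD' _ MXbX sy span_supported).
- by move=> u Mu; apply: starMX.
- move=> lam s ss Es; apply: hind; exists (fun l => prX (s (lift ord0 l))).
  split=> [l|mu]; first exact: Gr_prX.
  have -> : \sum_i lam i * dlt (b i) mu = prX (\sum_i lam i *: 'X_[bX i]) mu.
    by rewrite prX_sum; apply: eq_bigr => i _; rewrite prXZ prX_mono.
  rewrite Es prX_sum big_ord_recl /= tnth_mktuple prX_y0 // add0r.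
  by apply: eq_bigr => l _; rewrite tnth_mktuple prX_yl.
- apply: (comp_alg_indep span_MX (C := (1 + n * d)%N)).
  exact: growMX.
Qed.

Let t0 : n.+1.-tuple {mpoly E[n]} :=
  [tuple (if unlift ord0 i is Some l then 'X_l else 0) | i < n.+1].
Let iX : n.-tuple S := [tuple 'X_(lift ord0 l) | l < n].
Let yl : n.-tuple S := [tuple yX (lift ord0 l) | l < n].

(** [Phi] compares the free module on [b] over the polynomial ring, ['X_l] acting as [F_l], with
    [Rbar]. Its bijectivity transfers to [Rbar] the Koszul acyclicity of the variables and the count
    of monomials. *)
Definition PhiX (p : 'I_r -> {mpoly E[n]}) : S := \sum_i (p i \mPo yl) * 'X_[bX i].
Definition Phi (p : 'I_r -> {mpoly E[n]}) : 'rV[int]_n -> E := prX (PhiX p).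

Let iXK p : (p \mPo iX) \mPo t0 = p.
Proof.
rewrite comp_mpolyA -[RHS]comp_mpoly_id; congr (_ \mPo _).
apply: eq_from_tnth => l; rewrite !tnth_mktuple comp_mpolyXU -tnth_nth tnth_mktuple.
by rewrite liftK.
Qed.

Let ylE p : p \mPo yl = ev (p \mPo iX).
Proof.
rewrite comp_mpolyA; congr (_ \mPo _); apply: eq_from_tnth => l.
by rewrite !tnth_mktuple comp_mpolyXU -tnth_nth tnth_mktuple.
Qed.

Let sPhiX p : supported MX (PhiX p).
Proof.
apply: supported_sum => i _; apply: (supportedM MXD'); last by apply: supportedX.
by rewrite ylE; apply: supported_comp.
Qed.

Lemma Phi_Gr p : Gr (Phi p). Proof. exact: Gr_prX. Qed.

Lemma PhiD p q mu : Phi (fun i => p i + q i) mu = Phi p mu + Phi q mu.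
Proof.
rewrite /Phi -prXD; congr (prX _ _); rewrite /PhiX -big_split.
by apply: eq_bigr => i _; rewrite comp_mpolyD mulrDl.
Qed.

Lemma PhiZ c p mu : Phi (fun i => c *: p i) mu = c * Phi p mu.
Proof.
rewrite /Phi -prXZ; congr (prX _ _); rewrite /PhiX scaler_sumr.
by apply: eq_bigr => i _; rewrite comp_mpolyZ scalerAl.
Qed.

Lemma PhiXl l p mu : Phi (fun i => 'X_l * p i) mu = Fo l (Phi p) mu.
Proof.
rewrite /Phi -prX_yl //; congr (prX _ _); rewrite /PhiX mulr_sumr.
apply: eq_bigr => i _; rewrite rmorphM /= comp_mpolyXU -tnth_nth tnth_mktuple.
by rewrite mulrA.
Qed.

(** An element of the kernel is [t] times a combination of [b]. By freeness its coefficients are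
    multiples of the variable of [t], which they do not involve, so they vanish. *)
Lemma Phi_inj p : (forall mu, Phi p mu = 0) -> forall i, p i = 0.
Proof.
move=> H; have [a' [sa' Ea' _]] := kerX phi (@sPhiX p) H.
have [g Eg] := span_supported sa'.
have E0 : \sum_i ev (p i \mPo iX - 'X_ord0 * g i) * 'X_[bX i] = 0.
  under eq_bigr do rewrite comp_mpolyB rmorphM /= comp_mpolyXU -tnth_nth tnth_mktuple mulrBl.
  rewrite sumrB; apply/eqP; rewrite subr_eq0; apply/eqP.
  have <- : PhiX p = \sum_i ev (p i \mPo iX) * 'X_[bX i].
    by apply: eq_bigr => i _; rewrite ylE.
  by rewrite Ea' Eg mulr_sumr; apply: eq_bigr => i _; rewrite mulrA.
move=> i; have /eqP := basis_free E0 i; rewrite subr_eq0 => /eqP Ei.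
have := congr1 (comp_mpoly t0) Ei; rewrite iXK rmorphM /= comp_mpolyXU -tnth_nth.
by rewrite tnth_mktuple unlift_none mul0r.
Qed.

Lemma Phi_surj g : Gr g -> exists p, forall mu, Phi p mu = g mu.
Proof.
move=> [s Hs]; have sl : supported MX (liftX s g).
  apply: supported_sum => mu _; have [->|/Hs[_ Mm]] := eqVneq (g mu) 0.
    by rewrite scale0r; apply: supported0.
  by apply: supportedZ; apply: supportedX; apply: toX_MX.
have [q Eq] := span_supported sl.
have red (q0 : S) : exists s0 : S, q0 = (q0 \mPo t0) \mPo iX + 'X_ord0 * s0.
  elim/mpolyind: q0 => [|c al q0 _ _ [s0 Es0]].
    by exists 0; rewrite !comp_mpoly0 mulr0 addr0.
  have [s1 Es1] : exists s1 : S, 'X_[al] = ('X_[al] \mPo t0) \mPo iX + 'X_ord0 * s1.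
    have [a0|an0] := eqVneq (al ord0) 0%N; last first.
      have le : (U_(ord0) <= al)%MM by rewrite lep1mP.
      exists 'X_[al - U_(ord0)]; rewrite -mpolyXD addmC submK //.
      rewrite comp_mpolyX (bigD1 ord0) //= tnth_mktuple unlift_none expr0n (negPf an0).
      by rewrite mul0r comp_mpoly0 add0r.
    exists 0; rewrite mulr0 addr0 comp_mpolyX big_ord_recl a0 expr0 mul1r rmorph_prod /=.
    rewrite mpolyXE_id big_ord_recl a0 expr0 mul1r; apply: eq_bigr => l _.
    by rewrite rmorphXn /= tnth_mktuple liftK comp_mpolyXU -tnth_nth tnth_mktuple.
  exists (c *: s1 + s0); rewrite !comp_mpolyD !comp_mpolyZ mulrDr -scalerAr.
  by rewrite {1}Es1 {1}Es0 scalerDr addrACA.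
have /choice[s0 Hs0] := fun i => red (q i).
exists (fun i => q i \mPo t0) => mu; rewrite -(liftX_pr mu Hs) Eq.
have -> : \sum_i ev (q i) * 'X_[bX i] =
    PhiX (fun i => q i \mPo t0) + yX ord0 * \sum_i ev (s0 i) * 'X_[bX i].
  rewrite /PhiX mulr_sumr -big_split; apply: eq_bigr => i _ /=.
  rewrite ylE {1}(Hs0 i) comp_mpolyD rmorphM /= comp_mpolyXU -tnth_nth tnth_mktuple.
  by rewrite mulrDl mulrA.
rewrite prXD prX_y0 ?addr0 //; apply: supported_sum => i _.
by apply: (supportedM MXD'); [apply: supported_comp | apply: supportedX].
Qed.

Lemma Phi_deg p mu : Phi p mu != 0 ->
  exists i al, (p i)@_al != 0 /\ wd mu = (d * mdeg al + wd (b i))%N.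
Proof.
rewrite /Phi /PhiX prX_sum => nz.
have [i {}nz] : exists i, prX ((p i \mPo yl) * 'X_[bX i]) mu != 0.
  apply: contrapT => /forallNP H; case/negP: nz; apply/eqP; apply: big1 => i _.
  by apply/eqP/negPn/negP/H.
exists i; move: nz; rewrite comp_mpolyEX mulr_suml prX_sum => nz.
have [al [pal {}nz]] : exists al, (p i)@_al != 0 /\ prX (('X_[al] \mPo yl) * 'X_[bX i]) mu != 0.
  apply: contrapT => /forallNP H; case/negP: nz; apply/eqP; rewrite big_seq.
  apply: big1 => al; rewrite mcoeff_msupp => pal; rewrite -scalerAl prXZ.
  have [->|nz'] := eqVneq (prX (('X_[al] \mPo yl) * 'X_[bX i]) mu) 0; first by rewrite mulr0.
  by case: (H al).
exists al; split=> //.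
have homM m1 m2 (a1 a2 : S) : homX m1 a1 -> homX m2 a2 -> homX (m1 + m2) (a1 * a2).
  move=> h1 h2; rewrite [a1]mpolyE mulr_suml => v; rewrite raddf_sum /= => nzv.
  have [u [u1 nzu]] : exists u, a1@_u != 0 /\ ('X_[u] * a2)@_v != 0.
    apply: contrapT => /forallNP H; case/negP: nzv; apply/eqP; rewrite big_seq.
    apply: big1 => u; rewrite mcoeff_msupp => u1; rewrite -scalerAl mcoeffZ.
    have [->|nz'] := eqVneq (('X_[u] * a2)@_v) 0; first by rewrite mulr0.
    by case: (H u).
  have [Mu E1] := h1 _ u1; move: nzu; rewrite mcoeffXM.
  case: ifP => [le /h2[Mv E2]|]; last by rewrite eqxx.
  by rewrite -(submK le); split; [exact: MXD' | rewrite mnmDE E1 E2 addnC].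
have homy l : homX d (yX (lift ord0 l)).
  move=> v; rewrite /yX  liftK raddf_sum /= => nzv.
  have [nu [ns Ev]] : exists nu, nu \in sup /\ toX nu d = v.
    apply: contrapT => /forallNP H; case/negP: nzv; apply/eqP; rewrite big_seq.
    apply: big1 => nu ns; rewrite mcoeffZ mcoeffX.
    by have [Ev|] := eqVneq (toX nu d) v; [case: (H nu) | rewrite mulr0].
  have [Mn wn] := supM ns; rewrite -Ev toX0; split=> //.
  by apply: toX_MX; rewrite ?wn.
have hom1 : homX 0 (1 : S).
  move=> v; rewrite mcoeff1; have [->|] := eqVneq v 0%MM; last by rewrite eqxx.
  by rewrite mnm0E; split.
have homb : homX (wd (b i)) ('X_[bX i] : S).
  move=> v; rewrite mcoeffX; have [<-|] := eqVneq (bX i) v; last by rewrite eqxx.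
  by rewrite /bX toX0; split=> //; apply: MXbX.
have homal : homX (d * mdeg al) ('X_[al] \mPo yl).
  rewrite comp_mpolyX mdegE big_distrr /=; elim/big_ind2: _ => [//|x1 x2 z1 z2|l _].
    exact: homM.
  rewrite tnth_mktuple; elim: (al l) => [|e IHe]; first by rewrite muln0 expr0.
  by rewrite mulnS exprS; apply: homM.
move: nz; rewrite /prX; case: asboolP => [Mm|_]; last by rewrite eqxx.
by move=> /(homM _ _ _ _ homal homb)[_]; rewrite toX0.
Qed.

Lemma Phi0 mu : Phi (fun=> 0) mu = 0.
Proof.
have := PhiZ 0 (fun=> 0) mu; rewrite mul0r => E0; rewrite -[RHS]E0; congr (Phi _ mu).
by apply: funext => i; rewrite scale0r.
Qed.

Lemma Phi_sum (I : Type) (s : seq I) (P : pred I) (p : I -> 'I_r -> {mpoly E[n]}) mu :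
  Phi (fun i => \sum_(x <- s | P x) p x i) mu = \sum_(x <- s | P x) Phi (p x) mu.
Proof.
elim: s => [|x s IH].
  rewrite big_nil -[RHS](Phi0 mu); congr (Phi _ mu); apply: funext => i.
  by rewrite big_nil.
rewrite big_cons; case: ifP => Px; rewrite -IH -?PhiD; congr (Phi _ mu);
  by apply: funext => i; rewrite big_cons Px.
Qed.

Lemma koszul_Fo (om : {set 'I_n} -> 'rV[int]_n -> E) :
  (forall T, Gr (om T)) -> (forall mu, om [set: 'I_n]%SET mu = 0) ->
  (forall (T : {set 'I_n}) mu, \sum_(l in T) sgn E l T * Fo l (om (T :\ l)%SET) mu = 0) ->
  exists th : {set 'I_n} -> 'rV[int]_n -> E, (forall T, Gr (th T)) /\
    forall (T : {set 'I_n}) mu, om T mu = \sum_(l in T) sgn E l T * Fo l (th (T :\ l)%SET) mu.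
Proof.
move=> Gom omT dom; have /choice[P HP] := fun T => Phi_surj (Gom T).
have EP T : Phi (P T) = om T by apply: funext.
have dPhi (q : {set 'I_n} -> 'I_r -> {mpoly E[n]}) T mu :
    Phi (fun i => dX (fun T => q T i) T) mu =
    \sum_(l in T) sgn E l T * Fo l (Phi (q (T :\ l)%SET)) mu.
  rewrite /dX Phi_sum; apply: eq_bigr => l _.
  by rewrite PhiZ PhiXl.
have dP i T : dX (fun T => P T i) T = 0.
  move: i; apply: (Phi_inj (p := fun i => dX (fun T => P T i) T)) => mu.
  by rewrite dPhi -[RHS](dom T mu); apply: eq_bigr => l _; rewrite EP.
have PT i : P [set: 'I_n]%SET i = 0.
  by move: i; apply: Phi_inj => mu; rewrite HP omT.
have /choice[th Hth] := fun i => koszul_poly (PT i) (dP i).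
exists (fun T => Phi (fun i => th i T)); split=> [T|T mu]; first exact: Phi_Gr.
rewrite -HP -(dPhi (fun T i => th i T)); congr (Phi _ mu); apply: funext => i.
by have [-> _] := Hth i.
Qed.

Lemma card_bmultinom t : #|{: 'X_{1..n < t.+1}}| = 'C(n + t, n).
Proof.
rewrite -card_partial_ord_partitions.
pose g (al : 'X_{1..n < t.+1}) : n.-tuple 'I_t.+1 := [tuple inord ((val al : 'X_{1..n}) i) | i < n].
have le (al : 'X_{1..n < t.+1}) i : ((val al : 'X_{1..n}) i <= t)%N.
  have := bmdeg al; rewrite ltnS; apply: leq_trans.
  by rewrite mdegE (bigD1 i) //= leq_addr.
have ginj : injective g.
  move=> al be Eg; apply: val_inj => /=; apply/mnmP => i.
  have := congr1 (fun z : n.-tuple 'I_t.+1 => val (tnth z i)) Eg.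
  by rewrite /g !tnth_mktuple /= !inordK ?ltnS ?le.
rewrite -(card_imset _ ginj); apply: eq_card => z; rewrite !inE.
have sumE (y0 : n.-tuple 'I_t.+1) : (\sum_(i <- y0) i = \sum_(i < n) tnth y0 i)%N.
  by rewrite big_tuple.
apply/imsetP/idP => [[al _ ->]|le_z].
  rewrite sumE; have := bmdeg al; rewrite ltnS mdegE; apply: leq_trans.
  by apply: leq_sum => i _; rewrite tnth_mktuple inordK // ltnS le.
have lt : (mdeg [multinom (tnth z i : nat) | i < n] < t.+1)%N.
  by rewrite ltnS mdegE (eq_bigr (fun i => tnth z i : nat)) -?sumE // => i _; rewrite mnmE.
exists (BMultinom lt) => //; apply: eq_from_tnth => i; apply: val_inj.
by rewrite tnth_mktuple /= mnmE inordK.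
Qed.

(** Two dimension counts: the points of [s] expand in images of monomials of degree at most [N], and
    the independent images of monomials of degree at most [N - c] are supported on [s]. *)
Lemma count_bounds N (s : seq 'rV[int]_n) (c : nat) : uniq s ->
  (forall mu, (mu \in s) <-> M mu /\ (wd mu <= d * N)%N) ->
  (forall i, (wd (b i) <= d * c)%N) ->
  (size s <= r * 'C(n + N, n))%N /\ ((c <= N)%N -> (r * 'C(n + (N - c), n) <= size s)%N).
Proof.
move=> us Hs Hc; pose St := seq_sub s.
have cSt : #|{: St}| = size s by rewrite card_seq_sub.
pose e i (al : 'X_{1..n}) : 'rV[int]_n -> E := Phi (fun i' => if i' == i then 'X_[al] else 0).
have edeg i al mu : e i al mu != 0 -> wd mu = (d * mdeg al + wd (b i))%N.
  move=> /Phi_deg[i' [be []]]; have [->|_] := eqVneq i' i; last by rewrite mcoeff0 eqxx.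
  by rewrite mcoeffX; have [->|] := eqVneq al be; rewrite ?eqxx.
have expand (p : 'I_r -> {mpoly E[n]}) D mu : (forall i, (msize (p i) <= D)%N) ->
    Phi p mu = \sum_i \sum_(al : 'X_{1..n < D}) (p i)@_al * e i al mu.
  move=> sp; have Es i : Phi (fun i' => \sum_(al : 'X_{1..n < D})
      (p i)@_al *: (if i' == i then 'X_[al] else 0)) mu =
      \sum_(al : 'X_{1..n < D}) (p i)@_al * e i al mu.
    by rewrite Phi_sum; apply: eq_bigr => al _; rewrite PhiZ.
  under [RHS]eq_bigr do rewrite -Es.
  rewrite -Phi_sum.
  congr (Phi _ mu); apply: funext => i'; rewrite (bigD1 i') //= eqxx.
  rewrite [X in _ + X]big1 ?addr0 => [|i ni]; first exact: mpolywE.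
  by apply: big1 => al _; rewrite eq_sym (negPf ni) scaler0.
split.
  rewrite -cSt -card_bmultinom -[r]card_ord -card_prod.
  have /choice[p Hp] := fun x : St => Phi_surj (Gr_dlt E ((Hs (val x)).1 (valP x)).1).
  pose D := (\sum_x \sum_i msize (p x i) + N.+1)%N.
  have sp x i : (msize (p x i) <= D)%N.
    by rewrite /D (bigD1 x) //= (bigD1 i) //= -!addnA leq_addr.
  apply: (@leq_card_span_fun E 'rV[int]_n St _ (fun x mu => dlt (val x) mu)
    (fun z mu => if (d * mdeg (val z.2) + wd (b z.1) <= d * N)%N then e z.1 (val z.2) mu else 0)
    (fun x z => (p x z.1)@_(val z.2))).
    move=> x mu; have [Mx wx] := (Hs (val x)).1 (valP x).
    rewrite -(pair_bigA _ (fun i (al : 'X_{1..n < N.+1}) => (p x i)@_al *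
      (if (d * mdeg (val al) + wd (b i) <= d * N)%N then e i al mu else 0))) /=.
    have [gt|le] := ltnP (d * N)%N (wd mu).
      rewrite /dlt; have [E0|_] := eqVneq mu (val x); first by move: gt; rewrite E0 ltnNge wx.
      rewrite big1 // => i _; rewrite big1 // => al _; case: ifP => [le|]; last by rewrite mulr0.
      have [->|/edeg E0] := eqVneq (e i al mu) 0; first by rewrite mulr0.
      by move: gt; rewrite E0 ltnNge le.
    rewrite -Hp (expand _ D) //; apply: eq_bigr => i _.
    pose G (al : 'X_{1..n}) := (p x i)@_al * e i al mu.
    have GE (al : 'X_{1..n}) : G al = if (mdeg al < N.+1)%N then (p x i)@_al *
        (if (d * mdeg al + wd (b i) <= d * N)%N then e i al mu else 0) else 0.
      rewrite /G; have [->|/edeg E0] := eqVneq (e i al mu) 0; first by rewrite if_same mulr0 if_same.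
      rewrite E0 in le; rewrite le ltnS.
      by rewrite ifT // -(leq_pmul2l d_gt0); apply: leq_trans (leq_addr _ _) le.
    (* Passes from the common bound [D] on all expansions to the degree [N], beyond which nothing
       contributes at a point of weight at most [d * N]. *)
    have widen (H : 'X_{1..n} -> E) D1 D2 : (D1 <= D2)%N -> (forall al, (D1 <= mdeg al)%N -> H al = 0) ->
        \sum_(al : 'X_{1..n < D2}) H al = \sum_(al : 'X_{1..n < D1}) H al.
      move=> le12 Hz.
      have mE D0 : \sum_(al : 'X_{1..n < D0}) H al =
          \sum_(al <- [seq val x | x : 'X_{1..n < D0}]) H al.
        by rewrite big_map /= -big_enum.
      rewrite !mE (bigID (fun al : 'X_{1..n} => (mdeg al < D1)%N)) /= [X in _ + X]big1 ?addr0; last first.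
        by move=> al; rewrite -leqNgt; apply: Hz.
      rewrite -big_filter; apply: perm_big; apply: uniq_perm.
      - by rewrite filter_uniq // map_inj_uniq ?enum_uniq //; apply: val_inj.
      - by rewrite map_inj_uniq ?enum_uniq //; apply: val_inj.
      - move=> al; rewrite mem_filter; apply/andP/mapP => [[lt /mapP[x' _ Ex]]|[x' _ ->]].
          by exists (BMultinom lt); rewrite ?mem_enum.
        split; first exact: bmdeg.
        have lt2 := leq_trans (bmdeg x') le12.
        by apply/mapP; exists (BMultinom lt2); rewrite ?mem_enum.
    rewrite -[LHS]/(\sum_(al : 'X_{1..n < D}) G (val al)) (widen _ N.+1) ?leq_addl //.
      by apply: eq_bigr => al _; rewrite GE (bmdeg al).
    by move=> al le'; rewrite GE ltnNge le'.
  move=> u Eu x; have := Eu (val x).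
  rewrite (bigD1 x) //= [X in _ + X]big1 ?addr0 => [|x' nx].
    by rewrite /dlt eqxx => E0; rewrite -[RHS]E0 [RHS]mulr1.
  by rewrite /dlt eq_sym (inj_eq val_inj) (negPf nx); apply: mulr0.
move=> le_c; rewrite -cSt -card_bmultinom -[r]card_ord -card_prod.
apply: (@leq_card_span_fun E 'rV[int]_n _ St (fun z mu => e z.1 (val z.2) mu)
  (fun x mu => dlt (val x) mu) (fun z x => e z.1 (val z.2) (val x))).
  move=> [i al] mu /=.
  have [E0|nz] := eqVneq (e i al mu) 0.
    rewrite E0 big1 // => x _; rewrite /dlt; have [Ex|_] := eqVneq mu (val x); last exact: mulr0.
    by rewrite -Ex E0; apply: mul0r.
  have ms : mu \in s.
    apply/Hs; split; first by have [s' Hs'] := Phi_Gr (fun i' => if i' == i then 'X_[val al] else 0); have [] := Hs' _ nz.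
    rewrite (edeg _ _ _ nz); have := bmdeg al; rewrite ltnS => lal.
    apply: leq_trans (leq_add (leq_mul (leqnn d) lal) (Hc i)) _.
    by rewrite -mulnDr subnK.
  rewrite (bigD1 (SeqSub ms)) //= [X in _ + X]big1 ?addr0 => [|x nx].
    by rewrite /dlt eqxx [RHS]mulr1.
  rewrite /dlt; have [Ex|_] := eqVneq mu (val x); last exact: mulr0.
  by case/eqP: nx; apply: val_inj.
move=> u Eu [i0 al0].
pose p i := \sum_(al : 'X_{1..n < (N - c).+1}) u (i, al) *: 'X_[al] : {mpoly E[n]}.
have pE i (al : 'X_{1..n < (N - c).+1}) : (p i)@_al = u (i, al).
  rewrite raddf_sum /= (bigD1 al) //= mcoeffZ mcoeffX eqxx mulr1 big1 ?addr0 // => be nb.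
  by rewrite mcoeffZ mcoeffX (inj_eq val_inj) (negPf nb) mulr0.
have sp i : (msize (p i) <= (N - c).+1)%N.
  apply: leq_trans (mmeasure_sum _ _ _ _) _; apply/bigmax_leqP => al _.
  by apply: leq_trans (mmeasureZ_le _ _ _) _; rewrite mmeasureX; exact: bmdeg.
have p0 : forall i, p i = 0.
  apply: Phi_inj => mu; rewrite (expand _ _ _ sp).
  have E0 := Eu mu; rewrite -[RHS]E0 pair_bigA /=.
  by apply: eq_bigr => z _; rewrite pE; case: z.
by rewrite -pE p0 mcoeff0.
Qed.

End Basis.
End GradedOps.

End ToricJacobian.

(** * Fourier-Motzkin elimination and facet inequalities *)

Module FourierMotzkin.
From mathcomp Require Import all_boot all_order all_algebra falgebra fieldext.
From mathcomp Require Import finmap.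
From mathcomp Require Import all_classical all_reals all_analysis.
From mathcomp Require Import ring lra zify.
Import Defs.
Import Order.TTheory GRing.Theory Num.Theory.
Local Open Scope classical_set_scope.
Local Open Scope ring_scope.

Section FourierMotzkin.
Variable R : realType.
Implicit Types (L : seq (nat -> R)) (z t : nat -> R).

Definition lform M (c z : nat -> R) : R := \sum_(i < M) c i * z i.
Definition sat M L z : Prop := forall c, c \in L -> 0 <= lform M c z.
Definition integral_forms L : Prop := forall c, c \in L -> forall i, c i \is a Num.int.

Lemma between_seqs (lo up : seq R) :
  (forall l u, l \in lo -> u \in up -> l <= u) ->
  exists t : R, (forall l, l \in lo -> l <= t) /\ (forall u, u \in up -> t <= u).
Proof.
have bnd (s : seq R) : exists t : R, forall l, l \in s -> t <= l.
  elim: s => [|x s [t Ht]]; first by exists 0.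
  exists (Num.min x t) => l; rewrite inE => /predU1P[->|/Ht]; rewrite ge_min ?lexx //.
  by move=> ->; rewrite orbT.
elim: lo => [_|x lo IH H]; first by have [t Ht] := bnd up; exists t.
have [l u ls us|t [lot upt]] := IH; first by apply: H => //; rewrite inE ls orbT.
exists (Num.max x t); split=> [l|u us].
  by rewrite inE le_max => /predU1P[->|/lot->]; rewrite ?lexx ?orbT.
by rewrite ge_max upt // H // mem_head.
Qed.

(** Each lower bound on [t] is combined with each upper bound. The combination multiplies by the
    coefficients at [M] instead of dividing, so integral forms stay integral. *)
Lemma fm_step M L : exists L', (forall z,
    (exists t : R, forall c, c \in L -> 0 <= lform M c z + c M * t) <-> sat M L' z) /\
  (integral_forms L -> integral_forms L').
Proof.
pose pos := [seq c <- L | 0 < c M]; pose neg := [seq c <- L | c M < 0].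
pose zer := [seq c <- L | c M == 0].
pose cmb (c c' : nat -> R) : nat -> R := fun i => (- c' M) * c i + c M * c' i.
have cmbE c c' z : lform M (cmb c c') z = (- c' M) * lform M c z + c M * lform M c' z.
  by rewrite /lform !mulr_sumr -big_split; apply: eq_bigr => i _; rewrite /cmb /=; ring.
exists (zer ++ [seq cmb c c' | c <- pos, c' <- neg]); split; last first.
  move=> iL c; rewrite mem_cat mem_filter => /orP[/andP[_ /iL//]|].
  move=> /allpairsP[[c1 c2] /= []]; rewrite !mem_filter.
  move=> /andP[_ /iL i1] /andP[_ /iL i2] -> i.
  by rewrite /cmb rpredD ?rpredM ?rpredN.
move=> z; split=> [[t Ht] c|Hs].
  rewrite mem_cat mem_filter => /orP[/andP[/eqP c0 /Ht]|]; first by rewrite c0; lra.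
  move=> /allpairsP[[c1 c2] /= []]; rewrite !mem_filter.
  move=> /andP[p1 /Ht H1] /andP[n2 /Ht H2] ->; rewrite cmbE.
  have -> : - c2 M * lform M c1 z + c1 M * lform M c2 z =
    - c2 M * (lform M c1 z + c1 M * t) + c1 M * (lform M c2 z + c2 M * t) by ring.
  by rewrite addr_ge0 // mulr_ge0 //; lra.
have [|t [lot upt]] := @between_seqs [seq - lform M c z / c M | c <- pos]
    [seq lform M c z / - c M | c <- neg].
  move=> l u /mapP[c1]; rewrite mem_filter => /andP[p1 L1] -> /mapP[c2].
  rewrite mem_filter => /andP[n2 L2] ->.
  rewrite ler_pdivlMr ?oppr_gt0 // mulrAC ler_pdivrMr // -subr_ge0.
  have /Hs : cmb c1 c2 \in zer ++ [seq cmb c c' | c <- pos, c' <- neg].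
    rewrite mem_cat; apply/orP; right; apply/allpairsP; exists (c1, c2).
    by rewrite /= !mem_filter p1 n2 L1 L2.
  by rewrite cmbE; lra.
exists t => c cL; have [cn|cp|c0] := ltrgtP (c M) 0.
- have /upt : lform M c z / - c M \in [seq lform M c z / - c M | c <- neg].
    by apply/mapP; exists c => //; rewrite mem_filter cn.
  by rewrite ler_pdivlMr ?oppr_gt0 //; lra.
- have /lot : - lform M c z / c M \in [seq - lform M c z / c M | c <- pos].
    by apply/mapP; exists c => //; rewrite mem_filter cp.
  by rewrite ler_pdivrMr //; lra.
- have /Hs : c \in zer ++ [seq cmb c c' | c <- pos, c' <- neg].
    by rewrite mem_cat mem_filter c0 eqxx cL.
  by rewrite c0; lra.
Qed.

Lemma fm_elim m M L : exists L', (forall z,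
    (exists2 t, (forall i, (i < M)%N -> t i = z i) & sat (M + m) L t) <-> sat M L' z) /\
  (integral_forms L -> integral_forms L').
Proof.
have ext M' (c t t' : nat -> R) : (forall i, (i < M')%N -> t i = t' i) ->
    lform M' c t = lform M' c t'.
  by move=> E; apply: eq_bigr => i _; rewrite E.
elim: m L => [|m IH] L.
  exists L; split=> // z; rewrite addn0; split=> [[t Et Ht] c /Ht|Hz].
    by rewrite (ext _ _ _ _ Et).
  by exists z.
have [L1 [H1 i1]] := fm_step (M + m) L; have [L2 [H2 i2]] := IH L1.
exists L2; split=> [z|/i1/i2//]; rewrite -H2; split=> -[t Et Ht].
  exists t => //; apply/H1; exists (t (M + m)%N) => c /Ht.
  by rewrite addnS /lform big_ord_recr.
have /H1[x Hx] := Ht.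
exists (fun i => if i == (M + m)%N then x else t i) => [i lt|c /Hx H].
  by rewrite ifN ?Et //; lia.
rewrite addnS /lform big_ord_recr /= eqxx.
rewrite [X in 0 <= X + _](_ : _ = lform (M + m) c t) //; apply: eq_bigr => i _.
by rewrite ifN // neq_ltn ltn_ord.
Qed.

End FourierMotzkin.

Section HullInequalities.
Variables (R : realType) (n : nat).
Implicit Types (y u v : 'rV[R]_n) (c : R).

Lemma dotDr u x y : dot u (x + y) = dot u x + dot u y.
Proof. by rewrite /dot -big_split; apply: eq_bigr => i _; rewrite mxE mulrDr. Qed.

Lemma dotZr u c y : dot u (c *: y) = c * dot u y.
Proof. by rewrite /dot mulr_sumr; apply: eq_bigr => i _; rewrite mxE mulrCA. Qed.

Lemma dot0r u : dot u 0 = 0.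
Proof. by rewrite /dot big1 // => i _; rewrite mxE mulr0. Qed.

Lemma dotNr u y : dot u (- y) = - dot u y.
Proof. by rewrite -scaleN1r dotZr mulN1r. Qed.

Lemma dotDl u v y : dot (u + v) y = dot u y + dot v y.
Proof. by rewrite /dot -big_split; apply: eq_bigr => i _; rewrite mxE mulrDl. Qed.

Lemma dotZl c u y : dot (c *: u) y = c * dot u y.
Proof. by rewrite /dot mulr_sumr; apply: eq_bigr => i _; rewrite mxE mulrA. Qed.

Lemma dot_suml (I : Type) (r : seq I) (P : pred I) (F : I -> 'rV[R]_n) y :
  dot (\sum_(i <- r | P i) F i) y = \sum_(i <- r | P i) dot (F i) y.
Proof.
apply: (big_morph (fun u => dot u y)) => [u v|]; first exact: dotDl.
by rewrite /dot big1 // => i _; rewrite mxE mul0r.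
Qed.

(** Membership in the dilate by [c] of the hull of 0 and the [vs], the mass of the point 0 being
    left implicit in the inequality. *)
Definition posspan m (vs : 'I_m -> 'rV[R]_n) y c : Prop :=
  exists lam : 'I_m -> R, [/\ forall j, 0 <= lam j, y = \sum_j lam j *: vs j
    & \sum_j lam j <= c].

Lemma posspanD m (vs : 'I_m -> _) y y' c c' :
  posspan vs y c -> posspan vs y' c' -> posspan vs (y + y') (c + c').
Proof.
move=> [l [l0 -> lc]] [l' [l0' -> lc']]; exists (fun j => l j + l' j); split.
- by move=> j; rewrite addr_ge0.
- by rewrite -big_split; apply: eq_bigr => j _; rewrite scalerDl.
- by rewrite big_split lerD.
Qed.

Lemma posspanZ m (vs : 'I_m -> _) y c t : 0 <= t ->
  posspan vs y c -> posspan vs (t *: y) (t * c).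
Proof.
move=> t0 [l [l0 -> lc]]; exists (fun j => t * l j); split.
- by move=> j; rewrite mulr_ge0.
- by rewrite scaler_sumr; apply: eq_bigr => j _; rewrite scalerA.
- by rewrite -mulr_sumr ler_wpM2l.
Qed.

Lemma posspan0 m (vs : 'I_m -> _) c : 0 <= c -> posspan vs 0 c.
Proof.
move=> c0; exists (fun _ => 0); split=> //; last by rewrite big1.
by rewrite big1 // => j _; rewrite scale0r.
Qed.

Lemma posspan_vertex m (vs : 'I_m -> _) j : posspan vs (vs j) 1.
Proof.
exists (fun i => (i == j)%:R); split.
- by move=> i; rewrite ler0n.
- rewrite (bigD1 j) //= eqxx scale1r big1 ?addr0 // => i /negPf ->.
  by rewrite scale0r.
- by rewrite (bigD1 j) //= eqxx big1 ?addr0 // => i /negPf ->.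
Qed.

Lemma dilate_hullP m (vs : 'I_m -> 'rV[R]_n) y c :
  (0 <= c /\ dilate c (convex_hull ([set 0] `|` range vs)) y) <-> posspan vs y c.
Proof.
split=> [[c0 [x [k [v [lam [Xv lam0 lam1 ->]]]] <-]]|[lam [lam0 -> lamc]]].
  rewrite -[X in posspan _ _ X]mulr1 -lam1; apply: posspanZ => //.
  elim/big_ind2: _ => [|a1 a2 b1 b2|i _]; first exact: posspan0.
    exact: posspanD.
  rewrite -[X in posspan _ _ X]mulr1; apply: posspanZ => //.
  have [->|[j _ <-]] := Xv i; first by apply: posspan0.
  exact: posspan_vertex.
have c0 : 0 <= c by apply: le_trans lamc; apply: sumr_ge0.
split=> //; have [cz|cn] := eqVneq c 0.
  have lz j : lam j = 0.
    apply/eqP; rewrite eq_le lam0 andbT; apply: le_trans (_ : \sum_j lam j <= _).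
      by rewrite (bigD1 j) //= lerDl sumr_ge0.
    by move: lamc; rewrite cz.
  exists 0; last by rewrite scaler0 big1 // => j _; rewrite lz scale0r.
  exists 1%N, (fun _ => 0), (fun _ => 1); split=> //.
  - by move=> _; left.
  - by rewrite big_ord1.
  - by rewrite big_ord1 scaler0.
exists (c^-1 *: \sum_j lam j *: vs j); last by rewrite scalerA divff ?scale1r.
(* The point 0, at index [ord0], absorbs the mass missing from 1. *)
exists m.+1, (fun i => if unlift ord0 i is Some j then vs j else 0),
  (fun i => if unlift ord0 i is Some j then c^-1 * lam j else 1 - c^-1 * \sum_j lam j).
have ci : 0 <= c^-1 by rewrite invr_ge0.
split=> [i|i||].
- by case: unliftP => [j|] _; [right; exists j | left].
- case: unliftP => [j|] _; first by rewrite mulr_ge0.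
  by rewrite subr_ge0 mulrC ler_pdivrMr ?mul1r // lt_neqAle eq_sym cn.
- rewrite big_ord_recl unlift_none [X in _ + X](_ : _ = c^-1 * \sum_j lam j) ?subrK //.
  by rewrite mulr_sumr; apply: eq_bigr => j _; rewrite liftK.
- rewrite big_ord_recl unlift_none scaler0 add0r scaler_sumr.
  by apply: eq_bigr => j _; rewrite liftK scalerA.
Qed.

(* Facet description of the epigraph of the weight function. *)
Lemma hull_inequalities m (vs : 'I_m -> 'rV[R]_n) :
  exists rows : seq ('rV[R]_n * R), (forall y c,
    (0 <= c /\ dilate c (convex_hull ([set 0] `|` range vs)) y) <->
    (forall r, r \in rows -> 0 <= dot r.1 y + r.2 * c)) /\
  ((forall j i, vs j ord0 i \is a Num.int) ->
   forall r, r \in rows -> (forall i, r.1 ord0 i \is a Num.int) /\ r.2 \is a Num.int).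
Proof.
(* The unknowns are [y] at indices below [n], [c] at [n], and the multipliers [lam j] at [n.+1 + j],
   which get eliminated. Each equation for [y] is a pair of opposite inequalities. *)
pose lamc (j : 'I_m) : nat -> R := fun i => (i == (n.+1 + j)%N)%:R.
pose sumc : nat -> R := fun i => if i == n then 1 else if (n < i)%N then -1 else 0.
(* For [k <= n] the difference [k - n.+1] truncates to 0, hence the guard [n < k]. *)
pose ent (i : 'I_n) (k : nat) : R :=
  if (k == i)%N then 1 else
  if (k - n.+1 < m)%N =P true is ReflectT H then
    (if (n < k)%N then - vs (Ordinal H) ord0 i else 0) else 0.
pose L := [seq lamc j | j : 'I_m] ++ [:: sumc] ++
  [seq ent i | i : 'I_n] ++ [seq (fun k => - ent i k) | i : 'I_n].
have [L' [HL iL]] := fm_elim m n.+1 L.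
exists [seq ((\row_(i < n) a (i : nat), a n) : 'rV[R]_n * R) | a : nat -> R <- L']; split; last first.
  move=> ivs r /mapP[c cL ->] /=; have {}iL : integral_forms L'.
    apply: iL => a; rewrite !mem_cat inE => /or4P[].
    - by move=> /mapP[j _ ->] i; rewrite /lamc rpred_nat.
    - move=> /eqP -> i; rewrite /sumc; case: ifP => _; first exact: rpred1.
      by case: ifP => _; rewrite ?rpredN ?rpred1 ?rpred0.
    - move=> /mapP[j _ ->] i; rewrite /ent; case: ifP => _; first exact: rpred1.
      case: eqP => H; last exact: rpred0.
      by case: ifP => _; rewrite ?rpredN ?rpred0.
    - move=> /mapP[j _ ->] i; rewrite rpredN /ent; case: ifP => _; first exact: rpred1.
      case: eqP => H; last exact: rpred0.
      by case: ifP => _; rewrite ?rpredN ?rpred0.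
  by split=> [i|]; rewrite ?mxE; apply: iL.
move=> y c; rewrite dilate_hullP.
pose z (i : nat) : R := if insub i is Some j then y ord0 j else if i == n then c else 0.
have zE : sat n.+1 L' z <-> forall r, r \in [seq ((\row_(i < n) a (i : nat), a n) : 'rV[R]_n * R) | a : nat -> R <- L'] ->
    0 <= dot r.1 y + r.2 * c.
  have E (a : nat -> R) : lform n.+1 a z = dot (\row_i a (i : nat)) y + a n * c.
    rewrite /lform big_ord_recr /= /z insubF ?ltnn // eqxx; congr (_ + _).
    by apply: eq_bigr => i _; rewrite mxE valK.
  split=> [H r /mapP[a aL ->] /=|H a aL]; first by rewrite -E; apply: H.
  by rewrite E; apply: (H (\row_i a i, a n)); apply/mapP; exists a.
rewrite -zE -HL.
have lamE j t : lform (n.+1 + m) (lamc j) t = t (n.+1 + j)%N.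
  rewrite /lform (bigD1 (rshift n.+1 j)) //= /lamc eqxx mul1r big1 ?addr0 // => i ni.
  case: eqP => [E|_]; last by rewrite mul0r.
  by case/eqP: ni; apply: val_inj.
have sumE t : lform (n.+1 + m) sumc t = t n - \sum_(j < m) t (n.+1 + j)%N.
  rewrite /lform big_split_ord /= big_ord_recr /= /sumc eqxx mul1r.
  rewrite big1 ?add0r => [|i _]; last first.
    have lti := ltn_ord i; rewrite ifN; last by lia.
    by rewrite ifN ?mul0r //; lia.
  congr (_ + _); rewrite -sumrN; apply: eq_bigr => j _.
  rewrite ifN; last by lia.
  by rewrite ifT ?mulN1r //; lia.
have entE i t : lform (n.+1 + m) (ent i) t = t i - \sum_(j < m) t (n.+1 + j)%N * vs j ord0 i.
  rewrite /lform big_split_ord /= (bigD1 (widen_ord (leqnSn n) i)) //= {1}/ent eqxx mul1r.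
  rewrite big1 ?addr0 => [|k nk]; last first.
    rewrite /ent ifN; last by apply: contra nk => /eqP E; apply/eqP/val_inj.
    by case: eqP => [H|_]; rewrite ?mul0r // ifN ?mul0r // -leqNgt -ltnS.
  congr (_ + _); rewrite -sumrN; apply: eq_bigr => j _.
  rewrite /ent ifN; last by apply/eqP; have := ltn_ord i; lia.
  case: eqP => [H|]; last by rewrite addKn ltn_ord.
  rewrite ifT; last by lia.
  have -> : Ordinal H = j by apply: val_inj; rewrite /= addKn.
  by rewrite mulNr mulrC.
split=> [[lam [lam0 Ey lamc']]|[t Et Ht]].
  pose t (i : nat) : R := if (i < n.+1)%N then z i else
    if insub (i - n.+1)%N is Some j then lam j else 0.
  have tl (j : 'I_m) : t (n.+1 + j)%N = lam j.
    by rewrite /t ifN ?addKn ?valK // -leqNgt leq_addr.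
  exists t => [i lti|a]; first by rewrite /t lti.
  have tn : t n = c by rewrite /t ltnSn /z insubF ?ltnn // eqxx.
  have ti (i : 'I_n) : t i = y ord0 i.
    by rewrite /t ifT ?/z ?valK // ltnS ltnW.
  have tz (i : 'I_n) : t i - \sum_(j < m) t (n.+1 + j)%N * vs j ord0 i = 0.
    rewrite ti Ey summxE; apply/eqP; rewrite subr_eq0; apply/eqP.
    by apply: eq_bigr => j _; rewrite mxE tl.
  rewrite !mem_cat inE => /or4P[/mapP[j _ ->]|/eqP ->|/mapP[i _ ->]|/mapP[i _ ->]].
  - by rewrite lamE tl.
  - by rewrite sumE tn subr_ge0 (eq_bigr lam).
  - by rewrite entE tz.
  - have -> : lform (n.+1 + m) (fun k => - ent i k) t = - lform (n.+1 + m) (ent i) t.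
      by rewrite /lform -sumrN; apply: eq_bigr => k _; rewrite mulNr.
    by rewrite entE tz oppr0.
exists (fun j => t (n.+1 + j)%N); split.
- move=> j; rewrite -lamE; apply: Ht; rewrite mem_cat; apply/orP; left.
  by apply/mapP; exists j; rewrite ?mem_enum.
- apply/rowP => i; rewrite summxE; apply/eqP; rewrite -subr_eq0.
  have -> : y ord0 i = t i by rewrite Et ?/z ?valK // ltnS ltnW.
  rewrite (eq_bigr (fun j : 'I_m => t (n.+1 + j)%N * vs j ord0 i)) => [|j _]; last by rewrite mxE.
  rewrite -entE eq_le; apply/andP; split.
    rewrite -oppr_ge0.
    have -> : - lform (n.+1 + m) (ent i) t = lform (n.+1 + m) (fun k => - ent i k) t.
      by rewrite /lform -sumrN; apply: eq_bigr => k _; rewrite mulNr.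
    apply: Ht; rewrite !mem_cat; apply/or4P; constructor 4.
    by apply/mapP; exists i; rewrite ?mem_enum.
  apply: Ht; rewrite !mem_cat; apply/or4P; constructor 3.
  by apply/mapP; exists i; rewrite ?mem_enum.
- have -> : c = t n by rewrite Et // /z insubF ?ltnn // eqxx.
  rewrite -subr_ge0 -sumE; apply: Ht; rewrite !mem_cat; apply/or4P; constructor 2.
  by rewrite inE.
Qed.

End HullInequalities.

End FourierMotzkin.

(** * Weights, faces and cofaciality for polytopes containing 0 *)

Module PolytopeWeight.
From mathcomp Require Import all_boot all_order all_algebra falgebra fieldext.
From mathcomp Require Import finmap.
From mathcomp Require Import all_classical all_reals all_analysis.
From mathcomp Require Import ring lra zify.
Import Defs FourierMotzkin.
Import Order.TTheory GRing.Theory Num.Theory.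
Local Open Scope classical_set_scope.
Local Open Scope ring_scope.

Section Weight.
Variables (R : realType) (n : nat).
Implicit Types (D X F : set 'rV[R]_n) (x y z u : 'rV[R]_n) (c : R) (mu nu : 'rV[int]_n).

(** The relation w(y) <= c in a form usable before the infimum defining [weight] is known to be
    attained. *)
Definition wle D y c : Prop := 0 <= c /\ dilate c D y.

Definition rows_of D (rows : seq ('rV[R]_n * R)) : Prop :=
  forall y c, wle D y c <-> forall r, r \in rows -> 0 <= dot r.1 y + r.2 * c.

Definition integral_rows (rows : seq ('rV[R]_n * R)) : Prop :=
  forall r, r \in rows -> (forall i, r.1 ord0 i \is a Num.int) /\ r.2 \is a Num.int.

(* The properties of [D = convex_hull ([set 0] `|` X)], [X] finite, that are used. *)
Record polytope D : Prop := Polytope {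
  polytope_rows : exists rows, rows_of D rows;
  polytope0 : D 0;
  polytope_bounded : exists b : R, forall y c, wle D y c -> forall i, `|y ord0 i| <= b * c }.

Lemma finite_range X : finite_set X -> exists m (vs : 'I_m -> 'rV[R]_n), X = range vs.
Proof.
move=> /finite_seqP[s ->]; exists (size s), (fun j => nth 0 s j).
apply/seteqP; split=> x /=.
  by move=> /(nthP 0)[j lt <-]; exists (Ordinal lt).
by move=> [j _ <-]; apply: mem_nth.
Qed.

Lemma hull_polytope X : finite_set X -> polytope (convex_hull ([set 0] `|` X)).
Proof.
move=> /finite_range[m [vs ->]]; split.
- by have [rows [H _]] := hull_inequalities vs; exists rows.
- exists 1%N, (fun _ => 0), (fun _ => 1); split=> //.
  + by move=> _; left.
  + by rewrite big_ord1.
  + by rewrite big_ord1 scaler0.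
- pose b := \sum_j \sum_i `|vs j ord0 i|; exists b => y c.
  move=> /dilate_hullP[lam [lam0 -> lamc]] i.
  have b0 : 0 <= b by rewrite sumr_ge0 // => j _; rewrite sumr_ge0.
  rewrite summxE; apply: le_trans (ler_norm_sum _ _ _) _.
  apply: le_trans (_ : \sum_j lam j * b <= _); last first.
    by rewrite -mulr_suml mulrC ler_wpM2l.
  apply: ler_sum => j _; rewrite mxE normrM ger0_norm // ler_wpM2l //.
  rewrite /b (bigD1 j) //= (bigD1 i) //= -addrA lerDl addr_ge0 //.
    by rewrite sumr_ge0.
  by rewrite sumr_ge0 // => k _; rewrite sumr_ge0.
Qed.

Lemma hull_integral_rows X : finite_set X ->
  (forall x, X x -> forall i, x ord0 i \is a Num.int) ->
  exists rows, rows_of (convex_hull ([set 0] `|` X)) rows /\ integral_rows rows.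
Proof.
move=> /finite_range[m [vs ->]] iX.
have [rows [H iH]] := hull_inequalities vs; exists rows; split=> //.
by apply: iH => j i; apply: iX; exists j.
Qed.

Variable D : set 'rV[R]_n.
Hypothesis hD : polytope D.

Lemma wle0 c : 0 <= c -> wle D 0 c.
Proof.
by move=> c0; split=> //; exists 0; rewrite ?scaler0 //; apply: polytope0.
Qed.

Lemma wleD y y' c c' : wle D y c -> wle D y' c' -> wle D (y + y') (c + c').
Proof.
have [rows H] := polytope_rows hD; rewrite !H => h h' r rs.
by rewrite dotDr; have := h r rs; have := h' r rs; lra.
Qed.

Lemma wleZ y c t : 0 <= t -> wle D y c -> wle D (t *: y) (t * c).
Proof.
have [rows H] := polytope_rows hD; rewrite !H => t0 h r rs.
by rewrite dotZr mulrCA -mulrDr mulr_ge0 // h.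
Qed.

Lemma wle_mono y c c' : c <= c' -> wle D y c -> wle D y c'.
Proof.
move=> cc' h; rewrite -[y]addr0 -[c'](subrK c) addrC; apply: wleD => //.
by apply: wle0; rewrite subr_ge0.
Qed.

Lemma wle_cone y c : wle D y c -> cone D y.
Proof. by move=> [c0 h]; exists c. Qed.

Lemma coneP y : cone D y <-> exists c, wle D y c.
Proof. by split=> [[c c0 h]|[c []]]; exists c. Qed.

Lemma D_wle x : D x <-> wle D x 1.
Proof.
split=> [Dx|[_ [x' Dx' <-]]]; last by rewrite scale1r.
by split=> //; exists x; rewrite ?scale1r.
Qed.

(** The infimum is attained because [rows] are closed conditions on [c]: an inequality violated at
    the infimum would be violated at some admissible [c], close to it or equal to [c1] according to
    the sign of [r.2]. *)
Lemma weightP y : cone D y -> forall c, wle D y c <-> weight D y <= c.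
Proof.
move=> /coneP[c1 h1] c.
have lb : has_inf [set c | 0 <= c /\ dilate c D y].
  by split; [exists c1 | exists 0 => t []].
split=> [h|le]; first by apply: ge_inf => //; have [] := lb.
apply: (@wle_mono _ (weight D y)) => //.
have [rows H] := polytope_rows hD; apply/H => r rs.
rewrite leNgt; apply/negP => neg.
have [b0|b0] := ltP 0 r.2.
  have e0 : 0 < - (dot r.1 y + r.2 * weight D y) / r.2 by rewrite divr_gt0 // oppr_gt0.
  have [t ht lt] := inf_adherent e0 lb.
  have := (H y t).1 ht r rs.
  have : r.2 * t < r.2 * (weight D y + - (dot r.1 y + r.2 * weight D y) / r.2).
    by rewrite ltr_pM2l.
  rewrite mulrDr [X in _ + X]mulrC -mulrA mulVf ?gt_eqF // mulr1; lra.
have := (H y c1).1 h1 r rs.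
have le1 : weight D y <= c1 by apply: ge_inf => //; have [] := lb.
by have := ler_wnM2l b0 le1; lra.
Qed.

Lemma wle_weight y : cone D y -> wle D y (weight D y).
Proof. by move=> cy; apply/(weightP cy). Qed.

Lemma weight_ge0 y : cone D y -> 0 <= weight D y.
Proof. by move=> /wle_weight[]. Qed.

Lemma coneD y y' : cone D y -> cone D y' -> cone D (y + y').
Proof. by move=> /wle_weight h /wle_weight h'; apply: wle_cone (wleD h h'). Qed.

Lemma cone0 : cone D 0.
Proof. exact: wle_cone (wle0 (lexx 0)). Qed.

Lemma weightD y y' : cone D y -> cone D y' ->
  weight D (y + y') <= weight D y + weight D y'.
Proof.
by move=> cy cy'; apply/(weightP (coneD cy cy')); apply: wleD; apply: wle_weight.
Qed.

Lemma weight0 : weight D 0 = 0.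
Proof.
apply/eqP; rewrite eq_le weight_ge0; last exact: cone0.
by rewrite andbT; apply/(weightP cone0); apply: wle0.
Qed.

Lemma weight_eq0 y : cone D y -> weight D y = 0 -> y = 0.
Proof.
move=> /wle_weight h E; rewrite E in h; have [b hb] := polytope_bounded hD.
apply/rowP => i; apply/eqP; rewrite mxE -normr_le0.
by have := hb _ _ h i; rewrite mulr0.
Qed.

(** If all inequalities with a positive coefficient of [c] were strict at the weight, [c] could be
    lowered by a small [e]. *)
Lemma tight_row rows y : rows_of D rows -> cone D y -> 0 < weight D y ->
  exists r, [/\ r \in rows, 0 < r.2 & dot r.1 y + r.2 * weight D y = 0].
Proof.
move=> H cy w0; set w := weight D y.
apply: contrapT => nex.
have pos r : r \in rows -> 0 < r.2 -> 0 < dot r.1 y + r.2 * w.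
  move=> rs rb; rewrite lt_neqAle eq_sym.
  have := (H y w).1 (wle_weight cy) r rs => ->; rewrite andbT.
  by apply/eqP => E; apply: nex; exists r.
have [e [e0 ew he]] : exists e, [/\ 0 < e, e <= w &
    forall r, r \in rows -> 0 < r.2 -> 0 <= dot r.1 y + r.2 * (w - e)].
  elim: (rows) pos => [|r rs IH] pos; first by exists w; rewrite lexx w0.
  have [r' r's|e [e0 ew he]] := IH; first by apply: pos; rewrite inE r's orbT.
  have [rb|rb] := ltP 0 r.2; last first.
    exists e; split=> // r'; rewrite inE => /predU1P[->|]; last exact: he.
    by rewrite ltNge rb.
  pose e' := (dot r.1 y + r.2 * w) / r.2.
  have e'0 : 0 < e' by rewrite divr_gt0 // pos // mem_head.
  exists (Num.min e e'); split.
  - by rewrite lt_min e0.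
  - by rewrite ge_min ew.
  - move=> r'; rewrite inE => /predU1P[-> _|r's rb'].
      have : Num.min e e' <= e' by rewrite ge_min lexx orbT.
      by rewrite /e' ler_pdivlMr //; lra.
    have := he r' r's rb'; have : Num.min e e' <= e by rewrite ge_min lexx.
    by move=> h; have := ler_wpM2l (ltW rb') h; lra.
have : wle D y (w - e).
  apply/H => r rs; have [rb|rb] := ltP 0 r.2; first exact: he.
  have := (H y w).1 (wle_weight cy) r rs.
  by have := ler_wnM2l rb (ltW e0); lra.
by move/(weightP cy); rewrite -/w; lra.
Qed.

(** A tight inequality divided by its coefficient of [c]. *)
Lemma facet y : cone D y -> 0 < weight D y ->
  exists u, (forall x c, wle D x c -> dot u x <= c) /\ dot u y = weight D y.
Proof.
move=> cy w0; have [rows H] := polytope_rows hD.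
have [r [rs rb Er]] := tight_row H cy w0; exists (- r.2^-1 *: r.1); split.
  move=> x c /H/(_ r rs) h; rewrite dotZl mulNr lerNl mulrC ler_pdivlMr //.
  by move: h; lra.
rewrite dotZl; have -> : dot r.1 y = - (r.2 * weight D y) by move: Er; lra.
by rewrite mulrNN mulKf ?gt_eqF.
Qed.

(* The smallest face of [D] meeting the ray through [z]. *)
Lemma minimal_face rows z : rows_of D rows -> cone D z -> 0 < weight D z ->
  exists F, [/\ face D F, ~ F 0 & forall x, F x <-> D x /\
    forall r, r \in rows -> dot r.1 z + r.2 * weight D z = 0 -> dot r.1 x + r.2 = 0].
Proof.
move=> H cz w0; set w := weight D z.
have b0 r : r \in rows -> 0 <= r.2.
  by move=> rs; have := (H 0 1).1 (wle0 ler01) r rs; rewrite dot0r add0r mulr1.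
pose tight := [pred r : 'rV[R]_n * R | dot r.1 z + r.2 * w == 0].
(* The sum of the inequalities tight at [z] is a single supporting inequality, with equality on [D]
   exactly where all of them are tight. *)
pose u := \sum_(r <- rows | tight r) - r.1.
pose c := \sum_(r <- rows | tight r) r.2.
have ux x : D x -> c - dot u x = \sum_(r <- rows | tight r) (dot r.1 x + r.2).
  move=> _; rewrite /u /c dot_suml -sumrB; apply: eq_bigr => r _.
  by rewrite -[- r.1]scaleN1r dotZl; lra.
have tx x r : D x -> r \in rows -> 0 <= dot r.1 x + r.2.
  by move=> /D_wle/H h rs; have := h r rs; rewrite mulr1.
have wn0 : w != 0 by rewrite gt_eqF.
have zD : D (w^-1 *: z).
  apply/D_wle; rewrite -(mulVf wn0); apply: wleZ; last exact: wle_weight.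
  by rewrite invr_ge0 ltW.
have sum0 x : D x -> (dot u x = c <->
    forall r, r \in rows -> dot r.1 z + r.2 * w = 0 -> dot r.1 x + r.2 = 0).
  move=> Dx; have -> : dot u x = c <-> \sum_(r <- rows | tight r) (dot r.1 x + r.2) == 0.
    by rewrite -ux // subr_eq0 eq_sym; split=> /eqP.
  rewrite big_seq_cond psumr_eq0; last by move=> r /andP[rs _]; apply: tx.
  split=> [/allP h r rs t|h].
    by apply/eqP; have := h r rs; rewrite rs /= t eqxx.
  by apply/allP => r rs; apply/implyP => /andP[_ /eqP t]; apply/eqP; apply: h.
exists (D `&` [set x | dot u x = c]); split.
- split.
    exists (w^-1 *: z); split=> //=; apply/sum0 => // r rs t.
    have : w * (w^-1 * dot r.1 z + r.2) = 0 by rewrite mulrDr mulVKf // [w * r.2]mulrC.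
    by rewrite dotZr => /eqP; rewrite mulf_eq0 (negPf wn0) => /eqP.
  exists u, c; split=> // x Dx; rewrite -subr_ge0 ux // big_seq_cond sumr_ge0 //.
  by move=> r /andP[rs _]; apply: tx.
- move=> [D00 /= /(sum0 _ D00) h]; have [r [rs rb Er]] := tight_row H cz w0.
  by have := h r rs Er; rewrite dot0r add0r; move: rb => /[swap] ->; rewrite ltxx.
- by move=> x; split=> [[Dx /(sum0 _ Dx)]|[Dx h]]; split=> //=; apply/sum0.
Qed.

(** [z] is relatively interior to the cone over its minimal face, so a large multiple of it
    dominates [x] in the inequalities not tight at [z]; in the tight ones both sides vanish. *)
Lemma minimal_face_slack rows z x : rows_of D rows -> cone D z -> D x ->
  (forall r, r \in rows -> dot r.1 z + r.2 * weight D z = 0 -> dot r.1 x + r.2 = 0) ->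
  exists K : nat, wle D (K%:R *: z - x) (K%:R * weight D z - 1).
Proof.
move=> H cz Dx tx; set w := weight D z.
suff [K hK] : exists K : nat, forall r, r \in rows ->
    dot r.1 x + r.2 <= K%:R * (dot r.1 z + r.2 * w).
  exists K; apply/H => r rs; have := hK r rs; rewrite dotDr dotZr dotNr; lra.
have pos r : r \in rows -> 0 <= dot r.1 z + r.2 * w.
  by move=> rs; have /H := wle_weight cz; apply.
elim: (rows) tx pos => [|r rs IH] tx pos; first by exists 0%N.
have [r' r's|r' r's|K hK] := IH; [by apply: tx; rewrite inE r's orbT
  | by apply: pos; rewrite inE r's orbT |].
have p0 := pos r (mem_head _ _).
have [t0|tn0] := eqVneq (dot r.1 z + r.2 * w) 0.
  exists K => r'; rewrite inE => /predU1P[->|/hK//].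
  by rewrite t0 mulr0 tx // mem_head.
pose K' := Num.truncn (`|(dot r.1 x + r.2) / (dot r.1 z + r.2 * w)|).
exists (maxn K K'.+1) => r'; rewrite inE => /predU1P[->|r's].
  have lt0 : 0 < dot r.1 z + r.2 * w by rewrite lt_neqAle eq_sym tn0.
  rewrite -ler_pdivrMr //; apply: le_trans (ler_norm _) _.
  have := truncnS_gt `|(dot r.1 x + r.2) / (dot r.1 z + r.2 * w)|.
  move/ltW => h; apply: le_trans h _; rewrite ler_nat leq_max leqnn orbT //.
apply: le_trans (hK r' r's) _; apply: ler_wpM2r.
  by apply: pos; rewrite inE r's orbT.
by rewrite ler_nat leq_max leqnn.
Qed.

Lemma latD mu nu : lat R (mu + nu) = lat R mu + lat R nu.
Proof. by apply/rowP => i; rewrite !mxE intrD. Qed.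

Lemma lat0 : lat R (0 : 'rV[int]_n) = 0.
Proof. by apply/rowP => i; rewrite !mxE. Qed.

Lemma latMn mu k : lat R (mu *+ k) = k%:R *: lat R mu.
Proof.
elim: k => [|k IH]; first by rewrite mulr0n lat0 scale0r.
by rewrite mulrS latD IH -natr1 scalerDl scale1r addrC.
Qed.

Lemma lattice_coneD mu nu :
  lattice_cone D mu -> lattice_cone D nu -> lattice_cone D (mu + nu).
Proof. by rewrite /lattice_cone /= latD; apply: coneD. Qed.

Lemma lattice_cone0 : lattice_cone D 0.
Proof. by rewrite /lattice_cone /= lat0; apply: cone0. Qed.

Lemma lweightD mu nu : lattice_cone D mu -> lattice_cone D nu ->
  lweight D (mu + nu) <= lweight D mu + lweight D nu.
Proof. by move=> cm cn; rewrite /lweight latD weightD. Qed.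

Lemma lweight0 : lweight D 0 = 0.
Proof. by rewrite /lweight lat0 weight0. Qed.

Lemma lweight_ge0 mu : lattice_cone D mu -> 0 <= lweight D mu.
Proof. exact: weight_ge0. Qed.

(** Since 0 is in [D], a face not through 0 has a positive level [c]; its equation divided by [c]
    computes the weight on the cone over the face. *)
Lemma face_cone F : face D F -> ~ F 0 -> exists u,
  (forall x, cone D x -> dot u x <= weight D x) /\
  (forall y, cone F y -> cone D y /\ weight D y = dot u y).
Proof.
move=> [_ [u [c [le_u EF]]]] nF0.
have c0 : 0 < c.
  have := le_u _ (polytope0 hD); rewrite dot0r lt_neqAle => ->; rewrite andbT.
  apply/eqP => E; apply: nF0; rewrite EF; split; first exact: polytope0.
  by rewrite /= dot0r.
have le_w x t : wle D x t -> dot (c^-1 *: u) x <= t.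
  move=> [t0 [x' Dx' <-]]; rewrite dotZl dotZr mulrCA ler_piMr //.
  by rewrite mulrC ler_pdivrMr // mul1r le_u.
exists (c^-1 *: u); split=> [x /wle_weight/le_w//|y [t t0 [x Fx Ey]]].
move: Fx; rewrite EF => -[Dx /= ux].
have wy : wle D y t by split=> //; exists x.
have cy := wle_cone wy; split=> //; apply/eqP; rewrite eq_le (le_w _ _ (wle_weight cy)) andbT.
rewrite -Ey dotZl dotZr ux mulrCA mulVf ?gt_eqF // mulr1 Ey.
exact: (weightP cy t).1.
Qed.

Lemma cofacial_additive mu nu : cofacial D mu nu ->
  [/\ lattice_cone D mu, lattice_cone D nu &
      lweight D (mu + nu) = lweight D mu + lweight D nu].
Proof.
move=> [F [fF nF0 cm cn]]; have [u [le_u eq_u]] := face_cone fF nF0.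
have [dm Em] := eq_u _ cm; have [dn En] := eq_u _ cn; split=> //.
apply/eqP; rewrite eq_le lweightD //= /lweight Em En latD -dotDr.
by apply: le_u; apply: coneD.
Qed.

(** A linear function touching the weight at [mu + nu] touches it at both summands, and the face it
    supports carries both rays. Positivity of the weight of [mu] makes this face nonempty; a zero
    [nu] lies in the cone over it anyway. *)
Lemma additive_cofacial mu nu : lattice_cone D mu -> lattice_cone D nu ->
  0 < lweight D mu -> lweight D (mu + nu) = lweight D mu + lweight D nu ->
  cofacial D mu nu.
Proof.
move=> cm cn w0 Ew; have cmn := lattice_coneD cm cn.
have wmn0 : 0 < lweight D (mu + nu) by rewrite Ew ltr_pwDl // lweight_ge0.
have [u [le_u Eu]] := facet cmn wmn0.
have um := le_u _ _ (wle_weight cm); have un := le_u _ _ (wle_weight cn).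
rewrite latD dotDr in Eu; rewrite /lweight latD in Ew.
have Em : dot u (lat R mu) = weight D (lat R mu) by lra.
have En : dot u (lat R nu) = weight D (lat R nu) by lra.
have inF y : cone D y -> 0 < weight D y -> dot u y = weight D y ->
    (D `&` [set x | dot u x = 1]) ((weight D y)^-1 *: y).
  move=> cy w Ey; split; last by rewrite /= dotZr Ey mulVf ?gt_eqF.
  apply/D_wle; rewrite -(mulVf (x := weight D y)) ?gt_eqF //.
  by apply: wleZ; [rewrite invr_ge0 ltW | exact: wle_weight].
exists (D `&` [set x | dot u x = 1]); split.
- split; first by eexists; apply: inF cm w0 Em.
  by exists u, 1; split=> // x /D_wle/le_u.
- by move=> [_ /=]; rewrite dot0r => /eqP; rewrite eq_sym oner_eq0.
- exists (lweight D mu); first exact: ltW.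
  eexists; first exact: inF cm w0 Em.
  by rewrite scalerA divff ?gt_eqF // scale1r.
- have := weight_ge0 cn; rewrite le_eqVlt => /predU1P[E|w'].
    exists 0 => //; eexists; first exact: inF cm w0 Em.
    by rewrite scale0r (weight_eq0 cn).
  exists (lweight D nu); first exact: ltW.
  eexists; first exact: inF cn w' En.
  by rewrite scalerA divff ?gt_eqF // scale1r.
Qed.

Lemma finite_lattice_le c :
  finite_set [set mu | lattice_cone D mu /\ lweight D mu <= c].
Proof.
have [b hb] := polytope_bounded hD; pose N := Num.truncn `|b * c|.
pose f (g : {ffun 'I_n -> 'I_(N.*2.+1)}) : 'rV[int]_n := \row_i ((g i)%:Z - N%:Z).
apply: (@sub_finite_set _ _ (f @` setT)); last first.
  by apply: finite_image; apply: finite_finset.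
move=> mu [/= cm le]; have {le} h := (weightP cm c).2 le.
have bound i : (`|mu ord0 i| <= N)%N.
  have := hb _ _ h i; rewrite mxE => {}h.
  have : (`|mu ord0 i|%N)%:R <= `|b * c|.
    by rewrite natr_absz intr_norm; apply: le_trans h (ler_norm _).
  by rewrite /N truncn_ge_nat.
have lt i : (`|(mu ord0 i + N%:Z)%R|%N < N.*2.+1)%N by have := bound i; lia.
exists [ffun i => Ordinal (lt i)] => //; apply/rowP => i; rewrite mxE ffunE /=.
by change (mu 0 i) with (mu ord0 i); have := bound i; lia.
Qed.

End Weight.

End PolytopeWeight.

(** * Volume and lattice point asymptotics *)

Module LatticeVolume.
From mathcomp Require Import all_boot all_order all_algebra falgebra fieldext.
From mathcomp Require Import finmap.
From mathcomp Require Import all_classical all_reals all_analysis.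
From mathcomp Require Import measurable_realfun.
From mathcomp Require Import ring lra zify.
Import Defs FourierMotzkin PolytopeWeight.
Import Order.TTheory GRing.Theory Num.Theory.
Local Open Scope classical_set_scope.
Local Open Scope ring_scope.

Section Volume.
Variable R : realType.

Lemma volume_ge0 n (A : set 'rV[R]_n) : (0 <= volume A)%E.
Proof.
elim: n A => [|n IH] A /=; first by rewrite lee_fin indicE; case: (_ \in _).
by apply: integral_ge0 => x _; apply: IH.
Qed.

(* No measurability is needed: the integral of a nonnegative function is a supremum. *)
Lemma le_integralT (f g : R -> \bar R) : (forall x, 0 <= f x)%E -> (forall x, f x <= g x)%E ->
  (\int[@lebesgue_measure R]_x f x <= \int[@lebesgue_measure R]_x g x)%E.
Proof.
move=> f0 fg; have g0 x : (0 <= g x)%E by exact: le_trans (f0 x) (fg x).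
rewrite !ge0_integralTE //; apply: le_ereal_sup => _ [h /= hf <-].
by exists h => //= x; apply: le_trans (hf x) (fg x).
Qed.

Lemma volume_le n (A B : set 'rV[R]_n) : A `<=` B -> (volume A <= volume B)%E.
Proof.
elim: n A B => [|n IH] A B AB /=.
  by rewrite lee_fin !indicE ler_nat; case: (boolP (_ \in A)) => // /set_mem/AB/mem_set ->.
apply: le_integralT => x; first exact: volume_ge0.
by apply: IH => v /AB.
Qed.

(** A disjoint union of half-open cubes of side [1/N] with lower corners [nu/N], [nu] in [S]. *)
Definition cubes n (N : nat) (S : seq 'rV[int]_n) : set 'rV[R]_n :=
  [set x | (\row_i Num.floor (N%:R * x ord0 i)) \in S].

(** The slice at first coordinate [x] is the union of cubes over the tails of the points with head
    [floor(N x)], so the slice volumes form a step function. *)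
Lemma volume_cubes n (N : nat) (S : seq 'rV[int]_n) : (0 < N)%N -> uniq S ->
  volume (cubes N S) = ((size S)%:R / N%:R ^+ n)%:E.
Proof.
move=> N0; have NR : (0 : R) < N%:R by rewrite ltr0n.
elim: n S => [|n IH] S uS.
  rewrite /= expr0 divr1; congr EFin; rewrite indicE.
  have S1 (mu : 'rV[int]_0) : mu = 0 by apply/rowP => -[].
  case: S uS => [|a [|b S]] /=.
  - by move=> _; rewrite memNset // /cubes /= in_nil.
  - by move=> _; rewrite mem_set // /cubes /= inE (S1 a) (S1 (\row__ _)).
  - by rewrite inE negb_or (S1 a) (S1 b) eqxx.
pose hd (mu : 'rV[int]_n.+1) := mu ord0 ord0.
pose tl (mu : 'rV[int]_n.+1) : 'rV[int]_n := \row_i mu ord0 (lift ord0 i).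
pose St j := [seq tl mu | mu <- S & hd mu == j].
have uSt j : uniq (St j).
  rewrite map_inj_in_uniq ?filter_uniq // => mu nu.
  rewrite !mem_filter => /andP[/eqP h1 _] /andP[/eqP h2 _] /rowP Et.
  apply/rowP => i; case: (unliftP ord0 i) => [j' ->|->]; last by rewrite -/(hd mu) -/(hd nu) h1 h2.
  by have := Et j'; rewrite !mxE.
have shl (i : 'I_n) : lift ord0 i = rshift 1 i by exact: val_inj.
have sh0 : (ord0 : 'I_n.+1) = lshift n (ord0 : 'I_1) by exact: val_inj.
have slice x : volume [set v : 'rV[R]_n | cubes N S (row_mx (x%:M : 'rV[R]_1) v : 'rV[R]_(1 + n))] =
    ((size (St (Num.floor (N%:R * x))))%:R / N%:R ^+ n)%:E.
  rewrite -IH //; congr (volume _); apply/seteqP; split=> v; rewrite /cubes /=.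
    move=> vS; apply/mapP; exists (\row_i Num.floor
      (N%:R * (row_mx (x%:M : 'rV[R]_1) v : 'rV[R]_(1 + n)) ord0 i)).
      rewrite mem_filter; apply/andP; split; last exact: vS.
      by rewrite /hd mxE sh0 row_mxEl mxE mulr1n.
    by apply/rowP => i; rewrite /tl mxE [in RHS]mxE [in RHS]mxE shl row_mxEr.
  move=> /mapP[mu]; rewrite mem_filter => /andP[/eqP hm mS] Ev.
  rewrite (_ : \row_i _ = mu) //; apply/rowP => i; rewrite mxE.
  case: (unliftP ord0 i) => [j ->|->].
    have /rowP/(_ j) := Ev; rewrite mxE [in RHS]mxE => <-.
    by rewrite (shl j) (row_mxEr (x%:M : 'rV[R]_1) v).
  by rewrite [RHS]hm sh0 (row_mxEl (x%:M : 'rV[R]_1) v) mxE mulr1n.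
rewrite /=; under eq_integral do rewrite slice.
pose H := undup [seq hd mu | mu <- S].
pose I (j : int) : set R := `[j%:~R / N%:R, (j + 1)%:~R / N%:R[%classic.
have inI j x : (x \in I j) = (Num.floor (N%:R * x) == j).
  rewrite /I; apply/idP/eqP => [|<-].
    rewrite inE /= in_itv /= ler_pdivrMr // ltr_pdivlMr // => h.
    by apply: floor_def; rewrite mulrC.
  rewrite inE /= in_itv /= ler_pdivrMr // ltr_pdivlMr // [x * _]mulrC.
  exact: floor_itv.
pose cst j : R := (size (St j))%:R / N%:R ^+ n.
have step (x : R) : (cst (Num.floor (N%:R * x)))%:E =
    (\sum_(j <- H) (cst j)%:E * (\1_(I j) x : R)%:E)%E.
  set j0 := Num.floor _; have [j0H|nj0] := boolP (j0 \in H).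
    rewrite (bigD1_seq j0) ?undup_uniq //= indicE inI eqxx mule1 big1 ?adde0 // => j nj.
    by rewrite indicE inI eq_sym (negPf nj) mule0.
  have E1 : size (St j0) = 0%N.
    apply/eqP; rewrite size_map size_filter -leqn0 leqNgt -has_count; apply: contra nj0.
    by move=> /hasP[mu mS /eqP <-]; rewrite mem_undup; apply/mapP; exists mu.
  rewrite {1}/cst E1 mul0r big_seq big1 // => j jH; rewrite indicE inI.
  have [E0|_] := eqVneq (Num.floor (N%:R * x)) j; last by rewrite mule0.
  by case/negP: nj0; rewrite /j0 E0.
under eq_integral do rewrite -/(cst _) step.
rewrite ge0_integral_sum //; try by
  (move=> j; apply: emeasurable_funM; [exact: measurable_cst |
   first [apply/measurable_EFinP | apply: measurableT_comp; first exact: measurable_EFin | apply/EFin_measurable_fun]; apply: measurable_indic; apply: measurable_itv]).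
all: try by (move=> j x _; rewrite mule_ge0 // lee_fin /cst ?divr_ge0 ?exprn_ge0 ?ler0n).
have Ij j : (\int[@lebesgue_measure R]_x ((cst j)%:E * (\1_(I j) x : R)%:E) =
    ((size (St j))%:R / N%:R ^+ n.+1)%:E)%E.
  rewrite ge0_integralZl_EFin //; last 2 first.
  - by first [apply/measurable_EFinP | apply: measurableT_comp; first exact: measurable_EFin | apply/EFin_measurable_fun]; apply: measurable_indic; apply: measurable_itv.
  - by rewrite /cst divr_ge0 ?exprn_ge0.
  rewrite integral_indic ?setIT //; last exact: measurable_itv.
  have Em : @lebesgue_measure R (I j) = (N%:R^-1)%:E.
    rewrite /I lebesgue_measure_itv /= lte_fin ltr_pM2r ?invr_gt0 // ltr_int ltrDl ltr01.
    by rewrite -EFinB -mulrBl -intrB addrAC subrr add0r mul1r.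
  transitivity ((cst j)%:E * (N%:R^-1 : R)%:E)%E; first by congr (_ * _)%E; exact: Em.
  by rewrite -EFinM /cst exprSr invfM mulrA.
rewrite (eq_bigr _ (fun j _ => Ij j)) sumEFin; congr EFin; rewrite -mulr_suml; congr (_ / _).
rewrite -natr_sum; congr (_%:R); rewrite /St.
under eq_bigr do rewrite size_map size_filter.
under eq_bigr do rewrite -sum1_count.
rewrite (exchange_big_dep xpredT) //= -sum1_size; apply: eq_big_seq => mu mS.
rewrite sum1_count (eq_count (a2 := pred1 (hd mu))) => [|j]; last by rewrite /= eq_sym.
rewrite count_uniq_mem ?undup_uniq // mem_undup.
by rewrite (_ : (_ \in _) = true) //; apply/mapP; exists mu.
Qed.

Lemma binom_bounds n t : (t ^ n <= n`! * 'C(n + t, n) <= (t + n) ^ n)%N.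
Proof.
rewrite mulnC bin_ffact ffact_prod.
have cst (x : nat) : (x ^ n = \prod_(i < n) x)%N by rewrite prod_nat_const card_ord.
rewrite !cst; apply/andP; split; apply: leq_prod => i _; have := ltn_ord i; lia.
Qed.

Lemma le_linear_growth (a b C : R) (N0 : nat) :
  (forall N, (N0 <= N)%N -> a * N%:R <= b * N%:R + C) -> a <= b.
Proof.
move=> H; rewrite leNgt; apply/negP => ba.
have ab : 0 < a - b by rewrite subr_gt0.
pose N := (N0 + Num.bound (C / (a - b)))%N.
have := H N (leq_addr _ _).
have : C / (a - b) < N%:R.
  apply: le_lt_trans (ler_norm _) (lt_le_trans (archi_boundP (normr_ge0 _)) _).
  by rewrite ler_nat /N /Num.bound normr_id leq_addl.
rewrite ltr_pdivrMr // => h1 h2; nra.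
Qed.

Lemma exp1D_le (x : R) n : 0 <= x <= 1 -> (1 + x) ^+ n <= 1 + 3 ^+ n * x.
Proof.
move=> /andP[x0 x1]; elim: n => [|n IH]; first by rewrite !expr0; lra.
have t1 : 1 <= 3 ^+ n :> R by rewrite exprn_ege1 //; lra.
have x1p : 0 <= 1 + x by lra.
rewrite exprSr [3 ^+ n.+1]exprSr; have := ler_wpM2r x1p IH.
move=> /le_trans; apply.
move: t1; set T := 3 ^+ n => t1.
have h1 : x <= T * x by rewrite ler_peMl.
have h2 : T * (x * x) <= T * x by rewrite ler_wpM2l ?ler_piMl //; lra.
have -> : (1 + T * x) * (1 + x) = 1 + x + T * x + T * (x * x) by ring.
have -> : 1 + T * 3 * x = 1 + T * x + T * x + T * x by ring.
lra.
Qed.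

Lemma exp1B_ge (x : R) n : 0 <= x <= 1 -> 1 - n%:R * x <= (1 - x) ^+ n.
Proof.
move=> /andP[x0 x1]; elim: n => [|n IH]; first by rewrite mul0r subr0.
have x1p : 0 <= 1 - x by lra.
rewrite exprSr -[in n.+1%:R]addn1 natrD; have := ler_wpM2r x1p IH.
have : 0 <= n%:R :> R by exact: ler0n.
move: (n%:R) => k k0; set Z := (1 - x) ^+ n => h; nra.
Qed.

(** [D] is squeezed between unions of cubes. As 0 may lie on the boundary of the cone, corners of
    cubes meeting [N D] can leave it; they are shifted by [m0], around which a box lies in [c0 D].
    The shifts [c0] and [c] do not affect the limit. *)
Lemma volume_count n (D : set 'rV[R]_n) (hD : polytope D) (m0 : 'rV[int]_n) (c0 r c : nat) :
  (forall x : 'rV[R]_n, (forall i, `|x ord0 i| <= 1) -> wle D (lat R m0 + x) c0%:R) ->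
  (forall N : nat, exists S : seq 'rV[int]_n, [/\ uniq S,
      forall nu, nu \in S <-> wle D (lat R nu) N%:R, (size S <= r * 'C(n + N, n))%N
    & (c <= N)%N -> (r * 'C(n + (N - c), n) <= size S)%N]) ->
  (r%:R%:E = n`!%:R%:E * volume D)%E.
Proof.
move=> box hcount.
have frac (N : nat) (x : 'rV[R]_n) : exists y : 'rV[R]_n, (forall i, `|y ord0 i| <= 1) /\
    N%:R *: x = lat R (\row_i Num.floor (N%:R * x ord0 i)) + y.
  exists (N%:R *: x - lat R (\row_i Num.floor (N%:R * x ord0 i))); split; last by rewrite addrC subrK.
  move=> i; rewrite !mxE; have := floor_itv (N%:R * x ord0 i); rewrite intrD => /andP[h1 h2].
  by rewrite ger0_norm; lra.
have hup N : (0 < N)%N -> (volume D <= ((r * 'C(n + (N + c0), n))%:R / N%:R ^+ n)%:E)%E.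
  move=> N0; have [S [uS HS le _]] := hcount (N + c0)%N.
  pose S' := [seq mu - m0 | mu <- S].
  have uS' : uniq S' by rewrite map_inj_uniq //; apply: addIr.
  apply: (@le_trans _ _ (volume (cubes N S'))); last first.
    rewrite volume_cubes // lee_fin ler_pM2r ?invr_gt0 ?exprn_gt0 ?ltr0n //.
    by rewrite size_map ler_nat.
  apply: volume_le => x Dx; rewrite /cubes /=; have [y [y1 Ey]] := frac N x.
  set nu := \row_i _ in Ey *; apply/mapP; exists (nu + m0); last by rewrite addrK.
  apply/HS; rewrite latD natrD.
  have -> : lat R nu + lat R m0 = N%:R *: x + (lat R m0 + - y).
    by rewrite Ey; apply/rowP => i; rewrite !mxE; ring.
  apply: (wleD hD); last by apply: box => i; rewrite mxE normrN.
  rewrite -[X in wle D _ X]mulr1; apply: (wleZ hD); rewrite ?ler0n //.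
  exact/D_wle.
have hlo N : (0 < N)%N -> (c0 + c <= N)%N ->
    (((r * 'C(n + (N - c0 - c), n))%:R / N%:R ^+ n)%:E <= volume D)%E.
  move=> N0 leN; have [S [uS HS _ ge]] := hcount (N - c0)%N.
  pose S' := [seq mu + m0 | mu <- S].
  have uS' : uniq S' by rewrite map_inj_uniq //; apply: addIr.
  apply: (@le_trans _ _ (volume (cubes N S'))).
    rewrite volume_cubes // lee_fin ler_pM2r ?invr_gt0 ?exprn_gt0 ?ltr0n //.
    rewrite size_map ler_nat; apply: ge; lia.
  apply: volume_le => x; rewrite /cubes /= => /mapP[mu /HS wmu Emu].
  have [y [y1 Ey]] := frac N x; rewrite Emu latD in Ey.
  have [_ [z Dz Ez]] : wle D (N%:R *: x) N%:R.
    rewrite Ey -addrA (_ : N = N - c0 + c0)%N ?natrD; last by lia.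
    by apply: (wleD hD) => //; apply: box.
  suff -> : x = z by [].
  apply: (scalerI (a := N%:R)); last by rewrite Ez.
  by rewrite pnatr_eq0 -lt0n.
have fin : volume D \is a fin_num.
  rewrite ge0_fin_numE ?volume_ge0 //; apply: le_lt_trans (hup 1%N _) _ => //; exact: ltry.
rewrite -(fineK fin) -EFinM; congr EFin.
set V := fine _; set k := (c0 + n)%N; set k' := (c0 + c)%N.
have f0 : (0 : R) < n`!%:R by rewrite ltr0n fact_gt0.
(* After division by [N^(n-1)] each comparison is linear in [N] up to an error independent of [N],
   so the slopes compare. *)
apply/eqP; rewrite eq_le; apply/andP; split.
  apply: (@le_linear_growth _ _ (r%:R * (n%:R * k'%:R)) (k' + 1)) => N leN.
  have N0 : (0 < N)%N by lia.
  have NR : (0 : R) < N%:R by rewrite ltr0n.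
  have := hlo N N0 ltac:(lia); rewrite -(fineK fin) lee_fin -/V ler_pdivrMr ?exprn_gt0 //.
  move=> /(ler_wpM2l (ltW f0)); rewrite [V * _]mulrC => h1.
  have /andP[h2 _] := binom_bounds n (N - c0 - c).
  have {}h2 : r%:R * (N - k')%:R ^+ n <= n`!%:R * (r * 'C(n + (N - c0 - c), n))%:R :> R.
    by rewrite -natrX -!natrM ler_nat mulnCA leq_mul2l /k' subnDA h2 orbT.
  have h3 : (N - k')%:R = N%:R * (1 - k'%:R / N%:R) :> R.
    by rewrite natrB; [field; rewrite pnatr_eq0 -lt0n | lia].
  have kN : 0 <= (k'%:R / N%:R : R) <= 1.
    by rewrite divr_ge0 ?ler0n //= ler_pdivrMr // mul1r ler_nat; lia.
  have h4 := exp1B_ge n kN.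
  rewrite h3 exprMn in h2; have h5 := le_trans h2 h1.
  have Nn : (0 : R) < N%:R ^+ n by rewrite exprn_gt0.
  have h6 : r%:R * (1 - k'%:R / N%:R) ^+ n <= n`!%:R * V.
    by rewrite -(ler_pM2l Nn) [X in _ <= X]mulrCA [X in X <= _]mulrCA.
  have h7 : r%:R * (1 - n%:R * (k'%:R / N%:R)) <= n`!%:R * V.
    by apply: le_trans h6; rewrite ler_wpM2l ?ler0n.
  have := ler_wpM2r (ltW NR) h7.
  have -> : r%:R * (1 - n%:R * (k'%:R / N%:R)) * N%:R = r%:R * N%:R - r%:R * (n%:R * k'%:R) :> R.
    by field; rewrite pnatr_eq0 -lt0n.
  by rewrite lerBlDr.
apply: (@le_linear_growth _ _ (r%:R * (3 ^+ n * k%:R)) (k + 1)) => N leN.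
have N0 : (0 < N)%N by lia.
have NR : (0 : R) < N%:R by rewrite ltr0n.
have := hup N N0; rewrite -(fineK fin) lee_fin -/V ler_pdivlMr ?exprn_gt0 //.
move=> /(ler_wpM2l (ltW f0)); rewrite [V * _]mulrC => h1.
have /andP[_ h2] := binom_bounds n (N + c0).
have {}h2 : n`!%:R * (r * 'C(n + (N + c0), n))%:R <= r%:R * (N + k)%:R ^+ n :> R.
  rewrite -natrX -!natrM ler_nat (_ : N + k = N + c0 + n)%N; last by rewrite /k addnA.
  by rewrite mulnCA leq_mul2l h2 orbT.
have h3 : (N + k)%:R = N%:R * (1 + k%:R / N%:R) :> R.
  by rewrite natrD; field; rewrite pnatr_eq0 -lt0n.
have kN : 0 <= (k%:R / N%:R : R) <= 1.
  by rewrite divr_ge0 ?ler0n //= ler_pdivrMr // mul1r ler_nat; lia.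
have h4 := exp1D_le n kN.
rewrite h3 exprMn in h2; have h5 := le_trans h1 h2.
have Nn : (0 : R) < N%:R ^+ n by rewrite exprn_gt0.
have h6 : n`!%:R * V <= r%:R * (1 + k%:R / N%:R) ^+ n.
  by rewrite -(ler_pM2l Nn) [X in _ <= X]mulrCA [X in X <= _]mulrCA.
have h7 : n`!%:R * V <= r%:R * (1 + 3 ^+ n * (k%:R / N%:R)).
  by apply: le_trans h6 _; rewrite ler_wpM2l ?ler0n.
have := ler_wpM2r (ltW NR) h7.
have -> : r%:R * (1 + 3 ^+ n * (k%:R / N%:R)) * N%:R = r%:R * N%:R + r%:R * (3 ^+ n * k%:R) :> R.
  by field; rewrite pnatr_eq0 -lt0n.
by [].
Qed.

End Volume.

End LatticeVolume.

(** * The Newton polytope and its Jacobian ring as an instance of the abstract setting *)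

Module NewtonPolytope.
From mathcomp Require Import all_boot all_order all_algebra falgebra fieldext.
From mathcomp Require Import finmap.
From mathcomp Require Import all_classical all_reals all_analysis.
From mathcomp Require Import ring lra zify all_field.
Import Defs FourierMotzkin PolytopeWeight LatticeVolume CartierFreeness GradedNullstellensatz KoszulComplex ConeCharacters ToricJacobian.
Import Order.TTheory GRing.Theory Num.Theory.
Local Open Scope classical_set_scope.
Local Open Scope ring_scope.

(** Rational points are dense in a real kernel defined over the rationals. The columns [Z] force
    zero coordinates of [x] to stay zero, a close approximation keeps the positive ones positive,
    and denominators are cleared. *)
Lemma rational_cone (R : realType) (k l : nat) (A : 'M[int]_(k, l)) (x : 'rV[R]_k) :
  (forall i, 0 <= x ord0 i) -> (forall j, \sum_i x ord0 i * (A i j)%:~R = 0) ->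
  exists c : 'I_k -> nat, (forall j, \sum_i (c i)%:Z * A i j = 0) /\
    forall i, 0 < x ord0 i -> c i != 0%N.
Proof.
move=> x0 xA.
pose A1 : 'M[rat]_(k, l) := map_mx intr A.
pose Z : 'M[rat]_k := \matrix_(i, j) ((i == j) && (x ord0 i == 0))%:R.
pose B := kermx (row_mx A1 Z).
have [y Ey] : exists y : 'rV[R]_k, x = y *m map_mx ratr B.
  have : (x <= kermx (map_mx (ratr : rat -> R) (row_mx A1 Z)))%MS.
    apply/sub_kermxP; rewrite map_row_mx mul_mx_row -row_mx0; congr row_mx.
      apply/rowP => j; rewrite !mxE -[RHS](xA j); apply: eq_bigr => i _.
      by rewrite !mxE ratr_int.
    apply/rowP => j; rewrite !mxE big1 // => i _; rewrite !mxE ratr_nat.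
    by case: eqP => [->|_] /=; [case: eqP => [->|]; rewrite ?mul0r ?mulr0 | rewrite mulr0].
  by rewrite -map_kermx => /submxP[y ->]; exists y.
(* [S] turns a precision on [y] into one on [x], and [T^-1] is a lower bound for the positive
   coordinates of [x]. *)
pose S : R := 1 + \sum_i \sum_j `|ratr (B i j) : R|.
have S0 : 0 < S.
  rewrite ltr_wpDr //; apply: sumr_ge0 => i _; apply: sumr_ge0 => j _; exact: normr_ge0.
pose T : R := 1 + \sum_(i | 0 < x ord0 i) (x ord0 i)^-1.
have T0 : 0 < T by rewrite ltr_wpDr //; apply: sumr_ge0 => i xi; rewrite invr_ge0 ltW.
have Tx i : 0 < x ord0 i -> T^-1 <= x ord0 i.
  move=> xi; rewrite -[x ord0 i]invrK lef_pV2 ?posrE ?invr_gt0 //.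
  rewrite /T (bigD1 i) //= addrCA lerDl addr_ge0 //; apply: sumr_ge0 => j /andP[xj _].
  by rewrite invr_ge0 ltW.
pose eps := (T * S)^-1; have eps0 : 0 < eps by rewrite invr_gt0 mulr_gt0.
have /choice[q Hq] : forall i, exists q : rat, `|y ord0 i - ratr q| < eps.
  move=> i; have [|q] := @rat_in_itvoo R (y ord0 i - eps) (y ord0 i + eps); first by lra.
  rewrite in_itv /= => /andP[h1 h2]; exists q; rewrite ltr_norml; apply/andP; split; lra.
pose z : 'rV[rat]_k := (\row_i q i) *m B.
have zx i : `|x ord0 i - ratr (z ord0 i)| < T^-1.
  rewrite Ey !mxE raddf_sum -sumrB /=; apply: (@le_lt_trans _ _ (\sum_j eps * `|ratr (B j i) : R|)).
    apply: le_trans (ler_norm_sum _ _ _) _; apply: ler_sum => j _.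
    by rewrite !mxE rmorphM /= -mulrBl normrM ler_wpM2r // ltW.
  rewrite -mulr_sumr /eps invfM -mulrA gtr_pMr ?invr_gt0 // mulrC ltr_pdivrMr // mul1r.
  rewrite /S ltr_pwDl //; apply: ler_sum => j _; rewrite (bigD1 i) //= lerDl.
  by apply: sumr_ge0 => *; exact: normr_ge0.
have zker : z *m row_mx A1 Z = 0 by apply/sub_kermxP; apply: submxMl.
have zA j : \sum_i z ord0 i * (A i j)%:~R = 0.
  have : (z *m A1) ord0 j = 0.
    by move: zker; rewrite mul_mx_row -row_mx0 => /eq_row_mx[-> _]; rewrite mxE.
  by rewrite mxE => E0; rewrite -[RHS]E0; apply: eq_bigr => i _; rewrite !mxE.
have zZ i : x ord0 i = 0 -> z ord0 i = 0.
  move=> xi; have : (z *m Z) ord0 i = 0.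
    by move: zker; rewrite mul_mx_row -row_mx0 => /eq_row_mx[_ ->]; rewrite mxE.
  rewrite mxE (bigD1 i) //= big1 ?addr0 => [|j nj]; first by rewrite [Z i i]mxE eqxx xi eqxx mulr1.
  by rewrite [Z j i]mxE (negPf nj) mulr0.
have zpos i : 0 < x ord0 i -> 0 < z ord0 i.
  move=> xi; rewrite -(ltr0q R); have := zx i; have := Tx i xi; rewrite ltr_norml => h /andP[h1 h2].
  lra.
have z0 i : 0 <= z ord0 i.
  have [xi|] := eqVneq (x ord0 i) 0; first by rewrite zZ.
  by move=> xi; apply/ltW/zpos; rewrite lt_neqAle eq_sym xi x0.
pose dn : int := \prod_i denq (z ord0 i).
have dn0 : 0 < dn by apply: prodr_gt0 => i _; exact: denq_gt0.
have /choice[c Hc] : forall i, exists c : nat, c%:R = z ord0 i * dn%:~R.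
  move=> i; exists (absz (numq (z ord0 i) * \prod_(j | j != i) denq (z ord0 j))).
  have ge : 0 <= numq (z ord0 i) * \prod_(j | j != i) denq (z ord0 j).
    by apply: mulr_ge0; [rewrite numq_ge0 | apply: prodr_ge0 => j _; apply: denq_ge0].
  rewrite natr_absz ger0_norm // /dn [in RHS](bigD1 i) //= !intrM mulrA.
  by rewrite numqE.
exists c; split=> [j|i xi].
  apply/eqP; rewrite -(eqr_int rat) raddf_sum /=; apply/eqP.
  transitivity ((\sum_i z ord0 i * (A i j)%:~R) * dn%:~R); last by rewrite zA mul0r.
  rewrite mulr_suml; apply: eq_bigr => i _; rewrite intrM -pmulrn Hc mulrAC; by [].
rewrite -(pnatr_eq0 rat) Hc; apply: lt0r_neq0; apply: mulr_gt0; first exact: zpos.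
by rewrite ltr0z.
Qed.

Lemma sum_trim (m : nat) (a : 'I_m -> nat) N : (N <= \sum_j a j)%N ->
  exists a' : 'I_m -> nat, (forall j, (a' j <= a j)%N) /\ (\sum_j a' j)%N = N.
Proof.
elim: m a N => [|m IH] a N; first by rewrite big_ord0 leqn0 => /eqP ->; exists a; rewrite big_ord0.
rewrite big_ord_recl => h.
have [|b [Hb Eb]] := IH (fun j => a (lift ord0 j)) (N - a ord0)%N; first by rewrite leq_subLR.
exists (fun j => if unlift ord0 j is Some i then b i else minn N (a ord0)); split=> [j|].
  by case: unliftP => [i ->|->] //; lia.
rewrite big_ord_recl unlift_none; under eq_bigr do rewrite liftK.
by rewrite Eb; lia.
Qed.

Section Newton.
Variables (R : realType) (Fq : finFieldType) (n : nat) (f : {fsfun 'rV[int]_n -> Fq with 0}).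
Local Notation D := (newton R f).
Hypothesis hdim : full_dimensional D.
Hypothesis hwt : forall mu, f mu != 0 -> lweight D mu = 1.
Variable d : nat.
Hypothesis hd : (0 < d)%N.
Hypothesis hdDelta : forall mu, lattice_cone D mu -> d%:R * lweight D mu \is a Num.nat.

Definition supp_seq : seq 'rV[int]_n := enum_fset (finsupp f).
Local Notation m := (size supp_seq).
Definition vtx (j : 'I_m) : 'rV[int]_n := nth 0 supp_seq j.

Lemma supp_seqE : supp_seq = [seq vtx j | j <- enum 'I_m].
Proof. by rewrite -[LHS](mkseq_nth 0) /mkseq -val_enum_ord -map_comp. Qed.

Lemma mem_supp mu : (mu \in supp_seq) = (f mu != 0).
Proof. by rewrite -mem_finsupp. Qed.

Lemma supp_uniq : uniq supp_seq. Proof. exact: fset_uniq. Qed.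

Lemma vtx_supp j : f (vtx j) != 0. Proof. by rewrite -mem_supp mem_nth. Qed.

Lemma vtx_surj mu : f mu != 0 -> exists j, vtx j = mu.
Proof.
rewrite -mem_supp => /[dup] ms; rewrite -index_mem => lt; exists (Ordinal lt).
by rewrite /vtx nth_index.
Qed.

Lemma newtonE : D = convex_hull ([set 0] `|` range (fun j => lat R (vtx j))).
Proof.
rewrite /newton; congr (convex_hull (_ `|` _)); apply/seteqP; split=> x /=.
  by move=> [mu /= /vtx_surj[j <-] <-]; exists j.
by move=> [j _ <-]; exists (vtx j) => //=; apply: vtx_supp.
Qed.

Lemma newton_polytope : polytope D.
Proof.
by rewrite newtonE; apply: hull_polytope; apply: finite_image; apply: finite_finset.
Qed.
Let hD := newton_polytope.

Lemma newton_posspan y c : wle D y c <-> posspan (fun j => lat R (vtx j)) y c.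
Proof. by rewrite /wle newtonE; apply: dilate_hullP. Qed.

Definition wd mu : nat := Num.truncn (d%:R * lweight D mu).

Let dR : (0 : R) < d%:R. Proof. by rewrite ltr0n. Qed.

Lemma wdE mu : lattice_cone D mu -> (wd mu)%:R = d%:R * lweight D mu :> R.
Proof. by move=> /hdDelta h; rewrite /wd truncnK. Qed.

Lemma wd0 : wd 0 = 0%N.
Proof. by rewrite /wd (lweight0 hD) mulr0 truncn0. Qed.

Lemma wdD mu nu : lattice_cone D mu -> lattice_cone D nu -> (wd (mu + nu) <= wd mu + wd nu)%N.
Proof.
move=> cm cn; rewrite -(ler_nat R) natrD !wdE //; last exact: (lattice_coneD hD).
by rewrite -mulrDr ler_pM2l //; apply: (lweightD hD).
Qed.

Lemma wleP mu (c : R) : wle D (lat R mu) c <-> lattice_cone D mu /\ (wd mu)%:R <= d%:R * c.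
Proof.
split=> [h|[cm]]; last by rewrite wdE // ler_pM2l // => /(weightP hD cm).
have cm : lattice_cone D mu by apply: (wle_cone h).
by split=> //; rewrite wdE // ler_pM2l //; apply/(weightP hD cm).
Qed.

Lemma vtxP j : lattice_cone D (vtx j) /\ wd (vtx j) = d.
Proof.
have /wleP[cv _] : wle D (lat R (vtx j)) 1.
  apply/newton_posspan; exists (fun i => (i == j)%:R); split=> [i| |]; first by case: eqP.
    rewrite (bigD1 j) //= eqxx scale1r big1 ?addr0 // => i /negPf ->; exact: scale0r.
  by rewrite (bigD1 j) //= eqxx big1 ?addr0 // => i /negPf ->.
split=> //; apply/eqP; rewrite -(eqr_nat R) wdE // hwt ?mulr1 //; exact: vtx_supp.
Qed.

Lemma suppM nu : nu \in supp_seq -> lattice_cone D nu /\ wd nu = d.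
Proof. by rewrite mem_supp => /vtx_surj[j <-]; apply: vtxP. Qed.

Lemma boundM : exists C : nat, forall mu, lattice_cone D mu -> forall i, (`|mu ord0 i| <= C * wd mu)%N.
Proof.
have [b Hb] := polytope_bounded hD; exists (Num.bound `|b|) => mu cm i.
have h := Hb _ _ (wle_weight hD cm) i; rewrite mxE in h.
have b1 : b <= (Num.bound `|b|)%:R.
  apply: le_trans (ler_norm _) (ltW _).
  by have := archi_boundP (normr_ge0 b); rewrite /Num.bound normr_id.
rewrite -(ler_nat R) natrM wdE // natr_absz intr_norm; apply: le_trans h _.
have w0 := weight_ge0 hD cm; have d1 : 1 <= d%:R :> R by rewrite ler1n.
rewrite -/(lweight D mu) in w0 *; apply: le_trans (ler_wpM2r w0 b1) _.
by rewrite ler_wpM2l ?ler0n // ler_peMl.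
Qed.

(** The exponents of [f] are lattice points, so the inequalities of the epigraph can be taken
    integral; the passage from the level [k/d] to [k] multiplies the first part of each row by
    [d]. *)
Lemma rowsM : exists rows : seq ('rV[int]_n * int), forall mu (k : int),
  (lattice_cone D mu /\ (wd mu)%:Z <= k) <->
  forall r, r \in rows -> 0 <= \sum_i r.1 ord0 i * mu ord0 i + r.2 * k.
Proof.
have [|x|rows [H iH]] := @hull_integral_rows R n (range (fun j => lat R (vtx j))).
- by apply: finite_image; apply: finite_finset.
- by move=> [j _ <-] i; rewrite mxE intr_int.
rewrite -newtonE in H.
exists (map (fun r : 'rV[R]_n * R =>
  (\row_i (d%:Z * Num.floor (r.1 ord0 i)), Num.floor r.2)) rows) => mu k.
have dn0 : d%:R != 0 :> R by rewrite gt_eqF.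
have -> : (lattice_cone D mu /\ (wd mu)%:Z <= k) <-> wle D (lat R mu) (k%:~R / d%:R).
  rewrite wleP mulrCA divff // mulr1 pmulrn ler_int; by [].
have rE r : r \in rows -> dot r.1 (lat R mu) + r.2 * (k%:~R / d%:R) =
    (\sum_i (d%:Z * Num.floor (r.1 ord0 i)) * mu ord0 i + Num.floor r.2 * k)%:~R / d%:R.
  move=> rs; have [i1 i2] := iH r rs.
  rewrite intrD mulrDl intrM floorK // mulrA; congr (_ + _).
  rewrite raddf_sum /= mulr_suml; apply: eq_bigr => i _; rewrite !intrM floorK // mxE -pmulrn.
  by field.
split=> [/H h r /mapP[r0 rs ->]|h] /=.
  have := h r0 rs; rewrite rE // pmulr_lge0 ?invr_gt0 // ler0z.
  by under [X in _ -> 0 <= X + _]eq_bigr do rewrite mxE.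
apply/H => r rs; rewrite rE // pmulr_lge0 ?invr_gt0 // ler0z.
have := h _ (map_f _ rs); rewrite /=.
by under [X in 0 <= X + _ -> _]eq_bigr do rewrite mxE.
Qed.

(** The affinely independent points given by [hdim] are combinations of the exponents of [f], which
    therefore have rank [n]. *)
Lemma basis_vertices : exists g : 'I_n -> 'I_m,
  (\matrix_i lat R (vtx (g i))) \in unitmx.
Proof.
pose V : 'M[R]_(m, n) := \matrix_j lat R (vtx j).
have full : row_full V.
  rewrite -col_leq_rank; have [w [Dw rk]] := hdim.
  apply: (@leq_trans (\rank (\matrix_(i < n) (w (lift ord0 i) - w ord0)))); first by rewrite rk.
  apply: mxrankS.
  have sub i : (w i <= V)%MS.
    have /D_wle/newton_posspan[lam [_ -> _]] := Dw i.
    apply: summx_sub => j _; apply: scalemx_sub.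
    by rewrite -[lat R (vtx j)](rowK (fun j => lat R (vtx j))) row_sub.
  by apply/row_subP => i; rewrite rowK addmx_sub ?eqmx_opp.
exists (fullrankfun full); have := fullrowsub_unit full.
congr (_ \in unitmx); by apply/matrixP => i j; rewrite !mxE.
Qed.

Lemma basis_vertices_free : exists bs : 'I_n -> 'rV[int]_n, (forall i, bs i \in supp_seq) /\
  forall c : 'I_n -> int, \sum_i c i *: bs i = 0 -> forall i, c i = 0.
Proof.
have [g ug] := basis_vertices; exists (fun i => vtx (g i)); split=> [i|c Ec].
  by rewrite mem_supp vtx_supp.
have E0 : (\row_i (c i)%:~R) *m (\matrix_i lat R (vtx (g i))) = 0.
  apply/rowP => j; rewrite !mxE.
  have := congr1 (fun z : 'rV[int]_n => (z ord0 j)%:~R : R) Ec; rewrite !summxE !mxE raddf_sum /=.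
  move=> E0; transitivity (\sum_(i < n) ((c i *: vtx (g i)) ord0 j)%:~R : R); last exact: E0.
  by apply: eq_bigr => i _; rewrite !mxE intrM.
move=> i; have /rowP/(_ i) : \row_i (c i)%:~R = 0 :> 'rV[R]_n.
  by rewrite -[LHS](mulmxK ug) E0 mul0mx.
by rewrite !mxE => /eqP; rewrite intr_eq0 => /eqP.
Qed.

(** [T] bounds the coordinates of a vector of the unit box in a basis of exponents of [f]; adding
    [T] times each basis vector makes them nonnegative and at most [2T]. *)
Lemma unit_box : exists (m0 : 'rV[int]_n) (c0 : nat),
  forall x : 'rV[R]_n, (forall i, `|x ord0 i| <= 1) -> wle D (lat R m0 + x) c0%:R.
Proof.
have [g ug] := basis_vertices; set U := \matrix_i _ in ug.
pose b : R := \sum_i \sum_j `|invmx U j i|; pose T := Num.bound `|b|.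
have bT : b <= T%:R.
  apply: le_trans (ler_norm _) (ltW _).
  by have := archi_boundP (normr_ge0 b); rewrite /T /Num.bound normr_id.
exists (\sum_i vtx (g i) *+ T), (n * T.*2)%N => x x1.
pose t := x *m invmx U.
have tT i : `|t ord0 i| <= T%:R.
  apply: le_trans bT; rewrite /b (bigD1 i) //= ler_wpDr //.
    by apply: sumr_ge0 => *; apply: sumr_ge0 => *; apply: normr_ge0.
  rewrite mxE; apply: le_trans (ler_norm_sum _ _ _) _; apply: ler_sum => j _.
  by rewrite normrM ler_piMl.
have -> : lat R (\sum_i vtx (g i) *+ T) + x = \sum_i (T%:R + t ord0 i) *: lat R (vtx (g i)).
  have {1}-> : x = t *m U by rewrite mulmxKV.
  rewrite (mulmx_sum_row t U) (big_morph (@lat R n) (@latD R n) (@lat0 R n)) -big_split.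
  by apply: eq_bigr => i _ /=; rewrite scalerDl latMn rowK.
have -> : (n * T.*2)%:R = \sum_(i < n) T.*2%:R :> R.
  by rewrite sumr_const card_ord natrM mulr_natl.
elim/big_rec2: _ => [|i c y _ IH]; first exact: (wle0 hD).
apply: (wleD hD) => //; have := tT i; rewrite ler_norml => /andP[h1 h2].
apply: (@wle_mono _ _ _ hD _ (T%:R + t ord0 i)); first by rewrite -addnn natrD; lra.
rewrite -[X in wle D _ X]mulr1; apply: (wleZ hD); first by lra.
by apply/wleP; rewrite mulr1; have [? ->] := vtxP (g i).
Qed.

Let M : 'rV[int]_n -> Prop := lattice_cone D.
Local Notation Fo E := (@Fo n M wd supp_seq E).
Local Notation Gr E := (@Gr n M E).
Local Notation Jset E := (@Jset n M wd supp_seq E).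

Let M0 : M 0. Proof. exact: (lattice_cone0 hD). Qed.
Let MD mu nu : M mu -> M nu -> M (mu + nu). Proof. exact: (lattice_coneD hD). Qed.

Lemma sum_app (T : Type) (V : zmodType) (I : Type) (r : seq I) (P : pred I) (F : I -> T -> V) x :
  (\sum_(i <- r | P i) F i) x = \sum_(i <- r | P i) F i x.
Proof.
elim: r => [|i r IH]; first by rewrite !big_nil.
by rewrite !big_cons; case: ifP => // _; rewrite -IH.
Qed.

Lemma adm_cofacial nu mu : nu \in supp_seq -> adm M wd nu mu <-> cofacial D nu (mu - nu).
Proof.
move=> ns; have [Mn wn] := suppM ns; have fn : f nu != 0 by rewrite -mem_supp.
have E1 : nu + (mu - nu) = mu by rewrite addrC subrK.
split=> [/asboolP[Mm Ew]|/(cofacial_additive hD)[_ cm]].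
  apply: (additive_cofacial hD) => //; first by rewrite hwt.
  apply: (mulfI (lt0r_neq0 dR)); rewrite E1 mulrDr -!wdE // -?natrD ?Ew //.
  by rewrite -E1; apply: MD.
rewrite E1 => Ew; apply/asboolP; split=> //; apply/eqP.
rewrite -(eqr_nat R) natrD !wdE // ?Ew ?mulrDr //.
by rewrite -E1; apply: MD.
Qed.

Lemma gr_mulE l h mu : gr_mul D (logderiv f l) h mu = Fo Fq f l h mu.
Proof.
rewrite /gr_mul fsbig_mkcond (@fsbigTE _ _ _ _ (finsupp f)) => [|nu nf]; last first.
  rewrite /patch; case: ifP => // _; rewrite /logderiv.
  by rewrite fsfun_dflt // mulr0 mul0r.
rewrite /ToricJacobian.Fo -/supp_seq; rewrite big_seq [RHS]big_seq; apply: eq_bigr => nu ns.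
rewrite /patch /Gx /logderiv.
have -> : (nu \in [set nu | cofacial D nu (mu - nu)]) = adm M wd nu mu.
  by apply/idP/idP => [/set_mem/(adm_cofacial mu ns)|/(adm_cofacial mu ns)/mem_set].
by case: ifP => // _; rewrite mulr0.
Qed.

Lemma gr_ringP g : gr_ring D g <-> Gr Fq g.
Proof.
split=> [[/finite_seqP[s Hs] g0]|[s Hs]].
  exists s => mu nz; split; last by apply: contrapT => /g0/eqP; apply/negP.
  by have : [set mu | g mu != 0] mu by []; rewrite Hs.
split=> [|mu nM]; last by apply/eqP/negPn/negP => /Hs[_].
by apply: (@sub_finite_set _ _ [set` s]); [move=> mu /Hs[]|apply/finite_seqP; exists s].
Qed.

Lemma jacobian_idealP g : jacobian_ideal R f g <-> Jset Fq f g.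
Proof.
split=> [[h [Gh ->]]|[h [Gh Eg]]].
  exists h; split=> [l|mu]; first exact/gr_ringP.
  by rewrite sum_app; apply: eq_bigr => l _; rewrite gr_mulE.
exists h; split=> [l|]; first exact/gr_ringP.
by apply: funext => mu; rewrite sum_app Eg; apply: eq_bigr => l _; rewrite gr_mulE.
Qed.

Section FaceCondition.
Variables (Fbar : closedFieldType) (iota : {rmorphism Fq -> Fbar}).
Hypothesis hnd : nondegenerate_laurent R iota f.

Lemma lat_sum (I : Type) (r : seq I) (P : pred I) (F : I -> 'rV[int]_n) :
  lat R (\sum_(i <- r | P i) F i) = \sum_(i <- r | P i) lat R (F i).
Proof. exact: (big_morph (@lat R n) (@latD R n) (@lat0 R n)). Qed.

Let dot_sum (u : 'rV[R]_n) (I : Type) (r : seq I) (P : pred I) (F : I -> 'rV[R]_n) :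
  dot u (\sum_(i <- r | P i) F i) = \sum_(i <- r | P i) dot u (F i).
Proof. exact: (big_morph (dot u) (dotDr u) (dot0r u)). Qed.

Lemma totP (a : 'I_m -> nat) : M (\sum_j vtx j *+ a j) /\
  (wd (\sum_j vtx j *+ a j) <= d * \sum_j a j)%N.
Proof.
have : wle D (lat R (\sum_j vtx j *+ a j)) (\sum_j a j)%:R.
  rewrite lat_sum natr_sum; elim/big_rec2: _ => [|j c y _ IH]; first exact: (wle0 hD).
  apply: (wleD hD) => //; rewrite latMn -[X in wle D _ X]mulr1; apply: (wleZ hD); first exact: ler0n.
  by apply/wleP; have [? ->] := vtxP j; rewrite mulr1.
by move=> /wleP[cm]; rewrite -natrM ler_nat.
Qed.

(** The slack of [z] over the exponent [j] is a real combination of exponents, made integral by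
    [rational_cone]. In [A] the extra column records the number of exponents and the extra row the
    multiple of [z]; [Es] shows that the bound on the sum of [lam] is attained. *)
Lemma vtx_slack (T : {set 'I_m}) j (K : nat) : T != finset.set0 ->
  wd (\sum_(j in T) vtx j) = (d * #|T|)%N ->
  wle D (K%:R *: lat R (\sum_(j in T) vtx j) - lat R (vtx j)) (K%:R * #|T|%:R - 1) ->
  exists K' (a : 'I_m -> nat), [/\ a j != 0%N,
    \sum_j vtx j *+ a j = (\sum_(j in T) vtx j) *+ K' & (\sum_j a j = #|T| * K')%N].
Proof.
move=> Tn0 wT hK; set z := \sum_(j in T) vtx j in wT hK *.
have Mz : M z.
  by apply: big_ind => [||i _]; [exact: M0 | exact: MD | have [] := vtxP i].
have /newton_posspan[lam [lam0 Elam slam]] := hK.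
have wz : lweight D z = #|T|%:R.
  by apply: (mulfI (lt0r_neq0 dR)); rewrite -wdE // wT natrM.
have K0 : (0 < K)%N.
  rewrite lt0n; apply/eqP => E0; have [h _] := hK; move: h; rewrite E0 mul0r; lra.
have KR : (0 : R) < K%:R by rewrite ltr0n.
clearbody z.
have Es : \sum_j lam j = K%:R * #|T|%:R - 1.
  apply/eqP; rewrite eq_le slam lerBlDr /= mulrC -ler_pdivlMr // -wz.
  apply/(weightP hD Mz); rewrite mulrC.
  have -> : lat R z = K%:R^-1 *: (K%:R *: lat R z - lat R (vtx j) + lat R (vtx j)).
    by rewrite subrK scalerA mulVf ?scale1r // gt_eqF.
  apply: (wleZ hD); first by rewrite invr_ge0 ltW.
  apply: (wleD hD); first by apply/newton_posspan; exists lam.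
  by apply/wleP; have [? ->] := vtxP j; rewrite mulr1.
pose A : 'M[int]_(m.+1, n.+1) := \matrix_(i, c)
  match unlift ord0 i, unlift ord0 c with
  | Some i', Some c' => vtx i' ord0 c' | Some _, None => 1
  | None, Some c' => - z ord0 c' | None, None => - (#|T|%:Z) end.
pose x : 'rV[R]_m.+1 := \row_i
  if unlift ord0 i is Some i' then lam i' + (i' == j)%:R else K%:R.
have [i|c|c [cA cpos]] := @rational_cone R _ _ A x.
- rewrite mxE; case: unliftP => [i' _|_]; last exact: ler0n.
  by rewrite addr_ge0 ?ler0n.
- rewrite big_ord_recl !mxE unlift_none.
  under eq_bigr do rewrite !mxE liftK.
  have sj (G : 'I_m -> R) : \sum_i (i == j)%:R * G i = G j.
    rewrite (bigD1 j) //= eqxx mul1r big1 ?addr0 // => i /negPf ->; exact: mul0r.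
  case: unliftP => [c' _|_].
    have /rowP/(_ c') := Elam; rewrite !mxE summxE => E1.
    under eq_bigr do rewrite mulrDl.
    rewrite big_split /= (sj (fun i => (vtx i ord0 c')%:~R)) mulrNz.
    have -> : \sum_i lam i * (vtx i ord0 c')%:~R = K%:R * (z ord0 c')%:~R - (vtx j ord0 c')%:~R.
      by apply: etrans (esym E1); apply: eq_bigr => i _; rewrite !mxE.
    ring.
  under eq_bigr do rewrite mulr1z mulr1.
  have E2 : \sum_(i < m) (i == j)%:R = 1 :> R.
    by rewrite -[RHS](sj (fun=> 1)); apply: eq_bigr => i _; rewrite mulr1.
  by rewrite big_split /= Es E2 mulrNz -pmulrn; ring.
exists (c ord0), (fun i => c (lift ord0 i)); split.
- by apply: cpos; rewrite mxE liftK eqxx ltr_wpDl.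
- apply/rowP => l; have := cA (lift ord0 l); rewrite big_ord_recl !mxE unlift_none liftK.
  under eq_bigr do rewrite !mxE !liftK.
  move=> E1; rewrite summxE.
  have -> : \sum_i (vtx i *+ c (lift ord0 i)) ord0 l = \sum_i (c (lift ord0 i))%:Z * vtx i ord0 l.
    by apply: eq_bigr => i _; rewrite mulmxnE -mulr_natl natz.
  by rewrite mulmxnE -mulr_natl natz; move: E1; rewrite mulrN => /eqP; rewrite addrC subr_eq0 => /eqP.
- have := cA ord0; rewrite /A big_ord_recl !mxE !unlift_none.
  rewrite (eq_bigr (fun i => (c (lift ord0 i))%:Z)) => [|i _]; last first.
    by rewrite mxE liftK unlift_none mulr1.
  rewrite -(big_morph Posz PoszD (erefl _)) => E1; apply/eqP; rewrite -eqz_nat; apply/eqP.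
  rewrite PoszM mulrC; apply/eqP; rewrite -subr_eq0 addrC -mulrN; apply/eqP; exact: E1.
Qed.

(** [Fp] collects the exponents on the minimal face of their sum [z] over [T]. As the weights add up
    at [z], an inequality tight at [z] is tight at each summand, so [T] lies in that face. *)
Lemma face_condition (T : {set 'I_m}) : T != finset.set0 ->
  wd (\sum_(j in T) vtx j) = (d * #|T|)%N ->
  exists Fp : {set 'I_m}, [/\ T \subset Fp,
    forall a : 'I_m -> nat, (forall j, a j != 0%N -> j \in Fp) ->
      wd (\sum_j vtx j *+ a j) = (d * \sum_j a j)%N,
    forall j, j \in Fp -> exists K (a : 'I_m -> nat), [/\ a j != 0%N,
      \sum_j vtx j *+ a j = (\sum_(j in T) vtx j) *+ K & (\sum_j a j = #|T| * K)%N]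
    & ~ exists x : 'I_n -> Fbar, (forall i, x i != 0) /\ forall l,
        \sum_(j in Fp) iota (f (vtx j)) * (vtx j ord0 l)%:~R * \prod_i x i ^ vtx j ord0 i = 0].
Proof.
move=> Tn0 wT; set z := \sum_(j in T) vtx j in wT *.
have Mz : M z.
  by apply: big_ind => [||i _]; [exact: M0 | exact: MD | have [] := vtxP i].
have wz : lweight D z = #|T|%:R.
  by apply: (mulfI (lt0r_neq0 dR)); rewrite -wdE // wT natrM.
have T0 : (0 : R) < #|T|%:R by rewrite ltr0n card_gt0.
have [rows H] := polytope_rows hD.
have [|F [fF nF0 FP]] := minimal_face hD H Mz; first by rewrite -/(lweight D z) wz.
rewrite -/(lweight D z) wz in FP.
have Dv j : D (lat R (vtx j)) by apply/D_wle/wleP; have [? ->] := vtxP j; rewrite mulr1.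
exists [set j | `[< F (lat R (vtx j)) >]]%SET; split.
- apply/fintype.subsetP => j jT; rewrite inE; apply/asboolP/FP; split=> // r rs.
  rewrite lat_sum dot_sum -sum1_card natr_sum mulr_sumr -big_split /= => E0.
  have ge i : i \in T -> 0 <= dot r.1 (lat R (vtx i)) + r.2 * 1%:R.
    by move=> _; have /D_wle/H/(_ r rs) := Dv i.
  have := psumr_eq0P ge E0; move=> /(_ j jT); by rewrite mulr1.
- move=> a Ha; have [Ma la] := totP a; apply/eqP; rewrite eqn_leq la /=.
  have [u [le_u eq_u]] := face_cone hD fF nF0.
  rewrite -(ler_nat R) natrM wdE // ler_pM2l //; apply: le_trans (le_u _ Ma).
  rewrite lat_sum dot_sum natr_sum; apply: ler_sum => j _; rewrite latMn dotZr.
  have [->|/Ha] := eqVneq (a j) 0%N; first by rewrite mul0r.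
  rewrite inE => /asboolP Fj; have [|_ <-] := eq_u (lat R (vtx j)).
    by exists 1; rewrite ?ler01 //; exists (lat R (vtx j)); rewrite ?scale1r.
  by rewrite -/(lweight D (vtx j)) hwt ?mulr1 ?vtx_supp.
- move=> j; rewrite inE => /asboolP/FP[_ tight].
  have [r rs|K HK] := minimal_face_slack hD H Mz (Dv j).
    by rewrite -/(lweight D z) wz; apply: tight.
  apply: (vtx_slack (K := K)) => //.
  by move: HK; rewrite -/(lweight D z) wz.
- move=> [x [x0 Hx]]; apply: (hnd fF nF0); exists x; split=> // l.
  rewrite -[RHS](Hx l) /eval_logderiv fsbig_mkcond (@fsbigTE _ _ _ _ (finsupp f)) => [|nu nf]; last first.
    by rewrite /patch; case: ifP => // _; rewrite fsfun_dflt // rmorph0 !mul0r.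
  rewrite (perm_big [seq vtx j | j <- enum 'I_m]) /=; last by rewrite -supp_seqE.
  rewrite big_map big_enum /= [RHS]big_mkcond; apply: eq_bigr => j _.
  rewrite /patch inE; congr (if _ then _ else _).
  apply/idP/asboolP => [/set_mem[]//|Fj]; apply/mem_set; split=> //; exact: vtx_supp.
Qed.

(** Obtained over [Fbar] and brought down by [rho], which is [Fq]-linear and so commutes with the
    operators [Fo]. A point of high weight splits additively as [rest] plus a sum of [N] exponents
    of [f] of full weight, to which finite codimension applies. *)
Lemma jacobian_high : exists W, forall mu, M mu -> (W <= wd mu)%N -> Jset Fq f (dlt Fq mu).
Proof.
have [N HN] := finite_codim_fun M0 MD wd0 wdD suppM hd (psi := fun mu => iota (f mu))
  supp_seqE face_condition.
(* Rounding down loses less than 1 on each of the [m] exponents, so weight [N + m] leaves at least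
   [N] whole exponents. *)
exists (d * (N + m))%N => mu Mmu le_mu.
have [rho [rhoD rhoZ rho1]] := retraction iota.
have rho0 : rho 0 = 0 by have := rhoZ 0 0; rewrite rmorph0 !mul0r.
suff [h [Gh Eh]] : Jset Fbar (fun mu => iota (f mu)) (dlt Fbar mu).
  exists (fun l nu => rho (h l nu)); split=> [l|nu].
    have [s Hs] := Gh l; exists s => nu nz; apply: Hs; apply: contraNneq nz => ->.
    by rewrite rho0.
  have -> : dlt Fq mu nu = rho (dlt Fbar mu nu).
    by rewrite /dlt; case: eqP => _; rewrite ?rho1 ?rho0.
  rewrite Eh (big_morph rho rhoD rho0); apply: eq_bigr => l _.
  rewrite /ToricJacobian.Fo (big_morph rho rhoD rho0); apply: eq_bigr => nu' _.
  rewrite -(rmorph_int iota) -rmorphM rhoZ; congr (_ * _).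
  by rewrite /Gx; case: ifP.
have [lam [lam0 Elam slam]] := (newton_posspan _ _).1 (wle_weight hD Mmu).
have w_le : lweight D mu <= \sum_j lam j.
  by apply/(weightP hD Mmu)/newton_posspan; exists lam.
pose a j := Num.truncn (lam j).
have aE j : (a j)%:R <= lam j < (a j)%:R + 1.
  by have := truncn_itv (lam0 j); rewrite -natr1.
have [|a' [a'a sa']] := @sum_trim m a N.
  rewrite -(leq_add2r m) -(ler_nat R) !natrD.
  have : \sum_j lam j <= (\sum_j a j)%:R + m%:R.
    have -> : m%:R = \sum_(j < m) 1 :> R by rewrite sumr_const card_ord.
    rewrite natr_sum -big_split.
    by apply: ler_sum => j _; have /andP[_ /ltW] := aE j.
  move=> h; apply: le_trans h; apply: le_trans w_le.
  by rewrite -(ler_pM2l dR) -wdE // -natrD -natrM ler_nat.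
set tt := \sum_j vtx j *+ a' j; pose rest := mu - tt.
have Et : rest + tt = mu by rewrite subrK.
have [Mt lt] := totP a'; rewrite -/tt sa' in Mt lt.
have /wleP[Mr lr] : wle D (lat R rest) (\sum_j lam j - N%:R).
  apply/newton_posspan; exists (fun j => lam j - (a' j)%:R); split=> [j||].
  - have /andP[h _] := aE j; rewrite subr_ge0; apply: le_trans h; by rewrite ler_nat.
  - apply: (addIr (lat R tt)); rewrite -latD Et Elam lat_sum -big_split.
    by apply: eq_bigr => j _ /=; rewrite latMn -scalerDl subrK.
  - by rewrite sumrB -natr_sum sa'.
have {}lr : (wd rest + d * N <= wd mu)%N.
  rewrite -(ler_nat R) natrD natrM (wdE Mmu); have := ler_wpM2l (ltW dR) slam; rewrite -/(lweight D mu).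
  by move: lr; rewrite mulrBr; lra.
have := wdD Mr Mt; rewrite Et => le_s.
have Ewt : wd tt = (d * N)%N by lia.
have Ewm : wd mu = (wd rest + wd tt)%N by lia.
have := Jset_Gx MD wd0 wdD suppM hd Mr (HN a' sa' Ewt).
by apply: Jset_ext => nu; rewrite Gx_dlt // Et Ewm eqxx.
Qed.

Section JacobianBasis.
Variable B : set 'rV[int]_n.
Hypothesis hB : jacobian_basis R f B.

(** [B] is finite: a monomial of high weight in it would lie in both summands of the direct sum. *)
Lemma basis_enum : exists r (b : 'I_r -> 'rV[int]_n), [/\ injective b, range b = B,
  forall i, M (b i),
  forall g, Gr Fq g -> exists c : 'I_r -> Fq,
    Jset Fq f (fun mu => g mu - \sum_i c i * dlt Fq (b i) mu)
  & forall c : 'I_r -> Fq, Jset Fq f (fun mu => \sum_i c i * dlt Fq (b i) mu) ->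
    forall i, c i = 0].
Proof.
have [BM [hsum hint]] := hB; have [W HW] := jacobian_high.
have finB : finite_set B.
  apply: (@sub_finite_set _ _ [set mu | lattice_cone D mu /\ lweight D mu <= W%:R / d%:R]).
    move=> mu Bmu; have Mmu := BM mu Bmu; split=> //; rewrite ler_pdivlMr // mulrC -wdE // ler_nat.
    rewrite leqNgt; apply/negP => /ltnW /(HW mu Mmu)/jacobian_idealP J1.
    have : (monomial_span B `&` jacobian_ideal R f) (dlt Fq mu).
      split=> //; split=> [|nu nB].
        by apply: (@sub_finite_set _ _ [set mu]) => // nu /=; rewrite /dlt; have [->|_] := eqVneq nu mu => //; rewrite eqxx.
      by rewrite /dlt; case: eqP => // E0; case: nB; rewrite E0.
    rewrite hint => /(congr1 (fun g => g mu)); rewrite /dlt eqxx => /eqP.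
    by rewrite oner_eq0.
  exact: (finite_lattice_le hD).
pose s := enum_fset (fset_set B).
have sB mu : (mu \in s) = (mu \in B) by rewrite -in_fset_set.
have us : uniq s by exact: fset_uniq.
have bB (i : 'I_(size s)) : B (nth 0 s i) by apply/set_mem; rewrite -sB mem_nth.
have inj : injective (fun i : 'I_(size s) => nth 0 s i).
  by move=> i j /eqP; rewrite nth_uniq // => /eqP/val_inj.
have onto mu : B mu -> exists i : 'I_(size s), nth 0 s i = mu.
  move=> /mem_set; rewrite -sB => /[dup] ms; rewrite -index_mem => lt.
  by exists (Ordinal lt); rewrite /= nth_index.
exists (size s), (fun i => nth 0 s i); split=> //.
- by apply/seteqP; split=> [_ [i _ <-]//|mu /onto[i <-]]; exists i.
- by move=> i; apply: BM.
- move=> g /gr_ringP/hsum[y [z [[_ yB] Jz Eg]]]; exists (fun i => y (nth 0 s i)).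
  move/jacobian_idealP: Jz; apply: Jset_ext => mu; rewrite Eg.
  suff -> : \sum_(i < size s) y (nth 0 s i) * dlt Fq (nth 0 s i) mu = y mu.
    by rewrite -[(y + z) mu]/(y mu + z mu) addrAC subrr add0r.
  have [/onto[i Ei]|nB] := pselect (B mu).
    rewrite (bigD1 i) //= /dlt Ei eqxx mulr1 big1 ?addr0 // => j nj.
    by rewrite -Ei (inj_eq inj) eq_sym (negPf nj) mulr0.
  rewrite yB // big1 // => i _; rewrite /dlt; case: eqP => [E0|_]; last by rewrite mulr0.
  by case: nB; rewrite E0.
- move=> c Jc i; pose g mu := \sum_(i < size s) c i * dlt Fq (nth 0 s i) mu.
  have Eg (j : 'I_(size s)) : g (nth 0 s j) = c j.
    rewrite /g (bigD1 j) //= /dlt eqxx mulr1 big1 ?addr0 // => k nk.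
    by rewrite (inj_eq inj) eq_sym (negPf nk) mulr0.
  have : (monomial_span B `&` jacobian_ideal R f) g.
    split; last exact/jacobian_idealP.
    have gB mu : g mu != 0 -> mu \in s.
      apply: contraNT => ms; rewrite /g big1 // => j _; rewrite /dlt.
      by case: eqP => [E0|_]; [case/negP: ms; rewrite E0 mem_nth | rewrite mulr0].
    split=> [|mu nB]; last by apply/eqP/negPn/negP => /gB; rewrite sB => /set_mem.
    by apply: (@sub_finite_set _ _ [set` s]) => //; apply/finite_seqP; exists s.
  by rewrite hint => E0; rewrite -Eg E0.
Qed.

Variables (r : nat) (b : 'I_r -> 'rV[int]_n).
Hypothesis Mb : forall i, M (b i).
Hypothesis hspan : forall g, Gr Fq g -> exists c : 'I_r -> Fq,
    Jset Fq f (fun mu => g mu - \sum_i c i * dlt Fq (b i) mu).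
Hypothesis hind : forall c : 'I_r -> Fq, Jset Fq f (fun mu => \sum_i c i * dlt Fq (b i) mu) ->
    forall i, c i = 0.

Let Q_gt1 : (1 < #|Fq|)%N. Proof. exact: finNzRing_gt1. Qed.
Let pcharQ : [pchar Fq].-nat #|Fq|.
Proof. by have [p pp pc] := finPcharP Fq; rewrite (card_pprimeChar pc) pnatX pnatE ?pc. Qed.
Let expQ (c : Fq) : c ^+ #|Fq| = c. Proof. exact: expf_card. Qed.

Lemma koszul_newton (om : {set 'I_n} -> 'rV[int]_n -> Fq) :
  (forall T, Gr Fq (om T)) -> (forall mu, om [set: 'I_n]%SET mu = 0) ->
  (forall (T : {set 'I_n}) mu, \sum_(l in T) sgn Fq l T * Fo Fq f l (om (T :\ l)%SET) mu = 0) ->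
  exists th : {set 'I_n} -> 'rV[int]_n -> Fq, (forall T, Gr Fq (th T)) /\
    forall (T : {set 'I_n}) mu, om T mu = \sum_(l in T) sgn Fq l T * Fo Fq f l (th (T :\ l)%SET) mu.
Proof.
have [C HC] := boundM; have [rows Hrows] := rowsM; have [bs [bss bsf]] := basis_vertices_free.
exact: (koszul_Fo M0 MD wd0 wdD suppM hd HC Hrows bss bsf Q_gt1 pcharQ expQ Mb hspan hind).
Qed.

Lemma rank_volume : (r%:R%:E = n`!%:R%:E * volume D)%E.
Proof.
have [C HC] := boundM; have [rows Hrows] := rowsM; have [bs [bss bsf]] := basis_vertices_free.
have [m0 [c0 box]] := unit_box.
pose c := (\sum_i wd (b i))%N.
have hc i : (wd (b i) <= d * c)%N.
  rewrite (@leq_trans c) //; first by rewrite /c (bigD1 i) //= leq_addr.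
  by rewrite leq_pmull.
apply: (LatticeVolume.volume_count hD box (c := c)) => N.
have /finite_seqP[s Hs] := finite_lattice_le hD N%:R.
have Hs' mu : mu \in undup s <-> M mu /\ (wd mu <= d * N)%N.
  rewrite mem_undup; have -> : (mu \in s) <-> [set mu | lattice_cone D mu /\ lweight D mu <= N%:R] mu by rewrite Hs.
  split=> -[Mmu h]; split=> //; move: h; rewrite -(ler_pM2l dR) -wdE // -natrM ler_nat //.
exists (undup s).
have [h1 h2] := count_bounds M0 MD wd0 wdD suppM hd HC Hrows bss bsf Q_gt1 pcharQ expQ Mb hspan hind
  (undup_uniq s) Hs' hc.
split=> //; first exact: undup_uniq.
by move=> nu; rewrite Hs' wleP -natrM ler_nat.
Qed.

End JacobianBasis.
End FaceCondition.
End Newton.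

End NewtonPolytope.

(** * Valuations, summability and the ring of integers of [K] *)

Module PadicField.
From mathcomp Require Import all_boot all_order all_algebra falgebra fieldext.
From mathcomp Require Import finmap.
From mathcomp Require Import all_classical all_reals all_analysis.
From mathcomp Require Import ring lra zify.
Import Defs.
Import Order.TTheory GRing.Theory Num.Theory.
Local Open Scope classical_set_scope.
Local Open Scope ring_scope.

Section Valuation.
Variables (R : realType) (K : fieldType) (ord : K -> \bar R).
Hypothesis hord : valuation ord.
Implicit Types (x y : K) (c : \bar R).

Lemma vord0 : ord 0 = +oo%E.
Proof. by case: hord => _ h _ _; apply/h. Qed.

Lemma ord_fin x : x != 0 -> exists r : R, ord x = r%:E.
Proof.
case: hord => h1 h2 _ _ x0; have := h1 x; have := h2 x; case: (ord x) => [r|h _|] //; first by exists r.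
by case/eqP: x0; apply/h.
Qed.

Lemma ordM x y : ord (x * y) = (ord x + ord y)%E.
Proof. by case: hord. Qed.

Lemma ordD c x y : (c <= ord x)%E -> (c <= ord y)%E -> (c <= ord (x + y)%R)%E.
Proof. by case: hord => _ _ _ h h1 h2; apply: le_trans (h x y); rewrite le_min h1. Qed.

Lemma ordD_lt c x y : (c < ord x)%E -> (c < ord y)%E -> (c < ord (x + y)%R)%E.
Proof. by case: hord => _ _ _ h h1 h2; apply: lt_le_trans (h x y); rewrite lt_min h1. Qed.

Lemma vord1 : ord 1 = 0%E.
Proof.
have [r Er] := ord_fin (oner_neq0 K); have := ordM 1 1; rewrite mulr1 Er => -[] h.
by congr EFin; lra.
Qed.

Lemma ordN x : ord (- x) = ord x.
Proof.
rewrite -mulN1r ordM; suff -> : ord (-1) = 0%E by rewrite add0e.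
have [|r Er] := @ord_fin (-1); first by rewrite oppr_eq0 oner_neq0.
by have := ordM (-1) (-1); rewrite mulrNN mulr1 vord1 Er => -[] h; congr EFin; lra.
Qed.

Lemma ordB c x y : (c <= ord x)%E -> (c <= ord y)%E -> (c <= ord (x - y)%R)%E.
Proof. by move=> h1 h2; apply: ordD; rewrite ?ordN. Qed.

Lemma ord_distC x y : ord (x - y) = ord (y - x).
Proof. by rewrite -ordN opprB. Qed.

Lemma ord_sum c (I : Type) (r : seq I) (P : pred I) (F : I -> K) :
  (forall i, P i -> (c <= ord (F i))%E) -> (c <= ord (\sum_(i <- r | P i) F i)%R)%E.
Proof.
move=> h; elim/big_ind: _ => //; first by rewrite vord0 leey.
exact: ordD.
Qed.

Lemma ord_sum_lt c (I : Type) (r : seq I) (P : pred I) (F : I -> K) : (c < +oo)%E ->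
  (forall i, P i -> (c < ord (F i))%E) -> (c < ord (\sum_(i <- r | P i) F i)%R)%E.
Proof.
move=> c0 h; elim/big_ind: _ => //; first by rewrite vord0.
exact: ordD_lt.
Qed.

Lemma ordV x (r : R) : ord x = r%:E -> ord x^-1 = (- r)%:E.
Proof.
move=> Er; have x0 : x != 0 by apply: contra_eqN Er => /eqP ->; rewrite vord0.
have [|t Et] := @ord_fin x^-1; first by rewrite invr_eq0.
by have := ordM x x^-1; rewrite divff // vord1 Er Et => -[] h; congr EFin; lra.
Qed.

Lemma ordX x (r : R) k : ord x = r%:E -> ord (x ^+ k) = (k%:R * r)%:E.
Proof.
move=> Er; elim: k => [|k IH]; first by rewrite expr0 mul0r vord1.
by rewrite exprS ordM Er IH -EFinD -natr1 mulrDl mul1r addrC.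
Qed.

Lemma ord_eq0 x : (forall N : R, (N%:E <= ord x)%E) -> x = 0.
Proof.
move=> h; apply/eqP/negPn/negP => /ord_fin[r Er].
by have := h (r + 1); rewrite Er lee_fin; lra.
Qed.

Lemma ord_nat k : (0 <= ord k%:R)%E.
Proof. by elim: k => [|k IH]; rewrite ?vord0 ?leey // -natr1; apply: ordD; rewrite ?vord1. Qed.

Lemma ord_int (z : int) : (0 <= ord z%:~R)%E.
Proof.
case: z => k; first exact: ord_nat.
by rewrite NegzE mulrNz ordN; apply: ord_nat.
Qed.

Lemma ord_dom x y : (ord x < ord y)%E -> ord (x + y) = ord x.
Proof.
move=> lt; apply/eqP; rewrite eq_le; apply/andP; split; last by apply: ordD => //; apply: ltW.
rewrite leNgt; apply/negP => h.
have : (ord x < ord (x + y - y)%R)%E by apply: ordD_lt; rewrite ?ordN.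
by rewrite addrK ltxx.
Qed.

Section Sums.
Variable I : choiceType.
Implicit Types (F G : I -> K).

Lemma has_vsum_unique F S S' : has_vsum ord F S -> has_vsum ord F S' -> S = S'.
Proof.
move=> h h'; apply/eqP; rewrite -subr_eq0; apply/eqP/ord_eq0 => N.
have [J HJ] := h N; have [J' HJ'] := h' N.
have := ordB (HJ _ (fsubsetUl J J')) (HJ' _ (fsubsetUr J J')).
by rewrite opprB addrA subrK.
Qed.

Lemma vsumE F S : has_vsum ord F S -> vsum ord F = S.
Proof. by move=> h; apply: (has_vsum_unique _ h); apply: (@xgetPex _ 0); exists S. Qed.

Lemma sum_sub_ge F c (J0 J : {fset I}) : (J0 `<=` J)%fset ->
  (forall i, i \notin J0 -> (c <= ord (F i))%E) ->
  (c <= ord (\sum_(i <- J) F i - \sum_(i <- J0) F i)%R)%E.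
Proof.
move=> /fsubsetP sub h; rewrite (bigID (mem J0)) /=.
have -> : \sum_(i <- J | i \in J0) F i = \sum_(i <- J0) F i.
  rewrite -big_filter; apply: perm_big; apply: uniq_perm; rewrite ?filter_uniq ?fset_uniq //.
  by move=> i; rewrite mem_filter; case: (boolP (i \in J0)) => //= /sub ->.
by rewrite addrAC subrr add0r; apply: ord_sum.
Qed.

Hypothesis complete : forall u, val_cauchy ord u -> exists l, val_cvg ord u l.

(** Only finitely many terms, forming [J k], have valuation below [k]; the partial sums over the
    [J k] are Cauchy by the ultrametric inequality. *)
Lemma has_vsumP F : tends0 setT (fun i => ord (F i)) -> has_vsum ord F (vsum ord F).
Proof.
move=> t0; suff [S HS] : exists S, has_vsum ord F S by apply: (@xgetPex _ 0); exists S.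
pose J k := fset_set [set i | setT i /\ (ord (F i) < (k%:R : R)%:E)%E].
have JP k i : i \notin J k -> ((k%:R : R)%:E <= ord (F i))%E.
  rewrite in_fset_set; last exact: (t0 k%:R).
  by move=> /negP h; rewrite leNgt; apply/negP => lt; apply: h; rewrite inE.
have Jsub k k' : (k <= k')%N -> (J k `<=` J k')%fset.
  move=> le; apply/fsubsetP => i; rewrite !in_fset_set; [|exact: (t0 k'%:R)|exact: (t0 k%:R)].
  rewrite !inE /= => -[_ lt]; split=> //; apply: lt_le_trans lt _.
  by rewrite lee_fin ler_nat.
have nat_ge (N : R) : exists k : nat, N <= k%:R.
  exists (Num.bound `|N|); apply: le_trans (ler_norm _) (ltW _).
  by have := archi_boundP (normr_ge0 N); rewrite /Num.bound normr_id.
have [|S HS] := @complete (fun k => \sum_(i <- J k) F i).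
  move=> N; have [k0 lek] := nat_ge N; exists k0 => k k' le le'.
  have h0 k1 : (k0 <= k1)%N -> (N%:E <= ord (\sum_(i <- J k1) F i - \sum_(i <- J k0) F i)%R)%E.
    move=> /Jsub s; apply: sum_sub_ge => // i /JP; apply: le_trans; by rewrite lee_fin.
  have := ordB (h0 _ le) (h0 _ le'); rewrite opprB addrA subrK; by [].
exists S => N; have [k0 lek] := nat_ge N; have [k1 H1] := HS N.
exists (J (maxn k0 k1)) => J' sub.
have h1 := H1 _ (leq_maxr k0 k1); rewrite ord_distC in h1.
have h2 : (N%:E <= ord (\sum_(i <- J') F i - \sum_(i <- J (maxn k0 k1)) F i)%R)%E.
  apply: sum_sub_ge => // i /JP; apply: le_trans; rewrite lee_fin; apply: le_trans lek _.
  by rewrite ler_nat leq_maxl.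
by have := ordB h1 h2; rewrite opprB addrA subrK.
Qed.

Lemma vsum_approx F c (J : {fset I}) : tends0 setT (fun i => ord (F i)) ->
  (forall i, i \notin J -> (c <= ord (F i))%E) -> (c <= ord (vsum ord F - \sum_(i <- J) F i)%R)%E.
Proof.
move=> /has_vsumP hF h.
have real (N : R) : (N%:E <= c)%E -> (N%:E <= ord (vsum ord F - \sum_(i <- J) F i)%R)%E.
  move=> Nc; have [J0 HJ] := hF N; have h1 := HJ _ (fsubsetUl J0 J).
  have := ordD h1 (sum_sub_ge (fsubsetUr J0 J) (fun i ni => le_trans Nc (h i ni))).
  by rewrite addrA subrK.
case: c h real => [r|h real|h real]; first by move=> h; apply.
  by rewrite leye_eq; apply/eqP; case: hord => _ h2 _ _; apply/h2; apply: ord_eq0 => N; apply: real; rewrite leey.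
by rewrite leNye.
Qed.

Lemma vsum_ge F c : tends0 setT (fun i => ord (F i)) ->
  (forall i, (c <= ord (F i))%E) -> (c <= ord (vsum ord F))%E.
Proof. by move=> t0 h; have := @vsum_approx F c fset0 t0 (fun i _ => h i); rewrite big_seq_fset0 subr0. Qed.

Lemma has_vsumD F G S T : has_vsum ord F S -> has_vsum ord G T ->
  has_vsum ord (fun i => F i + G i) (S + T).
Proof.
move=> h h' N; have [J HJ] := h N; have [J' HJ'] := h' N; exists (J `|` J')%fset => J1 sub.
rewrite big_split /= opprD addrACA; apply: ordD.
  by apply: HJ; apply: fsubset_trans sub; apply: fsubsetUl.
by apply: HJ'; apply: fsubset_trans sub; apply: fsubsetUr.
Qed.

Lemma has_vsumZ F S x : has_vsum ord F S -> has_vsum ord (fun i => x * F i) (x * S).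
Proof.
move=> h N; have [->|/ord_fin[r Er]] := eqVneq x 0.
  by exists fset0 => J _; rewrite mul0r big1 ?subr0 ?vord0 ?leey // => i _; rewrite mul0r.
have [J HJ] := h (N - r); exists J => J1 /HJ h1.
rewrite -mulr_sumr -mulrBr ordM Er; have := leeD (lexx r%:E) h1.
by rewrite -EFinD (_ : r + (N - r) = N) //; ring.
Qed.

Lemma has_vsum_fin F (J : {fset I}) : (forall i, i \notin J -> F i = 0) ->
  has_vsum ord F (\sum_(i <- J) F i).
Proof.
move=> h N; exists J => J1 sub; rewrite ord_distC; apply: sum_sub_ge => // i /h ->.
by rewrite vord0 leey.
Qed.

End Sums.
End Valuation.

(** * Completeness of finite extensions *)

Section FiniteDimensional.
Variables (R : realType) (Qp : fieldType) (K : fieldExtType Qp) (ord : K -> \bar R) (p : nat).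
Hypothesis hord : valuation ord.
Hypothesis hQp : is_Qp (fun x : Qp => ord x%:A) p.

(** Half of the equivalence of norms on the span of [X]: passing to coordinates loses at most the
    constant [C] of precision. *)
Let bounded_coords (X : seq K) := exists C : R, forall (c : nat -> Qp) i, (i < size X)%N ->
  forall N : R, (N%:E <= ord (\sum_(j < size X) c j *: X`_j)%R)%E -> ((N - C)%:E <= ord (c i)%:A)%E.

Lemma ordZ (c : Qp) (x : K) : ord (c *: x) = (ord c%:A + ord x)%E.
Proof. by have -> : c *: x = c%:A * x; [rewrite mulr_algl | exact: (ordM hord)]. Qed.

Lemma bounded_coords_closed X u : bounded_coords X -> (forall k, u k \in <<X>>%VS) ->
  val_cauchy ord u -> exists2 l, l \in <<X>>%VS & val_cvg ord u l.
Proof.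
move=> [C HC] uX cu; pose t := in_tuple X.
pose c k j := if insub j is Some i then coord t i (u k) else 0.
have uE k : u k = \sum_(j < size X) c k j *: X`_j.
  rewrite {1}(coord_span (X := t) (uX k)); apply: eq_bigr => i _.
  by rewrite /c valK.
have cc j : exists l, (j < size X)%N -> val_cvg (fun x : Qp => ord x%:A) (c^~ j) l.
  have [lt|] := boolP (j < size X)%N; last by exists 0.
  have [_ _ _ comp] := hQp; have [|l Hl] := comp (c^~ j); last by exists l.
  move=> N; have [m0 Hm] := cu (N + C); exists m0 => m m' le le'.
  rewrite -[N](addrK C); apply: (HC (fun j => c m j - c m' j) _ lt).
  rewrite (eq_bigr (fun j : 'I_(size X) => c m j *: X`_j - c m' j *: X`_j)) => [|i _]; last by rewrite scalerBl.
  by rewrite sumrB -!uE; apply: Hm.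
have /choice[l Hl] := cc.
exists (\sum_(j < size X) l j *: X`_j).
  apply: rpred_sum => j _; apply: rpredZ; apply: memv_span; exact: mem_nth.
have [b Hb] : exists b : R, forall j, (j < size X)%N -> (b%:E <= ord X`_j)%E.
  elim: (X) => [|x X' [b Hb]]; first by exists 0.
  have [b' Hb'] : exists b' : R, (b'%:E <= ord x)%E.
    have [->|/(ord_fin hord)[r ->]] := eqVneq x 0; first by exists 0; rewrite (vord0 hord) leey.
    by exists r.
  exists (Num.min b b') => -[|j] /= lt.
    by apply: le_trans Hb'; rewrite lee_fin ge_min lexx orbT.
  by apply: le_trans (Hb j lt); rewrite lee_fin ge_min lexx.
move=> N; have [m0 Hm] : exists m0, forall j, (j < size X)%N -> forall m, (m0 <= m)%N ->
    ((N - b)%:E <= ord (c m j - l j)%:A)%E.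
  have : forall k, (k <= size X)%N -> exists m0, forall j, (j < k)%N -> forall m, (m0 <= m)%N ->
    ((N - b)%:E <= ord (c m j - l j)%:A)%E.
    elim=> [|k IH] le; first by exists 0%N.
    have [m1 H1] := IH (ltnW le); have [m2 H2] := Hl k le (N - b).
    exists (maxn m1 m2) => j; rewrite ltnS leq_eqVlt => /predU1P[->|lt] m; rewrite geq_max => /andP[l1 l2].
      exact: H2.
    exact: H1.
  by move=> /(_ _ (leqnn _)).
exists m0 => m le; rewrite uE -sumrB; apply: (ord_sum hord) => j _.
rewrite -scalerBl ordZ; have := leeD (Hm j (ltn_ord j) m le) (Hb j (ltn_ord j)).
by rewrite -EFinD subrK.
Qed.

(** By induction the span of the tail is complete, hence closed; so the valuation of [x - v] is
    bounded by some [C0] for [v] in it, which controls the coordinate along [x]. *)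
Lemma free_bounded_coords X : free X -> bounded_coords X.
Proof.
elim: X => [|x X IH]; first by exists 0.
rewrite free_cons => /andP[xX fX]; have [C HC] := IH fX.
have [C0 HC0] : exists C0 : R, forall v, v \in <<X>>%VS -> (ord (x - v)%R <= C0%:E)%E.
  apply: contrapT => /forallNP h.
  have /choice[u Hu] : forall k : nat, exists v, v \in <<X>>%VS /\ ((k%:R : R)%:E < ord (x - v)%R)%E.
    move=> k; apply: contrapT => /forallNP h'; apply: (h k%:R) => v vX.
    by rewrite leNgt; apply/negP => lt; apply: (h' v).
  have nat_ge (N : R) : exists k : nat, N <= k%:R.
    exists (Num.bound `|N|); apply: le_trans (ler_norm _) (ltW _).
    by have := archi_boundP (normr_ge0 N); rewrite /Num.bound normr_id.
  have hu (N : R) : exists m0, forall m, (m0 <= m)%N -> (N%:E <= ord (x - u m)%R)%E.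
    have [k lek] := nat_ge N; exists k => m le; apply: ltW; apply: le_lt_trans (Hu m).2.
    by rewrite lee_fin; apply: le_trans lek _; rewrite ler_nat.
  have cu : val_cauchy ord u.
    move=> N; have [m0 Hm] := hu N; exists m0 => m m' le le'.
    by have := ordB hord (Hm _ le') (Hm _ le); rewrite opprB addrC addrA subrK.
  have [l lX Hl] := bounded_coords_closed (IH fX) (fun k => (Hu k).1) cu.
  case/negP: xX; suff -> : x = l by [].
  apply/eqP; rewrite -subr_eq0; apply/eqP/(ord_eq0 hord) => N.
  have [m1 H1] := hu N; have [m2 H2] := Hl N.
  have := ordD hord (H1 _ (leq_maxl m1 m2)) (H2 _ (leq_maxr m1 m2)).
  by rewrite addrA subrK.
have x0 : x != 0 by apply: contraNneq xX => ->; rewrite mem0v.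
have [rx Erx] := ord_fin hord x0.
exists (`|C0| + `|C| + `|C0 - rx|) => c i lti N; rewrite big_ord_recl /=.
under eq_bigr do rewrite /=.
set v := \sum_(j < size X) _ => HN.
have vX : v \in <<X>>%VS.
  apply: rpred_sum => j _; apply: rpredZ; apply: memv_span; apply: mem_nth.
  exact: ltn_ord.
have n1 := ler_norm C0; have n2 := ler_norm C; have n3 := ler_norm (C0 - rx).
have n1' := normr_ge0 C0; have n2' := normr_ge0 C; have n3' := normr_ge0 (C0 - rx).
have [h0 hv] : ((N - C0)%:E <= ord (c 0%N)%:A)%E /\
    ((Num.min N (N - C0 + rx))%:E <= ord v)%E.
  have [c00|c0n] := eqVneq (c 0%N) 0.
    rewrite c00 scale0r (vord0 hord) leey; split=> //.
    move: HN; rewrite c00 scale0r add0r; apply: le_trans.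
    by rewrite lee_fin ge_min lexx.
  have [|r Er] := @ord_fin _ _ _ hord (c 0%N)%:A; first by rewrite scaler_eq0 (negPf c0n) oner_eq0.
  have Ey : c 0%N *: x + v = c 0%N *: (x - (- (c 0%N)^-1 *: v)).
    by rewrite scaleNr opprK scalerDr scalerA divff // scale1r.
  have h1 : N - C0 <= r.
    have := HC0 _ (rpredZ (- (c 0%N)^-1) vX); move: HN; rewrite Ey ordZ Er.
    case: (ord (x - _)) => [t| |] //; rewrite -?EFinD !lee_fin; lra.
  rewrite Er lee_fin; split=> //.
  have -> : v = c 0%N *: x + v - c 0%N *: x by rewrite addrAC subrr add0r.
  apply: (ordB hord).
    by apply: le_trans HN; rewrite lee_fin ge_min lexx.
  by rewrite ordZ Er Erx -EFinD lee_fin ge_min lerD2r h1 orbT.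
case: i lti => [_|i lti].
  by apply: le_trans h0; rewrite lee_fin; lra.
apply: le_trans (HC (fun j => c j.+1) i lti _ hv); rewrite lee_fin.
by case: (leP N (N - C0 + rx)) => h; lra.
Qed.

Lemma subspace_closed (V : {vspace K}) u : (forall k, u k \in V) -> val_cauchy ord u ->
  exists2 l, l \in V & val_cvg ord u l.
Proof.
have /andP[/eqP EV fV] := vbasisP V.
by have := @bounded_coords_closed (vbasis V) u (free_bounded_coords fV); rewrite EV.
Qed.

Lemma field_complete u : val_cauchy ord u -> exists l, val_cvg ord u l.
Proof.
by move=> cu; have [k|l _ Hl] := @subspace_closed fullv u _ cu; [rewrite memvf | exists l].
Qed.

End FiniteDimensional.

(** * The totally ramified extension generated by [pit] *)

Section Ramification.
Variables (R : realType) (p a : nat) (Fq : finFieldType).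
Hypothesis hp : prime p.
Variables (Qp : fieldType) (K : fieldExtType Qp) (Qq : {subfield K}) (ord : K -> \bar R).
Hypothesis hord : valuation ord.
Hypothesis hQp : is_Qp (fun x : Qp => ord x%:A) p.
Hypothesis hQq : unramified Qq ord a.
Variable red : K -> Fq.
Hypothesis hred : residue_map Qq ord red.
Variable tau : Fq -> K.
Hypothesis htau : teichmuller Qq ord red tau.
Variable ppi : K.
Hypothesis hpi : AH_root ord p ppi.
Variables (pit : K) (d : nat).
Hypothesis hd : (0 < d)%N.
Hypothesis hpit : pit ^+ d = ppi.
Hypothesis hK : <<Qq; pit>>%VS = fullv.

(** The ramification index over [Qq]: [ppi] has valuation [1/(p-1)] and [pit] is a [d]-th root of
    it. *)
Definition ram : nat := (d * p.-1)%N.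

Let p_gt1 : (1 < p)%N. Proof. exact: prime_gt1. Qed.

Lemma ram_gt0 : (0 < ram)%N.
Proof. by rewrite muln_gt0 hd -ltnS prednK // ltnW. Qed.

Let e_gt0 : 0 < ram%:R :> R. Proof. by rewrite ltr0n ram_gt0. Qed.

Lemma ram_pi : d%:R / ram%:R = (p%:R - 1)^-1 :> R.
Proof.
have p1 : p%:R - 1 != 0 :> R by rewrite subr_eq0 (eqr_nat _ p 1) gtn_eqF.
have d0 : d%:R != 0 :> R by rewrite pnatr_eq0 -lt0n.
rewrite /ram natrM -subn1 natrB 1?ltnW //; field; exact/andP.
Qed.

Lemma ord_pit : ord pit = (ram%:R^-1)%:E.
Proof.
have [|r Er] := @ord_fin _ _ _ hord pit.
  apply/eqP => E0; have := hpi.2; rewrite -hpit E0 expr0n gtn_eqF //= vord0 //.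
have := hpi.2; rewrite -hpit (ordX hord d Er) -ram_pi => -[] h.
have d0 : d%:R != 0 :> R by rewrite pnatr_eq0 -lt0n.
by rewrite Er; congr EFin; apply: (mulfI d0); rewrite h.
Qed.

Lemma ord_pitX k : ord (pit ^+ k) = (k%:R / ram%:R)%:E.
Proof. by rewrite (ordX hord k ord_pit). Qed.

Lemma pit_neq0 : pit != 0.
Proof. by apply: contra_eqN ord_pit => /eqP ->; rewrite (vord0 hord). Qed.

Lemma ord_p : ord p%:R = 1%:E.
Proof. by have [_ <- _ _] := hQp; rewrite scaler_nat. Qed.

Lemma p_neq0 : p%:R != 0 :> K.
Proof. by apply: contra_eqN ord_p => /eqP ->; rewrite (vord0 hord). Qed.

Lemma Qq_ord x : x \in Qq -> x != 0 -> exists m : int, ord x = (m%:~R)%:E.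
Proof. by have [_] := hQq; apply. Qed.

(** The nonzero summands have valuations in distinct classes modulo the integers, so nothing cancels
    and the sum has the least of them. *)
Lemma digits_ge (c : 'I_ram -> K) (N : \bar R) : (forall i, c i \in Qq) ->
  (N <= ord (\sum_i c i * pit ^+ i)%R)%E -> forall i, (N <= ord (c i * pit ^+ i)%R)%E.
Proof.
move=> cQ HN i; rewrite leNgt; apply/negP => lti.
pose F j := ord (c j * pit ^+ j).
have distinct j j' : j != j' -> F j = F j' -> F j = +oo%E.
  move=> nj; rewrite /F !(ordM hord) !ord_pitX.
  have [->|nz] := eqVneq (c j) 0; first by rewrite (vord0 hord).
  have [->|nz'] := eqVneq (c j') 0; first by rewrite (vord0 hord) => ->.
  have [m ->] := Qq_ord (cQ j) nz; have [m' ->] := Qq_ord (cQ j') nz'.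
  rewrite -!EFinD => -[] E0; case/negP: nj; apply/eqP; apply: val_inj => /=.
  have {}E0 : (m * ram%:Z + j%:Z)%:~R = (m' * ram%:Z + j'%:Z)%:~R :> R.
    have e0 := lt0r_neq0 e_gt0; move: E0 => /(congr1 (fun z => z * ram%:R)).
    by rewrite !mulrDl !divfK // !intrD !intrM -!pmulrn.
  have gen (x y e : nat) : (x < e)%N -> (y < e)%N ->
      m * e%:Z + x%:Z = m' * e%:Z + y%:Z -> x = y.
    move=> lx ly E1; have : (m - m') * e%:Z = y%:Z - x%:Z by lia.
    have [mm|mm] := eqVneq m m'; first by rewrite mm subrr mul0r; lia.
    have : (1 <= `|m - m'|)%R by rewrite -gtz0_ge1 normr_gt0 subr_eq0.
    by move=> h1 h2; exfalso; nia.
  exact: (gen _ _ _ (ltn_ord j) (ltn_ord j') (intr_inj E0)).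
have gen (s : seq 'I_ram) : exists i0, (F i0 <= F i)%E /\ forall j, j \in s -> (F i0 <= F j)%E.
  elim: s => [|j s [i0 [h0 h]]]; first by exists i.
  have [le|lt] := leP (F i0) (F j).
    by exists i0; split=> // x; rewrite inE => /predU1P[->//|/h].
  exists j; split=> [|x]; first exact: le_trans (ltW lt) h0.
  by rewrite inE => /predU1P[->//|/h]; apply: le_trans (ltW lt).
have [i0 [_ min]] := gen (enum 'I_ram).
have min0 j : xpredT j -> (F i0 <= F j)%E by move=> _; apply: min; rewrite mem_enum.
have lt0 : (F i0 < N)%E by apply: le_lt_trans (min0 i isT) lti.
have fin0 : (F i0 < +oo)%E by apply: lt_le_trans lt0 (leey _).
have gt_i0 j : j != i0 -> (F i0 < F j)%E.
  move=> nj; rewrite lt_neqAle min0 // andbT; apply/negP => /eqP E0.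
  have := distinct i0 j; rewrite eq_sym => /(_ nj E0) E1.
  by rewrite E1 ltxx in fin0.
move: HN; rewrite (bigD1 i0) //= (ord_dom hord) => [|]; last by apply: ord_sum_lt.
by rewrite leNgt lt0.
Qed.

Let W : {vspace K} := (\sum_(i < ram) (Qq * <[pit ^+ i]>))%VS.

Let WP x : x \in W -> exists c : 'I_ram -> K, (forall i, c i \in Qq) /\ x = \sum_i c i * pit ^+ i.
Proof.
move=> /memv_sumP[y Hy ->].
have /choice[c Hc] : forall i : 'I_ram, exists c, c \in Qq /\ y i = c * pit ^+ i.
  by move=> i; have /memv_cosetP[c cQ ->] := Hy i isT; exists c.
exists c; split=> [i|]; first by have [] := Hc i.
by apply: eq_bigr => i _; have [] := Hc i.
Qed.

Let Wmul c x : c \in Qq -> x \in W -> c * x \in W.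
Proof.
move=> cQ /WP[b [bQ ->]]; rewrite mulr_sumr; apply: rpred_sum => i _.
rewrite mulrA; apply: (subvP (sumv_sup i _ (subvv _))) => //.
by apply: memv_mul; rewrite ?memv_line // rpredM.
Qed.

Let Wpit i : (i < ram)%N -> pit ^+ i \in W.
Proof.
move=> lt; apply: (subvP (sumv_sup (Ordinal lt) _ (subvv _))) => //=.
by rewrite -[X in X \in _]mul1r; apply: memv_mul; rewrite ?memv_line ?rpred1.
Qed.

Let U (N : R) x := exists2 w, w \in W & (N%:E <= ord (x - w)%R)%E.

Let UD N x y : U N x -> U N y -> U N (x + y).
Proof.
move=> [w wW h] [w' wW' h']; exists (w + w'); first exact: rpredD.
by rewrite opprD addrACA; apply: (ordD hord).
Qed.

Let USum N (J : Type) (s : seq J) (P : pred J) (F : J -> K) :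
  (forall j, P j -> U N (F j)) -> U N (\sum_(j <- s | P j) F j).
Proof.
move=> h; elim/big_ind: _ => //; last exact: UD.
by exists 0; rewrite ?mem0v // subr0 (vord0 hord) leey.
Qed.

Let UM N r c x : c \in Qq -> ord c = r%:E -> U N x -> U (N + r) (c * x).
Proof.
move=> cQ Er [w wW h]; exists (c * w); first exact: Wmul.
by rewrite -mulrBr (ordM hord) Er addrC EFinD; apply: leeD.
Qed.

Let Usmall N x : (N%:E <= ord x)%E -> U N x.
Proof. by move=> h; exists 0; rewrite ?mem0v // subr0. Qed.

Let pQ k : p%:R ^+ k \in Qq.
Proof. by apply: rpredX; apply: rpred_nat. Qed.

Let pVQ k : (p%:R ^+ k)^-1 \in Qq.
Proof. by rewrite rpredV. Qed.

Let ord_pX k : ord (p%:R ^+ k) = (k%:R)%:E.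
Proof. by rewrite (ordX hord k ord_p) mulr1. Qed.

Lemma exp_sub1 j : exists q, ((p ^ j).-1 = q * p.-1)%N /\ (j <= q)%N /\ ((1 < j)%N -> (j < q)%N).
Proof.
elim: j => [|j [q [Eq [leq ltq]]]]; first by exists 0%N.
have p0 : (0 < p ^ j)%N by rewrite expn_gt0 ltnW.
exists (q * p + 1)%N; split; first by rewrite expnS; nia.
by split; nia.
Qed.

(** The Artin-Hasse equation times [p / ppi] expresses [pit^ram] as [-p] plus an infinite tail, an
    Eisenstein equation only approximately. It rewrites [pit^k] through [p] times a lower power and
    through much higher powers; hence a double induction, on the missing precision [t] and on
    [k]. *)
Lemma pit_dense (t : nat) (N : R) k : N <= k%:R / ram%:R + t%:R -> U N (pit ^+ k).
Proof.
elim: t N k => [|t IHt] N k; first by rewrite addr0 => h; apply: Usmall; rewrite ord_pitX lee_fin.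
elim: k {-2}k (leqnn k) N => [|k0 IHk] k lek N hN.
  by exists (pit ^+ k); rewrite ?subrr ?(vord0 hord) ?leey //; apply: Wpit; apply: leq_ltn_trans lek ram_gt0.
have [lt|ge] := ltnP k ram.
  by exists (pit ^+ k); rewrite ?subrr ?(vord0 hord) ?leey //; apply: Wpit.
have [cv ordpi] := hpi; pose x := pit ^+ (k - ram).
have [J HJ] := cv (N + (p%:R - 1)^-1).
have {HJ} := HJ (J + 2)%N (leq_addr _ _); rewrite subr0 => HJ.
have ppi0 : ppi != 0 by rewrite -hpit expf_neq0 ?pit_neq0.
have Ek : pit ^+ k = - (p%:R * x) + - (\sum_(j < J) (p%:R ^+ j.+1)^-1 * (x * ppi ^+ (p ^ j.+2).-1))
    + p%:R * (x * (ppi^-1 * AH_partial p ppi (J + 2))).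
  rewrite /AH_partial addn2 2!big_ord_recl /= expn0 expr1 expr0 divr1 expn1 expr1.
  have -> : pit ^+ k = x * ppi ^+ p.-1.
    by rewrite /x -hpit -exprM -exprD subnK.
  have -> : ppi^-1 * (ppi + (ppi ^+ p / p%:R + \sum_(i < J) ppi ^+ (p ^ bump 0 (bump 0 i)) / p%:R ^+ (bump 0 (bump 0 i)))) =
      1 + ppi ^+ p.-1 / p%:R + \sum_(j < J) ppi ^+ (p ^ j.+2).-1 / p%:R ^+ j.+2.
    rewrite !mulrDr mulVf // addrA; congr (_ + _ + _).
      rewrite -{1}(prednK (prime_gt0 hp)) exprS mulrA mulrA mulVf // mul1r //.
    rewrite mulr_sumr; apply: eq_bigr => j _; rewrite /bump /= !add1n.
    have -> : ppi ^+ (p ^ j.+2) = ppi * ppi ^+ (p ^ j.+2).-1.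
      by rewrite -exprS prednK // expn_gt0 prime_gt0.
    by rewrite !mulrA mulVf // mul1r.
  rewrite !mulrDr mulr1 !mulr_sumr.
  have -> : p%:R * (x * (ppi ^+ p.-1 / p%:R)) = x * ppi ^+ p.-1.
    by field; exact: p_neq0.
  have -> : \sum_(j < J) p%:R * (x * (ppi ^+ (p ^ j.+2).-1 / p%:R ^+ j.+2)) =
      \sum_(j < J) (p%:R ^+ j.+1)^-1 * (x * ppi ^+ (p ^ j.+2).-1).
    apply: eq_bigr => j _; rewrite [p%:R ^+ j.+2]exprS; have pn := p_neq0.
    have pj : p%:R ^+ j.+1 != 0 :> K by rewrite expf_neq0.
    by field; rewrite pn pj.
  by set S := \sum_(j < J) _; ring.
have kr : (k - ram)%:R / ram%:R = k%:R / ram%:R - 1 :> R.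
  by rewrite natrB // mulrBl divff // lt0r_neq0.
rewrite Ek; apply: UD; first apply: UD.
- rewrite -mulNr; have -> : N = (N - 1) + 1 by rewrite subrK.
  apply: UM; rewrite ?rpredN ?rpred_nat ?(ordN hord) ?ord_p //.
  apply: (IHk (k - ram)%N); first by have := ram_gt0; lia.
  by rewrite kr -natr1; move: hN; rewrite -natr1; lra.
- rewrite -sumrN; apply: USum => j _; rewrite -mulNr.
  have -> : N = (N + j.+1%:R) + - j.+1%:R by rewrite addrK.
  apply: UM; first by rewrite rpredN pVQ.
    by rewrite (ordN hord); apply: (ordV hord); apply: ord_pX.
  (* [q >= j + 3] exceeds the denominator [p^(j+1)] by 2 in valuation; one unit pays for the factor
     [pit^ram] taken out, the other lowers [t]. *)
  have [q [Eq [_ /(_ isT) ltq]]] := exp_sub1 j.+2.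
  rewrite /x -hpit -exprM -exprD; apply: IHt.
  rewrite natrD mulrDl kr Eq mulnCA -/ram natrM mulfK ?lt0r_neq0 //.
  have : j.+3%:R <= q%:R :> R by rewrite ler_nat.
  by move: hN; rewrite -!natr1; lra.
- apply: Usmall; rewrite !(ordM hord) ord_p (ordV hord ordpi) ord_pitX.
  have kk : (0 : R) <= (k - ram)%:R / ram%:R by rewrite divr_ge0 ?ler0n.
  move: HJ; case: (ord _) => [z| |] //=; last by move=> _; apply: leey.
  by rewrite lee_fin => h; rewrite -!EFinD lee_fin; lra.
Qed.

(** Every element is a limit of elements of [W], which is closed, being a finite-dimensional
    subspace. *)
Lemma digits (x : K) : exists c : 'I_ram -> K, (forall i, c i \in Qq) /\ x = \sum_i c i * pit ^+ i.
Proof.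
apply: WP.
have Ux (N : R) : U N x.
  have : x \in <<Qq; pit>>%VS by rewrite hK memvf.
  move=> /Fadjoin_polyP[P PQ ->]; rewrite horner_coef; apply: USum => i _.
  have ci : P`_i \in Qq by apply/polyOverP.
  have [->|nz] := eqVneq P`_i 0; first by rewrite mul0r; apply: Usmall; rewrite (vord0 hord) leey.
  have [m Em] := Qq_ord ci nz; rewrite -[N](subrK m%:~R); apply: UM => //.
  pose t := Num.bound `|N - m%:~R|; apply: (@pit_dense t).
  have : N - m%:~R <= t%:R.
    apply: le_trans (ler_norm _) (ltW _).
    by have := archi_boundP (normr_ge0 (N - m%:~R)); rewrite /t /Num.bound normr_id.
  have : (0 : R) <= i%:R / ram%:R by rewrite divr_ge0 ?ler0n.
  lra.
have /choice[u Hu] : forall k : nat, exists w, w \in W /\ ((k%:R : R)%:E <= ord (x - w)%R)%E.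
  by move=> k; have [w] := Ux k%:R; exists w.
have nat_ge (N : R) : exists k : nat, N <= k%:R.
  exists (Num.bound `|N|); apply: le_trans (ler_norm _) (ltW _).
  by have := archi_boundP (normr_ge0 N); rewrite /Num.bound normr_id.
have hu (N : R) : exists m0, forall m, (m0 <= m)%N -> (N%:E <= ord (x - u m)%R)%E.
  have [k lek] := nat_ge N; exists k => m le; apply: le_trans (Hu m).2.
  by rewrite lee_fin; apply: le_trans lek _; rewrite ler_nat.
have cu : val_cauchy ord u.
  move=> N; have [m0 Hm] := hu N; exists m0 => m m' le le'.
  by have := ordB hord (Hm _ le') (Hm _ le); rewrite opprB addrC addrA subrK.
have [l lW Hl] := subspace_closed hord hQp (fun k => (Hu k).1) cu.
suff -> : x = l by [].
apply/eqP; rewrite -subr_eq0; apply/eqP/(ord_eq0 hord) => N.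
have [m1 H1] := hu N; have [m2 H2] := Hl N.
have := ordD hord (H1 _ (leq_maxl m1 m2)) (H2 _ (leq_maxr m1 m2)).
by rewrite addrA subrK.
Qed.

Let digit_ge0 (c : 'I_ram -> K) i : (forall i, c i \in Qq) ->
  (0 <= ord (\sum_i c i * pit ^+ i)%R)%E -> (0 <= ord (c i))%E.
Proof.
move=> cQ /(digits_ge cQ)/(_ i); rewrite (ordM hord) ord_pitX.
have [->|nz] := eqVneq (c i) 0; first by rewrite (vord0 hord) leey.
have [m ->] := Qq_ord (cQ i) nz; rewrite -EFinD !lee_fin ler0z => h.
have : -1 < m%:~R :> R.
  have : i%:R / ram%:R < 1 :> R by rewrite ltr_pdivrMr // mul1r ltr_nat.
  lra.
by rewrite -[-1]/((-1)%:~R) ltr_int; lia.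
Qed.

(** The digits of an element of nonnegative valuation have integral valuation greater than -1. *)
Lemma integral_adjoin (x : K) : Zq_adjoin Qq ord pit x <-> (0 <= ord x)%E.
Proof.
split=> [[P [PZ ->]]|h].
  rewrite horner_coef; apply: (ord_sum hord) => i _; rewrite (ordM hord) ord_pitX.
  by have [_ h] := PZ i; apply: adde_ge0.
have [c [cQ Ex]] := digits x; rewrite Ex in h.
exists (\poly_(i < ram) (if insub i is Some j then c j else 0)); split=> [i|].
  rewrite coef_poly; case: ifP => _; last by split; rewrite ?mem0v ?(vord0 hord) ?leey.
  case: insubP => [j _ _|_]; last by split; rewrite ?mem0v ?(vord0 hord) ?leey.
  by split=> //; apply: digit_ge0 h.
by rewrite horner_poly Ex; apply: eq_bigr => i _; rewrite valK.
Qed.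

Lemma ord_values (x : K) : x != 0 -> exists z : int, ord x = (z%:~R / ram%:R)%:E.
Proof.
move=> x0; have [r Er] := ord_fin hord x0; have [c [cQ Ex]] := digits x.
have ge i : (r%:E <= ord (c i * pit ^+ i)%R)%E.
  by move: i; apply: digits_ge => //; rewrite -Ex Er.
have [i Ei] : exists i, ord (c i * pit ^+ i) = r%:E.
  apply: contrapT => /forallNP h.
  have : (r%:E < ord x)%E.
    rewrite Ex; apply: (ord_sum_lt hord); first exact: ltry.
    by move=> i _; rewrite lt_neqAle ge andbT eq_sym; apply/eqP.
  by rewrite Er ltxx.
move: Ei; rewrite (ordM hord) ord_pitX.
have [->|nz] := eqVneq (c i) 0; first by rewrite (vord0 hord).
have [m ->] := Qq_ord (cQ i) nz; rewrite -EFinD => Ei.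
exists (m * ram%:Z + i%:Z); rewrite Er -Ei; congr EFin.
by rewrite intrD intrM mulrDl -!pmulrn mulfK // lt0r_neq0.
Qed.

Lemma ord_gt0_ge (x : K) : (0 < ord x)%E -> ((ram%:R^-1)%:E <= ord x)%E.
Proof.
have [->|/ord_values[z ->]] := eqVneq x 0; first by rewrite (vord0 hord) leey.
rewrite lte_fin lee_fin pmulr_lgt0 ?invr_gt0 // ltr0z => z0.
by rewrite -[X in X <= _]mul1r ler_pM2r ?invr_gt0 // (_ : 1 = 1%:~R) // ler_int.
Qed.

(** Only the digit of index 0 counts modulo [pit], and it lies in [Zq]: the residue field does not
    grow. *)
Lemma residue_ex (x : K) : (0 <= ord x)%E -> exists c, (0 < ord (x - tau c)%R)%E.
Proof.
move=> h; have [c [cQ Ex]] := digits x; rewrite Ex in h.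
pose i0 := Ordinal ram_gt0; exists (red (c i0)).
have [_ redD red0 _] := hred.
have [[tQ t0] redt _] := htau (red (c i0)).
have cZ : Zq Qq ord (c i0) by split=> //; apply: digit_ge0 h.
rewrite Ex (bigD1 i0) //= expr0 mulr1 addrAC; apply: (ordD_lt hord).
  apply/red0; first by split; [rewrite rpredB | apply: (ordB hord); [case: cZ|]].
  have ZB : Zq Qq ord (c i0 - tau (red (c i0))).
    by split; [rewrite rpredB | apply: (ordB hord); [case: cZ|]].
  have [] := redD _ _ ZB (conj tQ t0); rewrite subrK redt => E0 _.
  by apply/eqP; rewrite -(inj_eq (addIr (red (c i0)))) add0r -E0.
apply: (ord_sum_lt hord) => // i ni; rewrite (ordM hord) ord_pitX.
have i1 : (0 < i)%N by rewrite lt0n; apply: contraNneq ni => E0; apply/eqP/val_inj.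
apply: (@lt_le_trans _ _ (i%:R / ram%:R)%:E); first by rewrite lte_fin divr_gt0 ?ltr0n ?ram_gt0.
rewrite -[X in (X <= _)%E]add0e; apply: leeD => //; exact: digit_ge0 h.
Qed.

Lemma ord_tau c : (0 <= ord (tau c))%E.
Proof. by have [[]] := htau c. Qed.

Lemma tau_inj_res c c' : (0 < ord (tau c - tau c')%R)%E -> c = c'.
Proof.
move=> h; have [[tQ t0] redt _] := htau c; have [[tQ' t0'] redt' _] := htau c'.
have ZB : Zq Qq ord (tau c - tau c') by split; [rewrite rpredB | exact: ltW].
have [_ redD red0 _] := hred.
have [] := redD _ _ ZB (conj tQ' t0'); rewrite subrK redt redt' => -> _.
by rewrite ((red0 _ ZB).2 h) add0r.
Qed.

(** [red] is controlled on [Zq] only; [res] extends the reduction to all integers of [K] through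
    Teichmueller representatives. *)
Definition res (x : K) : Fq := xget 0 [set c | (0 < ord (x - tau c)%R)%E].

Lemma resP x : (0 <= ord x)%E -> (0 < ord (x - tau (res x))%R)%E.
Proof.
move=> /residue_ex[c Hc].
exact: (@xgetPex _ 0 [set c | (0 < ord (x - tau c)%R)%E] (ex_intro _ c Hc)).
Qed.

Lemma res_eq x c : (0 <= ord x)%E -> (0 < ord (x - tau c)%R)%E -> res x = c.
Proof.
move=> /resP h1 h2; apply: tau_inj_res.
rewrite (_ : _ - _ = (x - tau c) - (x - tau (res x))); last by ring.
by apply: (ordD_lt hord); rewrite ?(ordN hord).
Qed.

Let tauM_res x y c : (0 <= ord x)%E -> (0 <= ord y)%E -> red (tau (res x) * tau (res y)) = c ->
  res (x * y) = c.
Proof.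
move=> hx hy E0; have := resP hx; have := resP hy; set cx := res x in E0 *; set cy := res y in E0 *.
move=> hy' hx'; apply: res_eq; first by rewrite (ordM hord) adde_ge0.
have [[txQ tx] _ _] := htau cx; have [[tyQ ty] _ _] := htau cy; have [[tQ t0] redt _] := htau c.
have Zp : Zq Qq ord (tau cx * tau cy) by split; [rewrite rpredM | rewrite (ordM hord) adde_ge0].
have ZB : Zq Qq ord (tau cx * tau cy - tau c).
  by split; [rewrite rpredB //; case: Zp | apply: (ordB hord) => //; case: Zp].
rewrite (_ : _ - _ = x * (y - tau cy) + (x - tau cx) * tau cy + (tau cx * tau cy - tau c)); last by ring.
apply: (ordD_lt hord); first apply: (ordD_lt hord); rewrite ?(ordM hord).
- by apply: lt_le_trans hy' _; rewrite -[X in (X <= _)%E]add0e; apply: leeD.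
- by apply: lt_le_trans hx' _; rewrite -[X in (X <= _)%E]adde0; apply: leeD.
have [_ redD red0 _] := hred; apply/red0 => //.
have [] := redD _ _ ZB (conj tQ t0); rewrite subrK E0 redt => E1 _.
by apply/eqP; rewrite -(inj_eq (addIr c)) add0r -E1.
Qed.

Lemma resM x y : (0 <= ord x)%E -> (0 <= ord y)%E -> res (x * y) = res x * res y.
Proof.
move=> hx hy; apply: tauM_res => //.
have [_ redD _ _] := hred; have [Zx rx _] := htau (res x); have [Zy ry _] := htau (res y).
by have [_ ->] := redD _ _ Zx Zy; rewrite rx ry.
Qed.

Lemma resD x y : (0 <= ord x)%E -> (0 <= ord y)%E -> res (x + y) = res x + res y.
Proof.
move=> hx hy; have := resP hx; have := resP hy; set cx := res x; set cy := res y.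
move=> hy' hx'; apply: res_eq; first exact: (ordD hord).
have [_ redD red0 _] := hred; have [Zx rx _] := htau cx; have [Zy ry _] := htau cy.
have [Zt rt _] := htau (cx + cy).
have ZS : Zq Qq ord (tau cx + tau cy).
  by case: Zx Zy => ? ? [? ?]; split; [rewrite rpredD | apply: (ordD hord)].
have ZB : Zq Qq ord (tau cx + tau cy - tau (cx + cy)).
  by case: ZS Zt => ? ? [? ?]; split; [rewrite rpredB | apply: (ordB hord)].
rewrite (_ : _ - _ = (x - tau cx) + (y - tau cy) + (tau cx + tau cy - tau (cx + cy))); last by ring.
apply: (ordD_lt hord); first exact: (ordD_lt hord).
apply/red0 => //; have [] := redD _ _ ZB Zt; rewrite subrK rt (redD _ _ Zx Zy).1 rx ry => E1 _.
by apply/eqP; rewrite -(inj_eq (addIr (cx + cy))) add0r -E1.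
Qed.

Lemma res0P x : (0 <= ord x)%E -> (res x = 0 <-> (0 < ord x)%E).
Proof.
move=> hx; have [[tQ t0] redt _] := htau 0; have [_ redD red0 _] := hred.
have t0' : (0 < ord (tau 0%R))%E by apply/red0.
split=> [E0|h]; last by apply: res_eq => //; apply: (ordD_lt hord); rewrite ?(ordN hord).
by have := resP hx; rewrite E0 => h; rewrite -[x](subrK (tau 0)); apply: (ordD_lt hord).
Qed.

Lemma res_tau c : res (tau c) = c.
Proof. by apply: res_eq; rewrite ?ord_tau // subrr (vord0 hord). Qed.

Lemma res_int (z : int) : res z%:~R = z%:~R.
Proof.
have r1 : res 1 = 1.
  apply: res_eq; first by rewrite (vord1 hord).
  have [red1 redD red0 _] := hred; have [Zt rt _] := htau 1.
  have Z1 : Zq Qq ord 1 by split; rewrite ?rpred1 ?(vord1 hord).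
  have ZB : Zq Qq ord (1 - tau 1).
    by case: Zt => ? ?; split; [rewrite rpredB ?rpred1 | apply: (ordB hord); rewrite ?(vord1 hord)].
  apply/red0 => //; have [] := redD _ _ ZB Zt; rewrite subrK rt red1 => E1 _.
  by apply/eqP; rewrite -(inj_eq (addIr 1)) add0r -E1.
have r0 : res 0 = 0 by apply/res0P; rewrite (vord0 hord) ?leey.
have nat k : res k%:R = k%:R.
  elim: k => [|k IH]; first exact: r0.
  by rewrite -natr1 resD ?(ord_nat hord) ?(vord1 hord) // IH r1 natr1.
case: z => k; first exact: nat.
have := @resD (Negz k)%:~R k.+1%:R (ord_int hord _) (ord_nat hord _).
rewrite NegzE mulrNz addNr r0 nat => E0.
by rewrite mulrNz; apply/eqP; rewrite -addr_eq0 eq_sym; apply/eqP; exact: E0.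
Qed.

End Ramification.

End PadicField.

(** * Lifting exactness, generation and independence from the reduction *)

Module ReductionLifting.
From mathcomp Require Import all_boot all_order all_algebra falgebra fieldext.
From mathcomp Require Import finmap.
From mathcomp Require Import all_classical all_reals all_analysis.
From mathcomp Require Import ring lra zify.
Import Defs PadicField KoszulComplex ToricJacobian.
Import Order.TTheory GRing.Theory Num.Theory.
Local Open Scope classical_set_scope.
Local Open Scope ring_scope.

Section Lift.
Variables (R : realType) (K : fieldType) (ord : K -> \bar R).
Hypothesis hord : valuation ord.
Hypothesis complete : forall u, val_cauchy ord u -> exists l, val_cvg ord u l.
Variables (n s : nat).
Local Notation E := ('rV[int]_s * 'rV[int]_n)%type.
Implicit Types (e a : E) (y : E -> K) (l : 'I_n) (T : {set 'I_n}).
Variables (pit : K) (o : R).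
Hypothesis o_gt0 : 0 < o.
Hypothesis ord_pit : ord pit = o%:E.
Variables (MG : 'rV[int]_s -> Prop) (wG : 'rV[int]_s -> nat).
Variables (M : 'rV[int]_n -> Prop) (wd : 'rV[int]_n -> nat).
Hypothesis MG0 : MG 0.
Hypothesis MGD : forall u v, MG u -> MG v -> MG (u + v).
Hypothesis wG0 : wG 0 = 0%N.
Hypothesis wGD : forall u v, MG u -> MG v -> (wG (u + v) <= wG u + wG v)%N.
Hypothesis M0 : M 0.
Hypothesis MD : forall u v, M u -> M v -> M (u + v).
Hypothesis wd0 : wd 0 = 0%N.
Hypothesis wdD : forall u v, M u -> M v -> (wd (u + v) <= wd u + wd v)%N.

Definition Mt e : Prop := MG e.1 /\ M e.2.
Definition Wt e : nat := (wG e.1 + wd e.2)%N.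

Lemma MtD e a : Mt e -> Mt a -> Mt (e + a).
Proof. by move=> [h1 h2] [h3 h4]; split; [apply: MGD | apply: MD]. Qed.

Lemma WtD e a : Mt e -> Mt a -> (Wt (e + a)%R <= Wt e + Wt a)%N.
Proof.
move=> [h1 h2] [h3 h4]; rewrite /Wt /= addnACA.
by apply: leq_add; [apply: wGD | apply: wdD].
Qed.

(** The valuation of [pi^W(e)]; the value [+oo] makes [bd] force the coefficients outside the cones
    to vanish. *)
Definition om e : \bar R := if `[< Mt e >] then ((Wt e)%:R * o)%:E else +oo%E.

Lemma omE e : Mt e -> om e = ((Wt e)%:R * o)%:E.
Proof. by move=> h; rewrite /om asboolT. Qed.

Lemma omNE e : ~ Mt e -> om e = +oo%E.
Proof. by move=> h; rewrite /om asboolF. Qed.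

Lemma om_ge0 e : (0%:E <= om e)%E.
Proof. by rewrite /om; case: ifP => _; rewrite ?leey // lee_fin mulr_ge0 ?ler0n ?ltW. Qed.

Lemma omD e a : (om e <= om a + om (e - a)%R)%E.
Proof.
have [h1|h1] := pselect (Mt a); last by rewrite (omNE h1) addye ?leey //; case: (om _) (om_ge0 (e - a)%R).
have [h2|h2] := pselect (Mt (e - a)%R); last by rewrite (omNE h2) (omE h1) leey.
have h3 : Mt e by rewrite -[e](subrK a); apply: MtD.
rewrite !omE // -EFinD lee_fin -mulrDl ler_pM2r // -natrD ler_nat addnC.
by have := WtD h2 h1; rewrite subrK.
Qed.

Lemma omD2 (N N' : R) e a c1 c2 : (N%:E + om a <= c1)%E -> (N'%:E + om (e - a)%R <= c2)%E ->
  ((N + N')%:E + om e <= c1 + c2)%E.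
Proof.
move=> h1 h2; apply: le_trans (leeD h1 h2); rewrite EFinD addeACA leeD2l //; exact: omD.
Qed.

Definition bd (N : R) y : Prop := forall e, (N%:E + om e <= ord (y e))%E.
(** [C0] in flattened form, one coefficient per pair of exponents, the two nested convergence
    conditions becoming a single one; see [C0P]. *)
Definition X y : Prop := bd 0 y /\ forall N : R, finite_set [set e | (ord (y e) < N%:E + om e)%E].

Variable G0 : E -> K.
Definition gl l a : K := (a.2 ord0 l)%:~R * G0 a.
Hypothesis g_bd : forall l, bd 0 (gl l).
Hypothesis g_fin : forall l (N : R), finite_set [set a | (ord (gl l a) < N%:E + om a)%E].

Definition dl l y : E -> K := fun e =>
  (e.2 ord0 l)%:~R * y e + vsum ord (fun a => gl l a * y (e - a)%R).

Lemma conv_tends0 l y e N : bd N y -> tends0 setT (fun a => ord (gl l a * y (e - a)%R)).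
Proof.
move=> by_ N'; apply: sub_finite_set (g_fin l (N' - N)) => a [_ /= lt].
rewrite ltNge; apply/negP => h; move: lt; rewrite ltNge => /negP; apply.
rewrite (ordM hord); apply: le_trans (omD2 h (by_ (e - a)%R)); rewrite subrK.
by rewrite -[X in (X <= _)%E]adde0 leeD2l // om_ge0.
Qed.

Lemma conv_has l y e N : bd N y ->
  has_vsum ord (fun a => gl l a * y (e - a)%R) (vsum ord (fun a => gl l a * y (e - a)%R)).
Proof. by move=> h; apply: has_vsumP => //; apply: (conv_tends0 l e h). Qed.

Lemma dl_bd l N y : bd N y -> bd N (dl l y).
Proof.
move=> h e; apply: (ordD hord).
  rewrite (ordM hord); apply: le_trans (h e) _; rewrite -[X in (X <= _)%E]add0e leeD2r //.
  exact: ord_int.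
apply: (vsum_ge hord complete (conv_tends0 l e h)) => a.
by rewrite (ordM hord) -[N]add0r; apply: omD2; [apply: g_bd | apply: h].
Qed.

Lemma dl_approx l N N' y (J : {fset E}) e : bd N y ->
  (forall a, a \notin J -> (N'%:E + om a <= ord (gl l a))%E) ->
  ((N' + N)%:E + om e <= ord (dl l y e - ((e.2 ord0 l)%:~R * y e + \sum_(a <- J) gl l a * y (e - a)))%R)%E.
Proof.
move=> h hJ; rewrite /dl opprD addrACA subrr add0r.
apply: (vsum_approx hord complete (conv_tends0 l e h)) => a /hJ h1.
by rewrite (ordM hord); apply: omD2 h1 (h _).
Qed.

Lemma dlD l y y' N : bd N y -> bd N y' -> dl l (fun e => y e + y' e) = fun e => dl l y e + dl l y' e.
Proof.
move=> h h'; apply: funext => e; rewrite /dl mulrDr addrACA; congr (_ + _).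
apply: (vsumE hord); have := has_vsumD hord (conv_has l e h) (conv_has l e h').
by congr has_vsum; apply: funext => a; rewrite mulrDr.
Qed.

Lemma dlZ l y c N : bd N y -> dl l (fun e => c * y e) = fun e => c * dl l y e.
Proof.
move=> h; apply: funext => e; rewrite /dl mulrDr; congr (_ + _); first by rewrite mulrCA.
apply: (vsumE hord); have := has_vsumZ hord c (conv_has l e h).
by congr has_vsum; apply: funext => a; rewrite mulrCA.
Qed.

Lemma X_bd y : X y -> bd 0 y. Proof. by case. Qed.

Lemma dl_X l y : X y -> X (dl l y).
Proof.
move=> [h fin]; split=> [|N]; first exact: dl_bd.
pose J1 := [set e | (ord (y e) < N%:E + om e)%E].
pose J2 := [set a | (ord (gl l a) < N%:E + om a)%E].
apply: (@sub_finite_set _ _ (J1 `|` [set z.1 + z.2 | z in J2 `*` J1])); last first.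
  by rewrite finite_setU; split; [exact: fin | apply: finite_image; apply: finite_setX; [exact: g_fin | exact: fin]].
move=> e /= lt; apply: contrapT => /not_orP[n1 n2]; move: lt; rewrite ltNge => /negP; apply.
have {}n1 : (N%:E + om e <= ord (y e))%E by rewrite leNgt; apply/negP.
apply: (ordD hord).
  by rewrite (ordM hord); apply: le_trans n1 _; rewrite -[X in (X <= _)%E]add0e leeD2r // ord_int.
apply: (vsum_ge hord complete (conv_tends0 l e h)) => a; rewrite (ordM hord).
have [lt1|ge1] := ltP (ord (gl l a)) (N%:E + om a)%E; last by rewrite -[N]addr0; apply: omD2 ge1 (h _).
have [lt2|ge2] := ltP (ord (y (e - a)%R)) (N%:E + om (e - a)%R)%E; last first.
  by rewrite -[N]add0r; apply: omD2 ge2; apply: g_bd.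
by case: n2; exists (a, e - a) => //=; rewrite addrC subrK.
Qed.

Lemma bdD N y y' : bd N y -> bd N y' -> bd N (fun e => y e + y' e).
Proof. by move=> h h' e; apply: (ordD hord). Qed.

Lemma XD y y' : X y -> X y' -> X (fun e => y e + y' e).
Proof.
move=> [h fin] [h' fin']; split=> [|N]; first exact: bdD.
apply: (@sub_finite_set _ _ ([set e | (ord (y e) < N%:E + om e)%E] `|` [set e | (ord (y' e) < N%:E + om e)%E])).
  move=> e /= lt; apply: contrapT => /not_orP[/= n1 n2]; move: lt; rewrite ltNge => /negP; apply.
  by apply: (ordD hord); rewrite leNgt; apply/negP.
by rewrite finite_setU.
Qed.

Lemma XZ c y : (0 <= ord c)%E -> X y -> X (fun e => c * y e).
Proof.
move=> c0 [h fin].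
have le e : (ord (y e) <= ord (c * y e)%R)%E.
  by rewrite (ordM hord) -[X in (X <= _)%E]add0e leeD2r.
split=> [e|N]; first exact: le_trans (h e) (le e).
by apply: sub_finite_set (fin N) => e /=; apply: le_lt_trans.
Qed.

Lemma X0 : X (fun=> 0).
Proof.
split=> [e|N]; first by rewrite (vord0 hord) leey.
apply: (@sub_finite_set _ _ set0) => // e /=; rewrite (vord0 hord) ltNge leey; by [].
Qed.

Lemma X_sum (I : Type) (r : seq I) (P : pred I) (F : I -> E -> K) :
  (forall i, P i -> X (F i)) -> X (fun e => \sum_(i <- r | P i) F i e).
Proof.
move=> H; elim: r => [|i r IH].
  by have := X0; congr X; apply: funext => e; rewrite big_nil.
have [Pi|nPi] := boolP (P i).
  by have := XD (H i Pi) IH; congr X; apply: funext => e; rewrite big_cons Pi.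
by move: IH; congr X; apply: funext => e; rewrite big_cons (negPf nPi).
Qed.

Lemma XN y : X y -> X (fun e => - y e).
Proof. by move=> [h fin]; split=> [e|N]; [rewrite (ordN hord)|have := fin N; congr finite_set; apply/funext => e /=; rewrite (ordN hord)]. Qed.

Lemma dl_sum l (I : Type) (r : seq I) (P : pred I) (F : I -> E -> K) :
  (forall i, P i -> X (F i)) ->
  dl l (fun e => \sum_(i <- r | P i) F i e) = fun e => \sum_(i <- r | P i) dl l (F i) e.
Proof.
move=> H; elim: r => [|i r IH].
  have := dlZ l 0 (X_bd X0); congr (_ = _).
    by congr dl; apply: funext => e; rewrite big_nil mul0r.
  by apply: funext => e; rewrite big_nil mul0r.
have [Pi|nPi] := boolP (P i).
  have := dlD l (X_bd (H i Pi)) (X_bd (X_sum r H)); rewrite IH; congr (_ = _).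
    by congr dl; apply: funext => e; rewrite big_cons Pi.
  by apply: funext => e; rewrite big_cons Pi.
move: IH; congr (_ = _); last by apply: funext => e; rewrite big_cons (negPf nPi).
by congr dl; apply: funext => e; rewrite big_cons (negPf nPi).
Qed.

(* Modulo any [N], both operators are given by one finite sum of multipliers. *)
Lemma dl_comm l l' y : bd 0 y -> dl l (dl l' y) = dl l' (dl l y).
Proof.
move=> h; apply: funext => e; apply/eqP; rewrite -subr_eq0; apply/eqP/(ord_eq0 hord) => N.
pose J := (fset_set [set a | (ord (gl l a) < N%:E + om a)%E] `|`
           fset_set [set a | (ord (gl l' a) < N%:E + om a)%E])%fset.
have J1 a : a \notin J -> (N%:E + om a <= ord (gl l a))%E.
  rewrite in_fsetU negb_or => /andP[+ _]; rewrite in_fset_set; last exact: g_fin.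
  by move=> /negP h1; rewrite leNgt; apply/negP => lt; apply: h1; rewrite inE.
have J2 a : a \notin J -> (N%:E + om a <= ord (gl l' a))%E.
  rewrite in_fsetU negb_or => /andP[_ +]; rewrite in_fset_set; last exact: g_fin.
  by move=> /negP h1; rewrite leNgt; apply/negP => lt; apply: h1; rewrite inE.
pose fl l0 z e0 := (e0.2 ord0 l0)%:~R * z e0 + \sum_(a <- J) gl l0 a * z (e0 - a).
have comp l1 l2 : (forall a, a \notin J -> (N%:E + om a <= ord (gl l1 a))%E) ->
    (forall a, a \notin J -> (N%:E + om a <= ord (gl l2 a))%E) ->
    (N%:E + om e <= ord (dl l1 (dl l2 y) e - fl l1 (fl l2 y) e)%R)%E.
  move=> hJ1 hJ2; rewrite -[dl l1 _ e](subrK (fl l1 (dl l2 y) e)) -addrA; apply: (ordD hord).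
    by rewrite -[N]addr0; apply: dl_approx => //; apply: dl_bd.
  have h2 e0 : (N%:E + om e0 <= ord (dl l2 y e0 - fl l2 y e0)%R)%E.
    by rewrite -[N]addr0; apply: dl_approx.
  rewrite /fl opprD addrACA -mulrBr -sumrB; apply: (ordD hord).
    by rewrite (ordM hord); apply: le_trans (h2 e) _; rewrite -[X in (X <= _)%E]add0e leeD2r // ord_int.
  apply: (ord_sum hord) => a _; rewrite -mulrBr (ordM hord) -[N]add0r; apply: omD2 (h2 _).
  exact: g_bd.
have Ef : fl l (fl l' y) e = fl l' (fl l y) e.
  rewrite /fl !mulrDr !mulr_sumr.
  under [X in _ + X = _]eq_bigr do rewrite mulrDr mulr_sumr.
  under [X in _ = _ + X]eq_bigr do rewrite mulrDr mulr_sumr.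
  rewrite !big_split /= -!addrA; congr (_ + _); first by rewrite mulrCA.
  rewrite !addrA; congr (_ + _); last first.
    rewrite exchange_big /=; apply: eq_bigr => a _; apply: eq_bigr => a' _.
    by rewrite mulrCA addrAC.
  rewrite -!big_split /=; apply: eq_bigr => a _; rewrite /gl !mxE !intrD !mulrNz.
  ring.
have := ordB hord (comp _ _ J1 J2) (comp _ _ J2 J1).
rewrite Ef opprB addrA subrK => h3; apply: le_trans h3.
by rewrite -[X in (X <= _)%E]adde0 leeD2l // om_ge0.
Qed.

Definition nab (w : {set 'I_n} -> E -> K) (T : {set 'I_n}) (e : E) : K :=
  \sum_(l in T) sgn K l T * dl l (w (T :\ l)%SET) e.

Lemma ord_sgn l T : ord (sgn K l T) = 0%E.
Proof. by rewrite /sgn -signr_odd; case: odd; rewrite ?expr1 ?expr0 ?(ordN hord) (vord1 hord). Qed.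

Lemma nab_bd N w : (forall T, bd N (w T)) -> forall T, bd N (nab w T).
Proof.
move=> h T e; apply: (ord_sum hord) => l _; rewrite (ordM hord) ord_sgn add0e.
exact: dl_bd.
Qed.

Lemma nab_X w : (forall T, X (w T)) -> forall T, X (nab w T).
Proof.
move=> h T; apply: X_sum => l _; apply: XZ; first by rewrite ord_sgn.
exact: dl_X.
Qed.

Lemma nabD w w' N : (forall T, bd N (w T)) -> (forall T, bd N (w' T)) -> forall T e,
  nab (fun T e => w T e + w' T e) T e = nab w T e + nab w' T e.
Proof.
move=> h h' T e; rewrite -big_split; apply: eq_bigr => l _ /=.
by rewrite (dlD l (h _) (h' _)) mulrDr.
Qed.

Lemma nabZ c w N : (forall T, bd N (w T)) -> forall T e,
  nab (fun T e => c * w T e) T e = c * nab w T e.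
Proof.
move=> h T e; rewrite mulr_sumr; apply: eq_bigr => l _.
by rewrite (dlZ l c (h _)) mulrCA.
Qed.

Hypothesis two_neq0 : 2%:R != 0 :> K.

(** Exchanging the two deleted indices shows that the double sum equals its opposite; then 2 is
    divided out. *)
Lemma nab_nab w : (forall T, X (w T)) -> forall T e, nab (nab w) T e = 0.
Proof.
move=> Xw T e; pose A l k := sgn K l T * (sgn K k (T :\ l)%SET * dl l (dl k (w (T :\ l :\ k)%SET)) e).
have EA : nab (nab w) T e = \sum_(l in T) \sum_(k in (T :\ l)%SET) A l k.
  apply: eq_bigr => l lT; rewrite -mulr_sumr; congr (_ * _).
  have Xk k : X (fun e => sgn K k (T :\ l)%SET * dl k (w (T :\ l :\ k)%SET) e).
    by apply: XZ; rewrite ?ord_sgn //; apply: dl_X.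
  apply: etrans (congr1 (fun g : E -> K => g e) (@dl_sum l _ _ (fun k => k \in (T :\ l)%SET)
    (fun k e => sgn K k (T :\ l)%SET * dl k (w (T :\ l :\ k)%SET) e) (fun k _ => Xk k))) _.
  apply: eq_bigr => k _.
  by rewrite (dlZ l _ (X_bd (dl_X k (Xw _)))).
have EA2 : nab (nab w) T e = \sum_(l in T) \sum_(k in T | k != l) A l k.
  rewrite EA; apply: eq_bigr => l _; apply: eq_bigl => k; by rewrite !inE andbC.
have : nab (nab w) T e = - nab (nab w) T e.
  rewrite {1}EA2 (exchange_big_dep (fun k => k \in T)) /=; last by move=> l k _ /andP[].
  rewrite EA2 -sumrN; apply: eq_bigr => l lT; rewrite -sumrN.
  apply: eq_big => [k|k /andP[kT /andP[lT' nkl]]].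
    by rewrite lT /= eq_sym; case: (k \in T).
  rewrite /A !mulrA sgn_swap2 // 1?eq_sym // mulNr; congr (- (_ * _)).
  have -> : (T :\ k :\ l)%SET = (T :\ l :\ k)%SET by apply/setP => x; rewrite !inE andbCA.
  by rewrite (dl_comm k l (X_bd (Xw _))).
move=> /eqP; rewrite -subr_eq0 opprK -mulr2n -mulr_natl mulf_eq0 (negPf two_neq0) /=.
by move=> /eqP.
Qed.

Variables (Fq : fieldType) (res : K -> Fq) (tau : Fq -> K).
Hypothesis gap : forall x, (0 < ord x)%E -> (o%:E <= ord x)%E.
Hypothesis resD : forall x x' : K, (0 <= ord x)%E -> (0 <= ord x')%E ->
  res (x + x') = res x + res x'.
Hypothesis resM : forall x x' : K, (0 <= ord x)%E -> (0 <= ord x')%E ->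
  res (x * x') = res x * res x'.
Hypothesis res0P : forall x, (0 <= ord x)%E -> (res x = 0 <-> (0 < ord x)%E).
Hypothesis res_tau : forall c, res (tau c) = c.
Hypothesis ord_tau : forall c, (0 <= ord (tau c))%E.
Hypothesis res_int : forall z : int, res z%:~R = z%:~R.

(** Reduction of a normalized coefficient. As [o] is the least positive valuation ([gap]), its
    vanishing means divisibility by [pit] in the weighted norm. *)
Definition rz e (z : K) : Fq := if `[< Mt e >] then res (z / pit ^+ Wt e) else 0.
Definition rs y e : Fq := rz e (y e).

Lemma pit_neq0' : pit != 0.
Proof. by apply: contra_eqN ord_pit => /eqP ->; rewrite (vord0 hord). Qed.

Lemma ord_div z k (c : R) : (c%:E <= ord (z / pit ^+ k)%R)%E = (c%:E + (k%:R * o)%:E <= ord z)%E.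
Proof.
rewrite (ordM hord) (ordV hord (ordX hord k ord_pit)).
case: (ord z) => [t| |]; rewrite -?EFinD ?lee_fin ?leey //; by rewrite lerBrDr.
Qed.

Lemma rz_int e z : Mt e -> (om e <= ord z)%E -> (0 <= ord (z / pit ^+ Wt e)%R)%E.
Proof. by move=> h; rewrite (omE h) ord_div add0e. Qed.

Lemma rz0P e z : (om e <= ord z)%E -> (rz e z = 0 <-> (o%:E + om e <= ord z)%E).
Proof.
rewrite /rz; case: asboolP => [h|h hz]; last first.
  by split=> // _; rewrite (omNE h) addey // -(omNE h).
move=> hz; rewrite res0P; last exact: rz_int.
rewrite (omE h) -ord_div; split=> [/gap//|]; apply: lt_le_trans; by rewrite lte_fin.
Qed.

Lemma rzD e z z' : (om e <= ord z)%E -> (om e <= ord z')%E -> rz e (z + z') = rz e z + rz e z'.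
Proof.
rewrite /rz; case: asboolP => [h hz hz'|_ _ _]; last by rewrite addr0.
by rewrite mulrDl resD //; apply: rz_int.
Qed.

Lemma rz_sum e (I : Type) (r : seq I) (P : pred I) (F : I -> K) :
  (forall i, P i -> (om e <= ord (F i))%E) ->
  rz e (\sum_(i <- r | P i) F i) = \sum_(i <- r | P i) rz e (F i).
Proof.
move=> H; elim: r => [|i r IH].
  rewrite !big_nil; apply/rz0P; rewrite (vord0 hord) leey //.
rewrite !big_cons; case: ifP => // Pi; rewrite rzD ?IH //; first exact: H.
exact: (ord_sum hord).
Qed.

Lemma rzZ e c z : (0 <= ord c)%E -> (om e <= ord z)%E -> rz e (c * z) = res c * rz e z.
Proof.
rewrite /rz; case: asboolP => [h hc hz|_ _ _]; last by rewrite mulr0.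
by rewrite -mulrA resM //; apply: rz_int.
Qed.

Let bd0 y e : bd 0 y -> (om e <= ord (y e))%E.
Proof. by move=> /(_ e); rewrite add0e. Qed.

Lemma res_sgn l T : res (sgn K l T) = sgn Fq l T.
Proof.
rewrite /sgn -signr_odd -[RHS]signr_odd; case: odd; rewrite ?expr1 ?expr0.
  by have := res_int (-1); rewrite !mulrNz !mulr1z.
by have := res_int 1; rewrite !mulr1z.
Qed.

Variables (f : 'rV[int]_n -> Fq) (d : nat) (sup : seq 'rV[int]_n).
Hypothesis usup : uniq sup.
Hypothesis d_gt0 : (0 < d)%N.
Hypothesis supM : forall nu, nu \in sup -> M nu /\ wd nu = d.
Hypothesis g_small : forall l a, ~ (a.1 = 0 /\ a.2 \in sup) -> (d <= wd a.2)%N ->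
  (o%:E + om a <= ord (gl l a))%E.
Hypothesis g_main : forall l nu, nu \in sup ->
  (o%:E + om ((0%R, nu) : E) <= ord (gl l (0%R, nu) - pit ^+ d * ((nu ord0 l)%:~R * tau (f nu)))%R)%E.
Local Notation Fo := (@Fo n M wd sup Fq f).
Local Notation Gr := (@Gr n M Fq).
Local Notation Jset := (@Jset n M wd sup Fq f).

(** All other contributions vanish: the derivation keeps the x-weight, multipliers of x-weight below
    [d] cannot lead from weight [m] to [m + d], the remaining multipliers outside [sup] are small by
    [g_small], and a product whose weights do not add gains a factor [pit]. *)
Lemma top_residue l y m : bd 0 y -> (forall e, rs y e != 0 -> (wd e.2 <= m)%N) ->
  forall e, (m + d <= wd e.2)%N -> rs (dl l y) e = Fo l (fun mu => rs y (e.1, mu)) e.2.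
Proof.
move=> by_ sy e le_e.
have z0 (x : 'rV[int]_s) : x - 0 = x by rewrite subr0.
have [Me|nMe] := pselect (Mt e); last first.
  rewrite /rs /rz asboolF // /ToricJacobian.Fo big_seq big1 // => nu ns; rewrite /Gx.
  case: ifP => [/asboolP[Mm _]|_]; last by rewrite mulr0.
  rewrite asboolF ?mulr0 // => -[/= h1 h2]; apply: nMe; split=> //.
  by rewrite -[e.2](subrK nu); apply: MD => //; have [] := supM ns.
pose J := [fset ((0, nu) : E) | nu in sup]%fset.
have small a : a \notin J -> (o%:E + om e <= ord (gl l a * y (e - a)%R)%R)%E.
  move=> aJ; rewrite (ordM hord).
  have [ge|lt] := leqP d (wd a.2).
    rewrite -(addr0 o); apply: omD2 (by_ _); apply: g_small => // -[E1 E2].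
    case/negP: aJ; apply/imfsetP; exists a.2 => //=.
    by rewrite -E1; case: (a).
  have [Ma|nMa] := pselect (Mt a); last first.
    have : ord (gl l a) = +oo%E by apply/eqP; rewrite -leye_eq -(omNE nMa); apply: bd0.
    move=> ->; rewrite addye ?leey //.
    by have [h _ _ _] := hord; apply: h.
  rewrite -(add0r o); apply: omD2; first exact: g_bd.
  apply/rz0P; first exact: bd0.
  apply/eqP/negPn/negP => nz; have le := sy _ nz.
  have [Mea|nMea] := pselect (Mt (e - a)); last by move: nz; rewrite /rz asboolF ?eqxx.
  have h1 := wdD Ma.2 Mea.2; have E1 : a.2 + (e - a).2 = e.2.
    by rewrite [(e - a).2]/(e.2 - a.2) addrC subrK.
  by rewrite E1 in h1; move: (leq_trans le_e (leq_trans h1 (leq_add (leqnn _) le))); lia.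
rewrite {1}/rs /dl rzD; first last.
- apply: (vsum_ge hord complete (conv_tends0 l e by_)) => a.
  by rewrite (ordM hord); have := omD2 (g_bd l a) (by_ (e - a)); rewrite addr0 add0e.
- rewrite (ordM hord); apply: le_trans (bd0 e by_) _.
  by rewrite -[X in (X <= _)%E]add0e leeD2r // ord_int.
rewrite (_ : rz e _ = 0) ?add0r; last first.
  rewrite rzZ ?ord_int //; last exact: bd0.
  suff -> : rz e (y e) = 0 by rewrite mulr0.
  by apply/eqP/negPn/negP => /sy; lia.
set V := vsum _ _; have hV := vsum_approx hord complete (conv_tends0 l e by_) small.
rewrite -/V in hV; rewrite -[V](subrK (\sum_(a <- J) gl l a * y (e - a))).
have tb a : (om e <= ord (gl l a * y (e - a)%R)%R)%E.
  by rewrite (ordM hord); have := omD2 (g_bd l a) (by_ (e - a)); rewrite addr0 add0e.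
have ole : (om e <= o%:E + om e)%E by rewrite -[X in (X <= _)%E]add0e leeD2r // lee_fin ltW.
rewrite rzD; first last.
- by apply: (ord_sum hord).
- exact: le_trans hV.
rewrite (_ : rz e _ = 0) ?add0r; last by apply/rz0P => //; apply: le_trans hV.
rewrite rz_sum // /ToricJacobian.Fo.
have -> : \sum_(a <- J) rz e (gl l a * y (e - a)) =
    \sum_(nu <- sup) rz e (gl l (0, nu) * y (e - (0, nu))).
  rewrite big_imfset /=; last by move=> x x' _ _ [].
  by rewrite undup_id.
rewrite big_seq [RHS]big_seq; apply: eq_bigr => nu ns; have [Mn wn] := supM ns.
have e_nu : e - (0, nu) = (e.1, e.2 - nu) :> E by case: (e) => u v; congr pair; rewrite /= subr0.
rewrite /Gx; case: ifP => [/asboolP[Mm Ew]|/asboolP nadm]; last first.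
  rewrite mulr0; apply/rz0P => //.
  have [Mm|nMm] := pselect (M (e.2 - nu)); last first.
    have nM : ~ Mt (e - (0, nu)) by rewrite e_nu => -[_ /=].
    have yo : ord (y (e - (0, nu))) = +oo%E by apply/eqP; rewrite -leye_eq -(omNE nM); apply: bd0.
    rewrite (ordM hord) yo addey ?leey //.
    by have [h _ _ _] := hord; apply: h.
  have Mea : Mt (e - (0, nu)) by rewrite e_nu; split=> //; case: Me.
  have M0n : Mt ((0, nu) : E) by split.
  rewrite (ordM hord); apply: le_trans (leeD (bd0 _ (g_bd l)) (bd0 _ by_)).
  rewrite !omE // -!EFinD lee_fin.
  have h : (Wt e < Wt ((0%R, nu) : E) + Wt (e - (0, nu))%R)%N.
    rewrite e_nu /Wt /= wG0; have := wdD Mm Mn; rewrite subrK.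
    have : wd e.2 <> (wd nu + wd (e.2 - nu))%N by move=> h; apply: nadm.
    lia.
  have : (Wt e)%:R + 1 <= (Wt ((0, nu) : E))%:R + (Wt (e - (0, nu))%R)%:R :> R.
    by rewrite natr1 -natrD ler_nat.
  by move=> h2; have := ler_wpM2r (ltW o_gt0) h2; rewrite !mulrDl mul1r; lra.
have Mea : Mt (e - (0, nu)) by rewrite e_nu; split=> //; case: Me.
rewrite /rs -e_nu -/(rs y _) /rz !asboolT //.
have -> : Wt e = (d + Wt (e - (0, nu))%R)%N by rewrite e_nu /Wt /= Ew wn addnCA.
have -> : gl l (0, nu) * y (e - (0, nu)) / pit ^+ (d + Wt (e - (0, nu))%R) =
    gl l (0, nu) / pit ^+ d * (y (e - (0, nu)) / pit ^+ Wt (e - (0, nu))%R).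
  by rewrite exprD invfM mulrACA.
have gi : (0 <= ord (gl l (0, nu) / pit ^+ d)%R)%E.
  have -> : d = Wt ((0, nu) : E) by rewrite /Wt /= wG0 wn.
  by apply: rz_int; [split | apply: bd0; apply: g_bd].
rewrite resM //; last by apply: rz_int => //; apply: bd0.
rewrite /rs /rz asboolT //; congr (_ * _).
have mi : (0 <= ord ((nu ord0 l)%:~R * tau (f nu)))%E.
  by rewrite (ordM hord) adde_ge0 ?ord_int.
have -> : (nu ord0 l)%:~R * f nu = res ((nu ord0 l)%:~R * tau (f nu)).
  by rewrite resM ?ord_int // res_int res_tau.
rewrite -[gl l (0, nu) / _](subrK ((nu ord0 l)%:~R * tau (f nu))).
have pd : pit ^+ d != 0 by rewrite expf_neq0 ?pit_neq0'.
have sm : (0 < ord (gl l (0, nu) / pit ^+ d - (nu ord0 l)%:~R * tau (f nu))%R)%E.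
  have -> : gl l (0, nu) / pit ^+ d - (nu ord0 l)%:~R * tau (f nu) =
      (gl l (0, nu) - pit ^+ d * ((nu ord0 l)%:~R * tau (f nu))) / pit ^+ d by field.
  apply: (@lt_le_trans _ _ o%:E); first by rewrite lte_fin.
  rewrite ord_div; have := g_main l ns; rewrite omE; last by split.
  by rewrite /Wt /= wG0 wn.
rewrite resD //; last exact: ltW.
by rewrite (res0P (ltW sm)).2 ?add0r.
Qed.

(** The test for 0 keeps the support, since [tau 0 = 0] is not among the assumptions of the
    section. *)
Definition lf (phi : E -> Fq) : E -> K := fun e => if phi e == 0 then 0 else tau (phi e) * pit ^+ Wt e.

Lemma lf_rs phi : (forall e, phi e != 0 -> Mt e) -> forall e, rs (lf phi) e = phi e.
Proof.
move=> hM e; rewrite /rs /rz /lf; case: asboolP => [Me|nMe].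
  have [->|nz] := eqVneq (phi e) 0.
    by rewrite mul0r; apply/res0P; rewrite (vord0 hord) ?leey.
  by rewrite mulfK ?res_tau // expf_neq0 ?pit_neq0'.
by apply/esym/eqP/negPn/negP => /hM.
Qed.

Lemma lf_X phi (fs : seq E) : (forall e, phi e != 0 -> e \in fs /\ Mt e) -> X (lf phi).
Proof.
move=> hM; split=> [e|N].
  rewrite /lf add0e; have [_|/hM[_ Me]] := eqVneq (phi e) 0; first by rewrite (vord0 hord) leey.
  rewrite (omE Me) (ordM hord) (ordX hord _ ord_pit) -[X in (X <= _)%E]add0e leeD2r //.
apply: (@sub_finite_set _ _ [set` fs]); last by apply/finite_seqP; exists fs.
move=> e /= lt; apply: contrapT => ne; move: lt; rewrite /lf.
have [_|/hM[]//] := eqVneq (phi e) 0; by rewrite (vord0 hord) ltNge leey.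
Qed.

Lemma rs_finite y : X y -> exists fs : seq E, forall e, rs y e != 0 -> e \in fs.
Proof.
move=> [h fin]; have /finite_seqP[fs Efs] := fin o; exists fs => e nz.
have : [set e | (ord (y e) < o%:E + om e)%E] e; last by rewrite Efs.
rewrite /= ltNge; apply: contraNN nz => le; apply/eqP/rz0P => //; exact: bd0.
Qed.

Lemma rs_Mt y e : rs y e != 0 -> Mt e.
Proof. by rewrite /rs /rz; case: asboolP => //; rewrite eqxx. Qed.

Lemma rs_nab w T e : (forall T, X (w T)) ->
  rs (nab w T) e = \sum_(l in T) sgn Fq l T * rs (dl l (w (T :\ l)%SET)) e.
Proof.
move=> Xw; rewrite /rs /nab.
have b l : (om e <= ord (dl l (w (T :\ l)%SET) e))%E by apply/bd0/dl_bd/X_bd.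
rewrite rz_sum => [|l _]; last by rewrite (ordM hord) ord_sgn add0e.
by apply: eq_bigr => l _; rewrite rzZ ?ord_sgn // res_sgn.
Qed.

(** The bound is strict so that [top 0] means that the reduction is zero. *)
Definition top m y := forall e, rs y e != 0 -> (wd e.2 < m)%N.
Definition deg i (w : {set 'I_n} -> E -> K) := forall T, #|T| <> i -> w T = fun=> 0.
Definition Xf (w : {set 'I_n} -> E -> K) := forall T, X (w T).

Lemma rs0 e : rs (fun=> 0) e = 0.
Proof. by apply/rz0P; rewrite (vord0 hord) leey. Qed.

Lemma dl0 l : dl l (fun=> 0) = fun=> 0.
Proof.
have := dlZ l 0 (X_bd X0) ; rewrite (_ : (fun e => 0 * _) = (fun=> 0)); last by apply: funext => e; rewrite mul0r.
by move=> ->; apply: funext => e; rewrite mul0r.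
Qed.

Lemma deg_nab i w : (forall T, #|T|.+1 <> i -> w T = fun=> 0) -> deg i (nab w).
Proof.
move=> h T nT; apply: funext => e; rewrite /nab big1 // => l lT.
by rewrite h ?dl0 ?mulr0 // => E1; apply: nT; rewrite (cardsD1 l) lT add1n.
Qed.

Lemma XfB w k : Xf w -> Xf k -> Xf (fun T e => w T e - nab k T e).
Proof. by move=> Xw Xk T; apply: XD => //; apply: XN; apply: nab_X. Qed.

Lemma rsB w k T e : Xf w -> Xf k -> rs (fun e => w T e - nab k T e) e = rs (w T) e - rs (nab k T) e.
Proof.
move=> Xw Xk; have b1 := bd0 e (X_bd (Xw T)); have b2 := bd0 e (X_bd (nab_X Xk T)).
apply/eqP; rewrite eq_sym subr_eq; apply/eqP; rewrite /rs -rzD ?subrK //.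
by apply: (ordB hord).
Qed.

Hypothesis koszul : forall (w : {set 'I_n} -> 'rV[int]_n -> Fq),
  (forall T, Gr (w T)) -> (forall mu, w [set: 'I_n]%SET mu = 0) ->
  (forall (T : {set 'I_n}) mu, \sum_(l in T) sgn Fq l T * Fo l (w (T :\ l)%SET) mu = 0) ->
  exists th : {set 'I_n} -> 'rV[int]_n -> Fq, (forall T, Gr (th T)) /\
    forall (T : {set 'I_n}) mu, w T mu = \sum_(l in T) sgn Fq l T * Fo l (th (T :\ l)%SET) mu.

(** For each exponent [g] of [t] the weight [m] part of the reduction of [w] is a Koszul cocycle; a
    lift of the weight [m - d] part of a primitive removes it. *)
Lemma top_step m i w : (i < n)%N -> Xf w -> deg i w -> (forall T, top m.+1 (w T)) ->
  (forall T e, wd e.2 = (m + d)%N -> rs (nab w T) e = 0) ->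
  exists k, [/\ Xf k, forall T, #|T|.+1 <> i -> k T = fun=> 0
    & forall T, top m (fun e => w T e - nab k T e)].
Proof.
move=> lt_in Xw dw tw nw.
have /choice[fsT HfsT] := fun T => rs_finite (Xw T).
pose fs := [seq e <- flatten [seq fsT T | T : {set 'I_n}] | `[< Mt e >]].
have fsP T e : rs (w T) e != 0 -> e \in fs.
  move=> nz; rewrite mem_filter asboolT /=; last exact: rs_Mt nz.
  by move: nz => /HfsT h; apply/flattenP; exists (fsT T) => //; apply/mapP; exists T; rewrite ?mem_enum.
have /choice[th Hth] : forall g : 'rV[int]_s, exists th : {set 'I_n} -> 'rV[int]_n -> Fq,
    (forall T, Gr (th T)) /\ forall (T : {set 'I_n}) mu,
    comp wd m (fun mu => rs (w T) (g, mu)) mu = \sum_(l in T) sgn Fq l T * Fo l (th (T :\ l)%SET) mu.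
  move=> g; apply: koszul => [T|mu|T mu].
  - exists [seq e.2 | e <- fs] => mu; rewrite /comp; case: ifP => _; last by rewrite eqxx.
    by move=> nz; split; [apply/mapP; exists (g, mu) => //; apply: fsP nz | have [] := rs_Mt nz].
  - rewrite /comp; case: ifP => // _; rewrite dw ?rs0 // cardsT card_ord => E1.
    by rewrite E1 ltnn in lt_in.
  - under eq_bigr do rewrite (Fo_comp supM).
    have [Em|nm] := eqVneq (wd mu) (d + m)%N; last by rewrite big1 // => l _; rewrite /comp (negPf nm) mulr0.
    have := nw T (g, mu); rewrite rs_nab // addnC => /(_ Em) E0; rewrite -[RHS]E0; apply: eq_bigr => l _.
    rewrite /comp Em eqxx; congr (_ * _); apply/esym.
    apply: (@top_residue l _ m (X_bd (Xw _)) _ (g, mu)); first by move=> e0 /tw.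
    by rewrite /= Em addnC.
(* The primitives are cut down to the finitely many exponents of [t] that occur, to form degree
   [i - 1] and to weight [m - d]. *)
pose phi T e := if [&& e.1 \in [seq e.1 | e <- fs], #|T|.+1 == i & (d <= m)%N]
  then comp wd (m - d) (th e.1 T) e.2 else 0.
have /choice[gsT HgsT] : forall g, exists gs : seq 'rV[int]_n, forall (T : {set 'I_n}) mu, th g T mu != 0 -> mu \in gs /\ M mu.
  move=> g; have [Gth _] := Hth g; have /choice[sT HsT] := Gth.
  exists (flatten [seq sT T | T : {set 'I_n}]) => T mu /HsT[h Mm]; split=> //.
  by apply/flattenP; exists (sT T) => //; apply/mapP; exists T; rewrite ?mem_enum.
pose es := [seq (e.1, mu) | e <- fs, mu <- gsT e.1] : seq E.
have phiP T e : phi T e != 0 -> [/\ e \in es, Mt e, #|T|.+1 = i, (d <= m)%N & (wd e.2 + d)%N = m].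
  rewrite /phi; case: ifP => [/and3P[/mapP[e0 e0s E1] /eqP cT le]|_]; last by rewrite eqxx.
  rewrite /comp; have [Ew|_] := eqVneq (wd e.2) (m - d)%N; last by rewrite eqxx.
  move=> /HgsT[h Mm]; split=> //; last by rewrite Ew subnK.
    by apply/allpairsPdep; exists e0, e.2; split=> //; rewrite -?E1 //; case: (e).
  split=> //; rewrite E1; by move: e0s; rewrite mem_filter => /andP[/asboolP[]].
pose k T := lf (phi T).
have Xk : Xf k by move=> T; apply: (@lf_X _ es) => e /phiP[].
have kE T e : rs (k T) e = phi T e by apply: lf_rs => e' /phiP[].
exists k; split=> // [T nT|T e].
  by apply: funext => e; rewrite /k /lf; have [//|/phiP[_ _ /nT]] := eqVneq (phi T e) 0.
rewrite rsB // ltnNge; apply: contraNN => le_e; rewrite subr_eq0; apply/eqP; rewrite rs_nab //.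
have cardD l : l \in T -> #|(T :\ l)%SET|.+1 = #|T| by move=> lT; rewrite [RHS](cardsD1 l) lT.
have Ek l T' : rs (dl l (k T')) e = Fo l (fun mu => phi T' (e.1, mu)) e.2.
  have [le|lt] := leqP d m.
    rewrite (@top_residue l _ (m - d)); last by rewrite subnK.
    + by congr (Fo _ _ _); apply: funext => mu; rewrite kE.
    + exact: X_bd.
    + by move=> e'; rewrite kE => /phiP[_ _ _ _]; lia.
  have p0 e' : phi T' e' = 0.
    by rewrite /phi; case: ifP => // /and3P[_ _]; rewrite leqNgt lt.
  have -> : k T' = fun=> 0 by apply: funext => e'; rewrite /k /lf p0 eqxx.
  rewrite dl0 rs0 (_ : (fun mu => _) = fun=> 0) ?Fo0 //.
  by apply: funext => mu; rewrite p0.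
under eq_bigr do rewrite Ek.
have [e1|e1] := boolP (e.1 \in [seq e.1 | e <- fs]); last first.
  rewrite big1 => [|l _]; last first.
    by rewrite (_ : (fun mu => _) = fun=> 0) ?Fo0 ?mulr0 //; apply: funext => mu; rewrite /phi (negPf e1).
  by apply/eqP/negPn/negP => /fsP h; case/negP: e1; apply/mapP; exists e.
have [Ti|nTi] := eqVneq #|T| i; last first.
  rewrite dw; last by apply/eqP.
  rewrite rs0 big1 // => l lT; rewrite (_ : (fun mu => _) = fun=> 0) ?Fo0 ?mulr0 //.
  by apply: funext => mu; rewrite /phi cardD // (negPf nTi) andbF.
have rsE : rs (w T) e = comp wd m (fun mu => rs (w T) (e.1, mu)) e.2.
  rewrite /comp; have [_|ne] := eqVneq (wd e.2) m; first by case: (e).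
  by apply/eqP/negPn/negP => /tw; lia.
rewrite rsE (Hth e.1).2.
have [Em|nm] := eqVneq (wd e.2) m; last first.
  rewrite -(Hth e.1).2 -rsE big1 => [|l lT].
    by apply/eqP/negPn/negP => /tw; lia.
  have [le|lt] := leqP d m.
    rewrite (_ : (fun mu => _) = comp wd (m - d) (th e.1 (T :\ l)%SET)).
      by rewrite (Fo_comp supM) subnKC // /comp (negPf nm) mulr0.
    by apply: funext => mu; rewrite /phi e1 cardD // Ti eqxx le.
  rewrite (_ : (fun mu => _) = fun=> 0) ?Fo0 ?mulr0 //; apply: funext => mu.
  by rewrite /phi [(d <= m)%N]leqNgt lt !andbF.
apply: eq_bigr => l lT; congr (_ * _); have [le|lt] := leqP d m.
  rewrite [RHS](_ : Fo l _ _ = Fo l (comp wd (m - d) (th e.1 (T :\ l)%SET)) e.2).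
    by rewrite (Fo_comp supM) subnKC // /comp Em eqxx.
  by congr (Fo _ _ _); apply: funext => mu; rewrite /phi e1 cardD // Ti eqxx le.
rewrite (_ : (fun mu => _) = fun=> 0) ?Fo0; last first.
  by apply: funext => mu; rewrite /phi [(d <= m)%N]leqNgt lt !andbF.
rewrite /ToricJacobian.Fo big_seq big1 // => nu ns; rewrite /Gx.
case: ifP => [/asboolP[_ E1]|_]; last by rewrite mulr0.
by exfalso; have := (supM ns).2; lia.
Qed.

Lemma nab0 T e : nab (fun _ _ => 0) T e = 0.
Proof. by rewrite /nab big1 // => l _; rewrite dl0 mulr0. Qed.

(** Descending induction on the top x-weight. [P] is any property that yields the cocycle condition
    in top weight: being a cocycle in [lift_exact], satisfying a relation with [be] in
    [indep_step]. *)
Lemma reduce i (P : ({set 'I_n} -> E -> K) -> Prop) : (i < n)%N ->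
  (forall w m, Xf w -> deg i w -> P w -> (forall T, top m.+1 (w T)) ->
     forall T e, wd e.2 = (m + d)%N -> rs (nab w T) e = 0) ->
  (forall w k, Xf w -> Xf k -> P w -> P (fun T e => w T e - nab k T e)) ->
  forall m w, Xf w -> deg i w -> P w -> (forall T, top m (w T)) ->
  exists k, [/\ Xf k, forall T, #|T|.+1 <> i -> k T = fun=> 0
    & forall T e, rs (fun e => w T e - nab k T e) e = 0].
Proof.
move=> lt_in H1 H2; elim=> [|m IH] w Xw dw Pw tw.
  exists (fun _ _ => 0); split=> // [T|T e]; first exact: X0.
  have -> : (fun e => w T e - nab (fun _ _ => 0) T e) = w T.
    by apply: funext => e'; rewrite nab0 subr0.
  by apply/eqP/negPn/negP => /tw.
have [k [Xk dk tk]] := top_step lt_in Xw dw tw (H1 _ _ Xw dw Pw tw).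
have [|k' [Xk' dk' rk']] := IH _ (XfB Xw Xk) _ (H2 _ _ Xw Xk Pw) tk.
  by move=> T nT; apply: funext => e; rewrite dw // (deg_nab dk) // subr0.
exists (fun T e => k T e + k' T e); split=> [T|T nT|T e]; first exact: XD.
  by apply: funext => e; rewrite dk // dk' // addr0.
rewrite -[RHS](rk' T e); congr rs; apply: funext => e'.
by rewrite (nabD (fun T => X_bd (Xk T)) (fun T => X_bd (Xk' T))) opprD addrA.
Qed.

Lemma top_ex w : Xf w -> exists m, forall T, top m (w T).
Proof.
move=> Xw; have /choice[fsT HfsT] := fun T => rs_finite (Xw T).
exists (\max_T \max_(e <- fsT T) wd e.2).+1 => T e /HfsT es; rewrite ltnS.
by apply: leq_trans (leq_bigmax T); apply: (leq_bigmax_seq (F := fun e : E => wd e.2)).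
Qed.

Lemma pdiv y : X y -> (forall e, rs y e = 0) -> X (fun e => pit^-1 * y e).
Proof.
move=> [h fin] r0; have Ey e : ord (y e) = (o%:E + ord (pit^-1 * y e)%R)%E.
  by rewrite -ord_pit -(ordM hord) mulrA divff ?mul1r // pit_neq0'.
have le (N : R) e : (N%:E + om e <= ord (pit^-1 * y e)%R)%E = ((o + N)%:E + om e <= ord (y e))%E.
  by rewrite Ey EFinD -addeA leeD2lE.
split=> [e|N]; first by rewrite le addr0; apply/rz0P; [exact: bd0 | exact: r0].
apply: sub_finite_set (fin (o + N)) => e /=.
by rewrite ltNge le -ltNge.
Qed.

Lemma pit_series (u : nat -> E -> K) : (forall k, X (u k)) -> exists U, [/\ X U,
  forall m, bd (m%:R * o) (fun e => U e - \sum_(k < m) pit ^+ k * u k e)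
  & forall e, (forall k, u k e = 0) -> U e = 0].
Proof.
move=> Xu.
have tb k e : ((k%:R * o)%:E + om e <= ord (pit ^+ k * u k e)%R)%E.
  rewrite (ordM hord) (ordX hord _ ord_pit) leeD2l //; apply: bd0; exact: X_bd.
have part e m m' : (m <= m')%N -> ((m%:R * o)%:E + om e <=
    ord (\sum_(k < m') pit ^+ k * u k e - \sum_(k < m) pit ^+ k * u k e)%R)%E.
  move=> le; rewrite -!(big_mkord xpredT (fun k => pit ^+ k * u k e)) (@big_cat_nat _ _ _ m) //=.
  rewrite addrAC subrr add0r big_nat; apply: (ord_sum hord) => k /andP[le_k _].
  by apply: le_trans (tb k e); rewrite leeD2r // lee_fin ler_pM2r // ler_nat.
have nat_ge (N : R) : exists k : nat, N <= k%:R * o.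
  exists (Num.bound `|N / o|); rewrite -ler_pdivrMr //; apply: le_trans (ler_norm _) (ltW _).
  by have := archi_boundP (normr_ge0 (N / o)); rewrite /Num.bound normr_id.
have /choice[U HU] : forall e, exists L : K, val_cvg ord (fun m => \sum_(k < m) pit ^+ k * u k e) L.
  move=> e; apply: complete => N; have [m0 Hm] := nat_ge N; exists m0 => m m' le le'.
  have h m1 : (m0 <= m1)%N -> (N%:E <= ord (\sum_(k < m1) pit ^+ k * u k e - \sum_(k < m0) pit ^+ k * u k e)%R)%E.
    move=> /part h; apply: le_trans (h e); rewrite -[X in (X <= _)%E]adde0; apply: leeD; rewrite ?lee_fin ?om_ge0 //.
  by have := ordB hord (h _ le) (h _ le'); rewrite opprB addrA subrK.
have HU2 m : bd (m%:R * o) (fun e => U e - \sum_(k < m) pit ^+ k * u k e).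
  move=> e; have real (N : R) : (N%:E <= (m%:R * o)%:E + om e)%E ->
      (N%:E <= ord (U e - \sum_(k < m) pit ^+ k * u k e)%R)%E.
    move=> hN; have [m1 H1] := HU e N; have h1 := H1 _ (leq_maxl m1 m).
    have h2 := le_trans hN (part e _ _ (leq_maxr m1 m)).
    rewrite (ord_distC hord) in h1.
    by have := ordD hord h1 h2; rewrite addrA subrK.
  move: real; case: (_ + om e)%E (om_ge0 e) => [t _|_|] real; first by apply: real.
    rewrite leye_eq; apply/eqP; have [_ h _ _] := hord; apply/h; apply: (ord_eq0 hord) => N.
    by apply: real; rewrite leey.
  by rewrite leNye.
exists U; split=> //; last first.
  move=> e u0; apply: (ord_eq0 hord) => N; have [m0 H0] := HU e N.
  by have := H0 m0 (leqnn _); rewrite big1 ?sub0r ?(ordN hord) // => k _; rewrite u0 mulr0.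
split=> [e|N].
  by have := HU2 0%N e; rewrite big_ord0 subr0 mul0r.
have [m Hm] := nat_ge N.
have [_ fin] : X (fun e => \sum_(k < m) pit ^+ k * u k e).
  by apply: X_sum => k _; apply: XZ => //; rewrite (ordX hord _ ord_pit) lee_fin mulr_ge0 ?ler0n ?ltW.
apply: sub_finite_set (fin N) => e /=; rewrite !ltNge; apply: contraNN => h.
rewrite -[U e](subrK (\sum_(k < m) pit ^+ k * u k e)); apply: (ordD hord) => //.
by apply: le_trans (HU2 m e); rewrite leeD2r // lee_fin.
Qed.

(** Successive approximation shared by exactness and generation: corrections modulo [pit], with a
    remainder again in [Z], are summed with powers of [pit]. [PB] and [PT] carry vanishing
    conditions to the limit. *)
Lemma approx (PB PT : {set 'I_n} -> E -> Prop) (Z : ({set 'I_n} -> E -> K) -> Prop) :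
  (forall w, Z w -> Xf w) ->
  (forall w, Z w -> exists b t w', [/\ Xf b, Xf t, forall T e, PB T e -> b T e = 0,
     forall T e, PT T e -> t T e = 0 & Z w' /\ forall T e, w T e = b T e + nab t T e + pit * w' T e]) ->
  forall w, Z w -> exists b t, [/\ Xf b, Xf t, forall T e, PB T e -> b T e = 0,
     forall T e, PT T e -> t T e = 0 & forall T e, w T e = b T e + nab t T e].
Proof.
move=> ZX Zdiv w Zw.
have /choice[F HF] : forall w, exists F : ({set 'I_n} -> E -> K) * ({set 'I_n} -> E -> K) * ({set 'I_n} -> E -> K),
    Z w -> [/\ Xf F.1.1, Xf F.1.2, forall T e, PB T e -> F.1.1 T e = 0,
     forall T e, PT T e -> F.1.2 T e = 0
     & Z F.2 /\ forall T e, w T e = F.1.1 T e + nab F.1.2 T e + pit * F.2 T e].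
  move=> w0; have [Zw0|nZ] := pselect (Z w0).
    by have [b [t [w' H]]] := Zdiv w0 Zw0; exists (b, t, w').
  by exists ((fun _ _ => 0), (fun _ _ => 0), (fun _ _ => 0)).
pose ws k := iter k (fun w => (F w).2) w.
have Zws k : Z (ws k) by elim: k => [//|k IH] /=; have [_ _ _ _ []] := HF _ IH.
pose b k := (F (ws k)).1.1; pose t k := (F (ws k)).1.2.
have Xb k : Xf (b k) by have [] := HF _ (Zws k).
have Xt k : Xf (t k) by have [] := HF _ (Zws k).
have Ews k T e : ws k T e = b k T e + nab (t k) T e + pit * ws k.+1 T e.
  by have [_ _ _ _ []] := HF _ (Zws k).
have /choice[b' Hb] := fun T => pit_series (fun k => Xb k T).
have /choice[t' Ht] := fun T => pit_series (fun k => Xt k T).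
have Xb' T : X (b' T) by have [] := Hb T.
have Xt' T : X (t' T) by have [] := Ht T.
exists b', t'; split=> // [T e PBe|T e PTe|T e].
- by have [_ _] := Hb T; apply=> k; have [_ _ h _ _] := HF _ (Zws k); apply: h.
- by have [_ _] := Ht T; apply=> k; have [_ _ _ h _] := HF _ (Zws k); apply: h.
have pk k : (0 <= ord (pit ^+ k))%E by rewrite (ordX hord _ ord_pit) lee_fin mulr_ge0 ?ler0n ?ltW.
have Xtm m : Xf (fun T e => \sum_(k < m) pit ^+ k * t k T e).
  by move=> T0; apply: X_sum => k _; apply: XZ; [exact: pk | exact: Xt].
have Ew m : w T e = \sum_(k < m) pit ^+ k * b k T e +
    nab (fun T e => \sum_(k < m) pit ^+ k * t k T e) T e + pit ^+ m * ws m T e.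
  elim: m => [|m IH].
    rewrite big_ord0 expr0 mul1r add0r.
    have -> : (fun (T0 : {set 'I_n}) (e0 : E) => \sum_(k < 0) pit ^+ k * t k T0 e0) = fun _ _ => 0.
      by apply: funext => T0; apply: funext => e0; rewrite big_ord0.
    by rewrite nab0 add0r.
  rewrite {}IH Ews big_ord_recr /=.
  have -> : (fun T0 e0 => \sum_(k < m.+1) pit ^+ k * t k T0 e0) =
      (fun T0 e0 => \sum_(k < m) pit ^+ k * t k T0 e0 + pit ^+ m * t m T0 e0).
    by apply: funext => T0; apply: funext => e0; rewrite big_ord_recr.
  rewrite (nabD (fun T0 => X_bd (Xtm m T0)) (fun T0 => X_bd (XZ (pk m) (Xt m T0)))).
  rewrite (nabZ _ (fun T0 => X_bd (Xt m T0))) exprSr -/(ws m.+1); ring.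
apply/eqP; rewrite -subr_eq0; apply/eqP/(ord_eq0 hord) => N.
pose m := Num.bound `|N / o|.
have Nm : N <= m%:R * o.
  rewrite -ler_pdivrMr //; apply: le_trans (ler_norm _) (ltW _).
  by have := archi_boundP (normr_ge0 (N / o)); rewrite /m /Num.bound normr_id.
have nt : nab t' T e = nab (fun T e => t' T e - \sum_(k < m) pit ^+ k * t k T e) T e +
    nab (fun T e => \sum_(k < m) pit ^+ k * t k T e) T e.
  have Xd : Xf (fun T e => t' T e - \sum_(k < m) pit ^+ k * t k T e).
    by move=> T0; apply: XD; [exact: Xt' | apply: XN; exact: Xtm].
  rewrite -(nabD (fun T0 => X_bd (Xd T0)) (fun T0 => X_bd (Xtm m T0))).
  by congr nab; apply: funext => T0; apply: funext => e0; rewrite subrK.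
rewrite (Ew m) nt.
set A := \sum_(k < m) _; set B := nab _ T e; set C := nab _ T e.
rewrite (_ : _ - _ = pit ^+ m * ws m T e - (b' T e - A) - C); last by rewrite /A; ring.
suff H : ((m%:R * o)%:E + om e <= ord (pit ^+ m * ws m T e - (b' T e - A) - C)%R)%E.
  by apply: le_trans H; rewrite -[X in (X <= _)%E]adde0; apply: leeD; rewrite ?lee_fin ?om_ge0.
apply: (ordB hord); first apply: (ordB hord).
- rewrite (ordM hord) (ordX hord _ ord_pit) leeD2l //; apply: bd0; apply: X_bd; exact: ZX.
- by have [_ h _] := Hb T; apply: h.
- by apply: nab_bd => T0; have [_ h _] := Ht T0; apply: h.
Qed.

(** A cocycle is corrected by a coboundary until its reduction is zero, and its quotient by [pit] is
    a cocycle again. *)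
Theorem lift_exact i w : (i < n)%N -> Xf w -> deg i w -> (forall T e, nab w T e = 0) ->
  exists t, [/\ Xf t, forall T, #|T|.+1 <> i -> t T = fun=> 0 & forall T e, w T e = nab t T e].
Proof.
move=> lt_in Xw dw nw.
pose Z w := [/\ Xf w, deg i w & forall T e, nab w T e = 0].
have [| | |b [t [_ Xt b0 t0 Ew]]] := @approx (fun _ _ => True) (fun T _ => #|T|.+1 <> i) Z _ _ w _.
- by move=> w0 [].
- move=> w0 [Xw0 dw0 nw0]; have [m tm] := top_ex Xw0.
  have [||k [Xk dk rk]] := @reduce i (fun w => forall T e, nab w T e = 0) lt_in _ _ m w0 Xw0 dw0 nw0 tm.
  + move=> w1 m1 _ _ nw1 _ T e _; rewrite (_ : nab w1 T = fun=> 0) ?rs0 //.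
    by apply: funext.
  + move=> w1 k1 Xw1 Xk1 nw1 T e.
    rewrite (nabD (w' := fun T e => - nab k1 T e) (fun T => X_bd (Xw1 T)) (fun T => X_bd (XN (nab_X Xk1 T)))).
    rewrite nw1 add0r (_ : (fun T e => - nab k1 T e) = fun T e => -1 * nab k1 T e).
      by rewrite (nabZ _ (fun T => X_bd (nab_X Xk1 T))) nab_nab // mulr0.
    by apply: funext => T0; apply: funext => e0; rewrite mulN1r.
  exists (fun _ _ => 0), k, (fun T e => pit^-1 * (w0 T e - nab k T e)); split=> //.
  + by move=> T; apply: X0.
  + by move=> T e /dk ->.
  split; last by move=> T e; rewrite add0r mulrA divff ?pit_neq0' // mul1r addrC subrK.
  split.
  + by move=> T; apply: pdiv; [apply: XfB | exact: rk].
  + by move=> T nT; apply: funext => e; rewrite dw0 // (deg_nab dk) // subr0 mulr0.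
  + move=> T e; rewrite (nabZ _ (fun T => X_bd (XfB Xw0 Xk T))).
    rewrite (nabD (w' := fun T e => - nab k T e) (fun T => X_bd (Xw0 T)) (fun T => X_bd (XN (nab_X Xk T)))).
    rewrite nw0 add0r (_ : (fun T e => - nab k T e) = fun T e => -1 * nab k T e).
      by rewrite (nabZ _ (fun T => X_bd (nab_X Xk T))) nab_nab // !mulr0.
    by apply: funext => T0; apply: funext => e0; rewrite mulN1r.
- by split.
exists t; split=> // [T nT|T e]; first by apply: funext => e; apply: t0.
by rewrite Ew b0 // add0r.
Qed.

(** * Top degree: generation and independence of the basis *)

Variables (r : nat) (b : 'I_r -> 'rV[int]_n).
Hypothesis b_inj : injective b.
Hypothesis Mb : forall i, M (b i).
Hypothesis hspan : forall g, Gr g -> exists c : 'I_r -> Fq,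
    Jset (fun mu => g mu - \sum_i c i * dlt Fq (b i) mu).
Hypothesis hind : forall c : 'I_r -> Fq, Jset (fun mu => \sum_i c i * dlt Fq (b i) mu) ->
    forall i, c i = 0.

Definition onB (y : E -> K) := forall e, (forall i, e.2 <> b i) -> y e = 0.

Lemma nab_setT t e : Xf t ->
  nab t [set: 'I_n]%SET e = \sum_l dl l (fun e => sgn K l [set: 'I_n]%SET * t ([set: 'I_n] :\ l)%SET e) e.
Proof.
move=> Xt; rewrite /nab; apply: eq_big => [l|l _]; first by rewrite inE.
by rewrite (dlZ l _ (X_bd (Xt _))).
Qed.

(** The form of degree [n - 1] whose signs undo those of [nab], so that its differential is the sum
    of the [D_l th_l]. *)
Definition of_fam (th : 'I_n -> E -> K) (T : {set 'I_n}) : E -> K := fun e =>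
  \sum_l (if T == ([set: 'I_n] :\ l)%SET then sgn K l [set: 'I_n]%SET else 0) * th l e.

Lemma of_fam_X th : (forall l, X (th l)) -> Xf (of_fam th).
Proof.
move=> Xth T; apply: X_sum => l _; apply: XZ => //.
by case: ifP => _; rewrite ?ord_sgn // (vord0 hord) leey.
Qed.

Lemma of_fam_nab th e : (forall l, X (th l)) ->
  nab (of_fam th) [set: 'I_n]%SET e = \sum_l dl l (th l) e.
Proof.
move=> Xth; rewrite nab_setT; last exact: of_fam_X.
apply: eq_bigr => l _; congr (dl _ _ _); apply: funext => e'; rewrite /of_fam.
rewrite (bigD1 l) //= eqxx mulrDr mulrA sgn_sq mul1r big1 ?mulr0 ?addr0 // => l' nl.
rewrite ifF ?mul0r //; apply/negP => /eqP/setP/(_ l); rewrite !inE eqxx eq_sym.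
by rewrite (negPf nl).
Qed.

Lemma card_full T : #|T| = n -> T = [set: 'I_n]%SET.
Proof.
move=> cT; apply/eqP; rewrite eqEcard finset.subsetT /= cardsT card_ord.
by rewrite leq_eqVlt cT eqxx.
Qed.

Lemma card_setD l : #|([set: 'I_n] :\ l)%SET|.+1 = n.
Proof. by rewrite -[RHS]card_ord -cardsT [RHS](cardsD1 l) inE. Qed.

(** The descent on the x-weight in top degree: the weight [m] part is a combination of [B] modulo
    the Jacobian ideal, with multipliers in weight [m - d]. *)
Lemma span_mod m y : X y -> top m y -> exists be th, [/\ X be, onB be, forall l, X (th l)
  & forall e, rs (fun e => y e - (be e + \sum_l dl l (th l) e)) e = 0].
Proof.
elim: m y => [|m IH] y Xy ty.
  exists (fun=> 0), (fun _ _ => 0); split=> // [|l|e]; try exact: X0.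
  apply/eqP/negPn/negP => /=; rewrite (_ : (fun e => _) = y); first by move=> /ty.
  by apply: funext => e'; rewrite big1 ?addr0 ?subr0 // => l _; rewrite dl0.
have [fs0 Hfs0] := rs_finite Xy; pose fs := [seq e <- fs0 | `[< Mt e >]].
have fsP e : rs y e != 0 -> e \in fs.
  by move=> nz; rewrite mem_filter Hfs0 // asboolT //; apply: rs_Mt nz.
pose g ga := comp wd m (fun mu => rs y (ga, mu)).
have Gg ga : Gr (g ga).
  exists [seq e.2 | e <- fs] => mu; rewrite /g /comp; case: ifP => _; last by rewrite eqxx.
  by move=> nz; split; [apply/mapP; exists (ga, mu) => //; apply: fsP nz | have [] := rs_Mt nz].
have /choice[c Hc] := fun ga => hspan (Gg ga).
have /choice[h Hh] : forall ga, exists h : 'I_n -> 'rV[int]_n -> Fq,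
    [/\ forall l, Gr (h l), forall l mu, h l mu != 0 -> (wd mu + d)%N = m
    & forall mu, comp wd m (fun mu => g ga mu - \sum_i c ga i * dlt Fq (b i) mu) mu = \sum_l Fo l (h l) mu].
  by move=> ga; apply: Jset_comp (Hc ga).
pose inS (e : E) := e.1 \in [seq e.1 | e <- fs].
have inSM e : inS e -> MG e.1.
  by move=> /mapP[e0 e0s ->]; move: e0s; rewrite mem_filter => /andP[/asboolP[]].
pose pb (e : E) := if inS e then comp wd m (fun mu => \sum_i c e.1 i * dlt Fq (b i) mu) e.2 else 0.
pose pt l (e : E) := if inS e then h e.1 l e.2 else 0.
have pbB e : pb e != 0 -> exists i, e.2 = b i.
  rewrite /pb; case: ifP => _; last by rewrite eqxx.
  rewrite /comp; case: ifP => _; last by rewrite eqxx.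
  move=> nz; apply: contrapT => /forallNP nb; case/negP: nz; apply/eqP; apply: big1 => i _.
  by rewrite /dlt; case: eqP => [/nb//|_]; rewrite mulr0.
have pbS e : pb e != 0 -> inS e by rewrite /pb; case: ifP => //; rewrite eqxx.
have Xb : X (lf pb).
  apply: (@lf_X _ [seq (e.1, b i) | e <- fs, i <- enum 'I_r]) => e nz.
  have [i Ei] := pbB e nz; have Se := pbS e nz; split; last by split; [apply: inSM | rewrite Ei].
  have /mapP[e0 e0s E0] := Se; apply/allpairsP; exists (e0, i); split=> //=; rewrite ?mem_enum //.
  by rewrite -E0 -Ei; case: (e).
have ptS l e : pt l e != 0 -> inS e /\ h e.1 l e.2 != 0.
  by rewrite /pt; case: ifP => //; rewrite eqxx.
have /choice[hs Hhs] : forall ga, exists hs : seq 'rV[int]_n, forall l mu, h ga l mu != 0 -> mu \in hs /\ M mu.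
  move=> ga; have [Gh _ _] := Hh ga; have /choice[sl Hsl] := Gh.
  exists (flatten [seq sl l | l : 'I_n]) => l mu /Hsl[hm Mm]; split=> //.
  by apply/flattenP; exists (sl l) => //; apply/mapP; exists l; rewrite ?mem_enum.
have ptM l e : pt l e != 0 -> e \in [seq (e.1, mu) | e <- fs, mu <- hs e.1] /\ Mt e.
  move=> /ptS[Se /Hhs[hm Mm]]; split; last by split=> //; apply: inSM.
  have /mapP[e0 e0s E0] := Se; apply/allpairsPdep; exists e0, e.2; split=> //; rewrite -E0 //.
  by case: (e).
have Xt l : X (lf (pt l)) by apply: (@lf_X _ [seq (e.1, mu) | e <- fs, mu <- hs e.1]); apply: ptM.
have rb e : rs (lf pb) e = pb e.
  apply: lf_rs => e' nz; split; first exact/inSM/pbS.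
  by have [i ->] := pbB e' nz.
have rt l e : rs (lf (pt l)) e = pt l e by apply: lf_rs => e' /ptM[].
pose y1 e := y e - (lf pb e + \sum_l dl l (lf (pt l)) e).
have Xs : X (fun e => lf pb e + \sum_l dl l (lf (pt l)) e).
  by apply: XD => //; apply: X_sum => l _; apply: dl_X.
have Xy1 : X y1 by apply: XD => //; apply: XN.
have ty1 : top m y1.
  move=> e; rewrite ltnNge; apply: contraNN => le_e; apply/eqP.
  have b1 := bd0 e (X_bd Xy); have b2 := bd0 e (X_bd Xb).
  have b3 : (om e <= ord (\sum_l dl l (lf (pt l)) e)%R)%E.
    by apply: (ord_sum hord) => l _; apply: bd0; apply: dl_bd; apply: X_bd.
  suff Ey : rs y e = rz e (lf pb e + \sum_l dl l (lf (pt l)) e).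
    have : rz e (y1 e + (lf pb e + \sum_l dl l (lf (pt l)) e)) = rs y e by rewrite subrK.
    rewrite rzD ?Ey; [|exact: bd0 (X_bd Xy1)|exact: (ordD hord)].
    by move=> /eqP; rewrite -[X in _ == X]add0r (inj_eq (addIr _)) => /eqP.
  rewrite rzD // rz_sum => [|l _]; last by apply: bd0; apply: dl_bd; apply: X_bd.
  rewrite -/(rs (lf pb) e) rb.
  have -> : \sum_l rz e (dl l (lf (pt l)) e) = \sum_l Fo l (fun mu => pt l (e.1, mu)) e.2.
    apply: eq_bigr => l _; rewrite -/(rs (dl l (lf (pt l))) e).
    have [le|lt] := leqP d m.
      rewrite (@top_residue l _ (m - d)); last by rewrite subnK.
      + by congr (Fo _ _ _); apply: funext => mu; rewrite rt.
      + exact: X_bd.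
      + move=> e'; rewrite rt => /ptS[_ nz]; have [_ /(_ _ _ nz) + _] := Hh e'.1; lia.
    have p0 e' : pt l e' = 0.
      apply/eqP/negPn/negP => /ptS[_ nz]; have [_ /(_ _ _ nz) + _] := Hh e'.1; lia.
    have -> : lf (pt l) = fun=> 0 by apply: funext => e'; rewrite /lf p0 eqxx.
    rewrite dl0 rs0 (_ : (fun mu => _) = fun=> 0) ?Fo0 //.
    by apply: funext => mu; rewrite p0.
  have rsE : rs y e = g e.1 e.2.
    rewrite /g /comp; have [_|ne] := eqVneq (wd e.2) m; first by case: (e).
    by apply/eqP/negPn/negP => /ty; lia.
  have [Se|nSe] := boolP (inS e); last first.
    rewrite /pb (negPf nSe) add0r big1 => [|l _].
      by apply/eqP/negPn/negP => /fsP h1; case/negP: nSe; apply/mapP; exists e.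
    by rewrite (_ : (fun mu => _) = fun=> 0) ?Fo0 //; apply: funext => mu; rewrite /pt ifF //; apply: negbTE.
  have -> : \sum_l Fo l (fun mu => pt l (e.1, mu)) e.2 = \sum_l Fo l (h e.1 l) e.2.
    by apply: eq_bigr => l _; congr (Fo _ _ _); apply: funext => mu; rewrite /pt ifT.
  have [_ _ <-] := Hh e.1; rewrite /pb Se rsE /comp; case: eqP => [_|ne]; first by rewrite addrC subrK.
  by rewrite /g /comp; case: eqP => //; rewrite addr0.
have [be [th [Xbe oBe Xth rth]]] := IH y1 Xy1 ty1.
exists (fun e => lf pb e + be e), (fun l e => lf (pt l) e + th l e); split=> [|e ne|l|e].
- exact: XD.
- rewrite oBe // addr0 /lf; case: eqP => // /eqP nz; have [i Ei] := pbB e nz.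
  by case: (ne i).
- exact: XD.
rewrite -[RHS](rth e); congr rs; apply: funext => e'; rewrite /y1.
under eq_bigr do rewrite (dlD _ (X_bd (Xt _)) (X_bd (Xth _))).
by rewrite big_split /=; ring.
Qed.

Theorem lift_span y : X y -> exists be th, [/\ X be, onB be, forall l, X (th l)
  & forall e, y e = be e + \sum_l dl l (th l) e].
Proof.
move=> Xy; pose Z (w : {set 'I_n} -> E -> K) := Xf w /\ forall T, T <> [set: 'I_n]%SET -> w T = fun=> 0.
pose w0 (T : {set 'I_n}) := if T == [set: 'I_n]%SET then y else fun=> 0.
have [| | |be [t [Xb Xt b0 _ Ew]]] := @approx
  (fun T e => T <> [set: 'I_n]%SET \/ forall i, e.2 <> b i) (fun _ _ => False) Z _ _ w0.
- by move=> w [].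
- move=> w [Xw dw]; have [m tm] := top_ex Xw.
  have [be [th [Xbe oB Xth rth]]] := span_mod (Xw [set: 'I_n]%SET) (tm _).
  pose on T (y : E -> K) : E -> K := if T == [set: 'I_n]%SET then y else fun=> 0.
  have Xon T y0 : X y0 -> X (on T y0) by rewrite /on; case: ifP => // _ _; apply: X0.
  pose w1 T e := on T (w T) e - (on T be e + on T (fun e => \sum_l dl l (th l) e) e).
  exists (fun T => on T be), (of_fam th), (fun T e => pit^-1 * on T (fun e => w T e -
    (be e + \sum_l dl l (th l) e)) e); split=> // [T|||].
  + exact: Xon.
  + exact: of_fam_X.
  + by move=> T e; rewrite /on; case: eqP => // ET [//|]; apply: oB.
  split; first split.
  + move=> T; rewrite /on; case: eqP => [ET|_]; last first.
      by have := X0; congr X; apply: funext => e; rewrite mulr0.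
    apply: pdiv; last by move=> e; rewrite ET; apply: rth.
    by apply: XD => //; apply: XN; apply: XD => //; apply: X_sum => l _; apply: dl_X.
  + by move=> T nT; apply: funext => e; rewrite /on; case: eqP => // _; rewrite mulr0.
  + move=> T e; rewrite mulrA divff ?pit_neq0' // mul1r /on; case: eqP => [->|nT].
      by rewrite of_fam_nab // addrC subrK.
    rewrite dw // addr0 add0r (@deg_nab n) // => [T'|]; last first.
      by move=> /card_full.
    move=> nT'; apply: funext => e'; rewrite /of_fam big1 // => l _; rewrite ifF ?mul0r //.
    by apply/negP => /eqP ET; apply: nT'; rewrite ET; apply: card_setD.
- split=> [T|T nT]; rewrite /w0; first by case: ifP => // _; apply: X0.
  by case: eqP.
exists (be [set: 'I_n]%SET), (fun l e => sgn K l [set: 'I_n]%SET * t ([set: 'I_n] :\ l)%SET e).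
split=> // [e ne|l|e]; first by apply: b0; right.
  by apply: XZ => //; rewrite ord_sgn.
by rewrite -nab_setT //; have := Ew [set: 'I_n]%SET e; rewrite /w0 eqxx.
Qed.

Let rel be t := [/\ X be, onB be, Xf t, deg n.-1 t & forall e, be e + nab t [set: 'I_n]%SET e = 0].

Lemma nabB_nab w k T e : Xf w -> Xf k -> nab (fun T e => w T e - nab k T e) T e = nab w T e.
Proof.
move=> Xw Xk; rewrite (nabD (w' := fun T e => - nab k T e) (fun T => X_bd (Xw T)) (fun T => X_bd (XN (nab_X Xk T)))).
rewrite (_ : (fun T e => - nab k T e) = fun T e => -1 * nab k T e).
  by rewrite (nabZ _ (fun T => X_bd (nab_X Xk T))) nab_nab // mulr0 addr0.
by apply: funext => T0; apply: funext => e0; rewrite mulN1r.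
Qed.

(** In top weight the relation puts a combination of [B] in the Jacobian ideal, so it vanishes by
    [hind] and the top part of [t] is a cocycle, which [reduce] removes. At the end [t], and with it
    [be], is divisible by [pit]. *)
Lemma indep_step be t : (0 < n)%N -> rel be t -> exists t', rel (fun e => pit^-1 * be e) t'.
Proof.
move=> n0 [Xb oB Xt dt Er]; have [m tm] := top_ex Xt.
have lt_n : (n.-1 < n)%N by rewrite prednK.
have [| |k [Xk dk rk]] := @reduce n.-1 (fun w => forall e, be e + nab w [set: 'I_n]%SET e = 0)
  lt_n _ _ m t Xt dt Er tm.
- move=> w m1 Xw dw Ew tw T e we.
  have [->|nT] := eqVneq T [set: 'I_n]%SET; last first.
    rewrite (@deg_nab n) ?rs0 // => [T' nT'|cT]; first by apply: dw => E0; apply: nT'; rewrite E0 prednK.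
    by case/eqP: nT; apply: card_full.
  have rE e' : rs be e' = - rs (nab w [set: 'I_n]%SET) e'.
    apply/eqP; rewrite -addr_eq0 /rs -rzD ?Ew; [|exact: bd0 (X_bd Xb)|exact: bd0 (X_bd (nab_X Xw _))].
    exact/eqP/rs0.
  apply/eqP; rewrite -oppr_eq0 -rE; apply/eqP.
  pose g mu := comp wd (m1 + d) (fun mu => rs be (e.1, mu)) mu.
  have gE mu : g mu = \sum_i g (b i) * dlt Fq (b i) mu.
    have [[i ->]|nb] := pselect (exists i, mu = b i).
      rewrite (bigD1 i) //= /dlt eqxx mulr1 big1 ?addr0 // => j nj.
      by rewrite (inj_eq b_inj) eq_sym (negPf nj) mulr0.
    rewrite big1 => [|i _]; last first.
      by rewrite /dlt; case: eqP => [E0|_]; [case: nb; exists i | rewrite mulr0].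
    rewrite /g /comp; case: ifP => // _; rewrite /rs oB; first exact: rs0.
    by move=> i E0; apply: nb; exists i.
  have Jg : Jset g.
    exists (fun l mu => - sgn Fq l [set: 'I_n]%SET * comp wd m1 (fun mu => rs (w ([set: 'I_n] :\ l)%SET) (e.1, mu)) mu); split=> [l|mu].
      have [fs Hfs] := rs_finite (Xw ([set: 'I_n] :\ l)%SET).
      exists [seq e.2 | e <- fs] => mu; rewrite /comp; case: ifP => _; last by rewrite mulr0 eqxx.
      rewrite mulf_eq0 negb_or => /andP[_ nz].
      by split; [apply/mapP; exists (e.1, mu) => //; apply: Hfs nz | have [] := rs_Mt nz].
    under eq_bigr do rewrite FoZ (Fo_comp supM).
    rewrite /g /comp addnC; have [Em|nm] := eqVneq (wd mu) (d + m1)%N; last first.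
      by rewrite big1 // => l _; rewrite mulr0.
    rewrite rE rs_nab // -sumrN; apply: eq_big => [l|l _]; first by rewrite inE.
    rewrite mulNr (@top_residue l _ m1) //; last by rewrite /= Em addnC.
      exact: X_bd.
    by move=> e' /tw.
  have gz : forall i, g (b i) = 0.
    by apply: hind; apply: Jset_ext Jg => mu; rewrite gE.
  have : g e.2 = 0 by rewrite gE big1 // => i _; rewrite gz mul0r.
  by rewrite /g /comp we eqxx; case: (e).
- by move=> w k Xw Xk Pw e; rewrite nabB_nab.
pose t' T e := pit^-1 * (t T e - nab k T e).
have Xt' : Xf t' by move=> T; apply: pdiv; [apply: XfB | apply: rk].
have Er' e : pit^-1 * be e + nab t' [set: 'I_n]%SET e = 0.
  by rewrite (nabZ _ (fun T => X_bd (XfB Xt Xk T))) nabB_nab // -mulrDr Er mulr0.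
exists t'; split=> //.
- have := XN (nab_X Xt' [set: 'I_n]%SET); congr X; apply: funext => e.
  by apply/eqP; rewrite eq_sym -addr_eq0 Er'.
- by move=> e /oB ->; rewrite mulr0.
- by move=> T nT; apply: funext => e; rewrite /t' dt // (deg_nab dk) // subr0 mulr0.
Qed.

(** By [indep_step] the element [be] is divisible by every power of [pit]. For [n = 0] there are no
    operators and the relation itself reads [be = 0]. *)
Theorem lift_indep be th : X be -> onB be -> (forall l, X (th l)) ->
  (forall e, be e + \sum_l dl l (th l) e = 0) -> forall e, be e = 0.
Proof.
move=> Xb oB Xth E0 e; have [n0|n0] := posnP n.
  have := E0 e; rewrite big1 ?addr0 // => l _; exfalso.
  have h : (0 < n)%N := leq_ltn_trans (leq0n l) (ltn_ord l); by rewrite n0 in h.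
have H k : exists t, rel (fun e => pit^-1 ^+ k * be e) t.
  elim: k => [|k [t Ht]].
    exists (of_fam th); split.
    - by move: Xb; congr X; apply: funext => e'; rewrite expr0 mul1r.
    - by move=> e' /oB ->; rewrite mulr0.
    - exact: of_fam_X.
    - move=> T nT; apply: funext => e'; rewrite /of_fam big1 // => l _; rewrite ifF ?mul0r //.
      apply/negP => /eqP ET; apply: nT; have := card_setD l; rewrite -ET => E1.
      by apply: succn_inj; rewrite E1 prednK.
    - by move=> e'; rewrite expr0 mul1r of_fam_nab.
  have [t' Ht'] := indep_step n0 Ht; exists t'; move: Ht'.
  by congr rel; apply: funext => e'; rewrite exprS mulrA.
apply: (ord_eq0 hord) => N; pose k := Num.bound `|N / o|.
have Nm : N <= k%:R * o.
  rewrite -ler_pdivrMr //; apply: le_trans (ler_norm _) (ltW _).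
  by have := archi_boundP (normr_ge0 (N / o)); rewrite /k /Num.bound normr_id.
have [t [[hb _] _ _ _ _]] := H k; have := hb e; rewrite add0e => hk.
have -> : be e = pit ^+ k * (pit^-1 ^+ k * be e).
  by rewrite mulrA -exprMn divff ?pit_neq0' // expr1n mul1r.
rewrite (ordM hord) (ordX hord _ ord_pit) -[X in (X <= _)%E]adde0; apply: leeD; first by rewrite lee_fin.
exact: le_trans (om_ge0 e) hk.
Qed.

(** * Translation to the series rings, the complex and its cohomology *)

Variables (A : set K) (pipow : R -> K) (ppi : K) (Delta : set 'rV[R]_n) (Gamma : set 'rV[R]_s).
Variable H : E -> K.
Variable B : set 'rV[int]_n.
Hypothesis AP : forall x, A x <-> (0 <= ord x)%E.
Hypothesis ME : forall mu, M mu <-> lattice_cone Delta mu.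
Hypothesis MGE : forall ga, MG ga <-> lattice_cone Gamma ga.
Hypothesis pipowD : forall mu, pipow (lweight Delta mu) = pit ^+ wd mu.
Hypothesis pipowG : forall ga, pipow (lweight Gamma ga) = pit ^+ wG ga.
Hypothesis G0E : forall a, G0 a = ppi * H a.
Hypothesis BE : range b = B.

Local Notation xtser := ('rV[int]_n -> 'rV[int]_s -> K).
Definition unc (eta : xtser) : E -> K := fun e => eta e.2 e.1.
Definition cur (y : E -> K) : xtser := fun mu ga => y (ga, mu).
Local Notation C0' := (C0 ord A pipow Delta Gamma).
Local Notation O0' := (O0 ord A pipow Gamma).
Local Notation Dop' := (Dop ord ppi H).

Lemma fun_sum_app (T : Type) (V : zmodType) (I : Type) (q : seq I) (P : pred I) (F : I -> T -> V) x :
  (\sum_(i <- q | P i) F i) x = \sum_(i <- q | P i) F i x.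
Proof.
elim: q => [|i q IH]; first by rewrite !big_nil.
by rewrite !big_cons; case: ifP => // _; rewrite -IH.
Qed.

Lemma curK y : unc (cur y) = y. Proof. by apply: funext => -[]. Qed.

Lemma ord_oo (x : K) : (+oo <= ord x)%E -> x = 0.
Proof. by rewrite leye_eq => /eqP h; have [_ h2 _ _] := hord; apply/h2. Qed.

Let pitX k : pit ^+ k != 0. Proof. by rewrite expf_neq0 ?pit_neq0'. Qed.

Lemma tcoef_ge (t : 'rV[int]_s -> K) ga (N : R) :
  (N%:E <= ord (tcoef pipow Gamma t ga))%E = (N%:E + ((wG ga)%:R * o)%:E <= ord (t ga))%E.
Proof. by rewrite /tcoef pipowG ord_div. Qed.

Lemma O0P (t : 'rV[int]_s -> K) : O0' t <-> [/\ forall ga, ~ MG ga -> t ga = 0,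
  forall ga, MG ga -> (((wG ga)%:R * o)%:E <= ord (t ga))%E
  & forall N : R, finite_set [set ga | MG ga /\ (ord (t ga) < N%:E + ((wG ga)%:R * o)%:E)%E]].
Proof.
have eqs (N : R) : [set ga | lattice_cone Gamma ga /\ (ord (tcoef pipow Gamma t ga) < N%:E)%E] =
    [set ga | MG ga /\ (ord (t ga) < N%:E + ((wG ga)%:R * o)%:E)%E].
  by apply/seteqP; split=> ga /= [/MGE Mg h]; split=> //; move: h; rewrite !ltNge tcoef_ge.
split=> [[h0 hA ht]|[h0 hA ht]]; split.
- by move=> ga nM; apply: h0 => /MGE.
- by move=> ga /MGE/hA/AP; rewrite tcoef_ge add0e.
- by move=> N; rewrite -eqs; apply: ht.
- by move=> ga nM; apply: h0 => /MGE.
- by move=> ga /MGE/hA h; apply/AP; rewrite tcoef_ge add0e.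
- by move=> N; have := ht N; rewrite -eqs.
Qed.

Lemma xcoef_ge (eta : xtser) mu ga (c : \bar R) : (c <= ord (xcoef pipow Delta eta mu ga))%E <->
  (c + ((wd mu)%:R * o)%:E <= ord (eta mu ga))%E.
Proof.
rewrite /xcoef pipowD; case: c => [c| |]; first by rewrite ord_div.
  rewrite addye // (ordM hord) (ordV hord (ordX hord _ ord_pit)).
  by case: (ord _).
by rewrite addNye !leNye.
Qed.

(** Nested against joint convergence: only finitely many [mu] have a normalized coefficient below a
    given valuation, and each of them only for finitely many [ga]. *)
Lemma C0P eta : C0' eta <-> X (unc eta).
Proof.
have Wo mu ga : ((Wt (ga, mu))%:R * o)%:E = (((wG ga)%:R * o)%:E + ((wd mu)%:R * o)%:E)%E.
  by rewrite -EFinD -mulrDl -natrD.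
split=> [[z0 hO t0]|[hb fin]].
  have hb : bd 0 (unc eta).
    move=> [ga mu]; rewrite add0e /unc /=.
    have [Mm|nMm] := pselect (M mu); last first.
      have -> : eta mu ga = 0 by rewrite z0 // => /ME.
      by rewrite (vord0 hord) leey.
    have /O0P[h0 hA _] := hO mu ((ME mu).1 Mm).
    have [Mg|nMg] := pselect (MG ga).
      by rewrite omE // Wo; apply/xcoef_ge; apply: hA.
    have := h0 ga nMg; rewrite /xcoef pipowD => /eqP.
    rewrite mulf_eq0 invr_eq0 (negPf (pitX _)) orbF => /eqP ->.
    by rewrite (vord0 hord) leey.
  split=> // N.
  pose F := [set mu | lattice_cone Delta mu /\ (ordO0 ord pipow Gamma (xcoef pipow Delta eta mu) < N%:E)%E].
  apply: (@sub_finite_set _ _ (\bigcup_(mu in F) [set (ga, mu) | ga in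
    [set ga | lattice_cone Gamma ga /\ (ord (tcoef pipow Gamma (xcoef pipow Delta eta mu) ga) < N%:E)%E]])); last first.
    apply: bigcup_finite; first exact: t0.
    by move=> mu [Mm _]; apply: finite_image; have [_ _ h] := hO mu Mm; apply: h.
  move=> [ga mu] /= lt.
  have [Mg Mm] : Mt (ga, mu).
    apply: contrapT => nM; have := hb (ga, mu); rewrite (omNE nM) addey // => h.
    by move: lt; rewrite (omNE nM) addey // ltNge h.
  have lt' : (ord (tcoef pipow Gamma (xcoef pipow Delta eta mu) ga) < N%:E)%E.
    rewrite ltNge tcoef_ge; apply/negP => /xcoef_ge h; move: lt; rewrite ltNge => /negP; apply.
    by rewrite omE // Wo addeA.
  exists mu; last by exists ga => //; split=> //; apply/MGE.
  split; first exact/ME.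
  by apply: le_lt_trans lt'; apply: ereal_inf_lbound; exists ga => //; apply/MGE.
have hO mu : lattice_cone Delta mu -> O0' (xcoef pipow Delta eta mu).
  move=> /ME Mm; apply/O0P; split=> [ga nM|ga Mg|N].
  - have E0 : eta mu ga = 0.
      by apply: ord_oo; have := hb (ga, mu); rewrite omNE ?addey // => -[].
    by rewrite /xcoef E0 mul0r.
  - by apply/xcoef_ge; have := hb (ga, mu); rewrite add0e omE // Wo.
  - apply: sub_finite_set (finite_image fst (fin N)) => ga [Mg lt]; exists (ga, mu) => //=.
    rewrite ltNge; apply/negP => h; move: lt; rewrite ltNge => /negP; apply; apply/xcoef_ge.
    by move: h; rewrite omE // Wo addeA.
split=> // [mu nM|N].
  apply: funext => ga; apply: ord_oo; have := hb (ga, mu); rewrite omNE ?addey //.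
  by move=> [_ /ME].
apply: sub_finite_set (finite_image snd (fin N)) => mu [Mm lt].
have [ga [Mg lt']] : exists ga, MG ga /\ (ord (tcoef pipow Gamma (xcoef pipow Delta eta mu) ga) < N%:E)%E.
  apply: contrapT => /forallNP h; move: lt; rewrite ltNge => /negP; apply.
  rewrite /ordO0; apply: le_ereal_inf_tmp => _ [ga Mg <-]; rewrite leNgt; apply/negP => lt.
  by apply: (h ga); split=> //; apply/MGE.
exists (ga, mu) => //=; rewrite ltNge; apply/negP => h; move: lt'; rewrite ltNge => /negP; apply.
by rewrite tcoef_ge; apply/xcoef_ge; move: h; rewrite omE ?Wo ?addeA //; split=> //; apply/ME.
Qed.

Lemma DopE l eta mu ga : Dop' l eta mu ga = dl l (unc eta) (ga, mu).
Proof.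
rewrite /Dop /dl /=; congr (_ + vsum _ _); apply: funext => a.
by rewrite /gl G0E [ppi * (_ * _)]mulrCA.
Qed.

Lemma nablaE w T mu ga : nabla ord ppi H w T mu ga = nab (fun T => unc (w T)) T (ga, mu).
Proof. by apply: eq_bigr => l _; rewrite DopE. Qed.

Lemma Omega_Xf i w : Omega ord A pipow Delta Gamma i w ->
  Xf (fun T => unc (w T)) /\ deg i (fun T => unc (w T)).
Proof.
move=> Om; split=> T.
  by have := Om T; case: eqP => _ => [/C0P//|->]; apply: X0.
by move=> nT; have := Om T; case: eqP => // _ ->.
Qed.

Lemma Omega_cur i t : Xf t -> (forall T, #|T| <> i -> t T = fun=> 0) ->
  Omega ord A pipow Delta Gamma i (fun T => cur (t T)).
Proof.
move=> Xt dt T; case: eqP => [_|nT]; first by apply/C0P; rewrite curK.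
by rewrite dt.
Qed.

Lemma cobP i w : coboundaries ord A pipow ppi Delta Gamma H i w <->
  (i = 0%N /\ w = 0) \/ exists j th, [/\ i = j.+1, Omega ord A pipow Delta Gamma j th & nabla ord ppi H th = w].
Proof.
case: i => [|i] /=; split.
- by move=> ->; left.
- by case=> [[_ ->]//|[j [th []]]].
- by move=> [th Oth <-]; right; exists i, th.
- by case=> [[]//|[j [th [[->] Oth <-]]]]; exists th.
Qed.

Lemma nab_cur t : (fun T => unc (cur (t T))) = t :> ({set 'I_n} -> E -> K).
Proof. by apply: funext => T; rewrite curK. Qed.

Theorem lift_acyclic i : i != n -> acyclic_at ord A pipow ppi Delta Gamma H i.
Proof.
move=> ni w [Om nw]; have [Xw dw] := Omega_Xf Om.
have nw' T e : nab (fun T => unc (w T)) T e = 0.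
  by case: e => ga mu; rewrite -nablaE nw.
apply/cobP; have [lt|ge] := ltnP i n; last first.
  have w0 : w = 0.
    apply: funext => T; have := Om T; case: eqP => // cT _; exfalso.
    have := max_card (mem T); rewrite card_ord cT => h.
    by case/eqP: ni; apply/eqP; rewrite eqn_leq h.
  case: i ni ge {Om dw} => [|j] _ _; first by left.
  right; exists j, (fun T => cur (fun=> 0)); split=> //.
    by apply: Omega_cur => // T; apply: X0.
  by rewrite w0; apply: funext => T; apply: funext => mu; apply: funext => ga; rewrite nablaE nab_cur nab0.
have [t [Xt dt Ew]] := lift_exact lt Xw dw nw'.
have Et : nabla ord ppi H (fun T => cur (t T)) = w.
  by apply: funext => T; apply: funext => mu; apply: funext => ga; rewrite nablaE nab_cur -Ew.
case: i ni Om dw lt dt => [|j] ni Om dw lt dt; last first.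
  right; exists j, (fun T => cur (t T)); split=> //; apply: Omega_cur => // T nT.
  by apply: dt => -[].
left; split=> //; rewrite -Et; apply: funext => T; apply: funext => mu; apply: funext => ga.
have t0 : t = fun _ _ => 0 by apply: funext => T0; apply: dt.
by rewrite nablaE nab_cur t0 nab0.
Qed.

Definition bea (c : 'I_r -> 'rV[int]_s -> K) : E -> K := fun e =>
  \sum_j (if e.2 == b j then c j e.1 * pit ^+ wd (b j) else 0).

Lemma bea_at c ga j : bea c (ga, b j) = c j ga * pit ^+ wd (b j).
Proof.
rewrite /bea (bigD1 j) //= eqxx big1 ?addr0 // => i ni.
by rewrite (inj_eq b_inj) eq_sym (negPf ni).
Qed.

Lemma bea_X c : (forall j, O0' (c j)) -> X (bea c) /\ onB (bea c).
Proof.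
move=> Oc; split; last first.
  by move=> e ne; rewrite /bea big1 // => j _; case: eqP => // /ne.
apply: X_sum => j _; have /O0P[h0 hA hf] := Oc j; split=> [[ga mu]|N] /=.
  rewrite add0e; case: eqP => [Em|_]; last by rewrite (vord0 hord) leey.
  have [Mg|nM] := pselect (MG ga); last by rewrite h0 // mul0r (vord0 hord) leey.
  rewrite omE; last by split=> //; rewrite /= Em.
  rewrite Em /Wt /= natrD mulrDl EFinD (ordM hord) (ordX hord _ ord_pit) leeD2r //.
  exact: hA.
apply: sub_finite_set (finite_image (fun ga => (ga, b j)) (hf N)) => -[ga mu] /=.
case: eqP => [Em|_]; last by rewrite (vord0 hord) ltNge leey.
have [Mg|nM] := pselect (MG ga); last by rewrite h0 // mul0r (vord0 hord) ltNge leey.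
move=> lt; exists ga; last by rewrite Em.
split=> //; rewrite ltNge; apply/negP => h; move: lt; rewrite ltNge => /negP; apply.
rewrite omE; last by split=> //; rewrite /= Em.
rewrite Em /Wt /= natrD mulrDl EFinD addeA (ordM hord) (ordX hord _ ord_pit) leeD2r //.
Qed.

Lemma onB_bea be : X be -> onB be -> exists c, (forall j, O0' (c j)) /\ forall e, be e = bea c e.
Proof.
move=> Xb oB; have /C0P[_ hO _] : X (unc (cur be)) by rewrite curK.
exists (fun j => xcoef pipow Delta (cur be) (b j)); split=> [j|[ga mu]]; first by apply: hO; apply/ME.
have [[j ->]|nb] := pselect (exists j, mu = b j).
  by rewrite bea_at /xcoef pipowD divfK.
rewrite oB; first by rewrite /bea big1 // => j _; case: eqP => // E0; case: nb; exists j.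
by move=> j E0; apply: nb; exists j.
Qed.

Lemma oscaleE (t : 'rV[int]_s -> K) (v mu : 'rV[int]_n) (ga : 'rV[int]_s) :
  oscale ord t (pimonomial pipow Delta v : xtser) mu ga =
  if mu == v then t ga * pit ^+ wd v else 0.
Proof.
rewrite /oscale /pimonomial; apply: etrans (vsumE hord (has_vsum_fin hord (J := [fset ga]%fset) _)) _.
  move=> g; rewrite inE => ng; have -> : (ga - g == 0) = false by rewrite subr_eq0 eq_sym (negPf ng).
  by rewrite andbF mulr0.
by rewrite big_seq_fset1 subrr eqxx andbT pipowD; case: ifP => // _; rewrite mulr0.
Qed.

Lemma spanP eta : O0_span ord A pipow Delta Gamma B eta <-> X (unc eta) /\ onB (unc eta).
Proof.
split=> [[J [t [JB Jt Ee]]]|[Xe oe]].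
  suff -> : unc eta = bea (fun j => if b j \in J then t (b j) else fun=> 0).
    apply: bea_X => j; case: ifP => [/Jt//|_]; apply/O0P; split=> // [ga _|N].
      by rewrite (vord0 hord) leey.
    by apply: (@sub_finite_set _ _ set0) => // ga [_]; rewrite (vord0 hord) ltNge leey.
  apply: funext => -[ga mu]; rewrite /unc /= Ee !fun_sum_app.
  under eq_bigr do rewrite oscaleE.
  have [[j ->]|nb] := pselect (exists j, mu = b j).
    rewrite bea_at; case: ifP => [bJ|nJ].
      rewrite (bigD1_seq (b j)) ?fset_uniq //= eqxx big1 ?addr0 // => v nv.
      by rewrite eq_sym (negPf nv).
    rewrite mul0r big_seq big1 // => v vJ; case: eqP => // E0.
    by move: vJ; rewrite -E0 nJ.
  rewrite /bea [RHS]big1 => [|j _]; last by case: eqP => // E0; case: nb; exists j.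
  rewrite big_seq big1 // => v vJ; case: eqP => // E0; case: nb.
  by have := JB v vJ; rewrite -BE => -[j _ Ej]; exists j; rewrite E0.
have [c [Oc Ec]] := onB_bea Xe oe.
have bB v : v \in [fset b j | j in 'I_r]%fset -> exists j, v = b j.
  by move=> /imfsetP[j _ ->]; exists j.
have inv v : exists t, forall j, v = b j -> t = c j.
  have [[j ->]|nb] := pselect (exists j, v = b j); first by exists (c j) => i /b_inj ->.
  by exists (fun=> 0) => j Ej; case: nb; exists j.
have /choice[t Ht] := inv.
exists [fset b j | j in 'I_r]%fset, t; split=> [v /bB[j ->]|v /bB[j Ej]|].
- by rewrite -BE; exists j.
- by rewrite (Ht v j Ej).
apply: funext => mu; apply: funext => ga; rewrite !fun_sum_app.
under eq_bigr do rewrite oscaleE.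
have -> : eta mu ga = unc eta (ga, mu) by [].
rewrite Ec big_imfset /=; last by move=> x y _ _ /b_inj.
rewrite /bea [RHS]big_enum_cond /=; apply: eq_big => [j|j _]; first by rewrite ?inE.
by rewrite (Ht (b j) j erefl).
Qed.

Lemma sum_Dop (th : 'I_n -> xtser) mu ga :
  (\sum_l Dop' l (th l)) mu ga = \sum_l dl l (unc (th l)) (ga, mu).
Proof. by rewrite !fun_sum_app; apply: eq_bigr => l _; rewrite DopE. Qed.

Theorem lift_direct_sum : direct_sum C0' (O0_span ord A pipow Delta Gamma B)
  (D_image ord A pipow ppi Delta Gamma H).
Proof.
split=> [x|].
  split=> [/C0P/lift_span[be [th [Xb oB Xth Ex]]]|[y [z [/spanP[Xy _] [th [Xth ->]] ->]]]].
    exists (cur be), (\sum_l Dop' l (cur (th l))); split.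
    - by apply/spanP; rewrite curK.
    - by exists (fun l => cur (th l)); split=> // l; apply/C0P; rewrite curK.
    - apply: funext => mu; apply: funext => ga; have := Ex (ga, mu); rewrite /unc /= => ->.
      rewrite -[RHS]/(cur be mu ga + (\sum_l Dop' l (cur (th l))) mu ga) sum_Dop.
      by congr (_ + _); apply: eq_bigr => l _; rewrite curK.
  apply/C0P; have Xs : X (fun e => \sum_l dl l (unc (th l)) e).
    by apply: X_sum => l _; apply: dl_X; apply/C0P.
  have := XD Xy Xs; congr X; apply: funext => -[ga mu].
  by rewrite -sum_Dop.
apply/seteqP; split=> [eta [/spanP[Xe oe] [th [Xth Ee]]]|eta ->].
  apply: funext => mu; apply: funext => ga.
  have Xt l : X (unc (th l)) by apply/C0P.
  apply: (@lift_indep _ (fun l e => -1 * unc (th l) e) Xe oe _ _ (ga, mu)) => [l|[ga' mu']].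
    by apply: XZ => //; rewrite (ordN hord) (vord1 hord).
  under eq_bigr do rewrite (dlZ _ _ (X_bd (Xt _))) mulN1r.
  by rewrite sumrN -sum_Dop -Ee subrr.
split; first by apply/spanP; split; [exact: X0 | ].
exists (fun _ _ _ => 0); split=> [l|]; first by apply/C0P; apply: X0.
by apply: funext => mu; apply: funext => ga; rewrite sum_Dop big1 // => l _; rewrite dl0.
Qed.

Lemma pimonomial_C0 j : C0' (pimonomial pipow Delta (b j)).
Proof.
apply/C0P; split=> [[ga mu]|N]; rewrite /unc /pimonomial /=.
  rewrite add0e; case: ifP => [/andP[/eqP -> /eqP ->]|_]; last by rewrite (vord0 hord) leey.
  rewrite pipowD (ordX hord _ ord_pit) omE; first by rewrite /Wt /= wG0 add0n.
  exact: (conj MG0 (Mb j)).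
apply: (@sub_finite_set _ _ [set (0, b j)]) => // -[ga mu] /=.
by case: ifP => [/andP[/eqP -> /eqP ->]|_] //; rewrite (vord0 hord) ltNge leey.
Qed.

Lemma cob_top w : coboundaries ord A pipow ppi Delta Gamma H n w ->
  exists th, (forall l, X (th l)) /\ forall mu ga, w [set: 'I_n]%SET mu ga = \sum_l dl l (th l) (ga, mu).
Proof.
move=> /cobP[[n0 ->]|[j [t [_ Ot <-]]]].
  exists (fun _ _ => 0); split=> [l|mu ga]; first exact: X0.
  by rewrite big1 // => l _; rewrite dl0.
have [Xt _] := Omega_Xf Ot.
exists (fun l e => sgn K l [set: 'I_n]%SET * unc (t ([set: 'I_n] :\ l)%SET) e); split=> [l|mu ga].
  by apply: XZ => //; rewrite ord_sgn.
by rewrite nablaE nab_setT.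
Qed.

Theorem lift_free : cohomology_free ord A pipow ppi Delta Gamma H n r.
Proof.
pose e (j : 'I_r) (T : {set 'I_n}) : xtser := if T == [set: 'I_n]%SET then pimonomial pipow Delta (b j) else 0.
have eS (c : 'I_r -> 'rV[int]_s -> K) T mu ga :
    (\sum_(j < r) (fun S => oscale ord (c j) (e j S))) T mu ga =
    if T == [set: 'I_n]%SET then bea c (ga, mu) else 0.
  rewrite !fun_sum_app /e; case: eqP => _.
    by apply: eq_bigr => j _; rewrite oscaleE.
  apply: big1 => j _; rewrite /oscale.
  apply: etrans (vsumE hord (has_vsum_fin hord (J := fset0) _)) _; last by rewrite big_seq_fset0.
  by move=> g _; rewrite mulr0.
exists e; split=> [j|w [Om nw]].
  split=> [T|].
    rewrite /e; case: eqP => cT; first by rewrite (card_full cT) eqxx; apply: pimonomial_C0.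
    by rewrite ifF //; apply/eqP => ET; apply: cT; rewrite ET cardsT card_ord.
  apply: funext => T; apply: funext => mu; apply: funext => ga; rewrite nablaE /nab big1 // => l lT.
  rewrite /e ifF; first by rewrite (_ : unc 0 = fun=> 0) ?dl0 ?mulr0.
  by apply/eqP => /setP/(_ l); rewrite !inE eqxx.
have [Xw dw] := Omega_Xf Om.
have [be [th [Xb oB Xth Ey]]] := lift_span (Xw [set: 'I_n]%SET).
have [c [Oc Ec]] := onB_bea Xb oB.
exists c; split=> [|c' [Oc' cob']].
  split=> //; apply/cobP.
  have Ew T mu ga : (w - \sum_(j < r) (fun S => oscale ord (c j) (e j S))) T mu ga =
      nab (of_fam th) T (ga, mu).
    rewrite -[LHS]/(w T mu ga - (\sum_(j < r) (fun S => oscale ord (c j) (e j S))) T mu ga) eS.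
    have [->|nT] := eqVneq T [set: 'I_n]%SET.
      rewrite of_fam_nab // -Ec; have := Ey (ga, mu); rewrite /unc /= => ->.
      by rewrite addrAC subrr add0r.
    have nTn : #|T| <> n by move=> /card_full; apply/eqP.
    rewrite subr0; have /(congr1 (fun g => g (ga, mu))) := dw T nTn; rewrite /unc /= => ->.
    rewrite (@deg_nab n) // => T' nT'; apply: funext => e0; rewrite /of_fam big1 // => l _; rewrite ifF ?mul0r //.
    by apply/negP => /eqP ET; apply: nT'; rewrite ET; apply: card_setD.
  (* In degree 0 the only coboundary is 0, so for [n = 0] the difference itself has to vanish. *)
  have [n0|n0] := posnP n.
    left; split=> //; apply: funext => T; apply: funext => mu; apply: funext => ga; rewrite Ew.
    rewrite /nab big1 // => l _; exfalso.
    have h : (0 < n)%N := leq_ltn_trans (leq0n l) (ltn_ord l); by rewrite n0 in h.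
  right; exists n.-1, (fun T => cur (of_fam th T)); split; first by rewrite prednK.
    apply: Omega_cur; first exact: of_fam_X.
    move=> T nT; apply: funext => e0; rewrite /of_fam big1 // => l _; rewrite ifF ?mul0r //.
    apply/negP => /eqP ET; apply: nT; have := card_setD l; rewrite -ET => E1.
    by apply: succn_inj; rewrite E1 prednK.
  by apply: funext => T; apply: funext => mu; apply: funext => ga; rewrite nablaE nab_cur Ew.
have [th' [Xth' Eth']] := cob_top cob'; have [Xc' oc'] := bea_X Oc'.
have Eb : forall e0, be e0 + -1 * bea c' e0 = 0.
  apply: (@lift_indep _ (fun l e => th l e + -1 * th' l e)).
  - by apply: XD => //; apply: XZ => //; rewrite (ordN hord) (vord1 hord).
  - by move=> e0 ne; rewrite oB // oc' // mulr0 addr0.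
  - by move=> l; apply: XD => //; apply: XZ => //; rewrite (ordN hord) (vord1 hord).
  - move=> [ga mu].
    have X1 l : X (fun e => -1 * th' l e) by apply: XZ => //; rewrite (ordN hord) (vord1 hord).
    under eq_bigr do rewrite (dlD _ (X_bd (Xth _)) (X_bd (X1 _))) (dlZ _ _ (X_bd (Xth' _))) mulN1r.
    rewrite sumrB -Eth' mulN1r.
    rewrite -[(w - _) _ mu ga]/(w [set: 'I_n]%SET mu ga - (\sum_(j < r) (fun S => oscale ord (c' j) (e j S))) [set: 'I_n]%SET mu ga).
    rewrite eS eqxx; have := Ey (ga, mu); rewrite /unc /= => ->.
    by ring.
apply: funext => j; apply: funext => ga; apply: (mulIf (pitX (wd (b j)))).
rewrite -!bea_at -Ec; apply/eqP; rewrite -subr_eq0 -mulN1r; apply/eqP; exact: Eb.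
Qed.

Theorem lift_main : [/\ forall i, i != n -> acyclic_at ord A pipow ppi Delta Gamma H i,
  cohomology_free ord A pipow ppi Delta Gamma H n r
  & direct_sum C0' (O0_span ord A pipow Delta Gamma B) (D_image ord A pipow ppi Delta Gamma H)].
Proof. by split; [exact: lift_acyclic | exact: lift_free | exact: lift_direct_sum]. Qed.

End Lift.

End ReductionLifting.

From mathcomp Require Import all_boot all_order all_algebra falgebra fieldext.
From mathcomp Require Import finmap.
From mathcomp Require Import all_classical all_reals all_analysis.
From mathcomp Require Import ring lra zify all_field.
Import Defs FourierMotzkin PolytopeWeight KoszulComplex ToricJacobian NewtonPolytope PadicField ReductionLifting.
Import Order.TTheory GRing.Theory Num.Theory.
Local Open Scope classical_set_scope.
Local Open Scope ring_scope.

(** * Artin-Hasse estimates for the coefficients of [pi x_l dH/dx_l] *)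

Section Estimates.
Variables (R : realType) (p a n s : nat) (hp : prime p).
Variables (Fq : finFieldType) (f : {fsfun 'rV[int]_n -> Fq with 0}).
Local Notation Delta := (newton R f).
Hypothesis hwt : forall mu, f mu != 0 -> lweight Delta mu = 1.
Variable P : {fsfun 'rV[int]_s * 'rV[int]_n -> Fq with 0}.
Hypothesis hP : forall e, P e != 0 -> lattice_cone Delta e.2 /\ lweight Delta e.2 < 1.
Local Notation Gamma := (deformation_polytope R f P).
Variables (Qp : fieldType) (K : fieldExtType Qp) (Qq : {subfield K}).
Variables (ord : K -> \bar R) (hord : valuation ord).
Hypothesis hQp : is_Qp (fun x : Qp => ord x%:A) p.
Variables (red : K -> Fq) (hred : residue_map Qq ord red).
Variables (tau : Fq -> K) (htau : teichmuller Qq ord red tau).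
Variables (ppi : K) (hpi : AH_root ord p ppi).
Variables (pit : K) (d : nat) (hd : (0 < d)%N) (hpit : pit ^+ d = ppi).
Hypothesis hdDelta : forall mu, lattice_cone Delta mu -> d%:R * lweight Delta mu \is a Num.nat.
Hypothesis hdGamma : forall ga, lattice_cone Gamma ga -> d%:R * lweight Gamma ga \is a Num.nat.
Variable sigma : {lrmorphism K -> K}.
Local Notation E := ('rV[int]_s * 'rV[int]_n)%type.
Local Notation G := (deformed f P).
Local Notation H := (Hcoef ord tau sigma p ppi G).
Local Notation wd := (@wd R Fq n f d).

Lemma Gamma_polytope : polytope Gamma.
Proof.
apply: hull_polytope; apply: finite_image; apply: (@sub_finite_set _ _ [set` finsupp P]).
  by move=> e /= nz; rewrite mem_finsupp.
exact: finite_fset.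
Qed.
Let hG := Gamma_polytope.
Let hD := newton_polytope R f.

Definition wG ga : nat := Num.truncn (d%:R * lweight Gamma ga).

Let dR : (0 : R) < d%:R. Proof. by rewrite ltr0n. Qed.

Lemma wGE ga : lattice_cone Gamma ga -> (wG ga)%:R = d%:R * lweight Gamma ga :> R.
Proof. by move=> /hdGamma h; rewrite /wG truncnK. Qed.

Lemma wG0 : wG 0 = 0%N.
Proof. by rewrite /wG (lweight0 hG) mulr0 truncn0. Qed.

Lemma wGD u v : lattice_cone Gamma u -> lattice_cone Gamma v -> (wG (u + v) <= wG u + wG v)%N.
Proof.
move=> cm cn; rewrite -(ler_nat R) natrD !wGE //; last exact: (lattice_coneD hG).
by rewrite -mulrDr ler_pM2l //; apply: (lweightD hG).
Qed.

Local Notation o := ((ram p d)%:R^-1 : R).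
Local Notation Mt := (@Mt n s (lattice_cone Gamma) (lattice_cone Delta)).
Local Notation Wt := (@Wt n s wG wd).
Local Notation om := (@om R n s o (lattice_cone Gamma) wG (lattice_cone Delta) wd).

Let ram0 : (0 < ram p d)%N. Proof. exact: ram_gt0. Qed.
Lemma o_gt0 : 0 < o. Proof. by rewrite invr_gt0 ltr0n. Qed.
Let p_gt1 : (1 < p)%N. Proof. exact: prime_gt1. Qed.
Let p1 : (1 : R) <= p%:R - 1.
Proof. by rewrite lerBrDr -(natrD _ 1 1) ler_nat. Qed.

Lemma do_pi : d%:R * o = (p%:R - 1)^-1.
Proof. exact: ram_pi. Qed.

Lemma o_le1 : o <= 1.
Proof. by rewrite invf_le1 ?ltr0n // ler1n. Qed.

(** The scaling by [1/(1 - w(mu))] in [Gamma] serves here: it makes the weight of [gamma] at most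
    [1 - w(mu)], so that [W <= 1] on the support of [G]. *)
Lemma supp_weight e : G e != 0 -> [/\ Mt e, (Wt e <= d)%N
  & (wd e.2 < d)%N \/ [/\ e.1 = 0, f e.2 != 0 & G e = f e.2]].
Proof.
rewrite /deformed; have [P0|Pn] := eqVneq (P e) 0.
  rewrite P0 !addr0; have [e1 fe|_] := eqVneq e.1 0; last by rewrite eqxx.
  have [Me We] : lattice_cone Delta e.2 /\ wd e.2 = d.
    by apply: (suppM hwt hd hdDelta); rewrite mem_supp.
  split; [split=> //; rewrite e1; exact: (lattice_cone0 hG) | by rewrite /ReductionLifting.Wt e1 wG0 We |].
  by right.
move=> _; have [Me we] := hP Pn.
have w1 : 0 < 1 - lweight Delta e.2 by rewrite subr_gt0.
have Ge : lattice_cone Gamma e.1.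
  exists (1 - lweight Delta e.2); first exact: ltW.
  exists ((1 - lweight Delta e.2)^-1 *: lat R e.1); last by rewrite scalerA divff ?scale1r // gt_eqF.
  exists 1%N, (fun _ => (1 - lweight Delta e.2)^-1 *: lat R e.1), (fun _ => 1).
  by split=> //; rewrite ?big_ord1 ?scale1r // => _; right; exists e.
have {}h : lweight Gamma e.1 <= 1 - lweight Delta e.2.
  apply/(weightP hG Ge); split; first exact: ltW.
  exists ((1 - lweight Delta e.2)^-1 *: lat R e.1); last by rewrite scalerA divff ?scale1r // gt_eqF.
  exists 1%N, (fun _ => (1 - lweight Delta e.2)^-1 *: lat R e.1), (fun _ => 1).
  by split=> //; rewrite ?big_ord1 ?scale1r // => _; right; exists e.
have wdE' := wdE hdDelta Me.
split=> //; first by rewrite -(ler_nat R) natrD wGE // wdE' -mulrDr -[X in _ <= X]mulr1 ler_pM2l //; lra.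
by left; rewrite -(ltr_nat R) wdE' gtr_pMr.
Qed.

(** The coefficient at [e] of the [i]-th Frobenius twist of [G]; the sum has at most one term. *)
Let cc i (e : E) : K := \sum_(e' \in [set e' : E | e'.1 *+ p ^ i = e.1 /\ e'.2 *+ p ^ i = e.2])
      iter i sigma (tau (G e')).

(** A valuation multiplied by [#|Fq| > 1] without changing is 0 or [+oo]. The equation is preserved
    by [sigma], which makes all iterates of [tau c] integral. *)
Lemma ord_fix (x : K) : x ^+ #|Fq| = x -> (0 <= ord x)%E /\ ((0 < ord x)%E -> x = 0).
Proof.
have [->|/(ord_fin hord)[r Er]] := eqVneq x 0; first by rewrite (vord0 hord) leey.
move=> E1; have := ordX hord #|Fq| Er; rewrite E1 Er => -[] E2.
have q1 : (2 : R) <= #|Fq|%:R by rewrite (ler_nat _ 2); apply: finNzRing_gt1.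
have r0 : r = 0 by nra.
by rewrite r0; split=> //; rewrite ltxx.
Qed.

Lemma tau0 : tau 0 = 0.
Proof.
have [Zt rt E1] := htau 0; have [_] := ord_fix E1; apply.
by have [_ _ h _] := hred; apply/h.
Qed.

Lemma iter_sigma0 i : iter i sigma 0 = 0.
Proof. by elim: i => //= i ->; rewrite rmorph0. Qed.

Lemma ord_iter i c : (0 <= ord (iter i sigma (tau c)))%E.
Proof.
apply: (ord_fix _).1; have [_ _ E1] := htau c.
by elim: i => //= i IH; rewrite -rmorphXn /= IH.
Qed.

Lemma pi_neq0 i : (p ^ i)%N != 0%N. Proof. by rewrite expn_eq0 gtn_eqF // ltnW. Qed.

Lemma mulrn_inj m k (u v : 'rV[int]_m) : (k != 0)%N -> u *+ k = v *+ k -> u = v.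
Proof.
move=> k0 /rowP h; apply/rowP => i; have := h i; rewrite !mulmxnE => /eqP.
by rewrite eqr_pMn2r ?lt0n // => /eqP.
Qed.

Lemma cc_cases i e : cc i e = 0 \/ exists e', [/\ e'.1 *+ p ^ i = e.1, e'.2 *+ p ^ i = e.2,
  G e' != 0 & cc i e = iter i sigma (tau (G e'))].
Proof.
set S := [set e' : E | e'.1 *+ p ^ i = e.1 /\ e'.2 *+ p ^ i = e.2].
have [[e' [E1 E2]]|nS] := pselect (exists e', S e'); last first.
  by left; rewrite /cc -/S (_ : S = set0) ?fsbig_set0 //; apply/seteqP; split=> // x Sx; apply: nS; exists x.
have SE : S = [set e'].
  apply/seteqP; split=> [x [h1 h2]|x ->] //=.
  by case: x e' E1 E2 h1 h2 => x1 x2 [y1 y2] /= <- <- /(mulrn_inj (pi_neq0 i)) -> /(mulrn_inj (pi_neq0 i)) ->.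
have EC : cc i e = iter i sigma (tau (G e')) by rewrite /cc -/S SE fsbig_set1.
have [G0|Gn] := eqVneq (G e') 0; first by left; rewrite EC G0 tau0 iter_sigma0.
by right; exists e'.
Qed.

Lemma cc0 e : cc 0 e = tau (G e).
Proof.
rewrite /cc (_ : [set e' | _] = [set e]) ?fsbig_set1 //.
by apply/seteqP; split=> [[x y]|_ ->] /=; rewrite ?expn0 ?mulr1n //; case: e => u v /= [-> ->].
Qed.

(** The full series vanishes at [ppi], so a partial sum is minus its tail; the valuations
    [p^j/(p-1) - j] of the tail do not decrease, and its first term gives the bound. *)
Lemma ord_AH i : (((p ^ i.+1)%:R * (p%:R - 1)^-1 - i.+1%:R)%:E <= ord (AH_partial p ppi i.+1))%E \/ i = 0%N.
Proof.
case: i => [|i]; [by right | left]; set B := (_ - _ : R).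
have [cv ordpi] := hpi; have [m0 Hm] := cv B; pose m := maxn m0 i.+2.
have h1 : (B%:E <= ord (AH_partial p ppi m))%E by rewrite -[AH_partial _ _ _]subr0; apply: Hm; rewrite leq_maxl.
have -> : AH_partial p ppi i.+2 = AH_partial p ppi m - \sum_(i.+2 <= j < m) ppi ^+ (p ^ j) / p%:R ^+ j.
  rewrite /AH_partial -!(big_mkord xpredT (fun j => ppi ^+ (p ^ j) / p%:R ^+ j)).
  by rewrite [X in _ = X - _](@big_cat_nat _ _ _ i.+2) //= ?leq_maxr // addrK.
apply: (ordB hord) => //; rewrite big_nat; apply: (ord_sum hord) => j /andP[le_j _].
rewrite (ordM hord) (ordX hord _ ordpi) (ordV hord (ordX hord j (ord_p hQp))) -EFinD lee_fin mulr1 /B.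
elim: j le_j => [//|j IH]; rewrite leq_eqVlt => /predU1P[<- //|/IH]; move=> h; apply: le_trans h _.
have pj : (1 : R) <= (p ^ j)%:R by rewrite ler1n lt0n pi_neq0.
rewrite expnS natrM -[j.+1%:R]natr1.
have -> : p%:R * (p ^ j)%:R * (p%:R - 1)^-1 = (p ^ j)%:R + (p ^ j)%:R * (p%:R - 1)^-1 :> R.
  by field; apply: lt0r_neq0; exact: lt_le_trans ltr01 p1.
lra.
Qed.

(** The [i]-th term of [pi x_l dH/dx_l], in which [pi] cancels the [pi^-1] of [gamma_i]. *)
Let tt l i (e : E) : K := (e.2 ord0 l)%:~R * (AH_partial p ppi i.+1 * cc i e).

Lemma om_mulrn e k : Mt e -> (om (e.1 *+ k, e.2 *+ k)%R <= (k%:R * ((Wt e)%:R * o))%:E)%E /\ Mt (e.1 *+ k, e.2 *+ k).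
Proof.
move=> [M1 M2].
have h1 : lattice_cone Gamma (e.1 *+ k) /\ (wG (e.1 *+ k) <= k * wG e.1)%N.
  elim: k => [|k [h1 h2]]; first by rewrite mulr0n wG0; split=> //; apply: (lattice_cone0 hG).
  rewrite mulrS; split; first exact: (lattice_coneD hG).
  by apply: leq_trans (wGD M1 h1) _; rewrite mulSn leq_add2l.
have h2 : lattice_cone Delta (e.2 *+ k) /\ (wd (e.2 *+ k) <= k * wd e.2)%N.
  elim: k {h1} => [|k [h2 h3]]; first by rewrite mulr0n wd0; split=> //; apply: (lattice_cone0 hD).
  rewrite mulrS; split; first exact: (lattice_coneD hD).
  by apply: leq_trans (wdD hd hdDelta M2 h2) _; rewrite mulSn leq_add2l.
have Mk : Mt (e.1 *+ k, e.2 *+ k) by split; [case: h1 | case: h2].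
split=> //; rewrite omE // lee_fin mulrA ler_pM2r ?o_gt0 // -natrM ler_nat /ReductionLifting.Wt mulnDr.
by apply: leq_add; [case: h1 | case: h2].
Qed.

(** For [e = p^i e'] the derivation gives valuation [i], the partial sum [p^i + p^i/(p-1) - (i+1)],
    and [om e <= p^i/(p-1)] because [W(e') <= 1]. What is left is [p^i - 1], positive for
    [i > 0]. *)
Lemma tt_ge l i e : (((p ^ i)%:R - 1)%:E + om e <= ord (tt l i e))%E.
Proof.
rewrite /tt; case: (cc_cases i e) => [->|[e' [E1 E2 G' ->]]]; first by rewrite !mulr0 (vord0 hord) leey.
have [M' W' _] := supp_weight G'.
have [h1 _] := om_mulrn (p ^ i) M'; rewrite E1 E2 in h1.
have -> : e = (e.1, e.2) by case: (e).
apply: le_trans (leeD (lexx _) h1) _; rewrite -EFinD /=.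
have hc : (i%:R%:E <= ord (e.2 ord0 l)%:~R)%E.
  have pz : ((p ^ i)%:R : int)%:~R = p%:R ^+ i :> K by rewrite natz -pmulrn natrX.
  rewrite -E2 mulmxnE -[_ *+ p ^ i]mulr_natl intrM pz (ordM hord) (ordX hord i (ord_p hQp)).
  by rewrite mulr1 -[X in (X <= _)%E]adde0 leeD2l // ord_int.
have wo : (Wt e')%:R * o <= (p%:R - 1)^-1 by rewrite -do_pi ler_pM2r ?o_gt0 // ler_nat.
have pi0 : (1 : R) <= (p ^ i)%:R by rewrite ler1n lt0n pi_neq0.
have pr : 0 < (p%:R - 1)^-1 :> R by rewrite invr_gt0; exact: lt_le_trans ltr01 p1.
have key (z : R) : (z%:E <= ord (AH_partial p ppi i.+1))%E ->
    (p ^ i)%:R - 1 + (p ^ i)%:R * (p%:R - 1)^-1 <= i%:R + z ->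
    (((p ^ i)%:R - 1 + (p ^ i)%:R * ((Wt e')%:R * o))%:E <=
    ord ((e.2 ord0 l)%:~R * (AH_partial p ppi i.+1 * iter i sigma (tau (G e'))))%R)%E.
  move=> hz hle; rewrite !(ordM hord).
  apply: (@le_trans _ _ (i%:R%:E + (z%:E + 0%:E))%E); last by apply: leeD => //; apply: leeD => //; apply: ord_iter.
  rewrite -!EFinD lee_fin addr0; apply: le_trans hle; rewrite lerD2l ler_wpM2l //; lra.
case: (ord_AH i) => [h|i0].
  apply: (key _ h); rewrite expnS natrM -[i.+1%:R]natr1.
  have -> : p%:R * (p ^ i)%:R * (p%:R - 1)^-1 = (p ^ i)%:R + (p ^ i)%:R * (p%:R - 1)^-1 :> R.
    by field; apply: lt0r_neq0; exact: lt_le_trans ltr01 p1.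
  lra.
apply: (key (p%:R - 1)^-1); last by rewrite i0 expn0; lra.
have [_ <-] := hpi; rewrite i0 /AH_partial big_ord1 expn0 expr1 expr0 divr1; exact: lexx.
Qed.

(** A nonzero coordinate of [e.2] is divisible by [p^i] for each contributing [i], so the series is
    finite; if [e.2 = 0], the derivation kills the coefficient. *)
Lemma gl_expand l e : exists J : {fset nat}, 0%N \in J /\ (gl (fun e => ppi * H e) l e = \sum_(i <- J) tt l i e).
Proof.
have [e2|e2] := eqVneq e.2 0.
  exists [fset 0%N]%fset; rewrite inE eqxx; split=> //; rewrite big_seq_fset1 /tt /gl e2 mxE.
  by rewrite !mul0r.
have [k ek] : exists k, e.2 ord0 k != 0.
  by apply: contrapT => /forallNP h; case/eqP: e2; apply/rowP => k; rewrite mxE; apply/eqP/negPn/negP/h.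
pose N := (absz (e.2 ord0 k)).+1; pose J := fset_set `I_N.
have JP i : (i \in J) = (i < N)%N.
  by rewrite in_fset_set; [apply/idP/idP; rewrite inE | exact: finite_II].
have out i : i \notin J -> gam p ppi i * cc i e = 0.
  move=> iJ; case: (cc_cases i e) => [->|[e' [_ E2 _ _]]]; first by rewrite mulr0.
  exfalso; have : (absz (e.2 ord0 k) = absz (e'.2 ord0 k) * p ^ i)%N.
    by rewrite -E2 mulmxnE -mulr_natr abszM natz.
  have : (absz (e.2 ord0 k) != 0)%N by rewrite absz_eq0.
  move: iJ; rewrite JP -leqNgt /N.
  have := ltn_expl i p_gt1; move: (p ^ i)%N (absz _) (absz _) => q x y h1 h2 h3 h4.
  have : x != 0%N by apply: contra_neq h3 => x0; rewrite h4 x0.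
  by rewrite -lt0n => h5; nia.
exists J; split; first by rewrite JP.
rewrite /gl /=; have -> : H e = \sum_(i <- J) gam p ppi i * cc i e.
  by rewrite /Hcoef; apply: (vsumE hord); apply: has_vsum_fin.
rewrite mulr_sumr mulr_sumr; apply: eq_bigr => i _; rewrite /tt /gam; congr (_ * _).
have p0 : ppi != 0 by apply: contra_eqN hpi.2 => /eqP ->; rewrite (vord0 hord).
by rewrite -!mulrA mulVKf.
Qed.

Let ole : (o%:E <= ((p ^ 1)%:R - 1 : R)%:E)%E.
Proof. by rewrite lee_fin expn1; apply: le_trans o_le1 p1. Qed.

Lemma tt_ge1 l i e : (0 < i)%N -> (o%:E + om e <= ord (tt l i e))%E.
Proof.
move=> i0; apply: le_trans (tt_ge l i e); rewrite leeD2r //; apply: le_trans ole _.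
by rewrite lee_fin lerD2r ler_nat leq_exp2l.
Qed.

Local Notation gl := (gl (fun e => ppi * H e)).

Lemma gl_split l e : exists rem, gl l e = (e.2 ord0 l)%:~R * (ppi * tau (G e)) + rem /\ (o%:E + om e <= ord rem)%E.
Proof.
have [J [J0 ->]] := gl_expand l e; exists (\sum_(i <- J | i != 0%N) tt l i e); split.
  rewrite (big_rem _ J0) /= rem_filter ?fset_uniq // big_filter; congr (_ + _).
  by rewrite /tt cc0 /AH_partial big_ord1 expn0 expr1 expr0 divr1.
by apply: (ord_sum hord) => i; rewrite -lt0n; apply: tt_ge1.
Qed.

Lemma gl_bd l e : (0%:E + om e <= ord (gl l e))%E.
Proof.
have [J [_ ->]] := gl_expand l e; apply: (ord_sum hord) => i _; apply: le_trans (tt_ge l i e).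
by rewrite leeD2r // lee_fin subr_ge0 ler1n lt0n pi_neq0.
Qed.

(** Terms with [p^i - 1 >= N] are small by [tt_ge]; the others come from finitely many [i] and the
    finite support of [G]. *)
Lemma gl_fin l (N : R) : finite_set [set e | (ord (gl l e) < N%:E + om e)%E].
Proof.
pose I := Num.bound `|N + 1|.
have hI i : (I <= i)%N -> N <= (p ^ i)%:R - 1.
  move=> le; have : N + 1 <= I%:R.
    apply: le_trans (ler_norm _) (ltW _).
    by have := archi_boundP (normr_ge0 (N + 1)); rewrite /I /Num.bound normr_id.
  have : (I%:R : R) <= (p ^ i)%:R by rewrite ler_nat (leq_trans le) // ltnW // ltn_expl.
  lra.
have finG : finite_set [set e | G e != 0].
  apply: (@sub_finite_set _ _ ([set` finsupp P] `|` [set ((0 : 'rV[int]_s), mu) | mu in [set` finsupp f]])).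
    move=> e /=; rewrite /deformed; have [->|Pn _] := eqVneq (P e) 0; last by left; rewrite mem_finsupp.
    rewrite addr0; have [e1 fe|_] := eqVneq e.1 0; last by rewrite eqxx.
    by right; exists e.2; [rewrite /= mem_finsupp | rewrite -e1; case: (e)].
  by rewrite finite_setU; split; [exact: finite_fset | apply: finite_image; exact: finite_fset].
apply: (@sub_finite_set _ _ [set (z.2.1 *+ p ^ z.1, z.2.2 *+ p ^ z.1) | z in `I_I `*` [set e | G e != 0]]); last first.
  by apply: finite_image; apply: finite_setX => //; apply: finite_II.
move=> e /= lt; apply: contrapT => nex; move: lt; rewrite ltNge => /negP; apply.
have [J [_ ->]] := gl_expand l e; apply: (ord_sum hord) => i _.
have [le|lt] := leqP I i; first by apply: le_trans (tt_ge l i e); rewrite leeD2r // lee_fin hI.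
rewrite /tt; case: (cc_cases i e) => [->|[e' [E1 E2 G' _]]]; first by rewrite !mulr0 (vord0 hord) leey.
by case: nex; exists (i, e') => //=; rewrite E1 E2; case: (e).
Qed.

Lemma gl_small l e : ~ (e.1 = 0 /\ e.2 \in supp_seq f) -> (d <= wd e.2)%N -> (o%:E + om e <= ord (gl l e))%E.
Proof.
move=> ne le; have [rem [-> hr]] := gl_split l e.
have [->|/supp_weight[_ _ [lt|[e1 fe _]]]] := eqVneq (G e) 0.
- by rewrite tau0 !mulr0 add0r.
- by rewrite ltnNge le in lt.
- by case: ne; rewrite mem_supp.
Qed.

Lemma gl_main l nu : nu \in supp_seq f -> (o%:E + om ((0%R, nu) : E) <=
  ord (gl l (0%R, nu) - pit ^+ d * ((nu ord0 l)%:~R * tau (f nu)))%R)%E.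
Proof.
rewrite mem_supp => fn; have [rem [-> hr]] := gl_split l (0, nu).
have P0 : P (0, nu) = 0.
  by apply/eqP/negPn/negP => /hP[_ /=]; rewrite hwt // ltxx.
rewrite /deformed /= eqxx P0 addr0 hpit mulrCA addrAC subrr add0r; exact: hr.
Qed.

End Estimates.

(** For [p = 2] the valuation of 2 is finite; for odd [p] the equation 2 = 0 would give [p = 1] in
    [K], against [ord p = 1]. *)
Lemma two_neq0 (R : realType) (p : nat) (Qp : fieldType) (K : fieldExtType Qp) (ord : K -> \bar R) :
  prime p -> valuation ord -> is_Qp (fun x : Qp => ord x%:A) p -> 2%:R != 0 :> K.
Proof.
move=> hp hord hQp; apply/eqP => two0; have := ord_p hQp.
have [E2|op] := even_prime hp; first by rewrite E2 two0 (vord0 hord).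
rewrite -(odd_double_half p) op natrD -muln2 natrM two0 mulr0 addr0 (vord1 hord) => -[] /eqP.
by rewrite eq_sym oner_eq0.
Qed.

Theorem theorem3p4
  (R : realType) (p a n s : nat) (hp : prime p)
  (Fq : finFieldType) (hFq : #|Fq| = (p ^ a)%N)
  (Fbar : closedFieldType) (iota : {rmorphism Fq -> Fbar})
  (hFbar : forall z : Fbar, algebraicOver iota z)
  (f : {fsfun 'rV[int]_n -> Fq with 0})
  (hdim : full_dimensional (newton R f))
  (hnd : nondegenerate_laurent R iota f)
  (hwt : forall mu, f mu != 0 -> lweight (newton R f) mu = 1)
  (P : {fsfun 'rV[int]_s * 'rV[int]_n -> Fq with 0})
  (hP : forall e, P e != 0 ->
     lattice_cone (newton R f) e.2 /\ lweight (newton R f) e.2 < 1)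
  (B : set 'rV[int]_n) (hB : jacobian_basis R f B)
  (Qp : fieldType) (K : fieldExtType Qp) (Qq : {subfield K})
  (ord : K -> \bar R) (hord : valuation ord)
  (hQp : is_Qp (fun x : Qp => ord x%:A) p)
  (hQq : unramified Qq ord a)
  (red : K -> Fq) (hred : residue_map Qq ord red)
  (tau : Fq -> K) (htau : teichmuller Qq ord red tau)
  (ppi : K) (hpi : AH_root ord p ppi)
  (pit : K) (d : nat) (hd : (0 < d)%N) (hpit : pit ^+ d = ppi)
  (hK : <<Qq; pit>>%VS = fullv)
  (hdDelta : forall mu, lattice_cone (newton R f) mu ->
     d%:R * lweight (newton R f) mu \is a Num.nat)
  (hdGamma : forall gamma, lattice_cone (deformation_polytope R f P) gamma ->
     d%:R * lweight (deformation_polytope R f P) gamma \is a Num.nat)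
  (sigma : {lrmorphism K -> K}) (hsigma : frobenius Qq ord p red pit sigma) :
  let Delta := newton R f in
  let Gamma := deformation_polytope R f P in
  let A := Zq_adjoin Qq ord pit in
  let pipow := fracpow pit d in
  let H := Hcoef ord tau sigma p ppi (deformed f P) in
  [/\ forall i, i != n -> acyclic_at ord A pipow ppi Delta Gamma H i,
      exists r : nat,
        (r%:R%:E = n`!%:R%:E * volume Delta)%E /\
        cohomology_free ord A pipow ppi Delta Gamma H n r
    & direct_sum (C0 ord A pipow Delta Gamma)
        (O0_span ord A pipow Delta Gamma B)
        (D_image ord A pipow ppi Delta Gamma H)].
Proof.
(* The rank [r] is the number of elements of [B], which is finite by nondegeneracy. *)
cbv zeta; have [r [b [binj Brange Mb hspan hind]]] := basis_enum hwt hd hdDelta hnd hB.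
have hG := Gamma_polytope R f P; have hD := newton_polytope R f.
have [ac fr ds] : [/\ forall i, i != n -> acyclic_at ord (Zq_adjoin Qq ord pit) (fracpow pit d) ppi
      (newton R f) (deformation_polytope R f P) (Hcoef ord tau sigma p ppi (deformed f P)) i,
    cohomology_free ord (Zq_adjoin Qq ord pit) (fracpow pit d) ppi
      (newton R f) (deformation_polytope R f P) (Hcoef ord tau sigma p ppi (deformed f P)) n r
  & direct_sum (C0 ord (Zq_adjoin Qq ord pit) (fracpow pit d) (newton R f) (deformation_polytope R f P))
        (O0_span ord (Zq_adjoin Qq ord pit) (fracpow pit d) (newton R f) (deformation_polytope R f P) B)
        (D_image ord (Zq_adjoin Qq ord pit) (fracpow pit d) ppi (newton R f) (deformation_polytope R f P)
           (Hcoef ord tau sigma p ppi (deformed f P)))].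
  (* The lifting argument is applied with the valuation [1/(d(p-1))] of [pit], the weights scaled by
     [d], and the coefficients of [pi H] as [G0]. *)
  eapply lift_main with (pit := pit) (o := (ram p d)%:R^-1) (MG := lattice_cone (deformation_polytope R f P))
    (wG := @wG R n s Fq f P d) (M := lattice_cone (newton R f)) (wd := @wd R Fq n f d)
    (G0 := fun e => ppi * Hcoef ord tau sigma p ppi (deformed f P) e)
    (res := res ord tau) (tau := tau) (f := f) (d := d) (sup := supp_seq f) (b := b).
  all: try assumption.
  all: try reflexivity.
  all: try exact: (field_complete hord hQp).
  all: try by (rewrite invr_gt0 ltr0n; apply: ram_gt0).
  all: try exact: (ord_pit hp hord hpi hd hpit).
  all: try exact: (lattice_cone0 hG).
  all: try exact: (lattice_coneD hG).
  all: try exact: (lattice_cone0 hD).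
  all: try exact: (lattice_coneD hD).
  all: try by [].
  all: try exact: wd0.
  all: try exact: (wdD hd hdDelta).
  all: try exact: (supp_uniq f).
  all: try exact: (suppM hwt hd hdDelta).
  all: try exact: (two_neq0 hp hord hQp).
  all: try exact: (ord_gt0_ge hp hord hQp hQq hpi hd hpit hK).
  all: try exact: (resD hp hord hQp hQq hred htau hpi hd hpit hK).
  all: try exact: (resM hp hord hQp hQq hred htau hpi hd hpit hK).
  all: try exact: (res0P hp hord hQp hQq hred htau hpi hd hpit hK).
  all: try exact: (res_tau hp hord hQp hQq hred htau hpi hd hpit hK).
  all: try exact: (res_int hp hord hQp hQq hred htau hpi hd hpit hK).
  all: try exact: (ord_tau htau).
  all: try exact: (integral_adjoin hp hord hQp hQq hpi hd hpit hK).
  all: try exact: (koszul_newton hdim hwt hd hdDelta Mb hspan hind).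
  all: try exact: (@wG0 R n s Fq f P d).
  all: try by (move=> u v; apply: wGD).
  all: try by (move=> l nu; apply: gl_main; eassumption).
  all: try by (move=> l nu; apply: gl_small; eassumption).
  all: try by (move=> l nu; apply: gl_bd; eassumption).
  all: try by (move=> l nu; apply: gl_fin; eassumption).
by split=> //; exists r; split=> //; exact: (rank_volume hdim hwt hd hdDelta Mb hspan hind).
Qed.
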